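(* Let $p\in(1,3/2)$ and let $\alpha=\alpha(p)$, where $\alpha(\cdot)$ is the function on $(1,3/2)$ defined in the context. Then there exists a function $a\in\mathfrak{A}(1,\alpha)$ such that the equation $$u_t=(a\,u_x)_x\quad\text{in } Q$$ has a nonzero solution $u$ in the class $\overset{0}{\mathcal{H}}{}^{1}_p(Q)$. Moreover, for this solution the functions $u_t$, $u_x$, and $a u_x$ are continuously differentiable functions of $(t,x)$, so that the equation $u_t=(au_x)_x$ holds in the classical sense everywhere in $Q$.
   Context: $Q=(0,1)\times\mathbb{R}$, with points written $(t,x)$. For $0<\beta\le\alpha<\infty$, $\mathfrak{A}(\beta,\alpha)$ is the set of Borel functions $a(t,x)$ on $Q$ with $\beta\le a(t,x)\le\alpha$ for all $(t,x)\in Q$. For $p\in(1,\infty)$, $W^{1,2}_p$ is the Sobolev space of functions $u(t,x)$ on $\mathbb{R}^2$ such that $u,u_x,u_{xx},u_t\in L_p(\mathbb{R}^2)$, and $\overset{0}{W}{}^{1,2}_p(Q)$ is the set of restrictions to $Q$ of functions in $W^{1,2}_p$ that are identically zero for $t\le0$. With $D=\partial/\partial x$, set $\Lambda=(1-D^2)^{1/2}$ (acting in the variable $x$), $H^n_p(\mathbb{R})=\Lambda^{-n}L_p(\mathbb{R})$, and $\overset{0}{\mathcal{H}}{}^{1}_p(Q)=\Lambda\,\overset{0}{W}{}^{1,2}_p(Q)$. For $u\in\overset{0}{\mathcal{H}}{}^{1}_p(Q)$, both $u_t$ and $(au_x)_x$ are $H^{-1}_p(\mathbb{R})$-valued functions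 of $t$ ($u_t$ being the strong $t$-derivative of $u$ as an $H^{-1}_p(\mathbb{R})$-valued function), and the equation is understood as an equality of $H^{-1}_p(\mathbb{R})$-valued functions. Definition of $\alpha(\cdot)$. For $\gamma\in(0,1)$ put $\lambda=\gamma-1\in(-1,0)$, $\phi_\lambda(x)=\int_0^\infty e^{-2xr-r^2}r^{-1-\lambda}\,dr$, $u_\lambda(x)=\phi_\lambda(x)+\phi_\lambda(-x)$. There is a unique $c_{0\lambda}>0$ such that $(u_\lambda(x)e^{-x^2})''=0$ at $x=c_{0\lambda}$, and a unique $c_{1\lambda}>0$ such that $(\phi_\lambda(x)e^{-x^2})''=0$ at $x=c_{1\lambda}$. Set $a_{1\gamma}=c_{0\lambda}/c_{1\lambda}$ (one has $a_{1\gamma}>1$) and $\beta(\gamma)=a_{1\gamma}^2$. Fix any function $\gamma:(1,3/2)\to(0,1)$ with $\gamma(q)<\frac3q-2$ for all $q\in(1,3/2)$ and $\lim_{q\downarrow1}\gamma(q)=1$, and set $\alpha(q)=\beta(\gamma(q))$ for $q\in(1,3/2)$. *)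

(* Defs.v *)
From HB Require Import structures.
From mathcomp Require Import all_boot all_order all_algebra.
From mathcomp Require Import all_classical all_reals all_analysis.

Set Implicit Arguments.
Unset Strict Implicit.
Unset Printing Implicit Defensive.
Import Order.TTheory GRing.Theory Num.Theory.
Import numFieldNormedType.Exports.

Local Open Scope classical_set_scope.
Local Open Scope ring_scope.

(* Functions of (t, x) are curried, [u t x]; only their values on the relevant
   set matter. *)

Section Planar.
Context {R : realType}.
Local Notation leb := (@lebesgue_measure R).

Definition unc (u : R -> R -> R) : R * R -> R := fun z => u z.1 z.2.

Definition leb2 := (leb \x leb)%E.

Definition Q : set (R * R) := [set z | 0 < z.1 < 1].

Definition dt (u : R -> R -> R) : R -> R -> R := fun t x => derive1 (u^~ x) t.
Definition dx (u : R -> R -> R) : R -> R -> R := fun t x => derive1 (u t) x.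

(* n-fold continuous differentiability on an open set U of the plane. *)
Fixpoint Ck_on (U : set (R * R)) (n : nat) (u : R -> R -> R) : Prop :=
  match n with
  | 0 => forall z, U z -> {for z, continuous (unc u)}
  | m.+1 => [/\ forall z, U z ->
                  derivable (u^~ z.2) z.1 1 /\ derivable (u z.1) z.2 1,
                Ck_on U m (dt u) & Ck_on U m (dx u)]
  end.

Definition test_fun (phi : R -> R -> R) : Prop :=
  (forall n, Ck_on setT n phi) /\
  exists M : R, forall t x, (M < `|t|) || (M < `|x|) -> phi t x = 0.

Definition weak_dt (w g : R -> R -> R) : Prop :=
  forall phi, test_fun phi ->
    \int[leb2]_z (w z.1 z.2 * dt phi z.1 z.2) =
    - \int[leb2]_z (g z.1 z.2 * phi z.1 z.2).

Definition weak_dx (w g : R -> R -> R) : Prop :=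
  forall phi, test_fun phi ->
    \int[leb2]_z (w z.1 z.2 * dx phi z.1 z.2) =
    - \int[leb2]_z (g z.1 z.2 * phi z.1 z.2).

Definition in_Lp2 (p : R) (u : R -> R -> R) : Prop :=
  unc u \in Lfun leb2 p%:E.

(* W^{1,2}_p *)
Definition W12 (p : R) (w : R -> R -> R) : Prop :=
  in_Lp2 p w /\ exists wt wx wxx : R -> R -> R,
    [/\ in_Lp2 p wt, in_Lp2 p wx & in_Lp2 p wxx] /\
    [/\ weak_dt w wt, weak_dx w wx & weak_dx wx wxx].

(* Functions in W^{1,2}_p vanishing for t <= 0; their restrictions to Q form
   the space called W^{1,2}_p(Q) with a superscript 0. *)
Definition W12_0 (p : R) (w : R -> R -> R) : Prop :=
  W12 p w /\ forall t x, t <= 0 -> w t x = 0.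

Definition frakA (b al : R) (a : R -> R -> R) : Prop :=
  measurable_fun Q (unc a) /\ forall t x, Q (t, x) -> b <= a t x <= al.

End Planar.

Section Tempered.
Context {R : realType}.
Local Notation leb := (@lebesgue_measure R).

Definition schwartz (phi : R -> R) : Prop :=
  forall n, (forall x, derivable (derive1n n phi) x 1) /\
    forall k, exists C : R, forall x, `|x ^+ k * derive1n n phi x| <= C.

(* Tempered distributions in the variable x: functionals on Schwartz
   functions, compared through [deq]. *)
Definition distr := (R -> R) -> R.

Definition deq (S T : distr) : Prop := forall phi, schwartz phi -> S phi = T phi.

Definition regd (f : R -> R) : distr := fun phi => \int[leb]_x (f x * phi x).

Definition represents (f : R -> R) (T : distr) : Prop :=
  (forall phi, schwartz phi ->
     leb.-integrable setT (EFin \o (fun x => f x * phi x))) /\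
  deq (regd f) T.

Definition distr_der (T : distr) : distr := fun phi => - T (derive1 phi).

(* Lambda^s = (1 - D^2)^{s/2} as the Fourier multiplier (1 + xi^2)^{s/2}:
   (2 pi)^{-1} \int (1 + xi^2)^{s/2} \int phi(y) e^{i xi (x - y)} dy dxi.
   As the symbol is even and phi is real, only the real part cos (xi (x - y))
   of the exponential contributes. *)
Definition Lambda (s : R) (phi : R -> R) : R -> R := fun x =>
  (2 * pi)^-1 *
  \int[leb]_xi ((1 + xi ^+ 2) `^ (s / 2) *
                \int[leb]_y (phi y * cos (xi * (x - y)))).

(* The operator is symmetric, hence extends to distributions by duality. *)
Definition distr_Lambda (s : R) (T : distr) : distr := fun phi =>
  T (Lambda s phi).

Definition H_preimage (n p : R) (T : distr) : set (R -> R) :=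
  [set f | f \in Lfun leb p%:E /\ deq T (distr_Lambda (- n) (regd f))].

(* H^n_p(R) = Lambda^{-n} L_p(R), normed by |Lambda^n T|_{L_p}. The preimage f
   is unique up to a null set, so the infimum below is over one value, and it
   is +oo when T is not in H^n_p(R). *)
Definition in_H (n p : R) (T : distr) : Prop := exists f, H_preimage n p T f.

Definition H_norm (n p : R) (T : distr) : \bar R :=
  ereal_inf [set 'N[leb]_(p%:E)[EFin \o f]%E | f in H_preimage n p T].

End Tempered.

Section Divergence_equation.
Context {R : realType}.
Local Notation leb := (@lebesgue_measure R).

(* u belongs to Lambda applied to the restrictions to Q of [W12_0]. *)
Definition calH1_0 (p : R) (u : R -> R -> R) : Prop :=
  measurable_fun Q (unc u) /\
  exists2 w, W12_0 p w &
    {ae leb, forall t, 0 < t < 1 ->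
       represents (u t) (distr_Lambda 1 (regd (w t)))}.

Definition nonzero_on_Q (u : R -> R -> R) : Prop :=
  ~ {ae leb2, forall z : R * R, Q z -> u z.1 z.2 = 0}.

(* Generalized x-derivative on Q. *)
Definition gen_dx (u ux : R -> R -> R) : Prop :=
  measurable_fun Q (unc ux) /\
  {ae leb, forall t, 0 < t < 1 ->
     represents (ux t) (distr_der (regd (u t)))}.

(* v is the strong t-derivative of u at t in H^{-1}_p(R). *)
Definition strong_dt_at (p : R) (u : R -> R -> R) (t : R) (v : distr) : Prop :=
  in_H (-1) p v /\
  H_norm (-1) p (fun phi =>
     h^-1 * (regd (u (t + h)) phi - regd (u t) phi) - v phi)
    @[h --> (0 : R)^'] --> 0%E.

(* u_t = (a u_x)_x as H^{-1}_p(R)-valued functions of t in (0, 1). *)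
Definition solves_div (p : R) (a u : R -> R -> R) : Prop :=
  exists (ux : R -> R -> R) (ut : R -> distr),
  [/\ gen_dx u ux,
      {ae leb, forall t, 0 < t < 1 -> strong_dt_at p u t (ut t)} &
      {ae leb, forall t, 0 < t < 1 ->
         let F := distr_der (regd (fun x => a t x * ux t x)) in
         in_H (-1) p F /\ deq (ut t) F}].

End Divergence_equation.

Section Alpha.
Context {R : realType}.
Local Notation leb := (@lebesgue_measure R).

Definition phi_ (l x : R) : R :=
  \int[leb]_(r in `]0, +oo[)
     (expR (- (2 * x * r) - r ^+ 2) * r `^ (- 1 - l)).

Definition u_ (l x : R) : R := phi_ l x + phi_ l (- x).

(* The positive zero (unique in the cases below) of (f(x) e^{-x^2})''. *)
Definition inflection (f : R -> R) : R :=
  xget 0 [set c : R | 0 < c /\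
                      derive1n 2 (fun x => f x * expR (- x ^+ 2)) c = 0].

Definition c0 (l : R) : R := inflection (u_ l).
Definition c1 (l : R) : R := inflection (phi_ l).

Definition a1 (g : R) : R := c0 (g - 1) / c1 (g - 1).

Definition beta_ (g : R) : R := a1 g ^+ 2.

Definition alpha (gamma : R -> R) (q : R) : R := beta_ (gamma q).

End Alpha.

(* Main.v *)
(* The solution is self-similar. With y = x / (2 sqrt t) and a(t, x) = A(y), the function
   w = t^(-m/2) g(y) solves w_t = a w_xx as soon as A g'' = -(2 m g + 2 y g'), and u = w_x then
   solves u_t = (a u_x)_x. For A = 1 and A = alpha and m = gamma, solutions are the even and the
   (rescaled) one-sided Hermite functions; gluing them at the inflection point c_0, where both
   second derivatives vanish, is what produces alpha = (c_0 / c_1)^2. The glued profile has a jump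
   in g''', so m is taken slightly larger than gamma (still below 3/p - 2) and the logarithmic
   derivative of the profile is perturbed near c_0, which makes g three times continuously
   differentiable and leaves A = -(2 m g + 2 y g') / g'' between 1 and alpha.

   Membership in the parabolic space is the integrability of Lambda^-1 u and its derivatives.
   Lambda^-1 is the superposition over tau of the resolvents (1 + tau^2 - D^2)^-1, whose kernels
   are exp (- kappa |r|) / (2 kappa), kappa^2 = 1 + tau^2. Interpolating between the bounds
   for V and for V' gives |Lambda^-1 V'| <= C t^(-mu) |x|^(-theta) exp (- |x| / 2) for the
   self-similar V that occur, with p mu < 1 and p theta < 1 precisely because m < 3/p - 2. *)
Require Import Defs.
From mathcomp Require Import all_boot all_order all_algebra.
From mathcomp Require Import all_classical all_reals all_analysis.
From mathcomp Require Import measurable_realfun ring lra.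
Import Order.TTheory GRing.Theory Num.Theory.
Import numFieldNormedType.Exports.
Local Open Scope classical_set_scope.
Local Open Scope ring_scope.
Set Implicit Arguments.
Unset Strict Implicit.
Unset Printing Implicit Defensive.

(** Write the profile as exp L and p = L'. The equation A g'' = -(2 m g + 2 y g') becomes A S = N
    with S = p' + p^2 and N = -(2 m + 2 y p), and 1 <= A <= alpha says that S lies between N and N /
    alpha. The glued Hermite profile has S = N left of c_0 and S = N / alpha right of it, so it
    always sits on an end of the permitted range. Replacing p by th p and gamma by th gamma, th > 1,
    puts S at distance T p^2 from that end, T = th^2 - th, on the inner side. Near c_0, where N
    changes sign and the range shrinks to a point, this is too much: a correction of p supported
    within radius ell cancels T p^2 there. Equality of the second derivatives of p from both sides
    ties th - 1 linearly to ell, and the rest holds for small ell. In the parabolic estimate u, u_x,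
    u_xx and u_t are all x-derivatives of rapidly decaying self-similar functions (u_t because of
    the equation), so one bound on Lambda^-1 V' serves them all. Admitting the singularity
    |x|^(-theta) gains t^(theta/2), which makes Lambda^-1 u tend to 0 as t decreases to 0: its
    extension by zero has no jump. *)

Ltac posit :=
  lazymatch goal with
  | |- is_true (0 <= _) =>
      first [ assumption | by [] | (apply: ltW; assumption)
            | apply: sqr_ge0 | apply: expR_ge0 | apply: powR_ge0 | apply: normr_ge0
            | (apply: mulr_ge0; posit) | (apply: addr_ge0; posit)
            | (rewrite invr_ge0; posit) | (apply: exprn_ge0; posit)
            | (apply: ltW; posit) ]
  | |- is_true (0 < _) =>
      first [ assumption | by [] | apply: expR_gt0
            | (apply: mulr_gt0; posit) | (apply: addr_gt0; posit)
            | (apply: ltr_wpDl; posit) | (apply: ltr_pwDl; posit)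
            | (rewrite invr_gt0; posit) | (apply: exprn_gt0; posit)
            | (apply: powR_gt0; posit) ]
  end.

(** * Integration on the line *)

Section Integration_tools.
Context {R : realType}.
Local Notation leb := (@lebesgue_measure R).
Implicit Types (f g F : R -> R) (D : set R).

Lemma integrable_dom d (T : measurableType d) (m : {measure set T -> \bar R})
    (D : set T) (f g : T -> R) : measurable D -> measurable_fun D f ->
  (forall x, D x -> `|f x| <= g x) -> m.-integrable D (EFin \o g) ->
  m.-integrable D (EFin \o f).
Proof.
move=> mD mf fg ig; apply: le_integrable ig => //; first exact/measurable_EFinP.
by move=> x Dx /=; rewrite lee_fin (le_trans (fg x Dx))// ler_norm.
Qed.

(** By uniqueness of Lebesgue measure it suffices to compare with [|a|] times the pushforward on
    half-open intervals; the preimage of such an interval is closed on the right or on the left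
    according to the sign of [a]. *)
Lemma lebesgue_measure_affine (a c : R) (A : set R) : a != 0 -> measurable A ->
  leb A = (`|a|%:E * leb ((fun x => (a * x + c)%R) @^-1` A))%E.
Proof.
move=> a0 mA.
pose phi : measurableTypeR R -> measurableTypeR R := fun x => (a * x + c)%R.
have mphi : measurable_fun setT phi by exact: measurable_funD.
pose pm : {measure set (measurableTypeR R) -> \bar R} :=
  measure_function_pushforward__canonical__measure_function_Measure leb mphi.
pose m : {measure set (measurableTypeR R) -> \bar R} :=
  mscale (NngNum (normr_ge0 a)) pm.
apply: (@lebesgue_measure_unique R m) => // _ [[u v]] _ <-.
suff : leb `]u, v]%classic = (`|a|%:E * leb (phi @^-1` `]u, v]%classic))%E by [].
rewrite lebesgue_measure_itv/=.
have [a_gt0|a_lt0|/eqP] := ltgtP 0 a; last by rewrite eq_sym (negbTE a0).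
- rewrite (_ : phi @^-1` _ = `](u - c) / a, (v - c) / a]%classic); last first.
    apply/seteqP; split => x /=; rewrite /phi !in_itv/= ltr_pdivrMr// ler_pdivlMr//;
      by rewrite ltrBlDr lerBrDr (mulrC x).
  rewrite lebesgue_measure_itv/= !lte_fin ltr_pM2r ?invr_gt0// ltrD2r.
  case: ifPn; rewrite ?mule0// -!EFinB -EFinM => _; congr EFin.
  by rewrite gtr0_norm//; field.
- rewrite (_ : phi @^-1` _ = `[(v - c) / a, (u - c) / a[%classic); last first.
    apply/seteqP; split => x /=; rewrite /phi !in_itv/= ltr_ndivlMr// ler_ndivrMr//;
      by rewrite ltrBlDr lerBrDr (mulrC x) andbC.
  rewrite lebesgue_measure_itv/= !lte_fin ltr_nM2r ?invr_lt0// ltrD2r.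
  case: ifPn; rewrite ?mule0// -!EFinB -EFinM => _; congr EFin.
  by rewrite ltr0_norm//; field; rewrite ltr0_neq0.
Qed.

Lemma ge0_integral_affine (a c : R) (f : R -> \bar R) : a != 0 ->
  measurable_fun setT f -> (forall x, 0 <= f x)%E ->
  (\int[leb]_x f (a * x + c)%R = `|a|^-1%:E * \int[leb]_x f x)%E.
Proof.
move=> a0 mf f0.
suff -> : (\int[leb]_x f x = `|a|%:E * \int[leb]_x f (a * x + c)%R)%E.
  by rewrite muleA -EFinM mulVf ?mul1e// normr_eq0.
pose phi : measurableTypeR R -> measurableTypeR R := fun x => (a * x + c)%R.
have mphi : measurable_fun setT phi by exact: measurable_funD.
pose pm : {measure set (measurableTypeR R) -> \bar R} :=
  measure_function_pushforward__canonical__measure_function_Measure leb mphi.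
pose m : {measure set (measurableTypeR R) -> \bar R} :=
  mscale (NngNum (normr_ge0 a)) pm.
transitivity (\int[m]_x f x)%E.
  by apply: eq_measure_integral => A mA _; exact: lebesgue_measure_affine.
rewrite ge0_integral_mscale//; congr (_ * _)%E.
by rewrite ge0_integral_pushforward.
Qed.

Lemma integrable_affine (a c : R) f : a != 0 ->
  leb.-integrable setT (EFin \o f) ->
  leb.-integrable setT (EFin \o (fun x => f (a * x + c))).
Proof.
move=> a0 /integrableP[/measurable_EFinP mf fi].
have mfa : measurable_fun setT (fun x => f (a * x + c)).
  by apply: measurableT_comp => //; exact: measurable_funD.
apply/integrableP; split; first exact/measurable_EFinP.
rewrite (@ge0_integral_affine a c (fun x => `|(f x)%:E|%E))//=; last first.
  by apply/measurable_EFinP; exact: measurableT_comp.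
by rewrite lte_mul_pinfty// lee_fin invr_ge0.
Qed.

Lemma Rintegral_affine (a c : R) f : a != 0 ->
  leb.-integrable setT (EFin \o f) ->
  \int[leb]_x f (a * x + c) = `|a|^-1 * \int[leb]_x f x.
Proof.
move=> a0 fi; have fai := integrable_affine c a0 fi.
have mf : measurable_fun setT (EFin \o f) by case/integrableP : fi.
have mfa : measurable_fun setT (EFin \o (fun x => f (a * x + c))).
  by case/integrableP : fai.
rewrite /Rintegral -[X in X * _]/(fine `|a|^-1%:E) -fineM//; last first.
  exact: integrable_fin_num.
have fin := integrable_neg_fin_num measurableT fi.
congr fine; rewrite [in RHS]integralE [in LHS]integralE.
rewrite muleBr//; last by apply: fin_num_adde_defl; rewrite fin_numN; exact: fin.
rewrite -(ge0_integral_affine c a0 (measurable_funepos mf) (fun x => funepos_ge0 _ x)).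
rewrite -(ge0_integral_affine c a0 (measurable_funeneg mf) (fun x => funeneg_ge0 _ x)).
by congr (_ - _)%E; apply: eq_integral => x _; rewrite ?funeposE ?funenegE.
Qed.

Lemma Rintegral_shift (c : R) f : leb.-integrable setT (EFin \o f) ->
  \int[leb]_x f (x + c) = \int[leb]_x f x.
Proof.
move=> fi; rewrite -[RHS]mul1r -[X in X * _]invr1 -[X in X^-1](@normr1 R).
rewrite -(@Rintegral_affine _ c)// ?oner_neq0//.
by apply: eq_Rintegral => x _; rewrite mul1r.
Qed.

Lemma integrable_shift (c : R) f : leb.-integrable setT (EFin \o f) ->
  leb.-integrable setT (EFin \o (fun x => f (x + c))).
Proof.
move=> /(integrable_affine c (oner_neq0 R)); apply: eq_integrable => // x _.
by rewrite /= mul1r.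
Qed.

Lemma Rintegral_reflect (c : R) f : leb.-integrable setT (EFin \o f) ->
  \int[leb]_x f (c - x) = \int[leb]_x f x.
Proof.
move=> fi; rewrite -[RHS]mul1r -[X in X * _]invr1 -[X in X^-1](@normrN1 R).
rewrite -(@Rintegral_affine _ c)// ?oppr_eq0 ?oner_neq0//.
by apply: eq_Rintegral => x _; rewrite mulN1r addrC.
Qed.

Lemma integrable_reflect (c : R) f : leb.-integrable setT (EFin \o f) ->
  leb.-integrable setT (EFin \o (fun x => f (c - x))).
Proof.
have n0 : -1 != 0 :> R by rewrite oppr_eq0 oner_neq0.
move=> /(integrable_affine c n0); apply: eq_integrable => // x _.
by rewrite /= mulN1r addrC.
Qed.

End Integration_tools.

Section Fundamental_theorem_unbounded.
Context {R : realType}.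
Local Notation leb := (@lebesgue_measure R).
Implicit Types (f g F : R -> R) (D : set R).

Lemma Rdominated_convergence d (T : measurableType d) (m : {measure set T -> \bar R})
    (D : set T) (f_ : nat -> T -> R) (f g : T -> R) : measurable D ->
  (forall n, measurable_fun D (f_ n)) ->
  (forall x, D x -> f_ n x @[n --> \oo] --> f x) ->
  m.-integrable D (EFin \o g) ->
  (forall n x, D x -> `|f_ n x| <= g x) ->
  m.-integrable D (EFin \o f) /\
  (\int[m]_(x in D) f_ n x) @[n --> \oo] --> \int[m]_(x in D) f x.
Proof.
move=> mD mf_ ff gi fg.
have mf : measurable_fun D f by exact: (measurable_fun_cvg (h := f_)).
have fi n : m.-integrable D (EFin \o f_ n).
  by apply: integrable_dom gi => // x Dx; exact: fg.
have hf x : D x -> (f_ n x)%:E @[n --> \oo] --> (f x)%:E.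
  by move=> Dx; apply: cvg_EFin; [exact: nearW|exact: ff].
have hle x n : D x -> (`|(f_ n x)%:E| <= (g x)%:E)%E.
  by move=> Dx /=; rewrite lee_fin fg.
have mE n : measurable_fun D (EFin \o f_ n) by exact/measurable_EFinP.
have mEf : measurable_fun D (EFin \o f) by exact/measurable_EFinP.
have [i1 _ c1] := @dominated_convergence _ _ _ m _ mD
  (fun n x => (f_ n x)%:E) (EFin \o f) (EFin \o g) mE mEf
  (aeW _ hf) gi (aeW _ hle).
split => //; rewrite /Rintegral; apply: fine_cvg; rewrite fineK//.
exact: integrable_fin_num.
Qed.

Lemma is_derive_continuous F (x l : R) : is_derive x 1 F l -> {for x, continuous F}.
Proof. by case=> dF _; apply/differentiable_continuous/derivable1_diffP. Qed.

(** The fundamental theorem on compact intervals exhausting [D], followed by dominated convergence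
    of the truncations of [f]. The line and the half-line are the two instances. *)
Lemma FTC_exhaustion D f F (a b : nat -> R) (A B : R) : measurable D ->
  leb.-integrable D (EFin \o f) ->
  (forall n, a n < b n) -> (forall n, `[a n, b n]%classic `<=` D) ->
  (forall x, D x -> \forall n \near \oo, x \in `[a n, b n]) ->
  (forall x, D x -> is_derive x 1 F (f x)) ->
  (forall x, D x -> {for x, continuous f}) ->
  F (a n) @[n --> \oo] --> A -> F (b n) @[n --> \oo] --> B ->
  \int[leb]_(x in D) f x = B - A.
Proof.
move=> mD fi ab abD exh dF cf FA FB.
have mf : measurable_fun D f by case/integrableP : fi => /measurable_EFinP.
pose h n x := (f \_ `[a n, b n]) x.
have mh n : measurable_fun D (h n).
  apply/(measurable_restrict _ _ _).1 => //.
  by apply: measurable_funS mf => //; apply: subIset; left.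
have hf x : D x -> h n x @[n --> \oo] --> f x.
  move=> Dx; apply: cvg_near_cst; near=> n.
  rewrite /h patchE mem_set//=.
  by near: n; exact: exh.
have hle n x : D x -> `|h n x| <= `|f x|.
  by move=> _ /=; rewrite /h patchE; case: ifPn => //; rewrite normr0.
have [_ hcvg] := Rdominated_convergence (m := leb) mD mh hf (integrable_norm fi) hle.
have inth n : \int[leb]_(x in D) h n x = F (b n) - F (a n).
  apply/EFin_inj; rewrite /Rintegral fineK; last first.
    apply: integrable_fin_num => //; apply: integrable_dom (integrable_norm fi) => //.
      exact: mh.
    exact: hle.
  transitivity (\int[leb]_(x in `[a n, b n]) (f x)%:E)%E.
    have -> : `[a n, b n]%classic = D `&` `[a n, b n]%classic.
      by apply/esym/setIidr; exact: abD.
    rewrite [RHS]integral_mkcondr; apply: eq_integral => x _.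
    by rewrite /h restrict_EFin.
  have D1 x : x \in `[a n, b n] -> D x by move=> xab; apply: (abD n).
  rewrite EFinB; apply: (@continuous_FTC2 _ f F) => //.
  - apply: continuous_in_subspaceT => x; rewrite inE => xab.
    exact: cf (D1 _ xab).
  - split.
    + move=> x xab; have Dx : D x by apply: D1; exact: subset_itv_oo_cc.
      by have [] := dF _ Dx.
    + apply: cvg_at_right_filter.
      have Dx : D (a n) by apply: D1; rewrite in_itv/= lexx ltW.
      exact: is_derive_continuous (dF _ Dx).
    + apply: cvg_at_left_filter.
      have Dx : D (b n) by apply: D1; rewrite in_itv/= lexx ltW.
      exact: is_derive_continuous (dF _ Dx).
  - move=> x xab; have Dx : D x by apply: D1; exact: subset_itv_oo_cc.
    by rewrite derive1E; have [_ ->] := dF _ Dx.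
have c2 : (F (b n) - F (a n)) @[n --> \oo] --> B - A by exact: cvgB.
apply: (cvg_unique _ hcvg) => //.
by apply: cvg_trans c2; apply: near_eq_cvg; apply: nearW => n; rewrite /= inth.
Unshelve. all: end_near. Qed.

Lemma cvg_natS_pinfty : n.+1%:R @[n --> \oo] --> (+oo : set_system R).
Proof.
apply/cvgryPge => r; near=> n; apply: (@le_trans _ _ n%:R); last by rewrite ler_nat.
by near: n; move: r; apply/cvgryPge; exact: cvgr_idn.
Unshelve. all: end_near. Qed.

Lemma FTC_line f F (A B : R) : leb.-integrable setT (EFin \o f) ->
  (forall x : R, is_derive x 1 F (f x)) -> continuous f ->
  F x @[x --> -oo] --> A -> F x @[x --> +oo] --> B ->
  \int[leb]_x f x = B - A.
Proof.
move=> fi dF cf FA FB.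
have un := cvg_natS_pinfty.
apply: (@FTC_exhaustion setT f F (fun n => - n.+1%:R) (fun n => n.+1%:R)) => //.
- by move=> n; rewrite (@lt_trans _ _ 0)// oppr_lt0.
- move=> x _; near=> n; rewrite in_itv/= -ler_norml.
  near: n; move/cvgryPge : un; exact.
- by move=> x _; exact: cf.
- apply: (@cvg_comp _ _ _ (fun n => - n.+1%:R) F _ _ _ _ FA).
  apply/cvgNrNy; exact: un.
- exact: (@cvg_comp _ _ _ (fun n => n.+1%:R) F _ _ _ un FB).
Unshelve. all: end_near. Qed.

Lemma FTC_half_line (c : R) f F (A B : R) :
  leb.-integrable `]c, +oo[%classic (EFin \o f) ->
  (forall x : R, c < x -> is_derive x 1 F (f x)) ->
  (forall x, c < x -> {for x, continuous f}) ->
  F x @[x --> c^'+] --> A -> F x @[x --> +oo] --> B ->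
  \int[leb]_(x in `]c, +oo[) f x = B - A.
Proof.
move=> fi dF cf FA FB.
have un := cvg_natS_pinfty.
apply: (@FTC_exhaustion _ f F (fun n => c + n.+1%:R^-1) (fun n => c + 1 + n.+1%:R)) => //.
- move=> n; rewrite -addrA ltrD2l (@le_lt_trans _ _ 1) ?invf_le1 ?ler1n//.
  by rewrite ltrDl.
- move=> n x /=; rewrite !in_itv/= andbT => /andP[+ _]; apply: lt_le_trans.
  by rewrite ltrDl invr_gt0.
- move=> x /=; rewrite in_itv/= andbT => cx; near=> n; rewrite in_itv/=; apply/andP; split.
    rewrite -lerBrDl invf_ple ?posrE ?subr_gt0//.
    near: n; move/cvgryPge : un; exact.
  rewrite -lerBlDl; near: n; move/cvgryPge : un; exact.
- by move=> x /=; rewrite in_itv/= andbT; exact: dF.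
- by move=> x /=; rewrite in_itv/= andbT; exact: cf.
- move/cvg_at_rightP : FA; apply; split.
    by move=> n; rewrite ltrDl invr_gt0.
  rewrite -[X in _ --> X]addr0; apply: cvgD; first exact: cvg_cst.
  by apply/gtr0_cvgV0 => //; exact: nearW.
- apply: (@cvg_comp _ _ _ (fun n => c + 1 + n.+1%:R) F _ _ _ _ FB); apply/cvgryPge => r; near=> n.
  rewrite -lerBlDl; near: n; move/cvgryPge : un; exact.
Unshelve. all: end_near. Qed.

End Fundamental_theorem_unbounded.

(** * Fubini's theorem for real-valued integrals *)

Section Fubini_real.
Context d1 d2 (T1 : measurableType d1) (T2 : measurableType d2) (R : realType).
Variables (m1 : {sigma_finite_measure set T1 -> \bar R})
  (m2 : {sigma_finite_measure set T2 -> \bar R}).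
Implicit Type f : T1 -> T2 -> R.

(** No integrability is assumed: the positive and negative parts are handled by Tonelli, and [fine]
    of their difference is measurable whether or not it is finite. *)
Lemma measurable_Rintegral f :
  measurable_fun setT (fun z : T1 * T2 => f z.1 z.2) ->
  measurable_fun setT (fun x => \int[m2]_y f x y).
Proof.
move=> mf; pose F (z : T1 * T2) := (f z.1 z.2)%:E.
have mF : measurable_fun setT F by exact/measurable_EFinP.
rewrite /Rintegral; apply: measurableT_comp => //.
under eq_fun do rewrite integralE.
apply: emeasurable_funB.
- apply: (eq_measurable_fun (fubini_F m2 F^\+%E)).
    by move=> x _; apply: eq_integral => y _; rewrite !funeposE.
  by apply: measurable_fun_fubini_tonelli_F; [exact: measurable_funepos|move=> z; exact: funepos_ge0].
- apply: (eq_measurable_fun (fubini_F m2 F^\-%E)).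
    by move=> x _; apply: eq_integral => y _; rewrite !funenegE.
  by apply: measurable_fun_fubini_tonelli_F; [exact: measurable_funeneg|move=> z; exact: funeneg_ge0].
Qed.

Lemma integrable_prod f (g : T1 -> R) :
  measurable_fun setT (fun z : T1 * T2 => f z.1 z.2) ->
  m1.-integrable setT (EFin \o g) ->
  (forall x, m2.-integrable setT (EFin \o f x)) ->
  (forall x, \int[m2]_y `|f x y| <= g x) ->
  (m1 \x m2)%E.-integrable setT (fun z : T1 * T2 => (f z.1 z.2)%:E).
Proof.
move=> mf gi fi fg; pose F (z : T1 * T2) := (f z.1 z.2)%:E.
have mF : measurable_fun setT F by exact/measurable_EFinP.
apply/integrable12ltyP => //.
apply: (@le_lt_trans _ _ (\int[m1]_x `|(EFin \o g) x|)%E).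
  apply: ge0_le_integral => //.
  - by move=> x _; exact: integral_ge0.
  - apply: (eq_measurable_fun (fubini_F m2 (abse \o F))) => //.
    apply: measurable_fun_fubini_tonelli_F; first exact: measurableT_comp.
    by move=> z; exact: abse_ge0.
  - by apply: measurableT_comp => //; case/integrableP : gi.
  move=> x _ /=.
  rewrite -[leLHS]fineK; last first.
    exact: (integrable_fin_num measurableT (integrable_norm (fi x))).
  by rewrite lee_fin (le_trans _ (ler_norm _))//; exact: fg.
by case/integrableP : gi.
Qed.

Lemma integrable_prod_dom f (g : T1 -> R) (h : T2 -> R) :
  measurable_fun setT (fun z : T1 * T2 => f z.1 z.2) ->
  m1.-integrable setT (EFin \o g) -> m2.-integrable setT (EFin \o h) ->
  (forall x y, `|f x y| <= g x * h y) ->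
  (m1 \x m2)%E.-integrable setT (fun z : T1 * T2 => (f z.1 z.2)%:E).
Proof.
move=> mf gi hi fgh.
have fi x : m2.-integrable setT (EFin \o f x).
  apply: (@integrable_dom _ _ _ _ _ _ (fun y => g x * h y)) => //.
    exact: (measurableT_comp mf (measurable_pair1 x)).
  by have := integrableZl measurableT (g x) hi; apply: eq_integrable.
apply: (@integrable_prod _ (fun x => g x * \int[m2]_y h y)) => //.
  by have := integrableZr measurableT (\int[m2]_y h y) gi; apply: eq_integrable.
move=> x; rewrite -RintegralZl//; apply: le_Rintegral => //.
- exact: integrable_norm.
- by have := integrableZl measurableT (g x) hi; apply: eq_integrable.
Qed.

Section integrable.
Variable f : T1 -> T2 -> R.
Hypothesis fi : (m1 \x m2)%E.-integrable setT (fun z : T1 * T2 => (f z.1 z.2)%:E).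

Lemma integrable_Rfubini : m1.-integrable setT (EFin \o (fun x => \int[m2]_y f x y)).
Proof.
have := integrable_fubini_F fi; apply: le_integrable => //.
  apply/measurable_EFinP; apply: measurable_Rintegral.
  by case/integrableP : fi => /measurable_EFinP.
by move=> x _ /=; rewrite /fubini_F /Rintegral/=; case: (integral _ _ _) => [r| |] //=;
  rewrite normr0 leey.
Qed.

(** The real inner integral agrees with the extended one wherever the section is integrable, hence
    almost everywhere. *)
Lemma Rfubini1 : \int[(m1 \x m2)%E]_z f z.1 z.2 = \int[m1]_x \int[m2]_y f x y.
Proof.
rewrite /Rintegral -integral12_prod_meas1//; congr fine.
apply: ae_eq_integral => //.
- exact: (measurable_fubini_F fi).
- by case/integrableP : integrable_Rfubini.
have := ae_integrable1 fi; apply: filterS => x /= ix _.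
by rewrite /fubini_F/= fineK//; exact: integrable_fin_num.
Qed.

End integrable.

End Fubini_real.

Section Fubini_real_swap.
Context d1 d2 (T1 : measurableType d1) (T2 : measurableType d2) (R : realType).
Variables (m1 : {sigma_finite_measure set T1 -> \bar R})
  (m2 : {sigma_finite_measure set T2 -> \bar R}).
Variable f : T1 -> T2 -> R.
Hypothesis fi : (m1 \x m2)%E.-integrable setT (fun z : T1 * T2 => (f z.1 z.2)%:E).

Lemma integrable_swap :
  (m2 \x m1)%E.-integrable setT (fun z : T2 * T1 => (f z.2 z.1)%:E).
Proof.
have mf : measurable_fun setT (fun z : T1 * T2 => (f z.1 z.2)%:E).
  by case/integrableP : fi.
apply/integrable12ltyP; first exact: (measurableT_comp mf (@measurable_swap _ _ _ _)).
exact: ((integrable21ltyP m1 m2 mf).1 fi).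
Qed.

Lemma integrable_Rfubini2 : m2.-integrable setT (EFin \o (fun y => \int[m1]_x f x y)).
Proof. exact: (integrable_Rfubini integrable_swap). Qed.

Lemma Rfubini2 : \int[(m1 \x m2)%E]_z f z.1 z.2 = \int[m2]_y \int[m1]_x f x y.
Proof.
rewrite /Rintegral -integral21_prod_meas1//; congr fine.
apply: ae_eq_integral => //.
- exact: (measurable_fubini_G fi).
- by case/integrableP : integrable_Rfubini2.
have := ae_integrable2 fi; apply: filterS => x /= ix _.
by rewrite /fubini_G/= fineK//; exact: integrable_fin_num.
Qed.

Lemma Rfubini_swap : \int[m1]_x \int[m2]_y f x y = \int[m2]_y \int[m1]_x f x y.
Proof. by rewrite -Rfubini1// Rfubini2. Qed.

End Fubini_real_swap.

Section Integrable_antiderivative.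
Context {R : realType}.
Local Notation leb := (@lebesgue_measure R).
Implicit Types (f g F : R -> R) (D : set R).

Lemma FTC_segment f F (a b : R) : a < b ->
  (forall x, a <= x <= b -> is_derive x 1 F (f x)) ->
  (forall x, a <= x <= b -> {for x, continuous f}) ->
  (\int[leb]_(x in `[a, b]) (f x)%:E)%E = (F b - F a)%:E.
Proof.
move=> ab dF cf.
have D1 x : x \in `]a, b[ -> a <= x <= b.
  by rewrite in_itv/= => /andP[/ltW -> /ltW ->].
rewrite EFinB; apply: (@continuous_FTC2 _ f F) => //.
- apply: continuous_in_subspaceT => x; rewrite inE/= in_itv/= => xab.
  exact: cf.
- split.
  + by move=> x /D1 /dF [].
  + apply: cvg_at_right_filter; apply: (is_derive_continuous (l := f a)).
    by apply: dF; rewrite lexx ltW.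
  + apply: cvg_at_left_filter; apply: (is_derive_continuous (l := f b)).
    by apply: dF; rewrite lexx ltW.
- by move=> x /D1 /dF [_]; rewrite derive1E.
Qed.

(** Fatou's lemma on truncations to compact intervals: their integrals are increments of [F], which
    converge. Integrability is thus a consequence of a bounded antiderivative. *)
Lemma integrable_half_line_ge0 (c : R) f F (A B : R) :
  (forall x, c < x -> 0 <= f x) ->
  (forall x, c < x -> is_derive x 1 F (f x)) ->
  (forall x, c < x -> {for x, continuous f}) ->
  F x @[x --> c^'+] --> A -> F x @[x --> +oo] --> B ->
  leb.-integrable `]c, +oo[%classic (EFin \o f).
Proof.
move=> f0 dF cf FA FB.
pose a n := c + n.+1%:R^-1; pose b n := c + 1 + n.+1%:R.
have ab n : a n < b n.
  rewrite /a /b -addrA ltrD2l (@le_lt_trans _ _ 1) ?invf_le1 ?ler1n//.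
  by rewrite ltrDl.
have ca n : c < a n by rewrite ltrDl invr_gt0.
have un := @cvg_natS_pinfty R.
have Fa : F (a n) @[n --> \oo] --> A.
  move/cvg_at_rightP : FA; apply; split; first by move=> n; rewrite ltrDl invr_gt0.
  rewrite -[X in _ --> X]addr0; apply: cvgD; first exact: cvg_cst.
  by apply/gtr0_cvgV0 => //; exact: nearW.
have Fb : F (b n) @[n --> \oo] --> B.
  apply: (@cvg_comp _ _ _ b F _ _ _ _ FB); apply/cvgryPge => r; near=> n.
  rewrite -lerBlDl; near: n; move/cvgryPge : un; exact.
have mf : measurable_fun `]c, +oo[%classic f.
  apply: open_continuous_measurable_fun; first exact: interval_open.
  by move=> x; rewrite inE/= in_itv/= andbT; exact: cf.
have mE : measurable_fun `]c, +oo[%classic (EFin \o f) by exact/measurable_EFinP.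
pose h n x := (f \_ `[a n, b n]) x.
have abD n : `[a n, b n]%classic `<=` `]c, +oo[%classic.
  by move=> x /=; rewrite !in_itv/= andbT => /andP[+ _]; apply: lt_le_trans.
have mh n : measurable_fun `]c, +oo[%classic (h n).
  apply/(measurable_restrict _ _ _).1 => //.
  by apply: measurable_funS mf => //; apply: subIset; left.
have hf x : `]c, +oo[%classic x -> (h n x)%:E @[n --> \oo] --> (f x)%:E.
  rewrite /= in_itv/= andbT => cx; apply: cvg_near_cst; near=> n.
  rewrite /h patchE mem_set//= in_itv/=; apply/andP; split.
    rewrite /a -lerBrDl invf_ple ?posrE ?subr_gt0//.
    near: n; move/cvgryPge : un; exact.
  rewrite /b -lerBlDl; near: n; move/cvgryPge : un; exact.
apply/integrableP; split => //.
have -> : (\int[leb]_(x in `]c, +oo[) `|(EFin \o f) x| =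
    \int[leb]_(x in `]c, +oo[) limn_einf (fun n => (h n x)%:E))%E.
  apply: eq_integral => x; rewrite inE/= => xc.
  rewrite (cvg_limn_einf_sup (hf _ xc)).1 ger0_norm//; apply: f0.
  by move: xc; rewrite in_itv/= andbT.
have h0 n x : `]c, +oo[%classic x -> (0 <= (h n x)%:E)%E.
  rewrite /= in_itv/= andbT => cx.
  by rewrite lee_fin /h patchE; case: ifPn => // _; exact: f0.
have mhE n : measurable_fun `]c, +oo[%classic (EFin \o h n) by exact/measurable_EFinP.
apply: le_lt_trans; first by apply: fatou.
have inth n : (\int[leb]_(x in `]c, +oo[) (h n x)%:E)%E = (F (b n) - F (a n))%:E.
  transitivity (\int[leb]_(x in `[a n, b n]) (f x)%:E)%E.
    have -> : `[a n, b n]%classic = `]c, +oo[%classic `&` `[a n, b n]%classic.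
      by apply/esym/setIidr; exact: abD.
    rewrite [RHS]integral_mkcondr; apply: eq_integral => x _.
    by rewrite /h restrict_EFin.
  apply: FTC_segment => //.
  - by move=> x /andP[ax _]; apply: dF; exact: lt_le_trans ax.
  - by move=> x /andP[ax _]; apply: cf; exact: lt_le_trans ax.
under eq_fun do rewrite inth.
have c2 : (F (b n) - F (a n))%:E @[n --> \oo] --> (B - A)%:E.
  by apply: cvg_EFin; [exact: nearW|exact: cvgB].
by rewrite (cvg_limn_einf_sup c2).1 ltry.
Unshelve. all: end_near. Qed.

Lemma integrable_even f : (forall x, f (- x) = f x) ->
  leb.-integrable `]0, +oo[%classic (EFin \o f) ->
  leb.-integrable setT (EFin \o f) /\
  \int[leb]_x f x = 2 * \int[leb]_(x in `]0, +oo[) f x.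
Proof.
move=> fN fi; pose g := f \_ `]0, +oo[.
have gi : leb.-integrable setT (EFin \o g).
  by rewrite -restrict_EFin; apply/(integrable_mkcond _ _).1.
have gi' := integrable_reflect 0 gi.
(* The origin lies in neither open half-line; [k] restores the value there, so that the
   decomposition of [f] is an identity at every point. *)
pose k x := f 0 * \1_[set (0 : R)] x.
have k0 : leb [set (0 : R)] = 0 by rewrite lebesgue_measure_set1.
have ki : leb.-integrable setT (EFin \o (\1_[set (0 : R)] : R -> R)).
  by rewrite -set_itv1; exact: integrable_indic_itv.
have ki' : leb.-integrable setT (EFin \o k).
  by have := integrableZl measurableT (f 0) ki; apply: eq_integrable.
have fE x : f x = g x + g (0 - x) + k x.
  rewrite /g /k !patchE indicE !mem_setE/= !in_itv/= !andbT sub0r oppr_gt0.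
  have [x0|x0|->] := ltgtP x 0.
  - by rewrite add0r fN memNset ?mulr0 ?addr0// => /= x0'; rewrite x0' ltxx in x0.
  - by rewrite memNset ?mulr0 ?addr0// => /= x0'; rewrite x0' ltxx in x0.
  - by rewrite mem_set// mulr1 !add0r.
have ggi : leb.-integrable setT (EFin \o (fun x => g x + g (0 - x))).
  by have := integrableD measurableT gi gi'; apply: eq_integrable.
split.
  have := integrableD measurableT ggi ki'; apply: eq_integrable => // x _ /=.
  by rewrite -EFinD -fE.
under eq_Rintegral do rewrite fE.
rewrite RintegralD// RintegralD// Rintegral_reflect//.
have -> : \int[leb]_x k x = 0.
  rewrite /k RintegralZl// /Rintegral integral_indic//.
  by rewrite setIT [X in fine X](_ : _ = 0%E) ?mulr0//; exact: lebesgue_measure_set1.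
by rewrite addr0 -mulr2n -Rintegral_mkcond mulr_natl.
Qed.

Lemma integrable_half_line_cont0 (c : R) f F (A B : R) :
  (forall x, c < x -> 0 <= f x) ->
  (forall x, c < x -> is_derive x 1 F (f x)) ->
  (forall x, c < x -> {for x, continuous f}) ->
  F x @[x --> c^'+] --> A -> F x @[x --> +oo] --> B ->
  leb.-integrable `]c, +oo[%classic (EFin \o f) /\
  \int[leb]_(x in `]c, +oo[) f x = B - A.
Proof.
move=> f0 dF cf FA FB.
have fi := integrable_half_line_ge0 f0 dF cf FA FB.
by split => //; exact: FTC_half_line FA FB.
Qed.

Lemma cvg_expRMNy (c : R) : 0 < c -> expR (- (c * x)) @[x --> +oo] --> (0 : R).
Proof.
move=> c0; apply: (@cvg_comp _ _ _ (fun x => c * x) (fun y => expR (- y)) _ _ _ _ (@cvgr_expR R)).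
by apply: (gt0_cvgMry c0); exact: cvg_id.
Qed.

Lemma integrable_expR_norm (c : R) : 0 < c ->
  leb.-integrable setT (EFin \o (fun x => expR (- (c * `|x|)))) /\
  \int[leb]_x expR (- (c * `|x|)) = 2 / c.
Proof.
move=> c0.
have E x : 0 < x -> expR (- (c * `|x|)) = expR (- (c * x)).
  by move=> x0; rewrite gtr0_norm.
pose F x := - c^-1 * expR (- (c * x)).
have dF (x : R) : is_derive x 1 F (expR (- (c * x))).
  by rewrite /F; apply: is_derive_eq; rewrite /GRing.scale/=; field; rewrite gt_eqF.
have [i1 e1] : leb.-integrable `]0, +oo[%classic (EFin \o (fun x => expR (- (c * x)))) /\
  \int[leb]_(x in `]0, +oo[) expR (- (c * x)) = 0 - F 0.
  apply: (@integrable_half_line_cont0 0 _ F).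
  - by move=> x _; exact: expR_ge0.
  - move=> x _; apply: (is_derive_continuous (l := - c * expR (- (c * x)))).
    by apply: is_derive_eq; rewrite /GRing.scale/=; ring.
  - by apply: cvg_at_right_filter; exact: is_derive_continuous (dF 0).
  - rewrite -(mulr0 (- c^-1)); apply: cvgMr; exact: cvg_expRMNy.
have [||i2 e2] := @integrable_even (fun x => expR (- (c * `|x|))).
- by move=> x; rewrite normrN.
- apply: eq_integrable i1 => // x; rewrite inE/= in_itv/= andbT => x0.
  by rewrite E.
split => //; rewrite e2; under eq_Rintegral => x.
  rewrite inE/= in_itv/= andbT => x0; rewrite E//; over.
by rewrite e1 /F mulr0 oppr0 expR0; field; rewrite gt_eqF.
Qed.

End Integrable_antiderivative.

Section Power_weights.
Context {R : realType}.
Local Notation leb := (@lebesgue_measure R).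

Lemma is_derive_powR_comp (f : R -> R) (m x l : R) : 0 < f x ->
  is_derive x 1 f l ->
  is_derive x 1 (fun y => f y `^ m) (m * f x `^ (m - 1) * l).
Proof.
by move=> fx df; exact: (is_derive1_comp (f := fun y => y `^ m) (is_derive1_powR m fx) df).
Qed.

Lemma cvg_invy (f : R -> R) (F : set_system R) : Filter F -> f x @[x --> F] --> +oo ->
  (f x)^-1 @[x --> F] --> (0 : R).
Proof.
move=> FF fy; apply/gtr0_cvgV0; first by move/cvgryPgt : fy; exact.
exact: fy.
Qed.

Lemma integrable_powR_weight (th : R) : 0 <= th < 1 ->
  leb.-integrable setT (EFin \o (fun r => `|r| `^ (- th) / (1 + `|r|) ^+ 2)).
Proof.
move=> /andP[th0 th1].
pose F (r : R) := (1 - th)^-1 * (r / (1 + r)) `^ (1 - th).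
pose f (r : R) := (r / (1 + r)) `^ (- th) / (1 + r) ^+ 2.
have pos (r : R) : 0 < r -> 0 < r / (1 + r) by move=> r0; rewrite divr_gt0// ltr_wpDl.
have dq (r : R) : 0 < r -> is_derive r 1 (fun r => r / (1 + r)) ((1 + r) ^- 2).
  move=> r0; have n0 : 1 + r != 0 by rewrite gt_eqF// addr_gt0.
  by apply: is_derive_eq; rewrite /GRing.scale/=; field.
have dF (r : R) : 0 < r -> is_derive r 1 F (f r).
  move=> r0; have := @is_derive_powR_comp (fun r => r / (1 + r)) (1 - th) _ _ (pos _ r0) (dq _ r0).
  move=> d; rewrite /F; apply: is_derive_eq; rewrite /GRing.scale/= /f.
  have -> : 1 - th - 1 = - th by ring.
  rewrite mulrA mulrA mulVf ?mul1r// gt_eqF// subr_gt0//.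
have cf (r : R) : 0 < r -> {for r, continuous f}.
  move=> r0; have n0 : 1 + r != 0 by rewrite gt_eqF// addr_gt0.
  have d1 := @is_derive_powR_comp (fun r => r / (1 + r)) (- th) _ _ (pos _ r0) (dq _ r0).
  have d2 : is_derive r 1 (fun r : R => (1 + r) ^- 2) (- 2 * (1 + r) ^- 3).
    have n1 : (1 + r) ^+ 2 != 0 by rewrite expf_neq0.
    by apply: is_derive_eq; rewrite /GRing.scale/=; field.
  exact: is_derive_continuous (is_deriveM d1 d2).
have i1 : leb.-integrable `]0, +oo[%classic (EFin \o f).
  apply: (@integrable_half_line_ge0 R 0 f F 0 ((1 - th)^-1 * 1)) => //.
  - by move=> x x0; rewrite divr_ge0 ?powR_ge0// exprn_ge0// addr_ge0// ltW.
  - rewrite -[X in _ --> X](mulr0 (1 - th)^-1); apply: cvgMr.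
    have p0 : 0 < 1 - th by rewrite subr_gt0.
    apply: (@squeeze_cvgr _ _ _ _ (cst 0) (fun x => x `^ (1 - th))).
    + near=> x; rewrite powR_ge0/= ge0_ler_powR ?nnegrE//; first exact: ltW.
      * by apply/ltW/pos; near: x; exact: nbhs_right_gt.
      * have x0 : 0 < x by near: x; exact: nbhs_right_gt.
        by rewrite ler_pdivrMr ?addr_gt0// ler_peMr ?lerDl// ltW.
    + exact: cvg_cst.
    + exact: powR_cvg0.
  - apply: cvgMr.
    have c1 : x / (1 + x) @[x --> +oo] --> (1 : R).
      have c2 : 1 - (1 + x)^-1 @[x --> +oo] --> (1 - 0 : R).
        apply: cvgB; first exact: cvg_cst.
        by apply: cvg_invy; exact: cvg_addrl.
      rewrite subr0 in c2; apply: cvg_trans c2; apply: near_eq_cvg; near=> x.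
      have x0 : 1 + x != 0 by rewrite gt_eqF// addr_gt0//; near: x; exact: nbhs_pinfty_gt.
      by field.
    have cp := is_derive_continuous (is_derive1_powR (1 - th) (@ltr01 R)).
    have := cvg_comp _ _ c1 cp; rewrite /= powR1; exact.
have [//||i2 _] := @integrable_even _ (fun r => `|r| `^ (- th) / (1 + `|r|) ^+ 2).
- by move=> x; rewrite normrN.
- apply: integrable_dom i1 => //.
    apply: measurable_funTS; apply: measurable_funM.
      by apply: (measurableT_comp (measurable_powR (- th))); apply: continuous_measurable_fun; exact: norm_continuous.
    apply: continuous_measurable_fun => x.
    apply: cvgV; first by rewrite expf_neq0// gt_eqF// ltr_pwDl.
    apply: (@cvg_comp _ _ _ (fun x => 1 + `|x|) (fun y => y ^+ 2)); last exact: exprn_continuous.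
    by apply: cvgD; [exact: cvg_cst|exact: norm_continuous].
  move=> x /=; rewrite in_itv/= andbT => x0.
  rewrite ger0_norm; last by rewrite divr_ge0 ?powR_ge0.
  rewrite gtr0_norm// /f ler_pM2r; last by rewrite invr_gt0 exprn_gt0// addr_gt0.
  rewrite !powRN lef_pV2 ?posrE ?powR_gt0 ?pos//.
  rewrite ge0_ler_powR ?nnegrE ?(ltW (pos _ x0)) ?(ltW x0)//.
  by rewrite ler_pdivrMr ?addr_gt0// ler_peMr ?lerDl// ltW.
- exact: i2.
Unshelve. all: end_near. Qed.

Lemma integrable_one_plus_powR (ep : R) : 0 < ep ->
  leb.-integrable setT (EFin \o (fun r => (1 + `|r|) `^ (- (1 + ep)))).
Proof.
move=> ep0; pose F (r : R) := - ep^-1 * (1 + r) `^ (- ep).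
have dp (m r : R) : 0 <= r -> is_derive r 1 (fun r => (1 + r) `^ m) (m * (1 + r) `^ (m - 1)).
  move=> r0; have p : 0 < 1 + r by rewrite ltr_pwDl.
  have d1 : is_derive r 1 (fun r : R => 1 + r) 1.
    by have := is_deriveD (is_derive_cst (1 : R) r 1) (is_derive_id r (1 : R)); rewrite add0r.
  by have := @is_derive_powR_comp (fun r => 1 + r) m r 1 p d1; rewrite mulr1.
have dF (r : R) : 0 < r -> is_derive r 1 F ((1 + r) `^ (- (1 + ep))).
  move=> r0; have d := dp (- ep) _ (ltW r0); rewrite /F; apply: is_derive_eq.
  rewrite /GRing.scale/= mulrA mulrNN mulVf ?gt_eqF// mul1r; congr powR; ring.
have i1 : leb.-integrable `]0, +oo[%classic (EFin \o (fun r => (1 + r) `^ (- (1 + ep)))).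
  apply: (@integrable_half_line_ge0 R 0 _ F (F 0) (- ep^-1 * 0)) => //.
  - by move=> x _; rewrite powR_ge0.
  - by move=> x x0; exact: is_derive_continuous (dp _ _ (ltW x0)).
  - apply: cvg_at_right_filter; apply: cvgMr.
    exact: is_derive_continuous (dp (- ep) 0 (lexx 0)).
  - apply: cvgMr; under eq_fun do rewrite powRN.
    apply: cvg_invy; apply/cvgryPge => A; near=> x.
    have x1 : 0 <= 1 + x by rewrite addr_ge0//; near: x; exact: nbhs_pinfty_ge.
    have : (Num.max A 1) `^ ep^-1 <= 1 + x.
      by rewrite -lerBlDl; near: x; exact: nbhs_pinfty_ge.
    move/(ge0_ler_powR (ltW ep0)); rewrite !nnegrE powR_ge0 => /(_ isT x1).
    rewrite -powRrM mulVf ?gt_eqF// powRr1; last by rewrite le_max ler01 orbT.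
    by apply: le_trans; rewrite le_max lexx.
have [//||i2 _] := @integrable_even _ (fun r => (1 + `|r|) `^ (- (1 + ep))).
- by move=> x; rewrite normrN.
- apply: eq_integrable i1 => // x; rewrite inE/= in_itv/= andbT => x0.
  by rewrite gtr0_norm.
- exact: i2.
Unshelve. all: end_near. Qed.

End Power_weights.

Section Real_integrable.
Context d (T : measurableType d) (R : realType) (m : {measure set T -> \bar R}).
Implicit Types (D : set T) (f g : T -> R).

Lemma integrableRZ D f (k : R) : measurable D -> m.-integrable D (EFin \o f) ->
  m.-integrable D (EFin \o (fun x => k * f x)).
Proof. by move=> mD fi; have := integrableZl mD k fi; apply: eq_integrable. Qed.

Lemma integrableRD D f g : measurable D -> m.-integrable D (EFin \o f) ->
  m.-integrable D (EFin \o g) -> m.-integrable D (EFin \o (fun x => f x + g x)).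
Proof. by move=> mD fi gi; have := integrableD mD fi gi; apply: eq_integrable. Qed.

Lemma integrableRB D f g : measurable D -> m.-integrable D (EFin \o f) ->
  m.-integrable D (EFin \o g) -> m.-integrable D (EFin \o (fun x => f x - g x)).
Proof. by move=> mD fi gi; have := integrableB mD fi gi; apply: eq_integrable. Qed.

Lemma integrableRT D f : measurable D -> m.-integrable setT (EFin \o f) ->
  m.-integrable D (EFin \o f).
Proof. by move=> mD; apply: integrableS. Qed.

End Real_integrable.

(** * The Hermite functions and the similarity profile *)

Section Superexponential_decay.
Context {R : realType}.
Implicit Types (f g : R -> R).

(** Asking for every rate [M] makes the class stable under multiplication by polynomials, so that
    the profiles of all derivatives stay in it. *)
Definition superexp_decay f := forall M : R, exists C : R, forall x, `|f x| <= C * expR (- (M * `|x|)).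

Lemma superexp_decay_le f g : (forall x, `|f x| <= `|g x|) ->
  superexp_decay g -> superexp_decay f.
Proof.
move=> fg dg M; have [C gC] := dg M; exists C => x.
exact: le_trans (fg x) (gC x).
Qed.

Lemma superexp_decayD f g : superexp_decay f -> superexp_decay g ->
  superexp_decay (fun x => f x + g x).
Proof.
move=> df dg M; have [C fC] := df M; have [C' gC] := dg M; exists (C + C') => x.
by rewrite mulrDl (le_trans (ler_normD _ _))// lerD.
Qed.

Lemma superexp_decayZ f (k : R) : superexp_decay f -> superexp_decay (fun x => k * f x).
Proof.
move=> df M; have [C fC] := df M; exists (`|k| * C) => x.
by rewrite normrM -mulrA ler_wpM2l.
Qed.

Lemma superexp_decay_id f : superexp_decay f -> superexp_decay (fun x => x * f x).
Proof.
(* One unit of the rate pays for the factor x, since |x| <= e^|x|. *)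
move=> df M; have [C fC] := df (M + 1); exists C => x.
have C0 : 0 <= C.
  have := fC 0; rewrite normr0 mulr0 oppr0 expR0 mulr1; exact: le_trans.
rewrite normrM (le_trans (ler_wpM2l (normr_ge0 x) (fC x)))//.
rewrite mulrCA ler_wpM2l// mulrDl mul1r opprD expRD mulrC -mulrA ger_pMr ?expR_gt0//.
rewrite mulrC expRN -ler_pdivlMr ?invr_gt0 ?expR_gt0// invrK mul1r.
by apply: le_trans (expR_ge1Dx _); rewrite lerDr.
Qed.

Lemma superexp_decay_gauss (c : R) : 0 < c -> superexp_decay (fun x => expR (- (c * x ^+ 2))).
Proof.
move=> c0 M; exists (expR (M ^+ 2 / (4 * c))) => x.
rewrite ger0_norm ?expR_ge0// -expRD ler_expR.
rewrite -subr_ge0.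
have -> : M ^+ 2 / (4 * c) - M * `|x| - - (c * x ^+ 2) = c * (`|x| - M / (2 * c)) ^+ 2.
  by rewrite -[x ^+ 2]real_normK ?num_real//; field; rewrite gt_eqF.
by rewrite mulr_ge0 ?sqr_ge0 ?ltW.
Qed.

End Superexponential_decay.

Section Hermite_function.
Context {R : realType}.
Local Notation leb := (@lebesgue_measure R).
Variable g : R.
Hypothesis g01 : 0 < g < 1.
Implicit Types (phi psi : R -> R).

Let pos : set R := `]0, +oo[%classic.

(** Up to a Gamma factor, the Weyl fractional integral of order 1 - g. Applied to the Gaussian it
    gives a Hermite function of non-integer order. *)
Definition rconv phi (x : R) : R := \int[leb]_(r in pos) (phi (x + r) * r `^ (- g)).

Let mpos : measurable (pos : set (measurableTypeR R)).
Proof. exact: measurable_itv. Qed.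

Let measurable_rpow : measurable_fun pos (fun r : R => r `^ (- g)).
Proof. by apply: measurable_funTS; exact: measurable_powR. Qed.

(** Comparison with r^(-g) / (1 + r)^2: e^r = (e^(r/2))^2 >= (1 + r/2)^2 >= (1 + r)^2 / 4, whence
    the factor 4. *)
Lemma integrable_expR_powR : leb.-integrable pos (EFin \o (fun r : R => expR (- r) * r `^ (- g))).
Proof.
have g0 : 0 <= g < 1 by case/andP : g01 => /ltW -> ->.
have := integrableRZ 4 mpos (integrableRT mpos (integrable_powR_weight g0)).
apply: integrable_dom => //.
  apply: measurable_funM => //.
  by apply: measurable_funTS; apply: measurableT_comp => //; exact: measurable_funN.
move=> x; rewrite /pos/= in_itv/= andbT => x0.
rewrite ger0_norm; last by rewrite mulr_ge0 ?expR_ge0 ?powR_ge0.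
rewrite gtr0_norm// mulrCA mulrC ler_wpM2l ?powR_ge0// expRN -[4]invrK -invfM.
rewrite lef_pV2 ?posrE ?expR_gt0 ?mulr_gt0 ?exprn_gt0 ?addr_gt0//.
have -> : expR x = expR (x / 2) ^+ 2 by rewrite -expRM_natl; congr expR; field.
have h := expR_ge1Dx (x / 2).
have h2 : (1 + x / 2) ^+ 2 <= expR (x / 2) ^+ 2.
  by rewrite ler_pXn2r// ?nnegrE ?expR_ge0// addr_ge0// divr_ge0// ltW.
apply: le_trans h2; nra.
Qed.

(** A majorant uniform for y in a bounded set, as differentiation under the integral requires. Rate
    1 is enough, because |y + r| >= r - M. *)
Lemma rconv_dom phi (M : R) : superexp_decay phi -> 0 < M ->
  exists2 C, 0 <= C & forall y, `|y| <= M -> forall r, 0 < r ->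
    `|phi (y + r) * r `^ (- g)| <= C * (expR (- r) * r `^ (- g)).
Proof.
move=> dphi M0; have [C phiC] := dphi 1.
have C0 : 0 <= C.
  have := phiC 0; rewrite normr0 mulr0 oppr0 expR0 mulr1; exact: le_trans.
exists (C * expR M); first by rewrite mulr_ge0 ?expR_ge0.
move=> y yM s s0; rewrite normrM mulrA (ger0_norm (powR_ge0 _ _)) ler_wpM2r ?powR_ge0//.
rewrite (le_trans (phiC _))// -mulrA ler_wpM2l// -expRD ler_expR mul1r.
have : s - `|y| <= `|y + s|.
  by have := ler_norm (y + s); have := ler_norm (- y); rewrite normrN; lra.
lra.
Qed.

Lemma integrable_rconv phi (x : R) : measurable_fun setT phi -> superexp_decay phi ->
  leb.-integrable pos (EFin \o (fun r => phi (x + r) * r `^ (- g))).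
Proof.
move=> mphi dphi.
have M0 : 0 < `|x| + 1 by rewrite ltr_wpDl.
have [C C0 phiC] := rconv_dom dphi M0.
have := integrableRZ C mpos integrable_expR_powR.
apply: integrable_dom => //.
  apply: measurable_funM => //; apply: measurable_funTS; apply: measurableT_comp => //.
  exact: measurable_funD.
move=> r; rewrite /pos/= in_itv/= andbT => r0; apply: phiC => //.
by rewrite lerDl.
Qed.

Lemma is_derive_rconv phi phi' : (forall s : R, is_derive s 1 phi (phi' s)) ->
  continuous phi' -> superexp_decay phi -> superexp_decay phi' ->
  forall x : R, is_derive x 1 (rconv phi) (rconv phi' x).
Proof.
move=> dphi cphi' decphi decphi' x.
have mphi : measurable_fun setT phi.
  by apply: continuous_measurable_fun => s; exact: is_derive_continuous (dphi s).
have M0 : 0 < `|x| + 1 by rewrite ltr_wpDl.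
have [C C0 phiC] := rconv_dom decphi' M0.
pose F (y r : R) := phi (y + r) * r `^ (- g).
have dF (y r : R) : is_derive y 1 (F ^~ r) (phi' (y + r) * r `^ (- g)).
  have d1 : is_derive y 1 (fun y : R => y + r) 1.
    by have := is_deriveD (is_derive_id y (1 : R)) (is_derive_cst (r : R) y 1); rewrite addr0.
  have d2 := @is_derive1_comp R phi (fun y => y + r) y _ _ (dphi (y + r)) d1.
  apply: (is_derive_eq (is_deriveM d2 (is_derive_cst (r `^ (- g)) y 1))).
  by rewrite /GRing.scale/=; ring.
have xI : `]x - 1, x + 1[%classic x by rewrite /= in_itv/= ltrBlDr ltrDl ltr01.
have intF y : `]x - 1, x + 1[%classic y -> leb.-integrable pos (EFin \o F y).
  by move=> _; exact: integrable_rconv.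
have derF y r : `]x - 1, x + 1[%classic y -> pos r -> derivable (F^~ r) y 1.
  by move=> _ _; have [] := dF y r.
pose G r := C * (expR (- r) * r `^ (- g)).
have G0 r : 0 <= G r by rewrite mulr_ge0// mulr_ge0 ?expR_ge0 ?powR_ge0.
have intG : leb.-integrable pos (EFin \o G).
  exact: integrableRZ integrable_expR_powR.
have Gub y r : `]x - 1, x + 1[%classic y -> pos r -> `|partial1of2 F y r| <= G r.
  move=> yI; rewrite /pos/= in_itv/= andbT => r0; rewrite partial1of2E.
  have [_ ->] := dF y r; apply: phiC => //.
  move: yI; rewrite /= in_itv/= => /andP[y1 y2].
  by have := ler_norm x; have := ler_norm (- x); rewrite normrN ler_norml => *; apply/andP; split; lra.
have D := @derivable_under_integral R _ _ leb F pos mpos x _ _ xI intF derF G G0 intG Gub.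
have E := @differentiation_under_integral R _ _ leb F pos mpos x _ _ xI intF derF G G0 intG Gub.
apply: DeriveDef => //; rewrite -derive1E E; apply: eq_Rintegral => r _.
by rewrite partial1of2E; have [_ ->] := dF x r.
Qed.

End Hermite_function.

Section Hermite_equation.
Context {R : realType}.
Local Notation leb := (@lebesgue_measure R).
Variable g : R.
Hypothesis g01 : 0 < g < 1.

Let pos : set R := `]0, +oo[%classic.
Let mpos : measurable (pos : set (measurableTypeR R)).
Proof. exact: measurable_itv. Qed.

Definition gauss0 (s : R) : R := expR (- s ^+ 2).
Definition gauss1 (s : R) : R := - 2 * (s * gauss0 s).
Definition gauss2 (s : R) : R := - 2 * gauss0 s + - 2 * (s * gauss1 s).

Let dec0 : superexp_decay gauss0.
Proof.
have := @superexp_decay_gauss R 1 ltr01.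
by apply: superexp_decay_le => x; rewrite mul1r.
Qed.
Let dec1 : superexp_decay gauss1.
Proof. exact/superexp_decayZ/superexp_decay_id. Qed.
Let dec2 : superexp_decay gauss2.
Proof. by apply: superexp_decayD; [exact: superexp_decayZ|exact/superexp_decayZ/superexp_decay_id]. Qed.

Let d0 (s : R) : is_derive s 1 gauss0 (gauss1 s).
Proof. by apply: is_derive_eq; rewrite /GRing.scale/= /gauss1 /gauss0; ring. Qed.
Let d1 (s : R) : is_derive s 1 gauss1 (gauss2 s).
Proof.
have h := d0 s; rewrite /gauss1; apply: is_derive_eq.
by rewrite /GRing.scale/= /gauss2; ring.
Qed.
Let d2 (s : R) : is_derive s 1 gauss2 (- 4 * gauss1 s - 2 * s * gauss2 s).
Proof.
have h := d0 s; have h1 := d1 s; rewrite /gauss2; apply: is_derive_eq.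
by rewrite /GRing.scale/= /gauss2; ring.
Qed.
Let c0 : continuous gauss0. Proof. by move=> s; exact: is_derive_continuous (d0 s). Qed.
Let c1 : continuous gauss1. Proof. by move=> s; exact: is_derive_continuous (d1 s). Qed.
Let c2 : continuous gauss2. Proof. by move=> s; exact: is_derive_continuous (d2 s). Qed.
Let i0 x := integrable_rconv g01 x (continuous_measurable_fun c0) dec0.
Let i1 x := integrable_rconv g01 x (continuous_measurable_fun c1) dec1.
Let i2 x := integrable_rconv g01 x (continuous_measurable_fun c2) dec2.

Definition herm0 := rconv g gauss0.
Definition herm1 := rconv g gauss1.

Lemma is_derive_herm0 (x : R) : is_derive x 1 herm0 (herm1 x).
Proof. exact: is_derive_rconv. Qed.

Let shift_derive (phi phi' : R -> R) (x r : R) : (forall s : R, is_derive s 1 phi (phi' s)) ->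
  is_derive r 1 (fun r => phi (x + r)) (phi' (x + r)).
Proof.
move=> dphi; have dd : is_derive r 1 (fun r : R => x + r) 1.
  by have := is_deriveD (is_derive_cst (x : R) r 1) (is_derive_id r (1 : R)); rewrite add0r.
have := @is_derive1_comp R phi (fun y => x + y) r _ _ (dphi (x + r)) dd.
by rewrite mulr1.
Qed.

Let shift_cont (phi : R -> R) (x : R) : continuous phi -> continuous (fun r => phi (x + r)).
Proof.
move=> cphi r; have : {for r, continuous (fun r : R => x + r)}.
  by apply: cvgD; [exact: cvg_cst|exact: cvg_id].
by move=> cr; exact: (continuous_comp cr (cphi _)).
Qed.

(** The combined integrand is the r-derivative of -(gauss0 (x + r) r^(1-g)), which vanishes at both
    ends. Read with the second derivative in place of [rconv g gauss2], this is h'' + 2 x h' + 2 g h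
    = 0. *)
Lemma rconv_gauss_ode (x : R) : 2^-1 * rconv g gauss2 x + x * herm1 x + g * herm0 x = 0.
Proof.
have /andP[g0 g1] := g01.
pose G (s : R) := 2^-1 * gauss2 s + x * gauss1 s + g * gauss0 s.
have EG r : G (x + r) * r `^ (- g) = 2^-1 * (gauss2 (x + r) * r `^ (- g)) +
    x * (gauss1 (x + r) * r `^ (- g)) + g * (gauss0 (x + r) * r `^ (- g)).
  by rewrite /G; ring.
pose F r := - (gauss0 (x + r) * r `^ (1 - g)).
have j2 := integrableRZ 2^-1 mpos (i2 x).
have j1 := integrableRZ x mpos (i1 x).
have j0 := integrableRZ g mpos (i0 x).
have j := integrableRD mpos (integrableRD mpos j2 j1) j0.
have -> : 2^-1 * rconv g gauss2 x + x * herm1 x + g * herm0 x =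
    \int[leb]_(r in pos) (G (x + r) * r `^ (- g)).
  under [RHS]eq_Rintegral do rewrite EG.
  rewrite RintegralD//; last exact: (integrableRD mpos j2 j1).
  by rewrite RintegralD// !RintegralZl.
have pw (r : R) : 0 < r -> r `^ (1 - g) = r * r `^ (- g).
  by move=> r0; rewrite powRD ?powRr1 ?ltW//; apply/implyP => _; rewrite gt_eqF.
rewrite -[RHS](subrr 0).
apply: (@FTC_half_line R 0 (fun r => G (x + r) * r `^ (- g)) F 0 0).
- by move: j; apply: eq_integrable => // r _ /=; rewrite EG.
- move=> r r0; have e0 := @shift_derive _ _ x r d0.
  have ep := is_derive1_powR (1 - g) r0.
  apply: (is_derive_eq (is_deriveN (is_deriveM e0 ep))).
  rewrite /GRing.scale/= pw// (_ : 1 - g - 1 = - g); last by ring.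
  by rewrite /G /gauss2 /gauss1; field.
- move=> r r0; apply: cvgM; last exact: is_derive_continuous (is_derive1_powR _ r0).
  have cG : continuous G.
    by move=> s; apply: cvgD; [apply: cvgD|]; apply: cvgMr; [exact: c2|exact: c1|exact: c0].
  exact: (shift_cont cG).
- rewrite -[X in _ --> X]oppr0; apply: cvgN.
  have p0 : 0 < 1 - g by rewrite subr_gt0.
  apply: (@squeeze_cvgr _ _ _ _ (cst 0) (fun r => r `^ (1 - g))).
  + near=> r; rewrite /= mulr_ge0 ?expR_ge0 ?powR_ge0//=.
    by rewrite ger_pMl ?powR_gt0// /gauss0 expR_le1 oppr_le0 sqr_ge0.
  + exact: cvg_cst.
  + exact: powR_cvg0.
- rewrite -[X in _ --> X]oppr0; apply: cvgN.
  have decK : superexp_decay (fun s => s * gauss0 s + - x * gauss0 s).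
    by apply: superexp_decayD; [exact: superexp_decay_id|exact: superexp_decayZ].
  have [C KC] := decK 1.
  have CP : 0 <= C.
    have := KC 0; rewrite normr0 mulr0 oppr0 expR0 mulr1; exact: le_trans.
  apply: (@squeeze_cvgr _ _ _ _ (cst 0) (fun r => C * expR `|x| * expR (- (1 * r)))).
  + near=> r; rewrite /= mulr_ge0 ?expR_ge0 ?powR_ge0//=.
    have r1 : 1 <= r by near: r; exact: nbhs_pinfty_ge.
    have r0 : 0 < r by exact: lt_le_trans r1.
    rewrite pw// mulrA (@le_trans _ _ (gauss0 (x + r) * r))//.
      rewrite ger_pMr ?mulr_gt0 ?expR_gt0// powRN invf_le1 ?powR_gt0//.
      by rewrite -[X in X <= _](powRr0 r) ler_powR// ltW.
    have -> : gauss0 (x + r) * r = (x + r) * gauss0 (x + r) + - x * gauss0 (x + r) by ring.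
    rewrite (le_trans (ler_norm _))// (le_trans (KC _))// -mulrA ler_wpM2l// -expRD ler_expR.
    have := ler_norm (x + r); have := ler_norm (- x); rewrite normrN; lra.
  + exact: cvg_cst.
  + rewrite -(mulr0 (C * expR `|x|)); apply: cvgMr; exact: cvg_expRMNy.
Unshelve. all: end_near. Qed.

Lemma is_derive_herm1 (x : R) : is_derive x 1 herm1 (- 2 * x * herm1 x - 2 * g * herm0 x).
Proof.
have := is_derive_rconv g01 d1 c2 dec1 dec2 x.
suff -> : - 2 * x * herm1 x - 2 * g * herm0 x = rconv g gauss2 x by [].
by have := rconv_gauss_ode x; lra.
Qed.

(** A continuous positive function is bounded below by a positive constant on [1, 2]. *)
Let Rintegral_pos_gt0 (h : R -> R) : (forall r, 0 < r -> 0 < h r) ->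
  (forall r, 0 < r -> {for r, continuous h}) -> leb.-integrable pos (EFin \o h) ->
  0 < \int[leb]_(r in pos) h r.
Proof.
move=> h0 ch ih.
have p12 (r : R) : r \in `[1, 2] -> 0 < r.
  by rewrite in_itv/= => /andP[r1 _]; exact: lt_le_trans r1.
have [m mI hm] : exists2 m, m \in `[1, 2] & forall t, t \in `[1, 2] -> h m <= h t.
  apply: EVT_min; first by rewrite ler1n.
  by apply: continuous_in_subspaceT => r; rewrite inE/= => rI; apply: ch; exact: p12.
have sub : `[1, 2]%classic `<=` pos.
  by move=> r rI; rewrite /pos/= in_itv/= andbT; exact: p12.
have ic : leb.-integrable pos (EFin \o (fun r => h m * \1_(`[1, 2]%classic) r)).
  by apply: integrableRZ => //; apply: integrableRT => //; exact: integrable_indic_itv.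
apply: (@lt_le_trans _ _ (\int[leb]_(r in pos) (h m * \1_(`[1, 2]%classic) r))); last first.
  apply: le_Rintegral => // r; rewrite /pos/= in_itv/= andbT => r0.
  rewrite indicE; case: (boolP (r \in _)) => rI.
    by rewrite mulr1; apply: hm; rewrite inE/= in rI.
  by rewrite mulr0 ltW// h0.
rewrite RintegralZl//; last by apply: integrableRT => //; exact: integrable_indic_itv.
rewrite mulr_gt0//; first by apply/h0/p12.
rewrite /Rintegral integral_indic// (_ : _ `&` _ = `[1, 2]%classic); last exact/setIidl.
have L : leb `[1, 2]%classic = 1%E.
  by rewrite lebesgue_measure_itv/= lte_fin ltr1n/= -EFinB; congr EFin; ring.
by rewrite [X in fine X](_ : _ = 1%E) ?ltr01//; exact: L.
Qed.

Let rc0 x r : 0 < r -> {for r, continuous (fun r => gauss0 (x + r) * r `^ (- g))}.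
Proof.
move=> r0; apply: cvgM; last exact: is_derive_continuous (is_derive1_powR _ r0).
exact: (shift_cont c0).
Qed.

Lemma herm0_gt0 x : 0 < herm0 x.
Proof.
apply: Rintegral_pos_gt0 => //; last exact: rc0.
by move=> r r0; rewrite mulr_gt0 ?expR_gt0 ?powR_gt0.
Qed.

Let herm1_rep x : - herm1 x - 2 * x * herm0 x =
  \int[leb]_(r in pos) (2 * (r * (gauss0 (x + r) * r `^ (- g)))) /\
  leb.-integrable pos (EFin \o (fun r => 2 * (r * (gauss0 (x + r) * r `^ (- g))))).
Proof.
have E (r : R) : 2 * (r * (gauss0 (x + r) * r `^ (- g))) =
    - 1 * (gauss1 (x + r) * r `^ (- g)) + (- (2 * x)) * (gauss0 (x + r) * r `^ (- g)).
  by rewrite /gauss1; ring.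
have j1 := integrableRZ (- 1) mpos (i1 x).
have j0 := integrableRZ (- (2 * x)) mpos (i0 x).
split; last first.
  by have := integrableRD mpos j1 j0; apply: eq_integrable => // r _ /=; rewrite E.
under eq_Rintegral do rewrite E.
by rewrite RintegralD// !RintegralZl// -/(rconv _ _ _) -/herm1 -/herm0 mulN1r mulNr.
Qed.

(** Since gauss1 s = -2 s gauss0 s, the difference of the two sides is a first moment in r > 0. It
    is what makes the logarithmic derivative decrease to the right of the gluing point. *)
Lemma herm1_lt x : herm1 x < - (2 * x * herm0 x).
Proof.
have [E ii] := herm1_rep x.
rewrite -subr_gt0 addrC E; apply: Rintegral_pos_gt0 => //.
  by move=> r r0; rewrite !mulr_gt0 ?expR_gt0 ?powR_gt0.
move=> r r0; apply: cvgMr; apply: cvgM; first exact: cvg_id.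
exact: rc0.
Qed.

(** The second moment in r is nonnegative; eliminating the second derivative by the equation leaves
    a bound showing that -h' / h grows at most linearly. *)
Lemma herm1_ge x : - (x * herm1 x) <= (2 * x ^+ 2 + 1 - g) * herm0 x.
Proof.
have E (r : R) : 2 * (r ^+ 2 * (gauss0 (x + r) * r `^ (- g))) =
    2^-1 * (gauss2 (x + r) * r `^ (- g)) + 2 * x * (gauss1 (x + r) * r `^ (- g)) +
    (1 + 2 * x ^+ 2) * (gauss0 (x + r) * r `^ (- g)).
  by rewrite /gauss2 /gauss1; field.
have j2 := integrableRZ 2^-1 mpos (i2 x).
have j1 := integrableRZ (2 * x) mpos (i1 x).
have j0 := integrableRZ (1 + 2 * x ^+ 2) mpos (i0 x).
have : 0 <= \int[leb]_(r in pos) (2 * (r ^+ 2 * (gauss0 (x + r) * r `^ (- g)))).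
  apply: Rintegral_ge0 => r _.
  by rewrite mulr_ge0// mulr_ge0 ?sqr_ge0// mulr_ge0 ?expR_ge0 ?powR_ge0.
under eq_Rintegral do rewrite E.
rewrite RintegralD//; last exact: (integrableRD mpos j2 j1).
rewrite RintegralD// !RintegralZl// -!/(rconv _ _ _) -/herm1 -/herm0.
by have := rconv_gauss_ode x; lra.
Qed.

Lemma herm0_decay x : 0 <= x -> herm0 x <= herm0 0 * gauss0 x.
Proof.
move=> x0; rewrite mulrC /herm0 /rconv -RintegralZl//; apply: le_Rintegral => //.
  by apply: integrableRZ => //; exact: i0.
move=> r; rewrite /pos/= in_itv/= andbT => r0.
rewrite mulrA ler_wpM2r ?powR_ge0// /gauss0 -expRD ler_expR add0r.
by rewrite -subr_ge0; have := mulr_ge0 x0 (ltW r0); nra.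
Qed.

(** Completing the square, -x^2 - 2 x r - r^2 = -(x + r)^2, identifies the integral of the statement
    with the fractional integral of the Gaussian. *)
Lemma herm0E x : phi_ (g - 1) x * expR (- x ^+ 2) = herm0 x.
Proof.
rewrite /phi_ /herm0 /rconv.
have E (r : R) : gauss0 (x + r) * r `^ (- g) =
    expR (- x ^+ 2) * (expR (- (2 * x * r) - r ^+ 2) * r `^ (- 1 - (g - 1))).
  rewrite mulrA -expRD (_ : - 1 - (g - 1) = - g); last by ring.
  by congr (expR _ * _); ring.
under [RHS]eq_Rintegral do rewrite E.
rewrite mulrC -RintegralZl//.
have := integrableRZ (expR (x ^+ 2)) mpos (i0 x); apply: eq_integrable => // r _ /=.
by rewrite E mulrA -expRD subrr expR0 mul1r.
Qed.

End Hermite_equation.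

Opaque herm0 herm1.

(** * The inflection point of a positive solution of h'' + 2 x h' + 2 g h = 0 *)

Section Hermite_inflection.
Context {R : realType}.
Variables (g : R) (h h1 : R -> R).
Hypothesis g0 : 0 < g.
Hypothesis dh : forall x : R, is_derive x 1 h (h1 x).
Hypothesis dh1 : forall x : R, is_derive x 1 h1 (- 2 * x * h1 x - 2 * g * h x).
Hypothesis h_gt0 : forall x, 0 < h x.
Hypothesis h1_le0 : h1 0 <= 0.

Let E (x : R) := expR (x ^+ 2).
Let dE (x : R) : is_derive x 1 E (2 * x * E x).
Proof. by rewrite /E; apply: is_derive_eq; rewrite /GRing.scale/=; ring. Qed.

Let mvt (f f' : R -> R) (a b : R) : (forall x : R, is_derive x 1 f (f' x)) -> a < b ->
  exists2 x, a < x < b & f b - f a = f' x * (b - a).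
Proof.
move=> df ab; have [|x xab E1] := @MVT R f f' a b ab (fun x _ => df x).
  by apply: continuous_in_subspaceT => x _; exact: is_derive_continuous (df x).
by exists x => //; move: xab; rewrite in_itv.
Qed.

Let F1 x := E x * h1 x.
Let dF1 (x : R) : is_derive x 1 F1 (- (2 * g * E x * h x)).
Proof.
by apply: (is_derive_eq (is_deriveM (dE x) (dh1 x))); rewrite /GRing.scale/=; ring.
Qed.

Let F1_decr (a b : R) : a < b -> F1 b < F1 a.
Proof.
move=> ab; have [x _ e] := mvt dF1 ab.
rewrite -subr_lt0 e mulNr oppr_lt0 !mulr_gt0 ?subr_gt0 ?expR_gt0//.
Qed.

(** By the equation e^(x^2) h' has derivative -2 g e^(x^2) h < 0, and it is nonpositive at 0. *)
Lemma hermite_derive_lt0 (x : R) : 0 < x -> h1 x < 0.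
Proof.
move=> x0; have : F1 x < 0.
  by apply: lt_le_trans (F1_decr x0) _; rewrite /F1 pmulr_rle0 ?expR_gt0.
by rewrite /F1 pmulr_rlt0 ?expR_gt0.
Qed.

(** By the equation, -1/2 times the second derivative of [h]: its zeros are the inflection
    points. *)
Definition hermite_k (x : R) := x * h1 x + g * h x.

Let m x := E x * hermite_k x.
Let dm (x : R) : is_derive x 1 m ((1 + g) * F1 x).
Proof.
have d1 : is_derive x 1 hermite_k (h1 x + x * (- 2 * x * h1 x - 2 * g * h x) + g * h1 x).
  have a1 := dh1 x; have a := dh x.
  by rewrite /hermite_k; apply: is_derive_eq; rewrite /GRing.scale/=; ring.
apply: (is_derive_eq (is_deriveM (dE x) d1)); rewrite /GRing.scale/= /F1 /hermite_k.
ring.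
Qed.

Let m_decr (a b : R) : 0 <= a -> a < b -> m b < m a.
Proof.
move=> a0 ab; have [x /andP[ax _] e] := mvt dm ab.
rewrite -subr_lt0 e pmulr_llt0 ?subr_gt0// pmulr_rlt0 ?addr_gt0// pmulr_rlt0 ?expR_gt0//.
by apply: hermite_derive_lt0; exact: le_lt_trans ax.
Qed.

(** [m] = e^(x^2) k is positive at 0 and its derivative (1 + g) e^(x^2) h' is negative and stays
    away from 0 beyond 1, so [m] becomes negative. *)
Lemma hermite_inflection_exists : exists2 c, 0 < c & hermite_k c = 0.
Proof.
have cm : continuous m by move=> x; exact: is_derive_continuous (dm x).
have m0 : 0 < m 0 by rewrite /m /hermite_k mul0r add0r !mulr_gt0 ?expR_gt0.
pose b := - F1 1.
have b0 : 0 < b.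
  by rewrite /b oppr_gt0 /F1 pmulr_rlt0 ?expR_gt0//; exact: hermite_derive_lt0.
have gb : 0 < (1 + g) * b by rewrite mulr_gt0// addr_gt0.
(* Beyond 1 the slope of [m] is below -(1 + g) b; between 1 and [x1] this forces a decrease of at
   least (1 + g) b + |m 1|, which exceeds [m 1]. *)
pose x1 := 2 + `|m 1| / ((1 + g) * b).
have x12 : 2 <= x1 by rewrite lerDl divr_ge0// ltW.
have x11 : 1 < x1 by apply: lt_le_trans x12; rewrite ltr1n.
have m1 : m x1 < 0.
  have [x /andP[x_gt1 _] e] := mvt dm x11.
  have Fx : F1 x < - b by rewrite opprK; exact: F1_decr.
  have : m x1 - m 1 <= - ((1 + g) * b) * (x1 - 1).
    rewrite e ler_wpM2r ?subr_ge0 ?(ltW x11)// -mulrN; apply: ler_wpM2l; [by rewrite addr_ge0// ltW|exact: ltW].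
  have -> : - ((1 + g) * b) * (x1 - 1) = - ((1 + g) * b) - `|m 1|.
    by rewrite /x1; move: ((1 + g) * b) gb => q q0; field; rewrite gt_eqF.
  by have := ler_norm (m 1); lra.
have x10 : 0 <= x1 by apply: le_trans x12.
have [||c + mc] := @IVT R m 0 x1 0 x10.
- by apply: continuous_in_subspaceT => x _; exact: cm.
- by rewrite ge_min le_max (ltW m0) (ltW m1) !orbT.
rewrite in_itv/= => /andP[c0 _]; exists c.
  by rewrite lt_neqAle c0 andbT; apply/eqP => c00; rewrite -c00 in mc; rewrite mc ltxx in m0.
by move/eqP: mc; rewrite mulf_eq0 gt_eqF ?expR_gt0//= => /eqP.
Qed.

(** The product with e^(x^2) is strictly decreasing on the half-line, so the zero is unique and the
    sign changes there. *)
Lemma hermite_k_sign (c x : R) : 0 < c -> hermite_k c = 0 -> 0 <= x ->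
  (x < c -> 0 < hermite_k x) /\ (c < x -> hermite_k x < 0).
Proof.
move=> c0 kc x0; have mc : m c = 0 by rewrite /m kc mulr0.
split => xc.
  by have := m_decr x0 xc; rewrite mc pmulr_rgt0 ?expR_gt0.
by have := m_decr (ltW c0) xc; rewrite mc pmulr_rlt0 ?expR_gt0.
Qed.

(** [xget] falls back on its default 0 only when there is no positive zero, which the previous
    existence result excludes. *)
Lemma inflectionP (f : R -> R) : (forall x, f x * expR (- x ^+ 2) = h x) ->
  0 < inflection f /\ hermite_k (inflection f) = 0.
Proof.
move=> fh; rewrite /inflection (_ : (fun x => _) = h); last exact/funext.
have D2 c : derive1n 2 h c = - 2 * hermite_k c.
  rewrite derive1nS derive1n1.
  have -> : (h^`())%classic = h1.
    by apply/funext => x; rewrite derive1E; have [_ ->] := dh x.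
  rewrite derive1E; have [_ ->] := dh1 c; rewrite /hermite_k; ring.
case: xgetP => [c _ [c0]|/(_ _)].
  rewrite D2 => /eqP; rewrite mulf_eq0 => /orP[|/eqP//].
  by rewrite oppr_eq0 pnatr_eq0.
have [c c0 kc] := hermite_inflection_exists => /(_ c)[].
by split => //; rewrite D2 kc mulr0.
Qed.

End Hermite_inflection.

Section Inflection_points.
Context {R : realType}.
Variable g : R.
Hypothesis g01 : 0 < g < 1.

Local Notation f := (herm0 g).
Local Notation f1 := (herm1 g).
Definition hermE0 (x : R) := f x + f (- x).
Definition hermE1 (x : R) := f1 x - f1 (- x).

Let is_derive_opp (F : R -> R) (x l : R) : is_derive (- x) 1 F l ->
  is_derive x 1 (fun x => F (- x)) (- l).
Proof.
move=> dF; have := @is_derive1_comp R F (fun y => - y) x _ _ dF (is_deriveNid x 1).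
by rewrite mulrN1.
Qed.

Lemma is_derive_hermE0 (x : R) : is_derive x 1 hermE0 (hermE1 x).
Proof.
have a := is_derive_herm0 g01 x; have b := is_derive_opp (is_derive_herm0 g01 (- x)).
exact: (is_derive_eq (is_deriveD a b)).
Qed.

Lemma is_derive_hermE1 (x : R) :
  is_derive x 1 hermE1 (- 2 * x * hermE1 x - 2 * g * hermE0 x).
Proof.
have a := is_derive_herm1 g01 x; have b := is_derive_opp (is_derive_herm1 g01 (- x)).
apply: (is_derive_eq (is_deriveB a b)); rewrite /hermE1 /hermE0.
by move: (f x) (f (- x)) (f1 x) (f1 (- x)) => A B C D; ring.
Qed.

Lemma hermE0_gt0 x : 0 < hermE0 x.
Proof. by rewrite addr_gt0// herm0_gt0. Qed.

Let g0 : 0 < g. Proof. by case/andP : g01. Qed.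
Let f10 : f1 0 < 0.
Proof. by have := herm1_lt g01 0; rewrite mulr0 mul0r oppr0. Qed.
Let fE10 : hermE1 0 <= 0. Proof. by rewrite /hermE1 oppr0 subrr. Qed.

Lemma c1P : 0 < c1 (g - 1) /\ hermite_k g f f1 (c1 (g - 1)) = 0.
Proof.
apply: (inflectionP g0 (is_derive_herm0 g01) (is_derive_herm1 g01) (herm0_gt0 g01) (ltW f10)).
by move=> x; exact: herm0E.
Qed.

Lemma c0P : 0 < c0 (g - 1) /\ hermite_k g hermE0 hermE1 (c0 (g - 1)) = 0.
Proof.
apply: (inflectionP g0 is_derive_hermE0 is_derive_hermE1 hermE0_gt0 fE10).
by move=> x; rewrite /u_ mulrDl -{2}(sqrrN x) !herm0E.
Qed.

(** Both functions solve the same equation, so e^(x^2) times their Wronskian is the constant [W],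
    positive by its value at 0. At c_1, where k of the one-sided solution vanishes, this makes k of
    the even solution positive; c_0 <= c_1 would make it nonpositive. *)
Lemma c1_lt_c0 : c1 (g - 1) < c0 (g - 1).
Proof.
have [p1 k1] := c1P; have [p0 k0] := c0P.
set c := c1 _ in p1 k1 *.
pose W (x : R) := expR (x ^+ 2) * (f x * hermE1 x - f1 x * hermE0 x).
have dW (x : R) : is_derive x 1 W 0.
  have a := is_derive_herm0 g01 x; have a1 := is_derive_herm1 g01 x.
  have b := is_derive_hermE0 x; have b1 := is_derive_hermE1 x.
  by rewrite /W; apply: is_derive_eq; rewrite /GRing.scale/=; ring.
have Wc : W c = W 0 by apply: is_derive_0_is_cst.
have W0 : 0 < W 0.
  rewrite /W expr0n/= expR0 mul1r /hermE1 oppr0 subrr mulr0 sub0r -mulNr mulr_gt0//.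
    by rewrite oppr_gt0.
  exact: hermE0_gt0.
rewrite ltNge; apply/negP => c0c.
have : hermite_k g hermE0 hermE1 c <= 0.
  move: c0c; rewrite le_eqVlt => /predU1P[<-|]; first by rewrite k0.
  by move=> /((hermite_k_sign g0 is_derive_hermE0 is_derive_hermE1 hermE0_gt0 fE10 p0 k0 (ltW p1)).2)/ltW.
rewrite leNgt => /negP; apply.
rewrite -(pmulr_rgt0 _ (herm0_gt0 g01 c)).
have -> : f c * hermite_k g hermE0 hermE1 c =
    c * (f c * hermE1 c - f1 c * hermE0 c) + hermE0 c * hermite_k g f f1 c.
  by rewrite /hermite_k; ring.
rewrite k1 mulr0 addr0 mulr_gt0//.
by move: W0; rewrite -Wc /W pmulr_rgt0// expR_gt0.
Qed.

End Inflection_points.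

(** * Gluing at a point, and truncated powers *)

Section Gluing.
Context {R : realType}.
Implicit Types (c x : R) (F D : R -> R).

Definition glue c F1 F2 x := if x <= c then F1 x else F2 x.

Lemma glue_le c F1 F2 x : x <= c -> glue c F1 F2 x = F1 x.
Proof. by rewrite /glue => ->. Qed.

Lemma glue_ge c F1 F2 x : F1 c = F2 c -> c <= x -> glue c F1 F2 x = F2 x.
Proof. by rewrite /glue le_eqVlt => Fc /predU1P[<-|cx]; rewrite ?lexx// leNgt cx. Qed.

(** Differentiability as linear approximation with error e |y - x| in a neighbourhood: in this form
    the left and the right side of a gluing point combine by taking the smaller radius. *)
Lemma is_derive_approx F x l : is_derive x 1 F l -> forall e, 0 < e ->
  exists2 d, 0 < d & forall y, `|y - x| <= d -> `|F y - F x - l * (y - x)| <= e * `|y - x|.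
Proof.
move=> [dF lE] e e0.
have := dF; rewrite /derivable => /cvg_ex[l' Hl].
have ll : l' = l by rewrite -lE; apply/esym/cvg_lim.
move: Hl => /cvgrPdist_le/(_ _ e0)/nbhs_ballP[d /= d0 Hd].
exists (d / 2); first by rewrite divr_gt0.
move=> y yx; have [->|yneq] := eqVneq y x; first by rewrite !subrr mulr0 subrr normr0 mulr0.
have yx0 : y - x != 0 by rewrite subr_eq0.
have yb : ball 0 d (y - x).
  rewrite /ball/= sub0r normrN (le_lt_trans yx)// ltr_pdivrMr// mulr2n mulrDr mulr1.
  by rewrite ltrDl.
have := Hd _ yb yx0.
rewrite ll /GRing.scale/= mulr1 subrK => h.
have -> : F y - F x - l * (y - x) = - ((l - (y - x)^-1 * (F y - F x)) * (y - x)).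
  by field.
by rewrite normrN normrM ler_wpM2r.
Qed.

Lemma is_derive_of_approx F x l : (forall e, 0 < e ->
  exists2 d, 0 < d & forall y, `|y - x| <= d -> `|F y - F x - l * (y - x)| <= e * `|y - x|) ->
  is_derive x 1 F l.
Proof.
move=> H.
suff Hl : h^-1 *: (F (h *: 1 + x) - F x) @[h --> 0^'] --> l.
  by apply: DeriveDef; [apply/cvg_ex; exists l|exact/cvg_lim].
apply/cvgrPdist_le => e /H[d d0 Hd]; apply/nbhs_ballP; exists d => //= h.
rewrite /ball/= sub0r normrN => hd h0; rewrite /GRing.scale/= mulr1.
have := Hd (h + x); rewrite addrK => /(_ (ltW hd)).
have -> : F (h + x) - F x - l * h = - ((l - h^-1 * (F (h + x) - F x)) * h) by field.
by rewrite normrN normrM ler_pM2r// normr_gt0.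
Qed.

Lemma is_derive_glue c F1 F2 D1 D2 : F1 c = F2 c -> D1 c = D2 c ->
  (forall x, x <= c -> is_derive x 1 F1 (D1 x)) ->
  (forall x, c <= x -> is_derive x 1 F2 (D2 x)) ->
  forall x, is_derive x 1 (glue c F1 F2) (glue c D1 D2 x).
Proof.
move=> Fc Dc d1 d2 x; apply: is_derive_of_approx => e e0.
have [xc|xc|xc] := ltgtP x c.
- have [d dp Hd] := is_derive_approx (d1 _ (ltW xc)) e0.
  exists (Num.min d (c - x)); first by rewrite lt_min dp subr_gt0.
  move=> y; rewrite le_min => /andP[yd yc].
  have yc' : y <= c by move: yc; rewrite ler_norml => /andP[_]; lra.
  by rewrite !glue_le ?(ltW xc)//; exact: Hd.
- have [d dp Hd] := is_derive_approx (d2 _ (ltW xc)) e0.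
  exists (Num.min d (x - c)); first by rewrite lt_min dp subr_gt0.
  move=> y; rewrite le_min => /andP[yd yc].
  have yc' : c <= y by move: yc; rewrite ler_norml => /andP[+ _]; lra.
  by rewrite !glue_ge ?(ltW xc)//; exact: Hd.
- rewrite xc; have [d dp Hd] := is_derive_approx (d1 _ (lexx c)) e0.
  have [d' dp' Hd'] := is_derive_approx (d2 _ (lexx c)) e0.
  exists (Num.min d d'); first by rewrite lt_min dp.
  move=> y; rewrite le_min => /andP[yd yd'].
  have [yc|yc] := leP y c; first by rewrite !glue_le//; exact: Hd.
  rewrite (glue_ge Fc (ltW yc)) !(glue_ge _ (lexx c))//; exact: Hd'.
Qed.

Lemma continuous_glue c F1 F2 : F1 c = F2 c -> continuous F1 -> continuous F2 ->
  continuous (glue c F1 F2).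
Proof.
move=> Fc c1 c2 x; apply/cvgrPdist_le => e e0.
have [xc|xc|->] := ltgtP x c.
- have /cvgrPdist_le/(_ _ e0) H := c1 x; rewrite glue_le ?(ltW xc)//.
  near=> y; rewrite glue_le; first by near: y; exact: H.
  by apply/ltW; near: y; exact: lt_nbhsl.
- have /cvgrPdist_le/(_ _ e0) H := c2 x; rewrite glue_ge ?(ltW xc)//.
  near=> y; rewrite glue_ge//; first by near: y; exact: H.
  by apply/ltW; near: y; exact: lt_nbhsr.
- have /cvgrPdist_le/(_ _ e0) H1 := c1 c; have /cvgrPdist_le/(_ _ e0) H2 := c2 c.
  near=> y; rewrite [glue _ _ _ c]glue_le//; have [yc|yc] := leP y c.
    by rewrite glue_le//; near: y; exact: H1.
  by rewrite Fc (glue_ge Fc (ltW yc)); near: y; exact: H2.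
Unshelve. all: end_near. Qed.

(** The truncated power s_+^n, of class C^(n-1) for n >= 1. The cube is the least power giving a
    correction with two continuous derivatives. *)
Definition pospow (n : nat) (s : R) : R := Num.max 0 s ^+ n.

Lemma pospowS n (s : R) : pospow n.+2 s = s * pospow n.+1 s.
Proof.
rewrite /pospow exprS; have [s0|s0] := leP s 0; last by [].
by rewrite expr0n/= !mulr0.
Qed.

Lemma is_derive_pospow n (s : R) : is_derive s 1 (pospow n.+2) (n.+2%:R * pospow n.+1 s).
Proof.
have -> : pospow n.+2 = glue 0 (cst 0) (fun s => s ^+ n.+2).
  by apply/funext => y; rewrite /pospow /glue; case: (leP y 0) => // y0; rewrite expr0n.
have -> : n.+2%:R * pospow n.+1 s = glue 0 (cst 0) (fun s => n.+2%:R * s ^+ n.+1) s.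
  by rewrite /pospow /glue; case: (leP s 0) => // y0; rewrite expr0n/= mulr0.
have g0 : (cst 0 : R -> R) 0 = 0 ^+ n.+2 by rewrite expr0n.
have g1 : (cst 0 : R -> R) 0 = n.+2%:R * 0 ^+ n.+1 by rewrite expr0n mulr0.
apply: (@is_derive_glue 0 (cst 0) (fun s => s ^+ n.+2) (cst 0) (fun s => n.+2%:R * s ^+ n.+1) g0 g1) => x _.
by have := is_deriveX n.+2 (is_derive_id x (1 : R)); rewrite exprfctE /GRing.scale/= mulr1.
Qed.

Lemma continuous_pospow n : continuous (pospow n).
Proof.
move=> s; have cm : {for s, continuous (fun s : R => Num.max 0 s)}.
  by apply: continuous_max; [exact: cvg_cst|exact: cvg_id].
exact: (continuous_comp cm (@exprn_continuous R n _)).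
Qed.

End Gluing.

(** * The corrected logarithmic derivative on one side of the gluing point *)

Section Perturbed_branch.
Context {R : realType}.
Variables (g al c : R) (L ps : R -> R) (th K ell e : R).
Hypothesis dL : forall y : R, is_derive y 1 L (ps y).
Hypothesis dps : forall y : R, is_derive y 1 ps (- ps y ^+ 2 - (2 * g + 2 * y * ps y) / al).
Hypothesis ell0 : 0 < ell.
Hypothesis ee : e * e = 1.

Definition branch_d (y : R) := - ps y ^+ 2 - (2 * g + 2 * y * ps y) / al.
(** Equal to 1 at [c] and to 0 at distance [ell] from it; [e] is 1 for the left branch and -1 for
    the right one. *)
Definition branch_s (y : R) := 1 + e * (y - c) / ell.
(** Zero at [c] with slope [K] there: the value of the logarithmic derivative is kept and only its
    derivative is corrected. Beyond [ell] it vanishes together with two derivatives. *)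
Definition branch_q (y : R) := K * (y - c) * pospow 3 (branch_s y).
Definition branch_q1 (y : R) :=
  K * pospow 3 (branch_s y) + 3 * K * (y - c) * (e / ell) * pospow 2 (branch_s y).
Definition branch_q2 (y : R) :=
  6 * K * (e / ell) * pospow 2 (branch_s y)
  + 6 * K * (y - c) * (e / ell) ^+ 2 * pospow 1 (branch_s y).
(** The polynomial part is a primitive of [branch_q]: in terms of s one has y - c = e ell (s -
    1). *)
Definition branch0 (y : R) := th * L y
  + K * ell ^+ 2 * (pospow 5 (branch_s y) / 5 - pospow 4 (branch_s y) / 4).
Definition branch1 (y : R) := th * ps y + branch_q y.
Definition branch2 (y : R) := th * branch_d y + branch_q1 y.
Definition branch3 (y : R) :=
  th * (- 2 * ps y * branch_d y - (2 * ps y + 2 * y * branch_d y) / al) + branch_q2 y.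

Let ds (y : R) : is_derive y 1 branch_s (e / ell).
Proof. by rewrite /branch_s; apply: is_derive_eq; rewrite /GRing.scale/=; ring. Qed.

Let dpp n (y : R) : is_derive y 1 (fun y => pospow n.+2 (branch_s y))
  (n.+2%:R * pospow n.+1 (branch_s y) * (e / ell)).
Proof. exact: (@is_derive1_comp R (pospow n.+2) branch_s y _ _ (is_derive_pospow n _) (ds y)). Qed.

Lemma is_derive_branch0 (y : R) : is_derive y 1 branch0 (branch1 y).
Proof.
have a := dL y; have b5 := dpp 3 y; have b4 := dpp 2 y.
rewrite /branch0; apply: is_derive_eq; rewrite /GRing.scale/= /branch1 /branch_q.
rewrite !(pospowS 3) !(pospowS 2).
have -> : K * (y - c) * pospow 3 (branch_s y) =
    K * ell * (e * e) * ((y - c) / ell) * pospow 3 (branch_s y).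
  by rewrite ee; field; rewrite gt_eqF.
by rewrite /branch_s; move: (pospow 3 _) => P; field; rewrite gt_eqF.
Qed.

Lemma is_derive_branch1 (y : R) : is_derive y 1 branch1 (branch2 y).
Proof.
have a := dps y; have b := dpp 1 y.
rewrite /branch1 /branch_q; apply: is_derive_eq; rewrite /GRing.scale/= /branch2 /branch_q1 /branch_d.
by move: (pospow 3 _) (pospow 2 _) al^-1 => P P' ai; field; rewrite gt_eqF.
Qed.

Lemma is_derive_branch2 (y : R) : is_derive y 1 branch2 (branch3 y).
Proof.
have a := dps y; have b := dpp 1 y; have b' := dpp 0 y.
rewrite /branch2 /branch_q1 /branch_d; apply: is_derive_eq.
rewrite /GRing.scale/= /branch3 /branch_q2 /branch_d.
move: (pospow 2 _) (pospow 1 _) (ps y) => P P' p.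
by move: al^-1 => ai; field; rewrite gt_eqF.
Qed.

Lemma continuous_branch3 : continuous branch3.
Proof.
have cps : continuous ps by move=> y; exact: is_derive_continuous (dps y).
have cs : continuous branch_s by move=> y; exact: is_derive_continuous (ds y).
have cpp n : continuous (fun y => pospow n (branch_s y)).
  by move=> y; exact: (continuous_comp (cs y) (@continuous_pospow R n _)).
have cid : continuous (fun y : R => y) by move=> y; exact: cvg_id.
have cd : continuous branch_d.
  move=> y; apply: cvgB; first by apply: cvgN; exact: (continuous_comp (cps y) (@exprn_continuous R 2 _)).
  apply: cvgMl; apply: cvgD; first exact: cvg_cst.
  by apply: cvgM; [apply: cvgMr; exact: cid|exact: cps].
move=> y; apply: cvgD.
  apply: cvgMr; apply: cvgB; first by apply: cvgM; [apply: cvgMr; exact: cps|exact: cd].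
  apply: cvgMl; apply: cvgD; first by apply: cvgMr; exact: cps.
  by apply: cvgM; [apply: cvgMr; exact: cid|exact: cd].
apply: cvgD; first by apply: cvgMr; exact: cpp.
apply: cvgM; last exact: cpp.
by apply: cvgMl; apply: cvgMr; apply: cvgB; [exact: cid|exact: cvg_cst].
Qed.

Lemma branch_far (y : R) : branch_s y <= 0 ->
  [/\ branch0 y = th * L y, branch_q y = 0, branch_q1 y = 0 & branch_q2 y = 0].
Proof.
move=> s0; have P n : pospow n.+1 (branch_s y) = 0.
  by rewrite /pospow; move: s0; case: leP => // _ _; rewrite expr0n.
rewrite /branch0 /branch_q /branch_q1 /branch_q2 !P.
by split; rewrite ?mul0r ?subrr ?mulr0 ?addr0.
Qed.

Hypothesis c0 : 0 < c.
Hypothesis al0 : al != 0.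
Hypothesis psc : ps c = - (g / c).

(** The entries below the third depend neither on [e] nor on [al], so two branches with equal [L c]
    agree at [c] up to [branch2] for any [K] and [ell]. Only [branch3] distinguishes them, and its
    matching determines K / ell. *)
Lemma branch_at :
  [/\ branch0 c = th * L c - K * ell ^+ 2 / 20, branch1 c = - (th * (g / c)),
      branch2 c = K - th * (g / c) ^+ 2 &
      branch3 c = th * (- 2 * (g / c) ^+ 3 + 2 * g * (1 + g) / (c * al)) + 6 * K * (e / ell)].
Proof.
have s1 : branch_s c = 1 by rewrite /branch_s subrr mulr0 mul0r addr0.
have P n : pospow n (branch_s c) = 1.
  by rewrite s1 /pospow (max_idPr ler01) expr1n.
have cn : c != 0 by rewrite gt_eqF.
have d : branch_d c = - (g / c) ^+ 2.
  rewrite /branch_d psc (_ : 2 * g + 2 * c * - (g / c) = 0); last by field.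
  by rewrite mul0r subr0 sqrrN.
rewrite /branch0 /branch1 /branch2 /branch3 /branch_q /branch_q1 /branch_q2 !P d psc.
split; rewrite ?subrr ?mulr0 ?mul0r ?addr0 ?mulr1.
- by field.
- by rewrite mulrN.
- by ring.
- by field; rewrite cn al0 gt_eqF.
Qed.

End Perturbed_branch.

(** * The two-sided bound on S within distance [ell] of the gluing point *)

Section Branch_inequalities.
Context {R : realType}.
Implicit Types (w n y d q : R).

(** The derivative of x (1 - x)^3; the slope of the correction at distance d from [c] is K nhat (d /
    ell). *)
Let nhat (x : R) := (1 - x) ^+ 2 * (1 - 4 * x).
Let nhat_le x : 0 <= x <= 1 -> nhat x <= 1 - x.
Proof.
move=> /andP[x0 x1]; rewrite -subr_ge0 /nhat.
have -> : 1 - x - (1 - x) ^+ 2 * (1 - 4 * x) = x * (1 - x) * (5 - 4 * x) by ring.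
by rewrite !mulr_ge0 ?subr_ge0//; lra.
Qed.
Let nhat_ge x : 0 <= x <= 1 -> 1 - 6 * x <= nhat x.
Proof.
move=> /andP[x0 x1]; rewrite -subr_ge0 /nhat.
have -> : (1 - x) ^+ 2 * (1 - 4 * x) - (1 - 6 * x) = x * x * (9 - 4 * x) by ring.
by rewrite !mulr_ge0//; lra.
Qed.

Variables (al th T w2 ell C B1 c : R).
Hypothesis al1 : 1 < al.
Hypothesis th12 : 1 < th <= 2.
Hypothesis T_def : T = th ^+ 2 - th.
Hypothesis w2_gt0 : 0 < w2.
Hypothesis ell0 : 0 < ell.
Hypothesis B10 : 0 <= B1.
Hypothesis c0 : 0 < c.
Hypothesis small : ell * (C + w2 * (4 * c + 4 * B1 + 1)) <= w2.
Hypothesis Tsmall : T * w2 * ell <= 1.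
Variable B : R.
Hypothesis B_def : T * w2 / ell = B / 12.

Let T0 : 0 <= T.
Proof. by rewrite T_def; have /andP[] := th12 => t1 t2; nra. Qed.

Let x01P d : 0 <= d -> d <= ell -> 0 <= d / ell <= 1 /\ 0 <= (1 - d / ell) ^+ 3 <= 1.
Proof.
move=> d0 dl.
have x0 : 0 <= d / ell by rewrite divr_ge0// ltW.
have x1 : d / ell <= 1 by rewrite ler_pdivrMr// mul1r.
split; first by rewrite x0.
by rewrite exprn_ge0 ?subr_ge0//= exprn_ile1 ?subr_ge0// gerDl oppr_le0.
Qed.

Let thw w : `|w| <= B1 -> - (2 * B1) <= th * w.
Proof.
move=> wB; have /andP[t1 t2] := th12; have h0 : 0 <= th by exact: le_trans (ltW t1).
have wn : - w <= B1 by apply: le_trans wB; rewrite -normrN ler_norm.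
have h1 := ler_wpM2l h0 wn; have h2 := ler_wpM2r B10 t2; lra.
Qed.

Let thw0 w : w <= 0 -> th * w <= 0.
Proof. by move=> w0; have /andP[t1 t2] := th12; rewrite pmulr_rle0// (lt_trans ltr01). Qed.

Let dival y z : 0 <= z -> y <= z -> y / al <= z.
Proof.
move=> z0 yz; rewrite ler_pdivrMr ?(lt_trans ltr01)// (le_trans yz)// ler_peMr// ltW//.
Qed.

(** Here [w] is the unperturbed logarithmic derivative at distance [d] from [c], and the expression
    is S - N. As [nhat] falls at least as fast as 1 - x, a surplus T w2 d / ell remains; every error
    is of order T d and is absorbed when [ell] is small. *)
Lemma branch_left_ge w d y q : 0 <= d <= ell -> `|w| <= B1 -> 0 <= y ->
  w2 - C * d <= w ^+ 2 ->
  q = T * w2 * d * (1 - d / ell) ^+ 3 ->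
  0 <= T * (w ^+ 2 - w2 * nhat (d / ell)) + q * (2 * th * w + 2 * y + q).
Proof.
move=> /andP[d0 dl] wB y0 wC qE.
have [x01 s01] := x01P d0 dl.
set s := (1 - d / ell) ^+ 3 in s01 qE.
have -> : T * (w ^+ 2 - w2 * nhat (d / ell)) + q * (2 * th * w + 2 * y + q) =
   T * ((w ^+ 2 - w2 * nhat (d / ell)) + w2 * d * s * (2 * th * w + 2 * y + q)).
  by rewrite {1}qE; ring.
apply: mulr_ge0 => //.
have q0 : 0 <= q.
  by rewrite qE mulr_ge0 ?(andP s01).1// mulr_ge0// mulr_ge0// ltW.
have n1 : w2 * (d / ell) - C * d <= w ^+ 2 - w2 * nhat (d / ell).
  have := ler_wpM2l (ltW w2_gt0) (nhat_le x01); lra.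
have l1 : d * (C + w2 * (4 * c + 4 * B1 + 1)) <= w2 * (d / ell).
  by rewrite mulrCA ler_wpM2l// ler_pdivlMr// mulrC.
have l2 : - (4 * B1) <= 2 * th * w + 2 * y + q.
  by have := thw wB; lra.
have l3 : - (w2 * d * (4 * B1)) <= w2 * d * s * (2 * th * w + 2 * y + q).
  have /andP[s0 s1] := s01.
  have wd : 0 <= w2 * d by rewrite mulr_ge0// ltW.
  have : - (w2 * d * s * (4 * B1)) <= w2 * d * s * (2 * th * w + 2 * y + q).
    by rewrite -mulrN ler_wpM2l// mulr_ge0.
  apply: le_trans; rewrite lerN2 ler_wpM2r ?mulr_ge0//.
  by rewrite ler_piMr.
have := mulr_ge0 d0 (mulr_ge0 (ltW w2_gt0) (addr_ge0 (mulr_ge0 (ler0n _ 4) (ltW c0)) ler01)).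
lra.
Qed.

(** The expression is N / al - S, and [n] stands for 2 g + 2 y w. The estimate nhat x >= 1 - 6 x
    costs 6 T w2 d / ell = B d / 2, the errors cost B d / 12, and [n] supplies 3/4 of B d. *)
Lemma branch_left_le w d y q n : 0 <= d <= ell -> 0 <= y <= c -> w <= 0 ->
  w ^+ 2 <= w2 + C * d ->
  q = T * w2 * d * (1 - d / ell) ^+ 3 ->
  3 / 4 * (B * d) <= (1 - al^-1) * th * n ->
  0 <= (1 - al^-1) * th * n - T * (w ^+ 2 - w2 * nhat (d / ell))
       - q * (2 * y / al + 2 * th * w + q).
Proof.
move=> /andP[d0 dl] /andP[y0 yc] w0 wC qE nB.
have [x01 s01] := x01P d0 dl.
set s := (1 - d / ell) ^+ 3 in s01 qE.
have Tw : 0 <= T * w2 * d by rewrite !mulr_ge0// ltW.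
have q0 : 0 <= q by rewrite qE mulr_ge0//; case/andP : s01.
have q1 : q <= T * w2 * d by rewrite qE ler_piMr//; case/andP : s01.
have q2 : q <= 1.
  apply: le_trans q1 _; apply: le_trans Tsmall; rewrite ler_wpM2l// mulr_ge0//.
  exact: ltW.
have e1 : T * (w ^+ 2 - w2 * nhat (d / ell)) <= T * (C * d) + B * d / 2.
  have -> : B * d / 2 = T * (w2 * (6 * (d / ell))).
    have -> : B = 12 * (T * w2 / ell) by rewrite B_def; field.
    by field; rewrite gt_eqF.
  rewrite -mulrDr ler_wpM2l//.
  have := ler_wpM2l (ltW w2_gt0) (nhat_ge x01); lra.
have yal : 2 * y / al <= 2 * c.
  by apply: dival; [rewrite mulr_ge0// ltW|lra].
have e2 : q * (2 * y / al + 2 * th * w + q) <= T * w2 * d * (2 * c + 1).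
  apply: (@le_trans _ _ (q * (2 * c + 1))); last by rewrite ler_wpM2r// addr_ge0// mulr_ge0 ?ltW.
  by rewrite ler_wpM2l//; have := thw0 w0; lra.
have e3 : T * d * (C + w2 * (4 * c + 4 * B1 + 1)) <= B * d / 12.
  have -> : B * d / 12 = T * d * (w2 / ell).
    have -> : B = 12 * (T * w2 / ell) by rewrite B_def; field.
    by field; rewrite gt_eqF.
  by rewrite ler_wpM2l ?mulr_ge0// ler_pdivlMr// mulrC.
have Td : 0 <= T * d * w2 by rewrite !mulr_ge0// ltW.
have Bd : 0 <= B * d.
  have -> : B = 12 * (T * w2 / ell) by rewrite B_def; field.
  have h : 0 <= T * w2 / ell by rewrite divr_ge0 ?(ltW ell0)// mulr_ge0// ltW.
  by posit.
have p1 := mulr_ge0 Td (ltW c0); have p2 := mulr_ge0 Td B10.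
lra.
Qed.

(** To the right the correction is negative, so its cofactor must be bounded from above: [w] and [q]
    are nonpositive, leaving 2 y / al <= 4 c. This is the origin of the term 4 c in the smallness
    condition. *)
Lemma branch_right_ge w d y q : 0 <= d <= ell -> 0 <= y <= 2 * c -> w <= 0 ->
  w2 - C * d <= w ^+ 2 ->
  q = - (T * w2 * d * (1 - d / ell) ^+ 3) ->
  0 <= T * (w ^+ 2 - w2 * nhat (d / ell)) + q * (2 * th * w + q + 2 * y / al).
Proof.
move=> /andP[d0 dl] /andP[y0 yc] w0 wC qE.
have [x01 s01] := x01P d0 dl.
set s := (1 - d / ell) ^+ 3 in s01 qE.
have -> : T * (w ^+ 2 - w2 * nhat (d / ell)) + q * (2 * th * w + q + 2 * y / al) =
   T * ((w ^+ 2 - w2 * nhat (d / ell)) - w2 * d * s * (2 * th * w + q + 2 * y / al)).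
  by rewrite {1}qE; ring.
apply: mulr_ge0 => //.
have q0 : q <= 0.
  by rewrite qE oppr_le0 mulr_ge0 ?(andP s01).1// mulr_ge0// mulr_ge0// ltW.
have n1 : w2 * (d / ell) - C * d <= w ^+ 2 - w2 * nhat (d / ell).
  have := ler_wpM2l (ltW w2_gt0) (nhat_le x01); lra.
have l1 : d * (C + w2 * (4 * c + 4 * B1 + 1)) <= w2 * (d / ell).
  by rewrite mulrCA ler_wpM2l// ler_pdivlMr// mulrC.
have yal : 2 * y / al <= 4 * c.
  by apply: dival; [rewrite mulr_ge0// ltW|lra].
have l2 : 2 * th * w + q + 2 * y / al <= 4 * c.
  by have := thw0 w0; lra.
have l3 : w2 * d * s * (2 * th * w + q + 2 * y / al) <= w2 * d * (4 * c).
  have /andP[s0 s1] := s01.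
  have wd : 0 <= w2 * d by rewrite mulr_ge0// ltW.
  apply: (@le_trans _ _ (w2 * d * s * (4 * c))); first by rewrite ler_wpM2l// mulr_ge0.
  by rewrite ler_wpM2r ?mulr_ge0 ?(ltW c0)// ler_piMr.
have p1 := mulr_ge0 d0 (ltW w2_gt0); have p2 := mulr_ge0 p1 B10.
lra.
Qed.

Lemma branch_right_le w d y q n : 0 <= d <= ell -> 0 <= y -> `|w| <= B1 ->
  w ^+ 2 <= w2 + C * d ->
  q = - (T * w2 * d * (1 - d / ell) ^+ 3) ->
  3 / 4 * (B * d) <= (1 - al^-1) * th * n ->
  0 <= (1 - al^-1) * th * n - T * (w ^+ 2 - w2 * nhat (d / ell))
       - q * (2 * y + 2 * th * w + q).
Proof.
move=> /andP[d0 dl] y0 wB wC qE nB.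
have [x01 s01] := x01P d0 dl.
set s := (1 - d / ell) ^+ 3 in s01 qE.
have Tw : 0 <= T * w2 * d by rewrite !mulr_ge0// ltW.
have q0 : 0 <= - q by rewrite qE opprK mulr_ge0//; case/andP : s01.
have q1 : - q <= T * w2 * d by rewrite qE opprK ler_piMr//; case/andP : s01.
have q2 : - q <= 1.
  apply: le_trans q1 _; apply: le_trans Tsmall; rewrite ler_wpM2l// mulr_ge0//.
  exact: ltW.
have e1 : T * (w ^+ 2 - w2 * nhat (d / ell)) <= T * (C * d) + B * d / 2.
  have -> : B * d / 2 = T * (w2 * (6 * (d / ell))).
    have -> : B = 12 * (T * w2 / ell) by rewrite B_def; field.
    by field; rewrite gt_eqF.
  rewrite -mulrDr ler_wpM2l//.
  have := ler_wpM2l (ltW w2_gt0) (nhat_ge x01); lra.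
have e2 : - q * - (2 * y + 2 * th * w + q) <= T * w2 * d * (4 * B1 + 1).
  apply: (@le_trans _ _ (- q * (4 * B1 + 1))).
    by rewrite ler_wpM2l//; have := thw wB; lra.
  by rewrite ler_wpM2r// addr_ge0// mulr_ge0.
have e3 : T * d * (C + w2 * (4 * c + 4 * B1 + 1)) <= B * d / 12.
  have -> : B * d / 12 = T * d * (w2 / ell).
    have -> : B = 12 * (T * w2 / ell) by rewrite B_def; field.
    by field; rewrite gt_eqF.
  by rewrite ler_wpM2l ?mulr_ge0// ler_pdivlMr// mulrC.
have Td : 0 <= T * d * w2 by rewrite !mulr_ge0// ltW.
have Bd : 0 <= B * d.
  have -> : B = 12 * (T * w2 / ell) by rewrite B_def; field.
  have h : 0 <= T * w2 / ell by rewrite divr_ge0 ?(ltW ell0)// mulr_ge0// ltW.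
  by posit.
have p1 := mulr_ge0 Td (ltW c0); have p2 := mulr_ge0 Td B10.
lra.
Qed.

End Branch_inequalities.

(** * Choice of the correction and verification of the bounds on the half-line *)

Section Profile_logarithm.
Context {R : realType}.
Variables (g al c : R) (LL LR psL psR : R -> R).
Hypotheses (g0 : 0 < g) (al1 : 1 < al) (c0 : 0 < c).
Hypothesis dLL : forall y : R, is_derive y 1 LL (psL y).
Hypothesis dLR : forall y : R, is_derive y 1 LR (psR y).
Hypothesis dpsL : forall y : R, is_derive y 1 psL (- psL y ^+ 2 - (2 * g + 2 * y * psL y) / 1).
Hypothesis dpsR : forall y : R, is_derive y 1 psR (- psR y ^+ 2 - (2 * g + 2 * y * psR y) / al).
Hypotheses (LLc : LL c = LR c) (psLc : psL c = - (g / c)) (psRc : psR c = - (g / c)).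
Hypothesis psL0 : psL 0 = 0.
Hypothesis nL : forall y, 0 <= y < c -> 0 < 2 * g + 2 * y * psL y.
Hypothesis nR : forall y, c < y -> 2 * g + 2 * y * psR y < 0.
(** Through the Riccati equation this says that [psR] is nonincreasing beyond [c]. *)
Hypothesis pR1 : forall y, c <= y -> - (2 * g + 2 * y * psR y) <= al * psR y ^+ 2.
Variables (r0 : R).
Hypotheses (r00 : 0 < r0).
Hypothesis pR2 : forall y, c <= y -> 2 * g + y * psR y <= 0 ->
  r0 * psR y ^+ 2 <= - (2 * g + 2 * y * psR y).

Let nonincr (f f' : R -> R) (a b : R) : (forall x : R, is_derive x 1 f (f' x)) ->
  a <= b -> (forall x, a < x < b -> f' x <= 0) -> f b <= f a.
Proof.
rewrite le_eqVlt => df /predU1P[->//|ab] f0.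
have [|x xab E1] := @MVT R f f' a b ab (fun x _ => df x).
  by apply: continuous_in_subspaceT => x _; exact: is_derive_continuous (df x).
rewrite -subr_le0 E1 pmulr_lle0 ?subr_gt0//; apply: f0.
by move: xab; rewrite in_itv.
Qed.

Let w2 := (g / c) ^+ 2.
(** The common value at [c] of minus the derivative of 2 g + 2 y ps, for ps = [psL] and ps =
    [psR]. *)
Let M := 2 * g * (1 + g) / c.
Let w2_gt0 : 0 < w2. Proof. by rewrite exprn_gt0// divr_gt0. Qed.
Let M_gt0 : 0 < M. Proof. by rewrite divr_gt0// !mulr_gt0// addr_gt0. Qed.
Let al0 : 0 < al. Proof. exact: lt_trans al1. Qed.
Let alV : 0 < 1 - al^-1. Proof. by rewrite subr_gt0 invf_lt1. Qed.
Let nl y := 2 * g + 2 * y * psL y.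
Let nr y := 2 * g + 2 * y * psR y.

Let dL y := - psL y ^+ 2 - (2 * g + 2 * y * psL y) / 1.
Let dR y := - psR y ^+ 2 - (2 * g + 2 * y * psR y) / al.
Let dn ps (d : R -> R) (y : R) : is_derive y 1 ps (d y) ->
  is_derive y 1 (fun y => 2 * g + 2 * y * ps y) (2 * ps y + 2 * y * d y).
Proof. by move=> a; apply: is_derive_eq; rewrite /GRing.scale/=; ring. Qed.

Let psL_le0 y : 0 <= y <= c -> psL y <= 0.
Proof.
move=> /andP[y0 yc]; rewrite -psL0; apply: (nonincr dpsL y0) => x /andP[x0 xy].
have := nL (y := x); rewrite (ltW x0) (lt_le_trans xy yc) => /(_ isT) h.
by rewrite divr1; have := sqr_ge0 (psL x); lra.
Qed.

Let psL_ge y : 0 <= y <= c -> - (g / c) <= psL y.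
Proof.
move=> /andP[y0 yc]; rewrite -psLc; apply: (nonincr dpsL yc) => x /andP[x0 xy].
have := nL (y := x); rewrite (le_trans y0 (ltW x0)) xy => /(_ isT) h.
by rewrite divr1; have := sqr_ge0 (psL x); lra.
Qed.

Let nl_decr a b : 0 <= a -> a <= b -> b <= c -> nl b <= nl a.
Proof.
move=> a0 ab bc; apply: (nonincr (fun y => @dn psL dL y (dpsL y)) ab) => x /andP[ax xb].
have x0 : 0 <= x by rewrite (le_trans a0)// ltW.
have xc : x < c by exact: lt_le_trans bc.
have := nL (y := x); rewrite x0 xc => /(_ isT) h.
have := @psL_le0 x; rewrite x0 (ltW xc) => /(_ isT) h1.
have := mulr_ge0 x0 (sqr_ge0 (psL x)); have := mulr_ge0 x0 (ltW h).
by rewrite /dL divr1; lra.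
Qed.

Let psR_lt0 y : c <= y -> psR y < 0.
Proof.
rewrite le_eqVlt => /predU1P[<-|yc]; first by rewrite psRc oppr_lt0 divr_gt0.
have := nR yc => h; have y0 : 0 < y by exact: lt_trans yc.
have h2 : 2 * g + 2 * (y * psR y) < 0 by rewrite mulrA.
have h3 := g0; have : y * psR y < 0 by lra.
by rewrite pmulr_rlt0.
Qed.

Let psR_d_le0 y : c <= y -> - psR y ^+ 2 - nr y / al <= 0.
Proof.
move=> cy; have := pR1 cy; rewrite -/(nr y) => h.
have : - nr y / al <= psR y ^+ 2 by rewrite ler_pdivrMr// mulrC.
by rewrite mulNr; lra.
Qed.

Let psR_decr a b : c <= a -> a <= b -> psR b <= psR a.
Proof.
move=> ca ab; apply: (nonincr dpsR ab) => x /andP[ax _].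
by apply: psR_d_le0; rewrite (le_trans ca)// ltW.
Qed.

(** The quotient -nr / psR^2 is nondecreasing while 2 g + y psR > 0, by the sign of its derivative;
    a lower bound just outside the correction therefore propagates outwards. *)
Let ratio_incr a y : c < a -> a <= y -> 0 < 2 * g + y * psR y ->
  - nr a * psR y ^+ 2 <= - nr y * psR a ^+ 2.
Proof.
move=> ca ay py; have cy : c < y by exact: lt_le_trans ay.
pose F t := nr t * (psR t ^+ 2)^-1.
have F_le : F y <= F a.
  have [->|] := eqVneq y a => // ya.
  have ay' : a < y by rewrite lt_neqAle eq_sym ya.
  have dF (t : R) : c < t -> is_derive t 1 F
     (psR t ^- 3 * (2 * psR t ^+ 2 - (- psR t ^+ 2 - nr t / al) * (2 * (2 * g + t * psR t)))).
    move=> ct; have p0 : psR t != 0 by rewrite lt_eqF// psR_lt0// ltW.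
    have p2 : psR t ^+ 2 != 0 by rewrite expf_neq0.
    have a1 := dpsR t; have a2 := @dn psR dR t (dpsR t).
    rewrite /F; apply: is_derive_eq; rewrite /GRing.scale/= /nr.
    by rewrite /dR; move: al^-1 (psR t) p0 p2 => ai p p0 p2; field.
  pose F' t := psR t ^- 3 * (2 * psR t ^+ 2 - (- psR t ^+ 2 - nr t / al) * (2 * (2 * g + t * psR t))).
  have dFI (x : R) : x \in `]a, y[ -> is_derive x 1 F (F' x).
    by rewrite in_itv/= => /andP[ax _]; apply: dF; exact: lt_trans ax.
  have cF : {within `[a, y], continuous F}.
    apply: continuous_in_subspaceT => x; rewrite inE/= in_itv/= => /andP[ax _].
    exact: is_derive_continuous (dF x (lt_le_trans ca ax)).
  have [x] := MVT ay' dFI cF.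
  rewrite in_itv/= => /andP[ax xy] E1.
  rewrite -subr_le0 E1 /F' pmulr_lle0 ?subr_gt0//.
  have cx : c <= x by rewrite ltW// (lt_trans ca).
  have x0 : 0 < x by exact: lt_le_trans cx.
  have px := psR_lt0 cx.
  rewrite nmulr_rle0; last by rewrite invr_lt0 exprSr pmulr_rlt0 ?exprn_even_gt0//= lt_eqF.
  have pxy := psR_decr cx (ltW xy).
  have h1 : 0 <= 2 * g + x * psR x.
    have : y * psR y <= x * psR x.
      apply: (@le_trans _ _ (x * psR y)); last by rewrite ler_pM2l.
      by rewrite ler_nM2r ?psR_lt0 ?(ltW cy)// ltW.
    lra.
  have h2 := psR_d_le0 cx.
  have := sqr_ge0 (psR x); have := mulr_le0_ge0 h2 h1; lra.
have pa : 0 < psR a ^+ 2 by rewrite exprn_even_gt0//= lt_eqF// psR_lt0// ltW.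
have py' : 0 < psR y ^+ 2 by rewrite exprn_even_gt0//= lt_eqF// psR_lt0// ltW.
move: F_le; rewrite /F ler_pdivrMr// mulrAC ler_pdivlMr// => h.
by rewrite !mulNr lerN2.
Qed.

Let D0 := 2 * g * w2 / c.
Let C := D0 + 1.
Let B1 := w2 + C + 1.
Let C0 : 0 <= C.
Proof. by rewrite /C /D0; posit. Qed.
Let B10 : 0 <= B1. Proof. by rewrite /B1; posit. Qed.

(** First-order expansion at [c]. Since 2 g + 2 y ps vanishes there, the Riccati equation gives ps'
    = -w2 for every coefficient [b]; hence [D0] and [-M] are the derivatives of ps^2 and of 2 g + 2
    y ps, the same on both sides. *)
Let near_c ps (b : R) : 0 < b -> ps c = - (g / c) ->
  (forall y : R, is_derive y 1 ps (- ps y ^+ 2 - (2 * g + 2 * y * ps y) / b)) ->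
  exists2 d, 0 < d & forall y, `|y - c| <= d ->
    [/\ `|ps y ^+ 2 - w2| <= C * `|y - c|,
        `|2 * g + 2 * y * ps y + M * (y - c)| <= M / 4 * `|y - c| & `|ps y| <= B1].
Proof.
move=> b0 psc dps.
have n0 : 2 * g + 2 * c * ps c = 0 by rewrite psc; field; rewrite gt_eqF.
have dc := dps c; rewrite n0 mul0r subr0 psc sqrrN -/w2 in dc.
have d1 : is_derive c 1 (fun y => ps y ^+ 2) D0.
  by apply: (is_derive_eq (is_deriveX 2 dc)); rewrite /GRing.scale/= psc /D0; field; rewrite gt_eqF.
have d2 : is_derive c 1 (fun y => 2 * g + 2 * y * ps y) (- M).
  apply: (is_derive_eq (@dn ps (fun=> - w2) c dc)); rewrite psc /M /w2.
  by field; rewrite gt_eqF.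
have [e1 e10 H1] := is_derive_approx d1 ltr01.
have M4 : 0 < M / 4 by rewrite divr_gt0.
have [e2 e20 H2] := is_derive_approx d2 M4.
exists (Num.min 1 (Num.min e1 e2)); first by rewrite !lt_min ltr01 e10.
move=> y; rewrite !le_min => /and3P[y1 ye1 ye2].
have h1 : `|ps y ^+ 2 - w2| <= C * `|y - c|.
  have := H1 _ ye1; rewrite psc sqrrN -/w2 mul1r => h.
  have D00 : 0 <= D0 by rewrite /D0; posit.
  have := ler_normD (ps y ^+ 2 - w2 - D0 * (y - c)) (D0 * (y - c)).
  by rewrite subrK normrM (ger0_norm D00) /C; lra.
split => //.
  by have := H2 _ ye2; rewrite n0 subr0 mulNr opprK.
have : ps y ^+ 2 <= B1 ^+ 2.
  have : ps y ^+ 2 - w2 <= C by rewrite (le_trans (ler_norm _))// (le_trans h1)// ler_piMr.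
  have : 1 <= B1 by rewrite lerDr addr_ge0// ltW.
  by rewrite /B1; nra.
by rewrite -[ps y ^+ 2]real_normK ?num_real// ler_pXn2r ?nnegrE.
Qed.

(** With S = g'' / g and N = A g'' / g for the profile g = exp L, this is the requirement 1 <= N / S
    <= al. It is written without division because S and N vanish together at [c]. *)
Let bracket (th : R) (p p1 : R -> R) (y : R) :=
  let N := - (2 * (th * g) + 2 * y * p y) in let S := p1 y + p y ^+ 2 in
  (N <= S /\ S <= N / al) \/ (N / al <= S /\ S <= N).

(* [lra] slows down with the number of hypotheses, but rejects cleared section variables. *)
Ltac lra_hyps := clear - nonincr w2 M w2_gt0 M_gt0 al0 alV nl nr dL dR dn psL_le0 psL_ge
  nl_decr psR_lt0 psR_d_le0 psR_decr ratio_incr D0 C B1 C0 B10 near_c bracket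
  dLL dLR dpsL dpsR LLc psLc psRc psL0 nL nR pR1 r00 pR2 g0 al1 c0; lra.

Lemma half_profile (eta : R) : 0 < eta ->
  exists th ell (L p p1 p2 : R -> R), [/\ 1 < th < 1 + eta, 0 < ell,
    [/\ (forall y : R, is_derive y 1 L (p y)), (forall y : R, is_derive y 1 p (p1 y)),
        (forall y : R, is_derive y 1 p1 (p2 y)) & continuous p2],
    p 0 = 0 /\ p2 0 = 0 &
    (forall y, 0 <= y -> bracket th p p1 y) /\
    (forall y, c + ell <= y -> [/\ L y = th * LR y, p y = th * psR y,
       p1 y = th * branch_d g al psR y &
       p2 y = th * (- 2 * psR y * branch_d g al psR y
                - (2 * psR y + 2 * y * branch_d g al psR y) / al)])].
Proof.
move=> eta0.
have [d1 d10 H1] := near_c ltr01 psLc dpsL.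
have [d2 d20 H2] := near_c al0 psRc dpsR.
(* Matching the second derivatives of the logarithmic derivative at [c] reads 12 T w2 / ell = th M
   (1 - 1 / al). With T = th (th - 1) this says th - 1 = ell E. *)
pose E := M * (1 - al^-1) / (12 * w2).
have E0 : 0 < E by rewrite divr_gt0// mulr_gt0.
pose G := C + w2 * (4 * c + 4 * B1 + 1).
have G0 : 0 <= G.
  by rewrite addr_ge0// mulr_ge0 ?(ltW w2_gt0)// !addr_ge0// mulr_ge0// ltW.
(* [ell] is subject to finitely many smallness conditions; [A] adds up the reciprocals of the
   bounds, and ell = 1 / A meets them all. *)
pose A := 1 + d1^-1 + d2^-1 + c^-1 + E + E / eta + G / w2 + 2 * w2 + M / (12 * w2 * r0).
have [a1 a2 a3 a4] : [/\ 0 < d1^-1, 0 < d2^-1, 0 < c^-1 & 0 < E / eta].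
  by rewrite !invr_gt0 divr_gt0.
have [a5 a6 a7] : [/\ 0 <= G / w2, 0 < 2 * w2 & 0 < M / (12 * w2 * r0)].
  by rewrite divr_ge0 ?(ltW w2_gt0)// mulr_gt0// divr_gt0// !mulr_gt0.
have A0 : 0 < A by rewrite /A; lra.
pose ell := A^-1.
have ell0 : 0 < ell by rewrite invr_gt0.
have le1 x : x <= A -> ell * x <= 1 by move=> xA; rewrite /ell mulrC ler_pdivrMr// mul1r.
have le2 x : 0 < x -> x^-1 <= A -> ell <= x.
  by move=> x0 xA; rewrite /ell -[x]invrK lef_pV2 ?posrE ?invr_gt0.
have l1 : ell <= d1 by apply: le2 => //; rewrite /A; lra.
have l2 : ell <= d2 by apply: le2 => //; rewrite /A; lra.
have l3 : ell <= c by apply: le2 => //; rewrite /A; lra.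
have l4 : ell * E <= 1 by apply: le1; rewrite /A; lra.
have l5 : ell * E < eta.
  have : ell * (E / eta) < 1 by rewrite /ell mulrC ltr_pdivrMr// mul1r /A; lra.
  by rewrite mulrA ltr_pdivrMr// mul1r.
have l6 : ell * G <= w2.
  have : ell * (G / w2) <= 1 by apply: le1; rewrite /A; lra.
  by rewrite mulrA ler_pdivrMr// mul1r.
have l7 : ell * (2 * w2) <= 1 by apply: le1; rewrite /A; lra.
have l8 : ell * M / (12 * w2) <= r0.
  have : ell * (M / (12 * w2 * r0)) <= 1 by apply: le1; rewrite /A; lra.
  rewrite (_ : _ * (_ / _) = ell * M / (12 * w2) / r0); last by field; rewrite !gt_eqF.
  by rewrite ler_pdivrMr// mul1r.
pose th := 1 + ell * E.
have th12 : 1 < th <= 2 by rewrite /th ltrDl mulr_gt0//=; lra.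
pose T := th ^+ 2 - th.
have TE : T = th * (ell * E) by rewrite /T /th; ring.
have th0 : 0 < th by case/andP: th12 => /(lt_trans ltr01).
have T0 : 0 < T by rewrite TE; posit.
(* At [c] both N and N / al are 0, so the term T psi^2 = T w2 of S has to be cancelled by the slope
   of the correction. *)
pose K := - (T * w2).
pose B := th * M * (1 - al^-1).
have B_def : T * w2 / ell = B / 12 by rewrite TE /E /B; field; rewrite !gt_eqF.
have Tsmall : T * w2 * ell <= 1.
  have T2 : T <= 2.
    rewrite TE -[2]mulr1; apply: ler_pM => //; [posit|posit|by case/andP: th12].
  apply: le_trans l7; rewrite (_ : ell * (2 * w2) = 2 * (w2 * ell)); last by ring.
  by rewrite -mulrA ler_wpM2r//; posit.
have one : (1 : R) * 1 = 1 by rewrite mulr1.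
have mone : (-1 : R) * -1 = 1 by rewrite mulrNN mulr1.
have n1 : (1 : R) != 0 by rewrite oner_neq0.
have nal : al != 0 by rewrite gt_eqF.
pose L0 := branch0 c LL th K ell 1; pose R0 := branch0 c LR th K ell (-1).
pose L1 := branch1 c psL th K ell 1; pose R1 := branch1 c psR th K ell (-1).
pose L2 := branch2 g 1 c psL th K ell 1; pose R2 := branch2 g al c psR th K ell (-1).
pose L3 := branch3 g 1 c psL th K ell 1; pose R3 := branch3 g al c psR th K ell (-1).
have [l0c l1c l2c l3c] := @branch_at R g 1 c LL psL th K ell 1 ell0 c0 n1 psLc.
have [r0c r1c r2c r3c] := @branch_at R g al c LR psR th K ell (-1) ell0 c0 nal psRc.
have e0 : L0 c = R0 c by rewrite /L0 /R0 l0c r0c LLc.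
have e1 : L1 c = R1 c by rewrite /L1 /R1 l1c r1c.
have e2 : L2 c = R2 c by rewrite /L2 /R2 l2c r2c.
have e3 : L3 c = R3 c.
  rewrite /L3 /R3 l3c r3c /K TE /E /w2 /M; field.
  by rewrite !gt_eqF// addr_gt0.
have [dL0 dL1 dL2 cL3] : [/\ forall y : R, is_derive y 1 L0 (L1 y), forall y : R, is_derive y 1 L1 (L2 y),
    forall y : R, is_derive y 1 L2 (L3 y) & continuous L3].
  split; [exact: is_derive_branch0|exact: is_derive_branch1|exact: is_derive_branch2|exact: continuous_branch3].
have [dR0 dR1 dR2 cR3] : [/\ forall y : R, is_derive y 1 R0 (R1 y), forall y : R, is_derive y 1 R1 (R2 y),
    forall y : R, is_derive y 1 R2 (R3 y) & continuous R3].
  split; [exact: is_derive_branch0|exact: is_derive_branch1|exact: is_derive_branch2|exact: continuous_branch3].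
have farL y : y <= c - ell -> branch_s c ell 1 y <= 0.
  rewrite -subr_ge0 => yc; rewrite -oppr_ge0 (_ : - _ = (c - ell - y) / ell).
    by rewrite divr_ge0// ltW.
  by rewrite /branch_s; field; rewrite gt_eqF.
have farR y : c + ell <= y -> branch_s c ell (-1) y <= 0.
  rewrite -subr_ge0 => yc; rewrite -oppr_ge0 (_ : - _ = (y - (c + ell)) / ell).
    by rewrite divr_ge0// ltW.
  by rewrite /branch_s; field; rewrite gt_eqF.
(* The correction vanishes at 0, which leaves [p 0] and [p2 0] equal to 0, as the odd extension of
   [p] needs. *)
have fl0 : 0 <= c - ell by rewrite subr_ge0.
have [b0 b1 b2 b3] := branch_far LL th K (farL 0 fl0).
exists th, ell, (glue c L0 R0), (glue c L1 R1), (glue c L2 R2), (glue c L3 R3).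
split => //.
- by rewrite /th ltrDl mulr_gt0//= ltrD2l.
- split.
  + exact: is_derive_glue.
  + exact: is_derive_glue.
  + exact: is_derive_glue.
  + exact: continuous_glue.
- rewrite !glue_le ?(ltW c0)// /L1 /L3 /branch1 /branch3 b1 b3.
  by rewrite psL0 !(mulr0, mul0r, addr0, subr0).
split; last first.
  move=> y yc; have cy : c <= y by rewrite (le_trans _ yc)// lerDl ltW.
  have [f0 f1 f2 f3] := branch_far LR th K (farR _ yc).
  by rewrite !glue_ge// /R0 /R1 /R2 /R3 /branch1 /branch2 /branch3 f0 f1 f2 f3 !addr0.
(* Within distance [ell] the truncation is inactive and the truncated powers are ordinary powers. *)
have sE n z : 0 <= z -> z <= ell -> pospow n (1 - z / ell) = (1 - z / ell) ^+ n.
  move=> z0 zl; rewrite /pospow; congr (_ ^+ _); apply/max_idPr.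
  by rewrite subr_ge0 ler_pdivrMr// mul1r.
move=> y y0; have [yc|yc] := leP y c.
  left; rewrite !glue_le//.
  pose q := branch_q c K ell 1 y; pose q1 := branch_q1 c K ell 1 y.
  (* The Riccati equation removes the linear terms: S differs from the end of its range by T psi^2,
     the slope [q1] of the correction and the cross terms with [q]. *)
  have SN : L2 y + L1 y ^+ 2 - (- (2 * (th * g) + 2 * y * L1 y)) =
      T * psL y ^+ 2 + q1 + q * (2 * th * psL y + 2 * y + q).
    by rewrite /L2 /L1 /branch2 /branch1 /branch_d -/q -/q1 divr1 /T; ring.
  have NS : (- (2 * (th * g) + 2 * y * L1 y)) / al - (L2 y + L1 y ^+ 2) =
      (1 - al^-1) * th * nl y - T * psL y ^+ 2 - q1 - q * (2 * y / al + 2 * th * psL y + q).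
    rewrite /L2 /L1 /branch2 /branch1 /branch_d -/q -/q1 divr1 /T /nl.
    by move: al^-1 => ai; ring.
  rewrite -subr_ge0 SN -[L2 y + L1 y ^+ 2 <= _]subr_ge0 NS.
  (* Away from the correction, [nl] is at least its value at c - ell, which is at least 3/4 M ell,
     while T psL^2 <= T w2 = ell B / 12. *)
  have [yl|yl] := leP y (c - ell).
    have [_ q0 q10 _] := branch_far LL th K (farL _ yl).
    rewrite /q /q1 q0 q10 !mul0r !subr0 !addr0; split; first by rewrite mulr_ge0 ?sqr_ge0 ?ltW.
    have cl0 : 0 <= c - ell by exact: le_trans yl.
    have h1 : 3 / 4 * (M * ell) <= nl y.
      apply: (@le_trans _ _ (nl (c - ell))); last by apply: nl_decr => //; rewrite gerBl ltW.
      have := H1 (c - ell); rewrite addrC addKr normrN gtr0_norm// => /(_ l1)[_ + _].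
      by rewrite -/(nl _) ler_norml => /andP[+ _]; lra_hyps.
    have h2 : psL y ^+ 2 <= w2.
      have := @psL_ge y; have := @psL_le0 y; rewrite y0 yc => /(_ isT) a /(_ isT) b.
      rewrite /w2 -[psL y ^+ 2]sqrrN ler_pXn2r ?nnegrE ?oppr_ge0 ?divr_ge0 ?(ltW g0) ?(ltW c0)//.
      move: a b; lra_hyps.
    have h3 : T * psL y ^+ 2 <= ell * B / 12.
      have -> : ell * B / 12 = T * w2 by rewrite -mulrA -B_def; field; rewrite gt_eqF.
      by rewrite ler_wpM2l// ltW.
    have h4 : (1 - al^-1) * th * (3 / 4 * (M * ell)) <= (1 - al^-1) * th * nl y.
      by rewrite ler_wpM2l//; posit.
    have : 0 <= ell * B.
      by rewrite /B; posit.
    by rewrite /B in h3 *; move: h3 h4; lra_hyps.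
  pose d := c - y.
  have d0 : 0 <= d by rewrite subr_ge0.
  have dl : d <= ell by move: yl; rewrite /d; lra_hyps.
  have sy : branch_s c ell 1 y = 1 - d / ell by rewrite /branch_s /d; ring.
  have qE : q = T * w2 * d * (1 - d / ell) ^+ 3.
    by rewrite /q /branch_q sy sE// /K /d; ring.
  have q1E : q1 = - (T * w2 * ((1 - d / ell) ^+ 2 * (1 - 4 * (d / ell)))).
    by rewrite /q1 /branch_q1 sy !sE// /K /d; field; rewrite gt_eqF.
  have dn' : `|y - c| = d by rewrite distrC ger0_norm.
  have := H1 y; rewrite dn' => /(_ (le_trans dl l1))[h1 h2 h3].
  have d0l : 0 <= d <= ell by rewrite d0.
  have h1' := h1; rewrite ler_norml in h1'; case/andP: h1' => h1a h1b.
  split.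
    have := @branch_left_ge R th T w2 ell C B1 c th12 erefl w2_gt0 ell0 B10 c0 l6 (psL y) d y q
      d0l h3 y0 _ qE.
    rewrite q1E; have -> : T * psL y ^+ 2 - T * w2 * ((1 - d / ell) ^+ 2 * (1 - 4 * (d / ell))) =
       T * (psL y ^+ 2 - w2 * ((1 - d / ell) ^+ 2 * (1 - 4 * (d / ell)))) by ring.
    by apply; move: h1a; lra_hyps.
  have := @branch_left_le R al th T w2 ell C B1 c al1 th12 erefl w2_gt0 ell0 B10 c0 l6 Tsmall B B_def
     (psL y) d y q (nl y) d0l _ _ _ qE _.
  rewrite q1E opprK; have -> : (1 - al^-1) * th * nl y - T * psL y ^+ 2 +
     T * w2 * ((1 - d / ell) ^+ 2 * (1 - 4 * (d / ell))) = (1 - al^-1) * th * nl y -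
       T * (psL y ^+ 2 - w2 * ((1 - d / ell) ^+ 2 * (1 - 4 * (d / ell)))) by ring.
  apply; rewrite ?y0 ?yc//.
  - by apply: psL_le0; rewrite y0.
  - move: h1b; lra_hyps.
  - have h4 : 3 / 4 * (M * d) <= nl y.
      by move: h2; rewrite -/(nl y) ler_norml => /andP[+ _]; rewrite /d; lra_hyps.
    have : (1 - al^-1) * th * (3 / 4 * (M * d)) <= (1 - al^-1) * th * nl y.
      by rewrite ler_wpM2l//; posit.
    suff -> : 3 / 4 * (B * d) = (1 - al^-1) * th * (3 / 4 * (M * d)) by [].
    by rewrite /B; ring.
right; have cy := ltW yc; rewrite !glue_ge//.
pose q := branch_q c K ell (-1) y; pose q1 := branch_q1 c K ell (-1) y.
have SN : R2 y + R1 y ^+ 2 - (- (2 * (th * g) + 2 * y * R1 y)) / al =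
    T * psR y ^+ 2 + q1 + q * (2 * th * psR y + q + 2 * y / al).
  rewrite /R2 /R1 /branch2 /branch1 /branch_d -/q -/q1 /T.
  by move: al^-1 => ai; ring.
have NS : (- (2 * (th * g) + 2 * y * R1 y)) - (R2 y + R1 y ^+ 2) =
    (1 - al^-1) * th * (- nr y) - T * psR y ^+ 2 - q1 - q * (2 * y + 2 * th * psR y + q).
  rewrite /R2 /R1 /branch2 /branch1 /branch_d -/q -/q1 /T /nr.
  by move: al^-1 => ai; ring.
rewrite -subr_ge0 SN -[R2 y + R1 y ^+ 2 <= _]subr_ge0 NS.
have near_nr d : 0 <= d -> d <= d2 -> 3 / 4 * (M * d) <= - nr (c + d).
  move=> d0 dd; have := H2 (c + d); rewrite addrC addKr ger0_norm// => /(_ dd)[_ + _].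
  by rewrite -/(nr _) ler_norml addrC => /andP[_ +]; lra_hyps.
have [yl|yl] := leP (c + ell) y.
  have [_ q0 q10 _] := branch_far LR th K (farR _ yl).
  rewrite /q /q1 q0 q10 !mul0r !subr0 !addr0; split; first by rewrite mulr_ge0 ?sqr_ge0 ?ltW.
  (* Since T = th (1 - 1 / al) ell M / (12 w2), this is exactly the upper bound on S outside the
     correction. [ratio_incr] carries it outwards from c + ell; where 2 g + y psR <= 0 the
     hypothesis [pR2] takes over, with l8 adapted to [r0]. *)
  have key : ell * M / (12 * w2) * psR y ^+ 2 <= - nr y.
    have [py|py] := leP (2 * g + y * psR y) 0.
      by apply: le_trans (pR2 cy py); rewrite ler_wpM2r ?sqr_ge0.
    have cl : c < c + ell by rewrite ltrDl.
    have rr := ratio_incr cl yl py.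
    have := H2 (c + ell); rewrite addrC addKr gtr0_norm// addrC => /(_ l2)[h1 _ _].
    have pl : 0 < psR (c + ell) ^+ 2 by rewrite exprn_even_gt0//= lt_eqF// psR_lt0// ltW.
    have h2 := near_nr _ (ltW ell0) l2.
    have h3 : psR (c + ell) ^+ 2 <= 2 * w2.
      move: h1; rewrite ler_norml => /andP[_ +].
      have : ell * C <= w2.
        apply: le_trans l6; rewrite ler_wpM2l ?(ltW ell0)// lerDl mulr_ge0 ?(ltW w2_gt0)//.
        by rewrite !addr_ge0// mulr_ge0// ltW.
      lra_hyps.
    rewrite -(ler_pM2r pl); apply: le_trans rr; rewrite mulrAC ler_wpM2r ?sqr_ge0//.
    apply: le_trans h2; rewrite -[X in _ <= X]mulr1 -[X in _ <= _ * X](@mulVf _ (2 * w2)) ?gt_eqF//.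
    rewrite (_ : _ * (_^-1 * _) = 3 / 4 * (ell * M) / (2 * w2) * (2 * w2)); last by ring.
    apply: ler_pM => //; [posit|posit|].
    rewrite ler_pdivrMr; last by posit.
    rewrite (_ : 3 / 4 * (ell * M) / (2 * w2) * (12 * w2) = 9 / 2 * (ell * M)); last first.
      by field; rewrite gt_eqF.
    have : 0 <= ell * M by posit.
    lra_hyps.
  have : (1 - al^-1) * th * (ell * M / (12 * w2) * psR y ^+ 2) <= (1 - al^-1) * th * - nr y.
    by rewrite ler_wpM2l//; posit.
  suff -> : (1 - al^-1) * th * (ell * M / (12 * w2) * psR y ^+ 2) = T * psR y ^+ 2 by lra_hyps.
  by rewrite TE /E; field; rewrite !gt_eqF.
pose d := y - c.
have d0 : 0 <= d by rewrite subr_ge0.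
have dl : d <= ell by move: yl; rewrite /d; lra_hyps.
have sy : branch_s c ell (-1) y = 1 - d / ell by rewrite /branch_s /d; ring.
have qE : q = - (T * w2 * d * (1 - d / ell) ^+ 3).
  by rewrite /q /branch_q sy sE// /K /d; ring.
have q1E : q1 = - (T * w2 * ((1 - d / ell) ^+ 2 * (1 - 4 * (d / ell)))).
  by rewrite /q1 /branch_q1 sy !sE// /K /d; field; rewrite gt_eqF.
have dn' : `|y - c| = d by rewrite ger0_norm.
have := H2 y; rewrite dn' => /(_ (le_trans dl l2))[h1 _ h3].
have d0l : 0 <= d <= ell by rewrite d0.
have h1' := h1; rewrite ler_norml in h1'; case/andP: h1' => h1a h1b.
split.
  have := @branch_right_ge R al th T w2 ell C B1 c al1 th12 erefl w2_gt0 ell0 B10 c0 l6 (psR y) d y q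
    d0l _ (ltW (psR_lt0 cy)) _ qE.
  rewrite q1E; have -> : T * psR y ^+ 2 - T * w2 * ((1 - d / ell) ^+ 2 * (1 - 4 * (d / ell))) =
     T * (psR y ^+ 2 - w2 * ((1 - d / ell) ^+ 2 * (1 - 4 * (d / ell)))) by ring.
  by apply; rewrite ?y0/=; [move: dl l3; rewrite /d; lra_hyps|move: h1a; lra_hyps].
have := @branch_right_le R al th T w2 ell C B1 c th12 erefl w2_gt0 ell0 B10 c0 l6 Tsmall B B_def
   (psR y) d y q (- nr y) d0l y0 h3 _ qE _.
rewrite q1E opprK; have -> : (1 - al^-1) * th * (- nr y) - T * psR y ^+ 2 +
   T * w2 * ((1 - d / ell) ^+ 2 * (1 - 4 * (d / ell))) = (1 - al^-1) * th * (- nr y) -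
     T * (psR y ^+ 2 - w2 * ((1 - d / ell) ^+ 2 * (1 - 4 * (d / ell)))) by ring.
apply; first by move: h1b; lra_hyps.
have h4 : 3 / 4 * (M * d) <= - nr y.
  by have := near_nr _ d0 (le_trans dl l2); rewrite /d subrKC.
have : (1 - al^-1) * th * (3 / 4 * (M * d)) <= (1 - al^-1) * th * (- nr y).
  by rewrite ler_wpM2l//; posit.
suff -> : 3 / 4 * (B * d) = (1 - al^-1) * th * (3 / 4 * (M * d)) by [].
by rewrite /B; ring.
Qed.

End Profile_logarithm.

(** * Extension to the whole line by parity, and decay *)

Section Profile.
Context {R : realType}.
Implicit Types (f : R -> R) (g : R).

(** Up to [Y] the function is bounded by compactness, and a constant there is a multiple of the
    Gaussian; beyond [Y] a polynomial times a Gaussian decays faster than every exponential. *)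
Lemma superexp_decay_tail f (Y C k : R) n : continuous f -> 0 < k ->
  (forall y, Y <= `|y| -> `|f y| <= C * `|y| ^+ n * expR (- (k * y ^+ 2))) ->
  superexp_decay f.
Proof.
move=> cf k0 fY.
have h n' : superexp_decay (fun y : R => y ^+ n' * expR (- (k * y ^+ 2))).
  elim: n' => [|m IH].
    apply: superexp_decay_le (superexp_decay_gauss k0) => x.
    by rewrite expr0 mul1r.
  apply: superexp_decay_le (superexp_decay_id IH) => x.
  by rewrite exprS mulrA.
have Y0 : - `|Y| <= `|Y| by rewrite -subr_ge0 opprK.
have [|z _ zP] := @EVT_max R (fun x => `|f x|) _ _ Y0.
  apply: continuous_subspaceT => x.
  by apply: continuous_comp; [exact: cf|exact: norm_continuous].
have d1 := superexp_decayZ (`|f z| * expR (k * Y ^+ 2)) (superexp_decay_gauss k0).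
have d2 : superexp_decay (fun x => `|C * (x ^+ n * expR (- (k * x ^+ 2)))|).
  apply: superexp_decay_le (superexp_decayZ C (h n)) => x; by rewrite normr_id.
apply: superexp_decay_le (superexp_decayD d1 d2) => y.
rewrite [leRHS]ger0_norm; last first.
  by rewrite addr_ge0// !mulr_ge0 ?expR_ge0.
have [yY|yY] := leP Y `|y|.
  apply: le_trans (fY y yY) _; rewrite ler_wpDl ?mulr_ge0 ?expR_ge0//.
  by rewrite -mulrA !normrM normrX [`|expR _|]ger0_norm ?expR_ge0// ler_wpM2r ?ler_norm// mulr_ge0 ?expR_ge0.
rewrite ler_wpDr// -mulrA -expRD.
have h1 : 1 <= expR (k * Y ^+ 2 + - (k * y ^+ 2)).
  rewrite -expR0 ler_expR subr_ge0 ler_pM2l//.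
  have Y1 : 0 <= Y by rewrite (le_trans _ (ltW yY)).
  by rewrite -(real_normK (num_real y)) ler_pXn2r ?nnegrE// ltW.
apply: le_trans (ler_peMr _ h1) => //; apply: zP.
by rewrite in_itv/= -ler_norml (le_trans (ltW yY))// ler_norm.
Qed.

Definition even_glue f := glue 0 (fun y => f (- y)) f.
Definition odd_glue f := glue 0 (fun y => - f (- y)) f.

Let comp_opp f f' : (forall y : R, is_derive y 1 f (f' y)) ->
  forall y : R, is_derive y 1 (fun y => f (- y)) (- f' (- y)).
Proof.
move=> df y.
have a : is_derive y 1 (fun y : R => - y) (-1) by apply: is_derive_eq.
by apply: (is_derive_eq (@is_derive1_comp R f _ y _ _ (df _) a)); rewrite mulrN1.
Qed.

Lemma is_derive_even_glue f f' : (forall y : R, is_derive y 1 f (f' y)) -> f' 0 = 0 ->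
  forall y : R, is_derive y 1 (even_glue f) (odd_glue f' y).
Proof.
move=> df f'0 y; apply: is_derive_glue => // [||x _]; rewrite ?oppr0 ?f'0 ?oppr0//.
exact: comp_opp.
Qed.

Lemma is_derive_odd_glue f f' : (forall y : R, is_derive y 1 f (f' y)) -> f 0 = 0 ->
  forall y : R, is_derive y 1 (odd_glue f) (even_glue f' y).
Proof.
move=> df f0 y; apply: is_derive_glue => // [||x _]; rewrite ?oppr0 ?f0 ?oppr0//.
have a := comp_opp df x.
by apply: (is_derive_eq (is_deriveN a)); rewrite opprK.
Qed.

Lemma even_glueE f y : even_glue f y = f `|y|.
Proof.
rewrite /even_glue; have [y0|y0] := leP y 0; first by rewrite glue_le// ler0_norm.
by rewrite glue_ge ?oppr0 ?(ltW y0)// gtr0_norm.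
Qed.

Lemma odd_glueE f y : f 0 = 0 -> odd_glue f y = (if 0 <= y then f y else - f (- y)).
Proof.
move=> f0; rewrite /odd_glue; have [y0|y0] := leP 0 y; first by rewrite glue_ge ?oppr0 ?f0 ?oppr0.
by rewrite glue_le ?(ltW y0).
Qed.

Lemma norm_odd_glue f y : f 0 = 0 -> `|odd_glue f y| = `|f `|y| |.
Proof.
by move=> f0; rewrite odd_glueE//; case: ger0P => y0//; rewrite normrN.
Qed.

End Profile.

Section Exponential_profile.
Context {R : realType}.
Variables (L p q r : R -> R).
Hypothesis dL : forall y : R, is_derive y 1 L (p y).
Hypothesis dp : forall y : R, is_derive y 1 p (q y).
Hypothesis dq : forall y : R, is_derive y 1 q (r y).
Hypothesis cr : continuous r.

Definition prof0 (y : R) := expR (L y).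
Definition prof1 (y : R) := expR (L y) * p y.
Definition prof2 (y : R) := expR (L y) * (q y + p y ^+ 2).
Definition prof3 (y : R) := expR (L y) * (r y + 3 * p y * q y + p y ^+ 3).

Lemma is_derive_prof0 (y : R) : is_derive y 1 prof0 (prof1 y).
Proof. exact: (@is_derive1_comp R (@expR R) L y _ _ (is_derive_expR _) (dL y)). Qed.

Lemma is_derive_prof1 (y : R) : is_derive y 1 prof1 (prof2 y).
Proof.
apply: (is_derive_eq (is_deriveM (is_derive_prof0 y) (dp y))).
by rewrite /GRing.scale/= /prof0 /prof1 /prof2; ring.
Qed.

Lemma is_derive_prof2 (y : R) : is_derive y 1 prof2 (prof3 y).
Proof.
have a : is_derive y 1 (fun y => q y + p y ^+ 2) (r y + 2 * p y * q y).
  have b := dq y; have b' := dp y.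
  by apply: is_derive_eq; rewrite /GRing.scale/=; ring.
apply: (is_derive_eq (is_deriveM (is_derive_prof0 y) a)).
by rewrite /GRing.scale/= /prof0 /prof1 /prof3; ring.
Qed.

Lemma continuous_prof3 : continuous prof3.
Proof.
have cp : continuous p by move=> y; exact: is_derive_continuous (dp y).
have cq : continuous q by move=> y; exact: is_derive_continuous (dq y).
move=> y; apply: cvgM; first exact: is_derive_continuous (is_derive_prof0 y).
apply: cvgD; last exact: (continuous_comp (cp y) (@exprn_continuous R 3 _)).
apply: cvgD; first exact: cr.
by apply: cvgM; [apply: cvgM; [exact: cvg_cst|exact: cp]|exact: cq].
Qed.

Variables (Y E k B : R).
Hypotheses (Y1 : 1 <= Y) (k0 : 0 < k) (B0 : 0 <= B).
Hypothesis L_le : forall y, Y <= `|y| -> L y <= E - k * y ^+ 2.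
Hypothesis p_le : forall y, Y <= `|y| -> `|p y| <= B * `|y|.
Hypothesis q_le : forall y, Y <= `|y| -> `|q y| <= B * `|y| ^+ 2.
Hypothesis r_le : forall y, Y <= `|y| -> `|r y| <= B * `|y| ^+ 3.

Let tail f C : continuous f ->
  (forall y, Y <= `|y| -> `|f y| <= C * `|y| ^+ 3) ->
  superexp_decay (fun y => expR (L y) * f y).
Proof.
move=> cf fC; apply: (@superexp_decay_tail R _ Y (expR E * C) k 3) => //.
  by move=> y; apply: cvgM; [exact: is_derive_continuous (is_derive_prof0 y)|exact: cf].
move=> y yY; rewrite normrM ger0_norm ?expR_ge0//.
rewrite (_ : _ * _ * _ * _ = expR (E - k * y ^+ 2) * (C * `|y| ^+ 3)); last first.
  by rewrite expRD; ring.
by apply: ler_pM; rewrite ?expR_ge0// ?ler_expR; [exact: L_le|exact: fC].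
Qed.

Let le3 (y : R) n : Y <= `|y| -> (n <= 3)%N -> `|y| ^+ n <= `|y| ^+ 3.
Proof. by move=> yY n3; apply: ler_weXn2l => //; exact: le_trans Y1 yY. Qed.

Lemma superexp_decay_prof : [/\ superexp_decay prof0, superexp_decay prof1,
  superexp_decay prof2 & superexp_decay prof3].
Proof.
have cp : continuous p by move=> y; exact: is_derive_continuous (dp y).
have cq : continuous q by move=> y; exact: is_derive_continuous (dq y).
have cX (f : R -> R) n : continuous f -> continuous (fun y : R => f y ^+ n).
  by move=> cf y; exact: (continuous_comp (cf y) (@exprn_continuous R n _)).
have p2 y : Y <= `|y| -> `|p y| ^+ 2 <= B ^+ 2 * `|y| ^+ 2.
  by move=> yY; rewrite -exprMn ler_pXn2r ?nnegrE ?mulr_ge0//; exact: p_le.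
have p3 y : Y <= `|y| -> `|p y| ^+ 3 <= B ^+ 3 * `|y| ^+ 3.
  by move=> yY; rewrite -exprMn ler_pXn2r ?nnegrE ?mulr_ge0//; exact: p_le.
split.
- have := @tail (fun=> 1) 1 (fun y => cvg_cst _); rewrite /prof0.
  have -> : (fun y => expR (L y) * 1) = (fun y => expR (L y)) by apply/funext => y; rewrite mulr1.
  by apply=> y yY; rewrite normr1 mul1r -(expr0 `|y|) le3.
- apply: (@tail _ B) => // y yY; apply: le_trans (p_le yY) _.
  by rewrite ler_wpM2l// -[leLHS]expr1 le3.
- apply: (@tail _ (B + B ^+ 2)) => [y|y yY].
    by apply: cvgD; [exact: cq|exact: cX].
  apply: le_trans (ler_normD _ _) _; rewrite normrX.
  apply: (@le_trans _ _ (B * `|y| ^+ 2 + B ^+ 2 * `|y| ^+ 2)).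
    by apply: lerD; [exact: q_le|exact: p2].
  by rewrite -mulrDl ler_wpM2l ?le3// addr_ge0// exprn_ge0.
- apply: (@tail _ (B + 3 * B ^+ 2 + B ^+ 3)) => [y|y yY].
    apply: cvgD; last exact: cX.
    apply: cvgD; first exact: cr.
    by apply: cvgM; [apply: cvgM; [exact: cvg_cst|exact: cp]|exact: cq].
  apply: le_trans (ler_normD _ _) _; rewrite normrX 2!(mulrDl _ _ (`|y| ^+ 3)); apply: lerD; last exact: p3.
  apply: le_trans (ler_normD _ _) _; apply: lerD; first exact: r_le.
  rewrite !normrM [`|3|]ger0_norm// -!mulrA ler_wpM2l//.
  rewrite (_ : B * _ = (B * `|y|) * (B * `|y| ^+ 2)); last by ring.
  by apply: ler_pM => //; [exact: p_le|exact: q_le].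
Qed.

End Exponential_profile.

(** * The profile built from the even and the rescaled one-sided Hermite function *)

Section Hermite_profile.
Context {R : realType}.
Variables (g : R) (h h' H H' : R -> R) (cc0 cc1 : R).
Hypothesis g0 : 0 < g.
Hypothesis dh0 : forall x : R, is_derive x 1 h (h' x).
Hypothesis dh1 : forall x : R, is_derive x 1 h' (- 2 * x * h' x - 2 * g * h x).
Hypothesis dH0 : forall x : R, is_derive x 1 H (H' x).
Hypothesis dH1 : forall x : R, is_derive x 1 H' (- 2 * x * H' x - 2 * g * H x).
Hypotheses (h0 : forall x, 0 < h x) (H0 : forall x, 0 < H x) (H'0 : H' 0 = 0).
Hypothesis h'_lt : forall x, h' x < - (2 * x * h x).
Hypothesis h'_ge : forall x, - (x * h' x) <= (2 * x ^+ 2 + 1 - g) * h x.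
Variable D : R.
Hypotheses (D0 : 0 < D) (h_decay : forall x, 0 <= x -> h x <= D * expR (- x ^+ 2)).
Hypotheses (p0 : 0 < cc0) (p1 : 0 < cc1) (c10 : cc1 < cc0).
Hypotheses (k_h : hermite_k g h h' cc1 = 0) (k_H : hermite_k g H H' cc0 = 0).

Let k : R := cc0 / cc1.
Let k1 : 1 < k. Proof. by rewrite ltr_pdivlMr// mul1r. Qed.
Let k0 : 0 < k. Proof. exact: lt_trans k1. Qed.
Let c0k : cc0 / k = cc1. Proof. by rewrite /k; field; rewrite !gt_eqF. Qed.
Let hne x : h x != 0. Proof. by rewrite gt_eqF. Qed.
Let Hne x : H x != 0. Proof. by rewrite gt_eqF. Qed.

Let LL (y : R) := ln (H y).
Let psL (y : R) := H' y / H y.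
(** Dilation by k = c_0 / c_1 moves the inflection point of the one-sided solution to c_0; the
    additive constant makes the two logarithms agree there. *)
Let LR (y : R) := ln (h (y / k)) + (ln (H cc0) - ln (h cc1)).
Let psR (y : R) := k^-1 * (h' (y / k) / h (y / k)).

Let ddiv (y : R) : is_derive y 1 (fun y : R => y / k) k^-1.
Proof. by apply: is_derive_eq; rewrite /GRing.scale/=; ring. Qed.

Let dh (y : R) : is_derive y 1 (fun y : R => h (y / k)) (h' (y / k) * k^-1).
Proof. exact: (@is_derive1_comp R h _ y _ _ (dh0 _) (ddiv y)). Qed.

Let dh' (y : R) : is_derive y 1 (fun y : R => h' (y / k))
  ((- 2 * (y / k) * h' (y / k) - 2 * g * h (y / k)) * k^-1).
Proof. exact: (@is_derive1_comp R h' _ y _ _ (dh1 _) (ddiv y)). Qed.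

Let dLL (y : R) : is_derive y 1 LL (psL y).
Proof.
apply: (is_derive_eq (@is_derive1_comp R (@ln R) H y _ _ (is_derive1_ln (H0 y)) (dH0 y))).
by rewrite mulrC.
Qed.

Let dLR (y : R) : is_derive y 1 LR (psR y).
Proof.
have a := @is_derive1_comp R (@ln R) _ y _ _ (is_derive1_ln (h0 (y / k))) (dh y).
rewrite /LR; apply: is_derive_eq; rewrite addr0 /psR.
by ring.
Qed.

Let dquot (f f' : R -> R) (y a b : R) : f' y != 0 -> is_derive y 1 f a -> is_derive y 1 f' b ->
  is_derive y 1 (fun y => f y / f' y) (a / f' y - f y * b / f' y ^+ 2).
Proof.
move=> n da db; apply: is_derive_eq.
by rewrite /GRing.scale/=; field.
Qed.

Let dpsL (y : R) : is_derive y 1 psL (- psL y ^+ 2 - (2 * g + 2 * y * psL y) / 1).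
Proof.
apply: (is_derive_eq (dquot (Hne y) (dH1 y) (dH0 y))).
rewrite /psL; have := Hne y.
by move: (H y) (H' y) => u v un; field.
Qed.

(** The dilation multiplies the coefficient of the second derivative by k^2; this is where alpha =
    (c_0 / c_1)^2 enters. *)
Let dpsR (y : R) : is_derive y 1 psR (- psR y ^+ 2 - (2 * g + 2 * y * psR y) / k ^+ 2).
Proof.
have a := dquot (f := fun y => h' (y / k)) (f' := fun y => h (y / k)) (hne (y / k)) (dh' y) (dh y).
rewrite /psR; apply: is_derive_eq; rewrite /GRing.scale/=.
have := hne (y / k); move: (h _) (h' _) => u v un; field.
by rewrite un gt_eqF.
Qed.

Let psL_k y : 2 * g + 2 * y * psL y = 2 * hermite_k g H H' y / H y.
Proof. by rewrite /psL /hermite_k; field. Qed.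
Let psR_k y : 2 * g + 2 * y * psR y = 2 * hermite_k g h h' (y / k) / h (y / k).
Proof. by rewrite /psR /hermite_k; field; rewrite hne gt_eqF. Qed.

Let psLc : psL cc0 = - (g / cc0).
Proof.
have : 2 * g + 2 * cc0 * psL cc0 = 0 by rewrite psL_k k_H mulr0 mul0r.
move=> e; rewrite (_ : psL cc0 = (2 * g + 2 * cc0 * psL cc0) / (2 * cc0) - g / cc0).
  by rewrite e mul0r sub0r.
by field; rewrite gt_eqF.
Qed.

Let psRc : psR cc0 = - (g / cc0).
Proof.
have : 2 * g + 2 * cc0 * psR cc0 = 0 by rewrite psR_k c0k k_h mulr0 mul0r.
move=> e; rewrite (_ : psR cc0 = (2 * g + 2 * cc0 * psR cc0) / (2 * cc0) - g / cc0).
  by rewrite e mul0r sub0r.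
by field; rewrite gt_eqF.
Qed.

Let psL0 : psL 0 = 0. Proof. by rewrite /psL H'0 mul0r. Qed.
Let h'0 : h' 0 <= 0.
Proof. by have := h'_lt 0; rewrite mulr0 mul0r oppr0 => /ltW. Qed.
Let H'0_le : H' 0 <= 0. Proof. by rewrite H'0. Qed.

Let nL y : 0 <= y < cc0 -> 0 < 2 * g + 2 * y * psL y.
Proof.
move=> /andP[y0 yc]; rewrite psL_k divr_gt0// mulr_gt0//.
exact: (hermite_k_sign g0 dH0 dH1 H0 H'0_le p0 k_H y0).1.
Qed.

Let nR y : cc0 < y -> 2 * g + 2 * y * psR y < 0.
Proof.
move=> cy; rewrite psR_k pmulr_llt0 ?invr_gt0// pmulr_rlt0//.
apply: (hermite_k_sign g0 dh0 dh1 h0 h'0 p1 k_h _).2.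
  by rewrite divr_ge0 ?ltW// (lt_trans p0).
by rewrite -c0k ltr_pM2r ?invr_gt0.
Qed.

Let rho_lt y : h' (y / k) / h (y / k) < - (2 * (y / k)).
Proof. by rewrite ltr_pdivrMr//; have := h'_lt (y / k); rewrite mulNr. Qed.

(** For r = h' / h at z = y / k the claim is -2 g - 2 z r <= r^2, which follows from r (r + 2 z) >=
    0, both factors being nonpositive. *)
Let pR1 y : cc0 <= y -> - (2 * g + 2 * y * psR y) <= k ^+ 2 * psR y ^+ 2.
Proof.
move=> cy; have y0 : 0 < y / k by rewrite divr_gt0// (lt_le_trans p0).
have := rho_lt y; rewrite /psR; set r := _ / h _ => rl.
have -> : k ^+ 2 * (k^-1 * r) ^+ 2 = r ^+ 2 by field; rewrite gt_eqF.
have -> : 2 * y * (k^-1 * r) = 2 * (y / k) * r by ring.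
have r0 : r <= 0 by rewrite (le_trans (ltW rl))// oppr_le0 mulr_ge0// ltW.
have : 0 <= r * (r + 2 * (y / k)) by rewrite mulr_le0// -lerBrDr sub0r ltW.
by have := g0; lra.
Qed.

(** Slope of a linear bound on |psR| beyond c_0: at z = y / k >= c_1 one has -z h' / h <= 2 z^2 + 1
    - g, and 1 <= z^2 / c_1^2. *)
Let Cr := (2 + cc1 ^- 2) / k ^+ 2.
Let Cr0 : 0 < Cr. Proof. by rewrite /Cr divr_gt0 ?addr_gt0 ?invr_gt0 ?exprn_gt0. Qed.

Let psR_ge y : cc0 <= y -> - (Cr * y) <= psR y <= 0.
Proof.
move=> cy; have y0 : 0 < y by rewrite (lt_le_trans p0).
have z0 : 0 < y / k by rewrite divr_gt0.
have zc : cc1 <= y / k by rewrite -c0k ler_pM2r ?invr_gt0.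
have rl := rho_lt y; have := h'_ge (y / k); rewrite -ler_pdivrMr//.
rewrite /psR mulNr -mulrA; set r := _ / h _ => hr; rewrite pmulr_rle0 ?invr_gt0//; apply/andP; split; last first.
  by rewrite (le_trans (ltW rl))// oppr_le0 mulr_ge0// ltW.
rewrite -ler_pdivrMl ?invr_gt0// invrK (_ : k * - (Cr * y) = - ((2 + cc1 ^- 2) * (y / k))); last first.
  by rewrite /Cr; field; rewrite !gt_eqF.
rewrite lerNl -(ler_pM2l z0) mulrN (le_trans hr)//.
have -> : y / k * ((2 + cc1 ^- 2) * (y / k)) = 2 * (y / k) ^+ 2 + (y / k) ^+ 2 / cc1 ^+ 2.
  by field; rewrite !gt_eqF.
rewrite -addrA lerD2l (@le_trans _ _ 1)//; first by rewrite gerBl ltW.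
by rewrite ler_pdivlMr ?exprn_gt0// mul1r ler_pXn2r ?nnegrE// ltW.
Qed.

Let pR2 y : cc0 <= y -> 2 * g + y * psR y <= 0 ->
  Cr^-1 * psR y ^+ 2 <= - (2 * g + 2 * y * psR y).
Proof.
move=> cy; have y0 : 0 < y by rewrite (lt_le_trans p0).
have /andP[a b] := psR_ge cy => e.
apply: (@le_trans _ _ (- (y * psR y))); last by move: e; lra.
rewrite mulrC ler_pdivrMr// -subr_ge0 (_ : _ - _ = - psR y * (Cr * y + psR y)); last by ring.
by rewrite mulr_ge0 ?oppr_ge0//; have /andP[+ _] := psR_ge cy; lra.
Qed.

Let LR_le : exists Cd, forall y : R, 0 <= y -> LR y <= Cd - k ^- 2 * y ^+ 2.
Proof.
exists (ln D + (ln (H cc0) - ln (h cc1))) => y y0.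
rewrite /LR addrAC lerD2r.
have -> : ln D - k ^- 2 * y ^+ 2 = ln (D * expR (- (y / k) ^+ 2)).
  rewrite lnM ?posrE ?expR_gt0// expRK; congr (_ - _).
  by field; rewrite gt_eqF.
by rewrite ler_ln ?posrE ?mulr_gt0 ?expR_gt0//; apply: h_decay; rewrite divr_ge0// ltW.
Qed.

(** Polynomial growth of the logarithmic derivative and of its next two derivatives, each read off
    from the Riccati equation; multiplied by the Gaussian decay of exp L this gives the decay of the
    profile. *)
Let bd_le : exists2 B, 0 <= B & forall y, cc0 <= y -> 1 <= y ->
  [/\ `|psR y| <= B * y, `|branch_d g (k ^+ 2) psR y| <= B * y ^+ 2 &
      `|- 2 * psR y * branch_d g (k ^+ 2) psR y
        - (2 * psR y + 2 * y * branch_d g (k ^+ 2) psR y) / k ^+ 2| <= B * y ^+ 3].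
Proof.
pose D2 := Cr ^+ 2 + (2 * g + 2 * Cr).
have D20 : 0 <= D2 by rewrite /D2; posit.
pose D3 := 2 * Cr * D2 + (2 * Cr + 2 * D2).
have D30 : 0 <= D3 by rewrite /D3; posit.
exists (Cr + D2 + D3) => [|y cy y1]; first by posit.
have y0 : 0 <= y by exact: le_trans y1.
have h1 : `|psR y| <= Cr * y.
  have /andP[a b] := psR_ge cy; rewrite ler_norml a (le_trans b)//.
  by rewrite mulr_ge0// ltW.
have kk (z C : R) : `|z| <= C -> `|z / k ^+ 2| <= C.
  apply: le_trans; rewrite normrM ler_piMr// ger0_norm ?invr_ge0 ?sqr_ge0//.
  by rewrite invf_le1 ?exprn_gt0// expr_ge1// ltW.
have e1 : y <= y ^+ 2 by rewrite expr2 ler_peMr.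
have e0 : 1 <= y ^+ 2 by exact: le_trans y1 e1.
have h2 : `|branch_d g (k ^+ 2) psR y| <= D2 * y ^+ 2.
  rewrite /branch_d /D2 (mulrDl _ _ (y ^+ 2)); apply: le_trans (ler_normB _ _) _; apply: lerD.
    rewrite normrN normrX -exprMn; apply: lerXn2r => //; rewrite nnegrE//.
    exact: mulr_ge0 (ltW Cr0) y0.
  apply: kk; apply: le_trans (ler_normD _ _) _; rewrite (mulrDl _ _ (y ^+ 2)); apply: lerD.
    by rewrite ger0_norm ?mulr_ge0 ?ler_peMr ?mulr_ge0 ?(ltW g0).
  rewrite normrM (normrM 2 y) [`|2|]ger0_norm// [`|y|]ger0_norm//.
  rewrite (_ : 2 * Cr * y ^+ 2 = 2 * y * (Cr * y)); last by ring.
  by rewrite ler_wpM2l ?mulr_ge0.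
have h3 : `|- 2 * psR y * branch_d g (k ^+ 2) psR y
        - (2 * psR y + 2 * y * branch_d g (k ^+ 2) psR y) / k ^+ 2| <= D3 * y ^+ 3.
  rewrite /D3 (mulrDl _ _ (y ^+ 3)); apply: le_trans (ler_normB _ _) _; apply: lerD.
    rewrite normrM (normrM (- 2)) normrN [`|2|]ger0_norm//.
    rewrite (_ : 2 * Cr * D2 * y ^+ 3 = 2 * (Cr * y) * (D2 * y ^+ 2)); last by ring.
    by rewrite ler_pM ?mulr_ge0// ler_wpM2l.
  apply: kk; apply: le_trans (ler_normD _ _) _; rewrite (mulrDl _ _ (y ^+ 3)); apply: lerD.
    rewrite normrM [`|2|]ger0_norm// -mulrA ler_wpM2l// (le_trans h1)// ler_wpM2l ?(ltW Cr0)//.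
    by rewrite (le_trans e1)// exprS ler_peMl ?sqr_ge0.
  rewrite normrM (normrM 2 y) [`|2|]ger0_norm// [`|y|]ger0_norm//.
  rewrite (_ : 2 * D2 * y ^+ 3 = 2 * y * (D2 * y ^+ 2)); last by ring.
  by rewrite ler_wpM2l ?mulr_ge0.
split.
- by rewrite (le_trans h1)// ler_wpM2r// -addrA lerDl addr_ge0.
- by rewrite (le_trans h2)// ler_wpM2r ?exprn_ge0// addrAC lerDr addr_ge0// ltW.
- by rewrite (le_trans h3)// ler_wpM2r ?exprn_ge0// lerDr addr_ge0// ltW.
Qed.

Lemma quotient_profile (eta : R) : 0 < eta ->
  exists th (G G1 G2 G3 A : R -> R), 1 < th < 1 + eta /\
  [/\ forall y : R, is_derive y 1 G (G1 y), forall y : R, is_derive y 1 G1 (G2 y),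
      forall y : R, is_derive y 1 G2 (G3 y) & continuous G3] /\
  [/\ superexp_decay G, superexp_decay G1, superexp_decay G2 & superexp_decay G3] /\
  [/\ measurable_fun setT A, forall y, 1 <= A y <= k ^+ 2,
      forall y, A y * G2 y = - (2 * (th * g) * G y + 2 * y * G1 y) &
      exists Y, forall y, Y <= y -> G1 y < 0].
Proof.
move=> eta0; have k21 : 1 < k ^+ 2 by rewrite expr_gt1// ltW.
have LLc : LL cc0 = LR cc0 by rewrite /LL /LR c0k; ring.
have Crv : 0 < Cr^-1 by rewrite invr_gt0.
have [th [ell [L [p [pp1 [pp2 [thE ell0 [dL dp dp1 cp2] [p00 p20] [br far]]]]]]]] :=
  half_profile g0 k21 p0 dLL dLR dpsL dpsR LLc psLc psRc psL0 nL nR pR1 Crv pR2 eta0.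
have th0 : 0 < th by case/andP: thE => /(lt_trans ltr01).
pose Le := even_glue L; pose pe := odd_glue p; pose qe := even_glue pp1; pose re := odd_glue pp2.
have dLe : forall y : R, is_derive y 1 Le (pe y) by exact: is_derive_even_glue.
have dpe : forall y : R, is_derive y 1 pe (qe y) by exact: is_derive_odd_glue.
have dqe : forall y : R, is_derive y 1 qe (re y) by exact: is_derive_even_glue.
have cre : continuous re.
  apply: continuous_glue; rewrite ?oppr0 ?p20 ?oppr0// => y.
  apply: cvgN; apply: continuous_comp; last exact: cp2.
  exact: opp_continuous.
exists th, (prof0 Le), (prof1 Le pe), (prof2 Le pe qe), (prof3 Le pe qe re).
pose N (y : R) := - (2 * (th * g) + 2 * y * pe y); pose S (y : R) := qe y + pe y ^+ 2.
have br' y : (N y <= S y /\ S y <= N y / k ^+ 2) \/ (N y / k ^+ 2 <= S y /\ S y <= N y).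
  have := br `|y| (normr_ge0 y); rewrite /N /S /qe even_glueE.
  have -> : pe y ^+ 2 = p `|y| ^+ 2.
    by rewrite -[pe y ^+ 2](real_normK (num_real _)) norm_odd_glue// real_normK ?num_real.
  have -> : 2 * y * pe y = 2 * `|y| * p `|y| by rewrite /pe odd_glueE//; case: ger0P => // y0; ring.
  by [].
(* Where S vanishes, in particular at the gluing point, N vanishes too; division by 0 returns 0
   there, and the maximum puts A = 1. *)
exists (fun y => Num.max 1 (N y / S y)); split => //; split.
  split; [exact: is_derive_prof0|exact: is_derive_prof1|exact: is_derive_prof2|exact: continuous_prof3].
split.
  have [B B0 HB] := bd_le; have [Cd HCd] := LR_le.
  pose Y := Num.max 1 (cc0 + ell).
  have YP y : Y <= `|y| -> [/\ 1 <= `|y|, cc0 <= `|y| & cc0 + ell <= `|y|].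
    rewrite ge_max => /andP[a b]; split => //.
    by rewrite (le_trans _ b)// lerDl ltW.
  apply: (@superexp_decay_prof R Le pe qe re dLe dpe dqe cre Y (th * Cd) (th * k ^- 2) (th * B)).
  - by rewrite le_max lexx.
  - by rewrite mulr_gt0// invr_gt0 exprn_gt0.
  - by rewrite mulr_ge0// ltW.
  - move=> y /YP[a b c]; rewrite /Le even_glueE; have [-> _ _ _] := far _ c.
    rewrite -mulrA -mulrBr ler_pM2l//; have := HCd `|y| (normr_ge0 y).
    by rewrite real_normK ?num_real.
  - move=> y /YP[a b c]; rewrite norm_odd_glue//; have [_ -> _ _] := far _ c.
    by rewrite normrM (gtr0_norm th0) -(mulrA th) ler_pM2l//; have [] := HB _ b a.
  - move=> y /YP[a b c]; rewrite /qe even_glueE; have [_ _ -> _] := far _ c.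
    by rewrite normrM (gtr0_norm th0) -(mulrA th) ler_pM2l//; have [] := HB _ b a.
  - move=> y /YP[a b c]; rewrite norm_odd_glue//; have [_ _ _ ->] := far _ c.
    by rewrite normrM (gtr0_norm th0) -(mulrA th) ler_pM2l//; have [] := HB _ b a.
have cpe : continuous pe by move=> y; exact: is_derive_continuous (dpe y).
have cqe : continuous qe by move=> y; exact: is_derive_continuous (dqe y).
have cN : continuous N.
  move=> y; apply: cvgN; apply: cvgD; first exact: cvg_cst.
  by apply: cvgM; [apply: cvgM; [exact: cvg_cst|exact: cvg_id]|exact: cpe].
have cS : continuous S.
  move=> y; apply: cvgD; first exact: cqe.
  exact: (continuous_comp (cpe y) (@exprn_continuous R 2 _)).
have alV : 0 < (k ^+ 2)^-1 by rewrite invr_gt0 exprn_gt0.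
have dich y : N y / S y <= k ^+ 2 /\ Num.max 1 (N y / S y) * S y = N y.
  have [S0|S0] := eqVneq (S y) 0.
    rewrite S0 invr0 mulr0 (max_idPl ler01) mulr0 exprn_ge0 ?(ltW k0)//; split => //.
    by have := br' y; rewrite S0 pmulr_lge0// pmulr_lle0// => -[[a b]|[a b]]; apply/le_anti; rewrite a b.
  have [[a b]|[a b]] := br' y.
    have S1 : S y < 0.
      rewrite lt_neqAle S0/= (le_trans b)// pmulr_lle0//.
      have : N y <= N y / k ^+ 2 by exact: le_trans b.
      move=> c; rewrite leNgt; apply/negP => N0; move: c.
      by rewrite leNgt ltr_pdivrMr ?exprn_gt0// ltr_pMr// k21.
    have c : 1 <= N y / S y by rewrite ler_ndivlMr// mul1r.
    by rewrite (max_idPr c) mulfVK//; split => //; rewrite ler_ndivrMr// mulrC -ler_pdivlMr ?exprn_gt0.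
  have S1 : 0 < S y.
    rewrite lt_neqAle eq_sym S0/= (le_trans _ a)// pmulr_lge0//.
    have : N y / k ^+ 2 <= N y by exact: le_trans b.
    move=> c; rewrite leNgt; apply/negP => N0; move: c.
    by rewrite leNgt ltr_pdivlMr ?exprn_gt0// gtr_nMr// k21.
  have c : 1 <= N y / S y by rewrite ler_pdivlMr// mul1r.
  by rewrite (max_idPr c) mulfVK//; split => //; rewrite ler_pdivrMr// mulrC -ler_pdivrMr ?exprn_gt0.
split.
- apply: measurable_maxr; first exact: measurable_cst.
  apply: measurable_funM; first exact: continuous_measurable_fun.
  apply: measurableT_comp (continuous_measurable_fun cS).
  (* The inverse as a product of measurable functions; both sides are 0 at 0. *)
  have -> : (@GRing.inv R) = (fun x : R => x * (x ^+ 2) `^ (- 1)).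
    apply/funext => x; have [->|x0] := eqVneq x 0; first by rewrite invr0 mul0r.
    by rewrite powR_inv1 ?sqr_ge0//; field.
  apply: measurable_funM; first exact: measurable_id.
  by apply: (measurableT_comp (measurable_powR _)); exact: exprn_measurable.
- move=> y; rewrite le_max lexx/= ge_max (ltW k21)/=; exact: (dich y).1.
- by move=> y; rewrite /prof2 mulrCA -/(S y) (dich y).2 /N /prof0 /prof1; ring.
- exists (cc0 + ell) => y yc.
  have cy : cc0 <= y by rewrite (le_trans _ yc)// lerDl ltW.
  have y0 : 0 < y by exact: lt_le_trans cy.
  rewrite /prof1 pmulr_rlt0 ?expR_gt0// /pe odd_glueE// (ltW y0).
  have [_ -> _ _] := far _ yc; rewrite pmulr_rlt0// /psR pmulr_rlt0 ?invr_gt0//.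
  by rewrite (lt_trans (rho_lt y))// oppr_lt0 mulr_gt0// divr_gt0.
Qed.

End Hermite_profile.

Lemma hermite_profile {R : realType} (g gmax : R) : 0 < g < 1 -> g < gmax ->
  exists gp (G G1 G2 G3 A : R -> R), g < gp < gmax /\
  [/\ forall y : R, is_derive y 1 G (G1 y), forall y : R, is_derive y 1 G1 (G2 y),
      forall y : R, is_derive y 1 G2 (G3 y) & continuous G3] /\
  [/\ superexp_decay G, superexp_decay G1, superexp_decay G2 & superexp_decay G3] /\
  [/\ measurable_fun setT A, forall y, 1 <= A y <= beta_ g,
      forall y, A y * G2 y = - (2 * gp * G y + 2 * y * G1 y) &
      exists Y, forall y, Y <= y -> G1 y < 0].
Proof.
move=> g01 gm; have /andP[g0 _] := g01.
have eta0 : 0 < gmax / g - 1 by rewrite subr_gt0 ltr_pdivlMr// mul1r.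
have E10 : @hermE1 R g 0 = 0 by rewrite /hermE1 oppr0 subrr.
have [th [G [G1 [G2 [G3 [A [thE rest]]]]]]] :=
  @quotient_profile R g _ _ _ _ _ _ g0 (is_derive_herm0 g01) (is_derive_herm1 g01)
    (is_derive_hermE0 g01) (is_derive_hermE1 g01) (herm0_gt0 g01) (hermE0_gt0 g01) E10
    (herm1_lt g01) (herm1_ge g01) _ (herm0_gt0 g01 0) (herm0_decay g01)
    (c0P g01).1 (c1P g01).1 (c1_lt_c0 g01) (c1P g01).2 (c0P g01).2 _ eta0.
exists (th * g), G, G1, G2, G3, A; split => //.
have /andP[t1 t2] := thE; rewrite -[ltLHS]mul1r ltr_pM2r// t1/=.
by rewrite -ltr_pdivlMr//; rewrite addrC subrK in t2.
Qed.

(** * The Bessel potential *)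

Section Bessel_kernel.
Context {R : realType}.
Local Notation leb := (@lebesgue_measure R).
Implicit Types (c xi r x : R).

(** The Fourier transform of the resolvent kernel, up to normalization; in the inversion formula the
    same integral, with the roles of the variables exchanged, is the Poisson kernel. *)
Lemma integral_expR_norm_cos c xi : 0 < c ->
  \int[leb]_r (expR (- (c * `|r|)) * cos (xi * r)) = 2 * c / (c ^+ 2 + xi ^+ 2).
Proof.
move=> c0; pose f r := expR (- (c * `|r|)) * cos (xi * r).
have cf : continuous f.
  move=> r; apply: cvgM.
    apply: continuous_comp; last exact: continuous_expR.
    apply: cvgN; apply: cvgMr; exact: norm_continuous.
  apply: continuous_comp; last exact: continuous_cos.
  by apply: cvgMr; exact: cvg_id.
have fi : leb.-integrable setT (EFin \o f).
  apply: integrable_dom (integrable_expR_norm c0).1 => //; first exact: continuous_measurable_fun.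
  by move=> r _; rewrite /f normrM ger0_norm ?expR_ge0// ler_piMr ?expR_ge0// cos_max.
have ev r : f (- r) = f r by rewrite /f normrN mulrN cosN.
have fiy : leb.-integrable `]0, +oo[%classic (EFin \o f) by exact: integrableRT.
rewrite -/f (integrable_even ev fiy).2.
have den : 0 < c ^+ 2 + xi ^+ 2 by rewrite ltr_wpDr ?sqr_ge0 ?exprn_gt0.
have denN : c ^+ 2 + xi ^+ 2 != 0 by rewrite gt_eqF.
pose F r := expR (- (c * r)) * ((xi * sin (xi * r) - c * cos (xi * r)) / (c ^+ 2 + xi ^+ 2)).
have dF (r : R) : is_derive r 1 F (expR (- (c * r)) * cos (xi * r)).
  have d1 : is_derive r 1 (fun r : R => xi * r) xi.
    by apply: is_derive_eq; rewrite /GRing.scale/= mulr1.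
  have d2 : is_derive r 1 (fun r : R => - (c * r)) (- c).
    by apply: is_derive_eq; rewrite /GRing.scale/= mulr1.
  have s := @is_derive1_comp R sin _ r _ _ (is_derive_sin _) d1.
  have t := @is_derive1_comp R cos _ r _ _ (is_derive_cos _) d1.
  have e := @is_derive1_comp R expR _ r _ _ (is_derive_expR _) d2.
  rewrite /F; apply: is_derive_eq; rewrite /GRing.scale/=.
  by move: (expR _) (cos _) (sin _) => *; field.
have -> : \int[leb]_(x in `]0, +oo[) f x = 0 - F 0; last first.
  by rewrite sub0r /F !(mulr0, oppr0, expR0, cos0, sin0, sub0r, mul1r, mulr1); field.
apply: FTC_half_line.
- exact: integrableRT.
- move=> r r0; apply: (is_derive_eq (dF r)).
  by rewrite /f gtr0_norm.
- by move=> r _; exact: cf.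
- apply: cvg_at_right_filter; exact: is_derive_continuous (dF 0).
- have := cvg_expRMNy c0.
  pose K := (`|xi| + c) / (c ^+ 2 + xi ^+ 2).
  move=> /(cvgMr (a := K)); rewrite mulr0 => h.
  have hN : - (K * expR (- (c * x))) @[x --> +oo] --> (0 : R) by rewrite -oppr0; exact: cvgN.
  apply: squeeze_cvgr hN h; apply: nearW => r /=.
  rewrite -ler_norml /F normrM ger0_norm ?expR_ge0// mulrC ler_wpM2r ?expR_ge0//.
  rewrite normrM [`|_^-1|]gtr0_norm ?invr_gt0// /K ler_pM2r ?invr_gt0//.
  apply: le_trans (ler_normB _ _) _; rewrite !normrM [`|c|]gtr0_norm//.
  by rewrite lerD// ?ler_piMr ?(ltW c0) ?cos_max ?sin_max.
Qed.

Let cont_oneDsqrV : continuous (fun x : R => (1 + x ^+ 2)^-1).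
Proof.
move=> x; apply: cvgV; first by rewrite gt_eqF// ltr_wpDr ?sqr_ge0.
by apply: cvgD; [exact: cvg_cst|exact: exprn_continuous].
Qed.

Lemma integrable_oneDsqrV :
  leb.-integrable setT (EFin \o (fun x => (1 + x ^+ 2)^-1)).
Proof.
have p x : 0 < 1 + x ^+ 2 by rewrite ltr_wpDr ?sqr_ge0.
have := integrableRZ 2 (@measurableT _ _) (@integrable_one_plus_powR R 1 ltr01).
apply: integrable_dom => // [|x _].
  exact: continuous_measurable_fun.
rewrite ger0_norm ?invr_ge0 ?(ltW (p x))//.
have -> : (1 + `|x|) `^ (- (1 + 1)) = ((1 + `|x|) ^+ 2)^-1.
  by rewrite powRN -(powR_mulrn 2) ?addr_ge0// (_ : 2%:R = 1 + 1) //.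
rewrite -ler_pdivrMl// mulrC -(real_normK (num_real x)).
rewrite -invfM lef_pV2 ?posrE ?exprn_gt0 ?mulr_gt0 ?ltr_wpDr//.
by have := sqr_ge0 (1 - `|x|); rewrite !expr2; lra.
Qed.

Lemma integral_sqrDsqrV (a : R) : 0 < a ->
  leb.-integrable setT (EFin \o (fun x => (a ^+ 2 + x ^+ 2)^-1)) /\
  \int[leb]_x (a ^+ 2 + x ^+ 2)^-1 = pi / a.
Proof.
move=> a0; have aV : a^-1 != 0 by rewrite invr_eq0 gt_eqF.
have i1 : \int[leb]_x (1 + x ^+ 2)^-1 = pi.
  rewrite (FTC_line (F := atan) (A := - (pi / 2)) (B := pi / 2)).
  - by rewrite opprK; field.
  - exact: integrable_oneDsqrV.
  - exact: cont_oneDsqrV.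
  - apply/cvgNy_compNP; rewrite (_ : _ \o _ = fun x => - atan x); last first.
      by apply/funext => x; rewrite /= atanN.
    by apply: cvgN; exact: cvgy_atan.
  - exact: cvgy_atan.
have e x : (a ^+ 2 + x ^+ 2)^-1 = a ^- 2 * (1 + (a^-1 * x + 0) ^+ 2)^-1.
  by rewrite addr0 -invfM; congr (_^-1); field; rewrite gt_eqF.
split.
  rewrite (_ : EFin \o _ = EFin \o (fun x => a ^- 2 * (1 + (a^-1 * x + 0) ^+ 2)^-1)); last first.
    by apply/funext => x; rewrite /= e.
  apply: integrableRZ => //; exact: (integrable_affine 0 aV integrable_oneDsqrV).
under eq_Rintegral do rewrite e.
rewrite RintegralZl//; last exact: (integrable_affine 0 aV integrable_oneDsqrV).
rewrite (Rintegral_affine 0 aV integrable_oneDsqrV) i1 gtr0_norm ?invr_gt0//.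
by field; rewrite gt_eqF.
Qed.

End Bessel_kernel.

Section Real_integral_bounds.
Context d (T : measurableType d) (R : realType) (m : {measure set T -> \bar R}).

Lemma Rintegral_norm_le (f g : T -> R) : measurable_fun setT f ->
  m.-integrable setT (EFin \o g) -> (forall x, `|f x| <= g x) ->
  `|\int[m]_x f x| <= \int[m]_x g x.
Proof.
move=> mf gi fg.
have fi : m.-integrable setT (EFin \o f) by apply: integrable_dom gi.
apply: le_trans (le_normr_Rintegral measurableT fi) _.
by apply: le_Rintegral => //; have := integrable_norm fi.
Qed.

Lemma is_derive_Rintegral (F F' : R -> T -> R) (u v a : R) (G0 G : T -> R) :
  u < a < v ->
  (forall s, measurable_fun setT (F s)) ->
  m.-integrable setT (EFin \o G0) -> m.-integrable setT (EFin \o G) ->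
  (forall (s : R) y, u < s < v -> is_derive s 1 (F ^~ y) (F' s y)) ->
  (forall (s : R) y, u < s < v -> `|F s y| <= G0 y) ->
  (forall (s : R) y, u < s < v -> `|F' s y| <= G y) ->
  is_derive a 1 (fun s => \int[m]_y F s y) (\int[m]_y F' a y).
Proof.
move=> uav mF G0i Gi dF FG0 FG.
have uP s : `]u, v[%classic s = (u < s < v) :> Prop by rewrite /= in_itv.
have aI : `]u, v[%classic a by rewrite uP.
have intF s : `]u, v[%classic s -> m.-integrable setT (EFin \o F s).
  by rewrite uP => us; apply: integrable_dom G0i => // y _; exact: FG0.
have derF s y : `]u, v[%classic s -> setT y -> derivable (F^~ y) s 1.
  by rewrite uP => us _; have [] := dF s y us.
have Gn y : 0 <= G y by rewrite (le_trans _ (FG a y uav)).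
have Gub s y : `]u, v[%classic s -> setT y -> `|partial1of2 F s y| <= G y.
  by rewrite uP => us _; rewrite partial1of2E; have [_ ->] := dF s y us; exact: FG.
have D := derivable_under_integral measurableT aI intF derF Gn Gi Gub.
have E := differentiation_under_integral measurableT aI intF derF Gn Gi Gub.
apply: DeriveDef => //; rewrite -derive1E E; apply: eq_Rintegral => y _.
by rewrite partial1of2E; have [_ ->] := dF a y uav.
Qed.

End Real_integral_bounds.

(** * Lambda^-1 as an integral of resolvents *)

Section Bessel_potential.
Context {R : realType}.
Local Notation leb := (@lebesgue_measure R).
Implicit Types (f g : R -> R) (t r x y xi M : R).

Definition kap t := Num.sqrt (1 + t ^+ 2).

Lemma sqr_kap t : kap t ^+ 2 = 1 + t ^+ 2.
Proof. by rewrite sqr_sqrtr// addr_ge0 ?sqr_ge0. Qed.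

Lemma kap_ge1 t : 1 <= kap t.
Proof. by rewrite -{1}[1]sqrtr1 ler_wsqrtr// lerDl sqr_ge0. Qed.

Lemma kap_gt0 t : 0 < kap t. Proof. exact: lt_le_trans (kap_ge1 t). Qed.

Lemma continuous_kap : continuous kap.
Proof.
move=> t; apply: continuous_comp; last exact: sqrt_continuous.
by apply: cvgD; [exact: cvg_cst|exact: exprn_continuous].
Qed.

Definition ekap t r := expR (- (kap t * `|r|)).

Lemma ekap_gt0 t r : 0 < ekap t r. Proof. exact: expR_gt0. Qed.

Lemma integrable_ekap t : leb.-integrable setT (EFin \o ekap t).
Proof. exact: (integrable_expR_norm (kap_gt0 t)).1. Qed.

Lemma integral_ekap t : \int[leb]_r ekap t r = 2 / kap t.
Proof. exact: (integrable_expR_norm (kap_gt0 t)).2. Qed.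

Lemma measurable_ekap d (T : measurableType d) (f g : T -> R) :
  measurable_fun setT f -> measurable_fun setT g ->
  measurable_fun setT (fun z => ekap (f z) (g z)).
Proof.
move=> mf mg; apply: measurableT_comp => //; apply: measurableT_comp => //.
apply: measurable_funM; last exact: measurableT_comp.
by apply: (measurableT_comp (continuous_measurable_fun continuous_kap)).
Qed.

Lemma measurable_kapV : measurable_fun setT (fun t => (kap t)^-1).
Proof.
apply: continuous_measurable_fun => t; apply: cvgV; last exact: continuous_kap.
by rewrite gt_eqF// kap_gt0.
Qed.

Lemma integrable_kapV2 : leb.-integrable setT (EFin \o (fun t => kap t ^- 2)).
Proof.
rewrite (_ : (fun t => _) = (fun t => (1 + t ^+ 2)^-1)); last first.
  by apply/funext => t; rewrite sqr_kap.
exact: integrable_oneDsqrV.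
Qed.

Lemma measurable_ekapM f t : measurable_fun setT f ->
  measurable_fun setT (fun y => ekap t y * f y).
Proof.
by move=> mf; apply: measurable_funM => //; apply: measurable_ekap => //; exact: measurable_cst.
Qed.

Lemma integrable_ekapM f M t : measurable_fun setT f -> (forall y, `|f y| <= M) ->
  leb.-integrable setT (EFin \o (fun y => ekap t y * f y)).
Proof.
move=> mf fM.
apply: integrable_dom (integrableRZ M measurableT (integrable_ekap t)) => //.
  exact: measurable_ekapM.
by move=> y _; rewrite normrM ger0_norm ?expR_ge0// mulrC ler_wpM2r ?expR_ge0.
Qed.

(** On the function w -> f (x - w) this is twice (kap t ^ 2 - D^2)^-1 f at x. *)
Definition resolvent f t := (kap t)^-1 * \int[leb]_y (ekap t y * f y).

Lemma resolvent_le f g t : measurable_fun setT f ->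
  leb.-integrable setT (EFin \o (fun y => ekap t y * g y)) ->
  (forall y, `|f y| <= g y) ->
  `|resolvent f t| <= (kap t)^-1 * \int[leb]_y (ekap t y * g y).
Proof.
move=> mf gi fg; rewrite normrM gtr0_norm ?invr_gt0 ?kap_gt0//.
rewrite ler_pM2l ?invr_gt0 ?kap_gt0//; apply: (Rintegral_norm_le (m := leb)) => //.
  exact: measurable_ekapM.
by move=> y; rewrite normrM gtr0_norm ?ekap_gt0// ler_wpM2l ?expR_ge0.
Qed.

Lemma resolvent_bound f M t : measurable_fun setT f -> (forall y, `|f y| <= M) ->
  `|resolvent f t| <= 2 * M * kap t ^- 2.
Proof.
move=> mf fM; have M0 : 0 <= M by rewrite (le_trans _ (fM 0)).
have h : forall y, `|cst M y| <= M by move=> y; rewrite ger0_norm.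
have gi := integrable_ekapM t (@measurable_cst _ _ _ _ setT M) h.
apply: le_trans (resolvent_le mf gi fM) _.
rewrite RintegralZr//; last exact: integrable_ekap.
rewrite integral_ekap le_eqVlt; apply/orP; left; apply/eqP; field.
by rewrite gt_eqF// kap_gt0.
Qed.

Lemma measurable_resolvent d (T : measurableType d) (f : T -> R -> R) :
  measurable_fun setT (fun z : T * R => f z.1 z.2) ->
  measurable_fun setT (fun z : T * R => resolvent (f z.1) z.2).
Proof.
move=> mf; apply: measurable_funM; first exact: (measurableT_comp measurable_kapV).
apply: (@measurable_Rintegral _ _ (T * R)%type _ R leb
  (fun (z : T * R) y => ekap z.2 y * f z.1 y)).
apply: measurable_funM; first by apply: measurable_ekap => //; exact: measurableT_comp.
rewrite (_ : (fun z => _) = (fun z : T * R => f z.1 z.2) \o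
  (fun z : (T * R) * R => (z.1.1, z.2)))//.
apply: measurableT_comp => //; apply/measurable_fun_pairP; split; last exact: measurable_snd.
exact: (measurableT_comp measurable_fst measurable_fst).
Qed.

Lemma measurable_resolvent1 f : measurable_fun setT f -> measurable_fun setT (resolvent f).
Proof.
move=> mf; have m2 : measurable_fun setT (fun z : R * R => f z.2) by exact: measurableT_comp.
have := @measurable_resolvent _ R (fun _ : R => f) m2.
by move=> /measurableT_comp /(_ (pair1_measurable (0 : R))).
Qed.

Lemma integrable_resolvent f M : measurable_fun setT f -> (forall y, `|f y| <= M) ->
  leb.-integrable setT (EFin \o resolvent f).
Proof.
move=> mf fM.
apply: integrable_dom (integrableRZ (2 * M) measurableT integrable_kapV2) => //.
  exact: measurable_resolvent1.
by move=> t _; exact: resolvent_bound.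
Qed.

(** This is Lambda^-1, because (kap t ^ 2 + xi^2)^-1 integrates over t to pi / sqrt (1 + xi^2). The
    argument is an already translated and reflected function, so that one differentiation lemma
    serves for x as well as for t. *)
Definition bessel0 f := (2 * pi)^-1 * \int[leb]_t resolvent f t.
Definition bessel f x := bessel0 (fun y => f (x - y)).

Lemma measurable_bessel0 d (T : measurableType d) (f : T -> R -> R) :
  measurable_fun setT (fun z : T * R => f z.1 z.2) ->
  measurable_fun setT (fun z => bessel0 (f z)).
Proof.
move=> mf; apply: measurable_funM; first exact: measurable_cst.
apply: (@measurable_Rintegral _ _ T _ R leb (fun z t => resolvent (f z) t)).
exact: measurable_resolvent.
Qed.

Lemma is_derive_resolvent (f f' : R -> R -> R) (u v a M t : R) : u < a < v ->
  (forall s, measurable_fun setT (f s)) ->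
  (forall s y, u < s < v -> is_derive s 1 (f ^~ y) (f' s y)) ->
  (forall s y, u < s < v -> `|f s y| <= M) ->
  (forall s y, u < s < v -> `|f' s y| <= M) ->
  is_derive a 1 (fun s => resolvent (f s) t) (resolvent (f' a) t).
Proof.
move=> uav mf df fM f'M.
have Gi := integrableRZ M measurableT (integrable_ekap t).
have dF : is_derive a 1 (fun s => \int[leb]_y (ekap t y * f s y)) (\int[leb]_y (ekap t y * f' a y)).
  apply: (@is_derive_Rintegral _ _ _ leb (fun s y => ekap t y * f s y)
    (fun s y => ekap t y * f' s y) u v a _ _ uav _ Gi Gi) => [s|s y us|s y us|s y us].
  - exact: measurable_ekapM.
  - apply: (is_derive_eq (is_deriveM (is_derive_cst (ekap t y) s 1) (df s y us))).
    by rewrite /GRing.scale/= mulr0 addr0.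
  - by rewrite normrM gtr0_norm ?ekap_gt0// mulrC ler_wpM2r ?expR_ge0//; exact: fM.
  - by rewrite normrM gtr0_norm ?ekap_gt0// mulrC ler_wpM2r ?expR_ge0//; exact: f'M.
apply: (is_derive_eq (is_deriveM (is_derive_cst (kap t)^-1 a 1) dF)).
by rewrite /GRing.scale/= mulr0 addr0.
Qed.

Lemma is_derive_bessel0 (f f' : R -> R -> R) (u v a M : R) : u < a < v ->
  (forall s, measurable_fun setT (f s)) ->
  (forall s, u < s < v -> measurable_fun setT (f' s)) ->
  (forall s y, u < s < v -> is_derive s 1 (f ^~ y) (f' s y)) ->
  (forall s y, u < s < v -> `|f s y| <= M) ->
  (forall s y, u < s < v -> `|f' s y| <= M) ->
  is_derive a 1 (fun s => bessel0 (f s)) (bessel0 (f' a)).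
Proof.
move=> uav mf mf' df fM f'M.
have Gi := integrableRZ (2 * M) measurableT integrable_kapV2.
have dF : is_derive a 1 (fun s => \int[leb]_t resolvent (f s) t) (\int[leb]_t resolvent (f' a) t).
  apply: (@is_derive_Rintegral _ _ _ leb (fun s t => resolvent (f s) t)
    (fun s t => resolvent (f' s) t) u v a _ _ uav _ Gi Gi) => [s|s y us|s y us|s y us].
  - exact: measurable_resolvent1.
  - exact: (@is_derive_resolvent f f' u v s M).
  - by apply: resolvent_bound => // z; exact: fM.
  - by apply: resolvent_bound => // [|z]; [exact: mf'|exact: f'M].
apply: (is_derive_eq (is_deriveM (is_derive_cst (2 * pi)^-1 a 1) dF)).
by rewrite /GRing.scale/= mulr0 addr0.
Qed.

End Bessel_potential.

(** * Fourier inversion on Schwartz functions, in real form *)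

Section Schwartz_functions.
Context {R : realType}.
Local Notation leb := (@lebesgue_measure R).
Implicit Types (phi : R -> R) (x y xi : R).

Let oneDsqr_gt0 x : 0 < 1 + x ^+ 2. Proof. by rewrite ltr_wpDr ?sqr_ge0. Qed.

Lemma cvg_oneDsqrV (f : R -> R) (C : R) (F : set_system R) : ProperFilter F ->
  (`|x| @[x --> F] --> +oo) -> (forall x, `|f x| <= C * (1 + x ^+ 2)^-1) ->
  f x @[x --> F] --> (0 : R).
Proof.
move=> FF Foo fC; have C0 : 0 <= C.
  by have := fC 0; rewrite expr0n/= addr0 invr1 mulr1; exact: le_trans.
have h1 : C * `|x|^-1 @[x --> F] --> (0 : R).
  rewrite -(mulr0 C); apply: cvgMr; exact: cvg_invy.
have h2 : - (C * `|x|^-1) @[x --> F] --> (0 : R) by rewrite -oppr0; exact: cvgN.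
apply: (squeeze_cvgr _ h2 h1).
have : \forall x \near F, 1 <= `|x| by move/cvgryPge : Foo; exact.
apply: filterS => x x1; rewrite -ler_norml (le_trans (fC x))// ler_wpM2l//.
rewrite lef_pV2 ?posrE ?oneDsqr_gt0//; last by rewrite (lt_le_trans _ x1).
rewrite -(real_normK (num_real x)) expr2.
by rewrite (@le_trans _ _ (`|x| * `|x|)) ?ler_peMr// lerDr.
Qed.

Lemma integral_derive_eq0 (f F : R -> R) (C : R) : leb.-integrable setT (EFin \o f) ->
  (forall x, is_derive x 1 F (f x)) -> continuous f ->
  (forall x, `|F x| <= C * (1 + x ^+ 2)^-1) ->
  \int[leb]_x f x = 0.
Proof.
move=> fi dF cf FC; rewrite -(subr0 (0 : R)).
apply: (FTC_line fi dF cf); apply: (@cvg_oneDsqrV F C _ _ _ FC).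
  rewrite (_ : (fun x => `|x|) = (fun x => `|- x|)); last by apply/funext => x; rewrite normrN.
  apply/cvgryPge => A; have := @nbhs_ninfty_le R (- `|A|) (num_real _).
  apply: filterS => x xA; rewrite (le_trans (ler_norm A))// (le_trans _ (ler_norm _))//.
  by rewrite lerNr.
apply/cvgryPge => A; have := @nbhs_pinfty_ge R A (num_real _).
by apply: filterS => x xA; rewrite (le_trans xA)// ler_norm.
Qed.

Lemma schwartz_derive phi : schwartz phi -> schwartz (derive1 phi).
Proof.
move=> sp n; have [d b] := sp n.+1; split => [x|k].
  by rewrite -derive1Sn; exact: d.
by have [C HC] := b k; exists C => x; rewrite -derive1Sn; exact: HC.
Qed.

Lemma schwartz_is_derive phi x : schwartz phi -> is_derive x 1 phi (derive1 phi x).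
Proof. by move=> /(_ 0%N)[/(_ x) d _]; apply: DeriveDef => //; rewrite derive1E. Qed.

Lemma schwartz_continuous phi : schwartz phi -> continuous phi.
Proof. by move=> sp x; exact: is_derive_continuous (schwartz_is_derive x sp). Qed.

Lemma schwartz_measurable phi : schwartz phi -> measurable_fun setT phi.
Proof. by move=> /schwartz_continuous; exact: continuous_measurable_fun. Qed.

Lemma schwartz_le phi : schwartz phi ->
  exists2 C, 0 <= C & forall x, `|phi x| <= C * (1 + x ^+ 2)^-1.
Proof.
move=> sp; have [_ b] := sp 0%N; have [C1 H1] := b 0%N; have [C2 H2] := b 2%N.
have h x : `|phi x| * (1 + x ^+ 2) <= C1 + C2.
  rewrite mulrDr mulr1; apply: lerD.
    by have := H1 x; rewrite expr0 mul1r.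
  by have := H2 x; rewrite normrM normrX real_normK ?num_real// mulrC.
exists (C1 + C2); first by rewrite (le_trans _ (h 0))// mulr_ge0// ltW.
by move=> x; rewrite ler_pdivlMr.
Qed.

Lemma schwartz_bounded phi : schwartz phi -> exists C, forall x, `|phi x| <= C.
Proof.
move=> /schwartz_le[C C0 HC]; exists C => x; rewrite (le_trans (HC x))//.
by rewrite ler_piMr// invf_le1// lerDl sqr_ge0.
Qed.

Lemma schwartz_integrable phi : schwartz phi -> leb.-integrable setT (EFin \o phi).
Proof.
move=> sp; have [C C0 HC] := schwartz_le sp.
apply: integrable_dom (integrableRZ C measurableT (@integrable_oneDsqrV R)) => //.
exact: schwartz_measurable.
Qed.

Let mcosf d (T : measurableType d) (f : T -> R) : measurable_fun setT f ->
  measurable_fun setT (fun z => cos (f z)).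
Proof.
by move=> mf; apply: (measurableT_comp (continuous_measurable_fun (@continuous_cos R))).
Qed.

(** The real part of e^(i x xi) times the Fourier transform of [phi], that is, the inner integral of
    [Lambda]. *)
Definition fcos phi x xi := \int[leb]_y (phi y * cos (xi * (x - y))).

Lemma measurable_fcos phi : schwartz phi ->
  measurable_fun setT (fun z : R * R => fcos phi z.1 z.2).
Proof.
move=> sp; apply: (@measurable_Rintegral _ _ (R * R)%type _ R leb
  (fun z y => phi y * cos (z.2 * (z.1 - y)))).
apply: measurable_funM; first by apply: measurableT_comp => //; exact: schwartz_measurable.
apply: mcosf; apply: measurable_funM.
  exact: (measurableT_comp measurable_snd measurable_fst).
apply: measurable_funB => //; exact: (measurableT_comp measurable_fst measurable_fst).
Qed.

Let cos_le (a z : R) : `|a * cos z| <= `|a|.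
Proof. by rewrite normrM ler_piMr// cos_max. Qed.

Let mcos x xi : measurable_fun setT (fun y => cos (xi * (x - y))).
Proof.
apply: mcosf; apply: measurable_funM => //; exact: measurable_funB.
Qed.

Lemma integrable_fcos phi x xi : schwartz phi ->
  leb.-integrable setT (EFin \o (fun y => phi y * cos (xi * (x - y)))).
Proof.
move=> sp; apply: integrable_dom (integrable_norm (schwartz_integrable sp)) => //.
  by apply: measurable_funM; [exact: schwartz_measurable|exact: mcos].
Qed.

Lemma fcos_le phi x xi : schwartz phi -> `|fcos phi x xi| <= \int[leb]_y `|phi y|.
Proof.
move=> sp; apply: (Rintegral_norm_le (m := leb)).
- by apply: measurable_funM; [exact: schwartz_measurable|exact: mcos].
- exact: integrable_norm (schwartz_integrable sp).
- by move=> y; exact: cos_le.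
Qed.

(** Both integrations by parts at once: phi'' cos + xi^2 phi cos is the derivative of [F], which
    decays at infinity. *)
Lemma fcos_derive2 phi x xi : schwartz phi ->
  fcos (derive1 (derive1 phi)) x xi = - (xi ^+ 2 * fcos phi x xi).
Proof.
move=> sp; have sp1 := schwartz_derive sp; have sp2 := schwartz_derive sp1.
apply/eqP; rewrite -subr_eq0 opprK; apply/eqP.
have i0 := integrable_fcos x xi sp; have i2 := integrable_fcos x xi sp2.
rewrite /fcos -RintegralZl// -RintegralD//; last exact: integrableRZ.
have [C C0 HC] := schwartz_le sp; have [C1 C10 HC1] := schwartz_le sp1.
pose F y := derive1 phi y * cos (xi * (x - y)) - xi * (phi y * sin (xi * (x - y))).
apply: (@integral_derive_eq0 _ F (C1 + `|xi| * C)).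
- exact: integrableRD i2 (integrableRZ _ measurableT i0).
- move=> y; have d0 : is_derive y 1 (fun y => xi * (x - y)) (- xi).
    by apply: is_derive_eq; rewrite /GRing.scale/=; ring.
  have c := @is_derive1_comp R cos _ y _ _ (is_derive_cos _) d0.
  have s := @is_derive1_comp R sin _ y _ _ (is_derive_sin _) d0.
  have p0 := schwartz_is_derive y sp; have p1 := schwartz_is_derive y sp1.
  by rewrite /F; apply: is_derive_eq; rewrite /GRing.scale/=; ring.
- have cc : continuous (fun y => cos (xi * (x - y))).
    move=> y; apply: continuous_comp; last exact: continuous_cos.
    by apply: cvgMr; apply: cvgB; [exact: cvg_cst|exact: cvg_id].
  move=> y; apply: cvgD; first by apply: cvgM; [exact: schwartz_continuous|exact: cc].
  by apply: cvgMr; apply: cvgM; [exact: schwartz_continuous|exact: cc].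
- move=> y; rewrite /F (le_trans (ler_normB _ _))// mulrDl; apply: lerD.
    by rewrite (le_trans (cos_le _ _)).
  rewrite normrM -mulrA ler_wpM2l// normrM (le_trans _ (HC y))//.
  by rewrite ler_piMr// sin_max.
Qed.

(** Four derivatives of [phi] give decay like (1 + xi^4)^-1, and kap xi (1 + xi^2) <= 2 (1 + xi^4):
    an integrable bound remains after multiplication by the symbol of Lambda. *)
Lemma fcos_decay phi : schwartz phi ->
  exists2 C, 0 <= C & forall x xi, `|kap xi * fcos phi x xi| <= C * (1 + xi ^+ 2)^-1.
Proof.
move=> sp; have sp2 := schwartz_derive (schwartz_derive sp).
have sp4 := schwartz_derive (schwartz_derive sp2).
pose C := \int[leb]_y `|phi y| + \int[leb]_y `|derive1 (derive1 (derive1 (derive1 phi))) y|.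
have C0 : 0 <= C by rewrite addr_ge0// Rintegral_ge0.
have h x xi : `|fcos phi x xi| * (1 + xi ^+ 4) <= C.
  rewrite mulrDr mulr1; apply: lerD; first exact: fcos_le.
  have := fcos_le x xi sp4; rewrite fcos_derive2// fcos_derive2// mulrN opprK mulrA.
  by rewrite -exprD normrM [`|xi ^+ _|]ger0_norm ?exprn_even_ge0// mulrC.
exists (2 * C); first by rewrite mulr_ge0.
move=> x xi; rewrite ler_pdivlMr ?oneDsqr_gt0// normrM gtr0_norm ?kap_gt0//.
have k1 := kap_ge1 xi; have k2 := sqr_kap xi.
have : kap xi * (1 + xi ^+ 2) <= 2 * (1 + xi ^+ 4).
  have : kap xi <= kap xi ^+ 2 by rewrite expr2 ler_peMl// (le_trans _ k1).
  rewrite k2 => k3; apply: (@le_trans _ _ ((1 + xi ^+ 2) * (1 + xi ^+ 2))).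
    by rewrite ler_wpM2r// ltW// oneDsqr_gt0.
  rewrite -subr_ge0 (_ : _ - _ = (1 - xi ^+ 2) ^+ 2) ?sqr_ge0//; ring.
move=> k3; rewrite mulrAC (le_trans (ler_wpM2r (normr_ge0 _) k3))//.
by rewrite -mulrA ler_wpM2l// mulrC.
Qed.

(** Abel summation. With the damping factor exp (- e |xi|) the order of integration may be
    exchanged, which turns the integral into the convolution of [phi] with the Poisson kernel 2 e /
    (e^2 + y^2). Scaling y = e v, dominated convergence as e tends to 0 gives phi x times the
    integral of 2 / (1 + v^2). *)
Lemma fourier_inversion phi x : schwartz phi ->
  \int[leb]_xi fcos phi x xi = 2 * pi * phi x.
Proof.
move=> sp; have [C C0 HC] := fcos_decay sp; have [B HB] := schwartz_bounded sp.
pose e n : R := n.+1%:R^-1.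
have e0 n : 0 < e n by rewrite invr_gt0.
have ecvg : e n @[n --> \oo] --> (0 : R) by exact: cvg_harmonic.
have mf : measurable_fun setT (fcos phi x).
  exact: (measurableT_comp (measurable_fcos sp) (pair1_measurable x)).
have dom xi : `|fcos phi x xi| <= C * (1 + xi ^+ 2)^-1.
  by rewrite (le_trans _ (HC x xi))// normrM (gtr0_norm (kap_gt0 xi)) ler_peMl// kap_ge1.
have ai n := (integrable_expR_norm (e0 n)).1.
have step n : \int[leb]_xi (expR (- (e n * `|xi|)) * fcos phi x xi) =
    \int[leb]_v (phi (x - e n * v) * (2 * (1 + v ^+ 2)^-1)).
  have fi : (leb \x leb)%E.-integrable setT (fun z : R * R =>
      (expR (- (e n * `|z.1|)) * (phi z.2 * cos (z.1 * (x - z.2))))%:E).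
    apply: (@integrable_prod_dom _ _ _ _ R leb leb
      (fun xi y => expR (- (e n * `|xi|)) * (phi y * cos (xi * (x - y))))
      (fun xi => expR (- (e n * `|xi|))) (fun y => `|phi y|)) => //.
    - apply: measurable_funM.
        do 2 apply: measurableT_comp => //; apply: measurable_funM => //.
        exact: measurableT_comp.
      apply: measurable_funM; first by apply: measurableT_comp => //; exact: schwartz_measurable.
      apply: mcosf; apply: measurable_funM => //; exact: measurable_funB.
    - exact: integrable_norm (schwartz_integrable sp).
    - by move=> xi y; rewrite normrM ger0_norm ?expR_ge0// ler_wpM2l ?expR_ge0.
  transitivity (\int[leb]_xi \int[leb]_y (expR (- (e n * `|xi|)) * (phi y * cos (xi * (x - y))))).
    by apply: eq_Rintegral => xi _; rewrite RintegralZl//; exact: integrable_fcos.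
  rewrite (Rfubini_swap fi).
  pose h y := phi (x - y) * (2 * e n / (e n ^+ 2 + y ^+ 2)).
  have ki y : 2 * e n / (e n ^+ 2 + y ^+ 2) <= 2 / e n.
    rewrite ler_pdivlMr// mulrAC ler_pdivrMr ?ltr_wpDr ?sqr_ge0 ?exprn_gt0//.
    by rewrite -mulrA -expr2 ler_pM2l// lerDl sqr_ge0.
  have k0 y : 0 <= 2 * e n / (e n ^+ 2 + y ^+ 2).
    by rewrite divr_ge0 ?addr_ge0 ?sqr_ge0 ?mulr_ge0 ?(ltW (e0 n)).
  have hi : leb.-integrable setT (EFin \o h).
    have := integrable_reflect x (schwartz_integrable sp).
    move=> /(integrable_norm)/(integrableRZ (2 / e n) measurableT).
    apply: integrable_dom => //.
      apply: measurable_funM.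
        by apply: measurableT_comp; [exact: schwartz_measurable|exact: measurable_funB].
      apply: continuous_measurable_fun => y; apply: cvgMr; apply: cvgV.
        by rewrite gt_eqF// ltr_wpDr ?sqr_ge0 ?exprn_gt0.
      by apply: cvgD; [exact: cvg_cst|exact: exprn_continuous].
    by move=> y _; rewrite normrM mulrC (ger0_norm (k0 y)) ler_wpM2r.
  transitivity (\int[leb]_y h (x - y)).
    apply: eq_Rintegral => y _; rewrite /h subKr.
    under eq_Rintegral => xi _ do rewrite mulrCA (mulrC xi).
    rewrite RintegralZl; last 2 first.
    - by [].
    - apply: integrable_dom (ai n) => //.
        apply: measurable_funM.
          by do 2 apply: measurableT_comp => //; apply: measurable_funM => //; exact: measurableT_comp.
        by apply: mcosf; exact: measurable_funM.
      by move=> xi _; rewrite (le_trans (cos_le _ _))// ger0_norm ?expR_ge0.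
    by rewrite integral_expR_norm_cos.
  rewrite (Rintegral_reflect x hi).
  have en : e n != 0 by rewrite gt_eqF.
  rewrite -[LHS](mulKf en) -[X in X^-1](gtr0_norm (e0 n)) mulrCA -(Rintegral_affine 0 en hi).
  have hi' := integrable_affine 0 en hi.
  rewrite -RintegralZl//; apply: eq_Rintegral => v _; rewrite /h addr0 mulrCA; congr (_ * _).
  have d : 1 + v ^+ 2 != 0 by rewrite gt_eqF ?oneDsqr_gt0.
  move: (e n) en => a an; have d2 : a ^+ 2 + (a * v) ^+ 2 != 0.
    by rewrite exprMn -[X in X + _]mulr1 -mulrDr mulf_neq0 ?expf_neq0.
  by field; rewrite d2 d.
have [_ l1] : leb.-integrable setT (EFin \o fcos phi x) /\
    \int[leb]_xi (expR (- (e n * `|xi|)) * fcos phi x xi) @[n --> \oo] -->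
      \int[leb]_xi fcos phi x xi.
  apply: (Rdominated_convergence (m := leb) (g := fun xi => C * (1 + xi ^+ 2)^-1)) => //.
  - move=> n; apply: measurable_funM => //.
    by do 2 apply: measurableT_comp => //; apply: measurable_funM => //; exact: measurableT_comp.
  - move=> xi _; rewrite -[X in _ --> X]mul1r; apply: cvgMl.
    rewrite -expR0 -oppr0 -[X in - X](mul0r `|xi|).
    apply: continuous_cvg; first exact: continuous_expR.
    by apply: cvgN; apply: cvgMl.
  - by apply: integrableRZ => //; exact: integrable_oneDsqrV.
  - move=> n xi _; rewrite normrM ger0_norm ?expR_ge0// (le_trans _ (dom xi))//.
    by rewrite ler_piMl// -expR0 ler_expR oppr_le0 mulr_ge0// ltW.
have [_ l2] : leb.-integrable setT (EFin \o (fun v => phi x * (2 * (1 + v ^+ 2)^-1))) /\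
    \int[leb]_v (phi (x - e n * v) * (2 * (1 + v ^+ 2)^-1)) @[n --> \oo] -->
    \int[leb]_v (phi x * (2 * (1 + v ^+ 2)^-1)).
  apply: (Rdominated_convergence (m := leb) (g := fun v => (B * 2) * (1 + v ^+ 2)^-1)) => //.
  - move=> n; apply: measurable_funM.
      apply: measurableT_comp; first exact: schwartz_measurable.
      by apply: measurable_funB => //; exact: measurable_funM.
    apply: measurable_funM => //.
    by apply/measurable_EFinP; exact: measurable_int (@integrable_oneDsqrV R).
  - move=> v _; apply: cvgMl.
    apply: continuous_cvg; first exact: schwartz_continuous.
    rewrite -[X in _ --> X]subr0; apply: cvgB; first exact: cvg_cst.
    by rewrite -(mul0r v); apply: cvgMl.
  - by apply: integrableRZ => //; exact: integrable_oneDsqrV.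
  - move=> n v _; rewrite normrM -mulrA [`|2 * _|]ger0_norm.
      by rewrite ler_wpM2r// mulr_ge0// invr_ge0 ltW// oneDsqr_gt0.
    by rewrite mulr_ge0// invr_ge0 ltW// oneDsqr_gt0.
rewrite (funext step) in l1; rewrite (cvg_unique _ l1 l2)//.
have [oi ov] := integral_sqrDsqrV (@ltr01 R).
rewrite RintegralZl//; last by apply: integrableRZ => //; exact: integrable_oneDsqrV.
rewrite RintegralZl//; last exact: integrable_oneDsqrV.
rewrite (_ : \int[leb]_v (1 + v ^+ 2)^-1 = pi); first by ring.
by rewrite -[RHS](divr1) -ov expr1n.
Qed.

End Schwartz_functions.

(** * [bessel] inverts [Lambda 1] on Schwartz functions *)

Section Bessel_duality.
Context {R : realType}.
Local Notation leb := (@lebesgue_measure R).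
Implicit Types (phi psi f : R -> R) (t x y xi w : R).

Let oneDsqr_gt0 x : 0 < 1 + x ^+ 2. Proof. by rewrite ltr_wpDr ?sqr_ge0. Qed.

Lemma LambdaE phi x : Lambda 1 phi x = (2 * pi)^-1 * \int[leb]_xi (kap xi * fcos phi x xi).
Proof.
by rewrite /Lambda; congr (_ * _); apply: eq_Rintegral => xi _; rewrite div1r powR12_sqrt ?(ltW (oneDsqr_gt0 xi)).
Qed.

Lemma measurable_Lambda phi : schwartz phi -> measurable_fun setT (Lambda 1 phi).
Proof.
move=> sp; rewrite (funext (LambdaE phi)); apply: measurable_funM => //.
apply: (@measurable_Rintegral _ _ R _ R leb (fun x xi => kap xi * fcos phi x xi)).
apply: measurable_funM; last exact: measurable_fcos.
exact: (measurableT_comp (continuous_measurable_fun continuous_kap)).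
Qed.

Let mkf phi x : schwartz phi -> measurable_fun setT (fun xi => kap xi * fcos phi x xi).
Proof.
move=> sp; apply: measurable_funM; first exact: (continuous_measurable_fun continuous_kap).
exact: (measurableT_comp (measurable_fcos sp) (pair1_measurable x)).
Qed.

Let kfi phi x : schwartz phi -> leb.-integrable setT (EFin \o (fun xi => kap xi * fcos phi x xi)).
Proof.
move=> sp; have [C C0 HC] := fcos_decay sp.
apply: integrable_dom (integrableRZ C measurableT (@integrable_oneDsqrV R)) => //.
exact: mkf.
Qed.

Lemma Lambda_bounded phi : schwartz phi -> exists C, forall x, `|Lambda 1 phi x| <= C.
Proof.
move=> sp; have [C C0 HC] := fcos_decay sp.
exists ((2 * pi)^-1 * \int[leb]_xi (C * (1 + xi ^+ 2)^-1)) => x.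
have p0 : 0 < (2 * pi : R)^-1 by rewrite invr_gt0 mulr_gt0// pi_gt0.
rewrite LambdaE normrM (gtr0_norm p0) ler_pM2l//; apply: (Rintegral_norm_le (m := leb)) => //.
  exact: mkf.
by apply: integrableRZ => //; exact: integrable_oneDsqrV.
Qed.

Let mpair d d1 d2 (T : measurableType d) (T1 : measurableType d1) (T2 : measurableType d2)
    (f : T -> T1) (g : T -> T2) : measurable_fun setT f -> measurable_fun setT g ->
  measurable_fun setT (fun z => (f z, g z)).
Proof. by move=> mf mg; apply/measurable_fun_pairP; split. Qed.

Let mcosf d (T : measurableType d) (f : T -> R) : measurable_fun setT f ->
  measurable_fun setT (fun z => cos (f z)).
Proof.
by move=> mf; apply: (measurableT_comp (continuous_measurable_fun (@continuous_cos R))).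
Qed.

Lemma fcosD phi x xi w : schwartz phi ->
  fcos phi (x - w) xi + fcos phi (x + w) xi = 2 * (cos (xi * w) * fcos phi x xi).
Proof.
move=> sp; rewrite /fcos -RintegralD//; try exact: integrable_fcos.
rewrite mulrA -RintegralZl//; last exact: integrable_fcos.
apply: eq_Rintegral => y _.
rewrite (_ : xi * (x - w - y) = xi * (x - y) - xi * w); last by ring.
rewrite (_ : xi * (x + w - y) = xi * (x - y) + xi * w); last by ring.
by rewrite cosB cosD; ring.
Qed.

(** The kernel is even and so only sees the even part of [F], which by hypothesis is a multiple of a
    cosine. *)
Lemma integral_ekap_cosine (F : R -> R) (M F0 xi t : R) : measurable_fun setT F ->
  (forall w, `|F w| <= M) -> (forall w, F w + F (- w) = 2 * (cos (xi * w) * F0)) ->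
  \int[leb]_w (ekap t w * F w) = 2 * kap t / (kap t ^+ 2 + xi ^+ 2) * F0.
Proof.
move=> mF FM FE; pose h w := ekap t w * F w.
have hi : leb.-integrable setT (EFin \o h) by exact: integrable_ekapM FM.
have r0 : (fun w => h (0 - w)) = (fun w => h (- w)) by apply/funext => w; rewrite sub0r.
have e := Rintegral_reflect 0 hi; rewrite r0 in e.
have hi' := integrable_reflect 0 hi; rewrite r0 in hi'.
have ci : leb.-integrable setT (EFin \o (fun w => ekap t w * cos (xi * w))).
  apply: (@integrable_ekapM _ (fun w => cos (xi * w)) 1) => [|w]; last exact: cos_max.
  by apply: mcosf; exact: measurable_funM.
have c := integral_expR_norm_cos xi (kap_gt0 t).
apply: (@mulfI _ 2) => //; rewrite -/h mulrC mulr_natr mulr2n -{2}e.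
rewrite -RintegralD//.
transitivity (\int[leb]_w (ekap t w * cos (xi * w) * (2 * F0))).
  by apply: eq_Rintegral => w _; rewrite /h /ekap normrN -mulrDr FE; ring.
by rewrite RintegralZr// [X in X * _]c; ring.
Qed.

Lemma integral_ekap_fcos phi x xi t : schwartz phi ->
  \int[leb]_w (ekap t w * fcos phi (x - w) xi) =
  2 * kap t / (kap t ^+ 2 + xi ^+ 2) * fcos phi x xi.
Proof.
move=> sp; apply: (integral_ekap_cosine (M := \int[leb]_y `|phi y|)) => [|w|w].
- rewrite (_ : (fun w => _) = (fun z : R * R => fcos phi z.1 z.2) \o (fun w => (x - w, xi)))//.
  apply: measurableT_comp; first exact: measurable_fcos.
  by apply: mpair => //; exact: measurable_funB.
- exact: fcos_le.
- by rewrite opprK fcosD.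
Qed.

Let lorentz_le t xi : 2 / (kap t ^+ 2 + xi ^+ 2) <= 2 * (1 + t ^+ 2)^-1.
Proof.
rewrite sqr_kap ler_pM2l// lef_pV2 ?posrE ?oneDsqr_gt0 ?ltr_wpDr ?sqr_ge0 ?oneDsqr_gt0//.
by rewrite lerDl sqr_ge0.
Qed.

Let lorentz_ge0 t xi : 0 <= 2 / (kap t ^+ 2 + xi ^+ 2).
Proof. by rewrite divr_ge0// addr_ge0 ?sqr_ge0. Qed.

Let mlorentz : measurable_fun setT (fun z : R * R => 2 / (kap z.1 ^+ 2 + z.2 ^+ 2)).
Proof.
rewrite (_ : (fun z => _) = (fun z : R * R => 2 * (kap z.1 ^+ 2 + z.2 ^+ 2) `^ (- 1))).
  apply: measurable_funM => //; apply: (measurableT_comp (measurable_powR _)).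
  apply: measurable_funD; apply: measurable_funX => //.
  exact: (measurableT_comp (continuous_measurable_fun continuous_kap)).
by apply/funext => z; rewrite powR_inv1// addr_ge0 ?sqr_ge0.
Qed.

Lemma resolvent_Lambda phi x t : schwartz phi ->
  resolvent (fun w => Lambda 1 phi (x - w)) t =
  (2 * pi)^-1 * \int[leb]_xi (2 / (kap t ^+ 2 + xi ^+ 2) * (kap xi * fcos phi x xi)).
Proof.
move=> sp; have [C C0 HC] := fcos_decay sp; have k0 := kap_gt0 t.
have Ci := integrableRZ C measurableT (@integrable_oneDsqrV R).
have fi : (leb \x leb)%E.-integrable setT (fun z : R * R =>
    (ekap t z.1 * (kap z.2 * fcos phi (x - z.1) z.2))%:E).
  apply: (@integrable_prod_dom _ _ _ _ R leb leb
    (fun w xi => ekap t w * (kap xi * fcos phi (x - w) xi)) (ekap t)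
    (fun xi => C * (1 + xi ^+ 2)^-1)) => //.
  - apply: measurable_funM; first by apply: measurable_ekap => //; exact: measurable_cst.
    apply: measurable_funM; first exact: (measurableT_comp (continuous_measurable_fun continuous_kap)).
    rewrite (_ : (fun z => _) = (fun z : R * R => fcos phi z.1 z.2) \o (fun z : R * R => (x - z.1, z.2)))//.
    apply: measurableT_comp; first exact: measurable_fcos.
    by apply: mpair => //; exact: measurable_funB.
  - exact: integrable_ekap.
  - by move=> w xi; rewrite normrM gtr0_norm ?ekap_gt0// ler_pM2l ?ekap_gt0.
transitivity ((kap t)^-1 * ((2 * pi)^-1 * \int[leb]_w \int[leb]_xi (ekap t w * (kap xi * fcos phi (x - w) xi)))).
  rewrite -[in RHS]RintegralZl//; last exact: (integrable_Rfubini fi).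
  congr (_ * _); apply: eq_Rintegral => w _.
  by rewrite LambdaE RintegralZl// ?mulrA 1?[_ * ekap t w]mulrC//; exact: kfi.
rewrite (Rfubini_swap fi) mulrCA -RintegralZl//; last exact: (integrable_Rfubini2 fi).
congr (_ * _); apply: eq_Rintegral => xi _.
under eq_Rintegral => w _ do rewrite mulrCA.
rewrite RintegralZl//; last first.
  apply: (@integrable_ekapM _ (fun w => fcos phi (x - w) xi)) => [|w]; last exact: fcos_le.
  rewrite (_ : (fun w => _) = (fun z : R * R => fcos phi z.1 z.2) \o (fun w => (x - w, xi)))//.
  apply: measurableT_comp; first exact: measurable_fcos.
  by apply: mpair => //; exact: measurable_funB.
rewrite integral_ekap_fcos//; field.
by apply/andP; split; rewrite gt_eqF// ltr_wpDr ?sqr_ge0 ?exprn_gt0.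
Qed.

(** On the Fourier side the resolvent multiplies by 2 / (kap t ^ 2 + xi^2). After Fubini its
    integral over t is 2 pi / kap xi, which cancels the symbol of [Lambda 1], and the inversion
    formula concludes. *)
Lemma bessel_Lambda phi x : schwartz phi -> bessel (Lambda 1 phi) x = phi x.
Proof.
move=> sp; have [C C0 HC] := fcos_decay sp.
have Ci := integrableRZ C measurableT (@integrable_oneDsqrV R).
have pi0 : pi != 0 :> R by rewrite gt_eqF// pi_gt0.
have fi : (leb \x leb)%E.-integrable setT (fun z : R * R =>
    (2 / (kap z.1 ^+ 2 + z.2 ^+ 2) * (kap z.2 * fcos phi x z.2))%:E).
  apply: (@integrable_prod_dom _ _ _ _ R leb leb
    (fun t xi => 2 / (kap t ^+ 2 + xi ^+ 2) * (kap xi * fcos phi x xi))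
    (fun t => 2 * (1 + t ^+ 2)^-1) (fun xi => C * (1 + xi ^+ 2)^-1)) => //.
  - apply: measurable_funM; first exact: mlorentz.
    exact: (measurableT_comp (mkf x sp)).
  - by apply: integrableRZ => //; exact: integrable_oneDsqrV.
  - move=> t xi; rewrite normrM (ger0_norm (lorentz_ge0 _ _)).
    by rewrite ler_pM ?lorentz_ge0 ?lorentz_le.
rewrite /bessel /bessel0.
under eq_Rintegral => t _ do rewrite resolvent_Lambda//.
rewrite RintegralZl//; last exact: (integrable_Rfubini fi).
rewrite (Rfubini_swap fi).
have -> : \int[leb]_xi \int[leb]_t (2 / (kap t ^+ 2 + xi ^+ 2) * (kap xi * fcos phi x xi)) =
    \int[leb]_xi (2 * pi * fcos phi x xi).
  apply: eq_Rintegral => xi _; have [li lv] := integral_sqrDsqrV (kap_gt0 xi).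
  transitivity (\int[leb]_t (2 * (kap xi * fcos phi x xi) * (kap xi ^+ 2 + t ^+ 2)^-1)).
    apply: eq_Rintegral => t _.
    have -> : kap t ^+ 2 + xi ^+ 2 = kap xi ^+ 2 + t ^+ 2 by rewrite !sqr_kap addrAC.
    by rewrite mulrAC.
  rewrite RintegralZl// lv; move: (kap xi) (kap_gt0 xi) (fcos phi x xi) => k k0 F.
  by field; rewrite gt_eqF.
rewrite RintegralZl//; last first.
  apply: integrable_dom (integrable_norm (kfi x sp)) => //.
    exact: (measurableT_comp (measurable_fcos sp) (pair1_measurable x)).
  by move=> xi _; rewrite /= normrM gtr0_norm ?kap_gt0// ler_peMl// kap_ge1.
by rewrite (fourier_inversion x sp); move: (phi x) pi pi0 => F P P0; field.
Qed.

End Bessel_duality.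

Section Bessel_symmetry.
Context {R : realType}.
Local Notation leb := (@lebesgue_measure R).
Implicit Types (phi psi f : R -> R) (t x y w M K : R).

Lemma integral_kapV2 : \int[leb]_t (kap t ^- 2) = pi.
Proof.
rewrite -[RHS]divr1 -(integral_sqrDsqrV (@ltr01 R)).2; apply: eq_Rintegral => t _.
by rewrite sqr_kap expr1n.
Qed.

Let expd (c : R) x := expR (- (c * `|x|)).

Let integrable_exphalf : leb.-integrable setT (EFin \o expd 2^-1).
Proof. by have h : 0 < (2^-1 : R); [rewrite invr_gt0|exact: (integrable_expR_norm h).1]. Qed.

(** Half of the decay in w is traded for decay in x: |x| <= |x - w| + |w| and |w| <= kap t |w|. *)
Lemma ekap_split t x w : ekap t w * expR (- `|x - w|) <= expd 2^-1 x * expd (kap t / 2) w.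
Proof.
rewrite /ekap /expd -!expRD ler_expR.
have := ler_normD (x - w) w; rewrite subrK.
have : `|w| <= kap t * `|w| by rewrite ler_peMl ?kap_ge1.
have := normr_ge0 (x - w).
by move: `|x| `|w| `|x - w| => a b c; lra.
Qed.

Let kapH t : 0 < kap t / 2. Proof. by rewrite divr_gt0// kap_gt0. Qed.

Let mshift f x : measurable_fun setT f -> measurable_fun setT (fun w => f (x - w)).
Proof. by move=> mf; apply: measurableT_comp => //; exact: measurable_funB. Qed.

Let mshift2 f : measurable_fun setT f -> measurable_fun setT (fun z : R * R => f (z.1 - z.2)).
Proof. by move=> mf; apply: measurableT_comp => //; exact: measurable_funB. Qed.

Lemma integrable_expRN : leb.-integrable setT (EFin \o (fun x => expR (- `|x|))).
Proof.
have := (@integrable_expR_norm R 1 ltr01).1.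
by under [X in EFin \o X]funext => x do rewrite mul1r.
Qed.

Lemma resolvent_decay f M x t : measurable_fun setT f ->
  (forall y, `|f y| <= M * expR (- `|y|)) ->
  `|resolvent (fun w => f (x - w)) t| <= 4 * M * expd 2^-1 x * kap t ^- 2.
Proof.
move=> mf fM; have k0 := kap_gt0 t.
have M0 : 0 <= M by have := fM 0; rewrite normr0 oppr0 expR0 mulr1; exact: le_trans.
have me : measurable_fun setT (fun w => M * expR (- `|x - w|)).
  apply: measurable_funM => //; do 3 apply: measurableT_comp => //.
  exact: measurable_funB.
have gi : leb.-integrable setT (EFin \o (fun w => ekap t w * (M * expR (- `|x - w|)))).
  apply: (@integrable_ekapM _ _ M) => // w.
  by rewrite ger0_norm ?mulr_ge0 ?expR_ge0// ler_piMr// -expR0 ler_expR oppr_le0.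
have Gi := integrableRZ (M * expd 2^-1 x) measurableT (integrable_expR_norm (kapH t)).1.
apply: le_trans (resolvent_le (mshift x mf) gi _) _ => //.
apply: (@le_trans _ _ ((kap t)^-1 * (M * expd 2^-1 x * (2 / (kap t / 2))))).
  rewrite ler_pM2l ?invr_gt0// -(integrable_expR_norm (kapH t)).2.
  rewrite -RintegralZl//; last exact: (integrable_expR_norm (kapH t)).1.
  apply: le_Rintegral => // w _.
  by rewrite mulrCA -mulrA ler_wpM2l//; exact: ekap_split.
by rewrite le_eqVlt; apply/orP; left; apply/eqP; field; rewrite gt_eqF.
Qed.

Lemma bessel_decay f M x : measurable_fun setT f ->
  (forall y, `|f y| <= M * expR (- `|y|)) ->
  `|bessel f x| <= 2 * M * expd 2^-1 x.
Proof.
move=> mf fM; have p0 : 0 < (2 * pi : R)^-1 by rewrite invr_gt0 mulr_gt0// pi_gt0.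
rewrite normrM (gtr0_norm p0).
have i := integrableRZ (4 * M * expd 2^-1 x) measurableT (@integrable_kapV2 R).
have := Rintegral_norm_le (m := leb) (measurable_resolvent1 (mshift x mf)) i
  (fun t => resolvent_decay x t mf fM).
rewrite RintegralZl//; last exact: integrable_kapV2.
rewrite integral_kapV2 -(ler_pM2l p0); move/le_trans; apply.
have pin : pi != 0 :> R by rewrite gt_eqF// pi_gt0.
by rewrite le_eqVlt; apply/orP; left; apply/eqP; move: pi pin => P Pn; field.
Qed.

Let mpair d d1 d2 (T : measurableType d) (T1 : measurableType d1) (T2 : measurableType d2)
    (f : T -> T1) (g : T -> T2) : measurable_fun setT f -> measurable_fun setT g ->
  measurable_fun setT (fun z => (f z, g z)).
Proof. by move=> mf mg; apply/measurable_fun_pairP; split. Qed.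

Let mres f : measurable_fun setT f ->
  measurable_fun setT (fun z : R * R => resolvent (fun w => f (z.1 - w)) z.2).
Proof.
move=> mf; apply: (@measurable_resolvent R _ R (fun x w => f (x - w))); exact: mshift2.
Qed.

Lemma resolvent_symmetric f psi M K t : measurable_fun setT f -> measurable_fun setT psi ->
  (forall y, `|f y| <= M * expR (- `|y|)) -> (forall y, `|psi y| <= K) ->
  \int[leb]_x (resolvent (fun w => f (x - w)) t * psi x) =
  \int[leb]_x (f x * resolvent (fun w => psi (x - w)) t).
Proof.
move=> mf mp fM pK.
have K0 : 0 <= K by rewrite (le_trans _ (pK 0)).
have M0 : 0 <= M by have := fM 0; rewrite normr0 oppr0 expR0 mulr1; exact: le_trans.
have fb y : `|f y| <= M by rewrite (le_trans (fM y))// ler_piMr// -expR0 ler_expR oppr_le0.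
have fi : leb.-integrable setT (EFin \o f).
  by apply: integrable_dom (integrableRZ M measurableT integrable_expRN).
have i1 : (leb \x leb)%E.-integrable setT (fun z : R * R =>
    (ekap t z.2 * f (z.1 - z.2) * psi z.1)%:E).
  apply: (@integrable_prod_dom _ _ _ _ R leb leb
    (fun x w => ekap t w * f (x - w) * psi x) (fun x => K * M * expd 2^-1 x) (expd (kap t / 2))).
  - apply: measurable_funM; last exact: measurableT_comp.
    apply: measurable_funM; last exact: mshift2.
    by apply: measurable_ekap => //; exact: measurable_cst.
  - by apply: integrableRZ => //; exact: integrable_exphalf.
  - exact: (integrable_expR_norm (kapH t)).1.
  - move=> x w; rewrite !normrM gtr0_norm ?ekap_gt0// mulrC -!mulrA.
    apply: ler_pM => //; first by rewrite mulr_ge0// ltW// ekap_gt0.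
    apply: (@le_trans _ _ (ekap t w * (M * expR (- `|x - w|)))).
      by rewrite ler_pM2l ?ekap_gt0.
    by rewrite mulrCA ler_wpM2l// ekap_split.
have i2 : (leb \x leb)%E.-integrable setT (fun z : R * R =>
    (ekap t z.1 * (f z.2 * psi (z.2 + z.1)))%:E).
  apply: (@integrable_prod_dom _ _ _ _ R leb leb
    (fun w x => ekap t w * (f x * psi (x + w))) (ekap t) (fun x => K * `|f x|)).
  - apply: measurable_funM; first by apply: measurable_ekap => //; exact: measurable_cst.
    apply: measurable_funM; first exact: measurableT_comp.
    by apply: measurableT_comp => //; exact: measurable_funD.
  - exact: integrable_ekap.
  - by apply: integrableRZ => //; exact: integrable_norm fi.
  - move=> w x; rewrite !normrM gtr0_norm ?ekap_gt0// ler_pM2l ?ekap_gt0// mulrC.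
    exact: ler_wpM2r.
have fpi w : leb.-integrable setT (EFin \o (fun x => f (x - w) * psi x)).
  apply: integrable_dom (integrableRZ K measurableT (integrable_norm (integrable_shift (- w) fi))) => //.
    apply: measurable_funM => //; apply: measurableT_comp => //; exact: measurable_funB.
  by move=> x _; rewrite normrM mulrC ler_wpM2r.
have psii x := integrable_ekapM t (mshift x mp) (fun w => pK _).
have -> : \int[leb]_x (resolvent (fun w => f (x - w)) t * psi x) =
   (kap t)^-1 * \int[leb]_x \int[leb]_w (ekap t w * f (x - w) * psi x).
  rewrite -RintegralZl//; last exact: (integrable_Rfubini i1).
  apply: eq_Rintegral => x _; rewrite RintegralZr ?mulrA//.
  exact: integrable_ekapM t (mshift x mf) (fun w => fb _).
rewrite (Rfubini_swap i1).
have -> : \int[leb]_w \int[leb]_x (ekap t w * f (x - w) * psi x) =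
    \int[leb]_w \int[leb]_x (ekap t w * (f x * psi (x + w))).
  apply: eq_Rintegral => w _.
  under eq_Rintegral => x _ do rewrite -mulrA.
  rewrite RintegralZl// RintegralZl//; last first.
    by apply: eq_integrable (integrable_shift w (fpi w)) => // x _; rewrite /= addrK.
  congr (_ * _); rewrite -(Rintegral_shift w (fpi w)).
  by apply: eq_Rintegral => x _; rewrite addrK.
rewrite (Rfubini_swap i2) -RintegralZl//; last exact: (integrable_Rfubini2 i2).
apply: eq_Rintegral => x _.
under eq_Rintegral => w _ do rewrite mulrCA.
have r0 : (fun w => ekap t (0 - w) * psi (x - (0 - w))) = (fun w => ekap t w * psi (x + w)).
  by apply/funext => w; rewrite sub0r opprK /ekap normrN.
have e := Rintegral_reflect 0 (psii x); rewrite r0 in e.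
have pi' := integrable_reflect 0 (psii x); rewrite r0 in pi'.
by rewrite RintegralZl// e /resolvent mulrCA.
Qed.

(** The kernel is even, so this is Fubini's theorem. Mere boundedness of [psi] is what is known for
    [Lambda 1 phi]; the decay of [f] alone secures integrability. *)
Lemma bessel_symmetric f psi M K : measurable_fun setT f -> measurable_fun setT psi ->
  (forall y, `|f y| <= M * expR (- `|y|)) -> (forall y, `|psi y| <= K) ->
  \int[leb]_x (bessel f x * psi x) = \int[leb]_x (f x * bessel psi x).
Proof.
move=> mf mp fM pK.
have K0 : 0 <= K by rewrite (le_trans _ (pK 0)).
have M0 : 0 <= M by have := fM 0; rewrite normr0 oppr0 expR0 mulr1; exact: le_trans.
have fi : leb.-integrable setT (EFin \o f).
  by apply: integrable_dom (integrableRZ M measurableT integrable_expRN).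
have fb y : `|f y| <= M by rewrite (le_trans (fM y))// ler_piMr// -expR0 ler_expR oppr_le0.
have i1 : (leb \x leb)%E.-integrable setT (fun z : R * R =>
    (resolvent (fun w => f (z.1 - w)) z.2 * psi z.1)%:E).
  apply: (@integrable_prod_dom _ _ _ _ R leb leb
    (fun x t => resolvent (fun w => f (x - w)) t * psi x)
    (fun x => 4 * M * K * expd 2^-1 x) (fun t => kap t ^- 2)).
  - by apply: measurable_funM; [exact: mres|exact: measurableT_comp].
  - by apply: integrableRZ => //; exact: integrable_exphalf.
  - exact: integrable_kapV2.
  - move=> x t; rewrite normrM.
    apply: le_trans (ler_pM (normr_ge0 _) (normr_ge0 _) (resolvent_decay x t mf fM) (pK x)) _.
    by rewrite le_eqVlt; apply/orP; left; apply/eqP; ring.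
have i2 : (leb \x leb)%E.-integrable setT (fun z : R * R =>
    (f z.2 * resolvent (fun w => psi (z.2 - w)) z.1)%:E).
  apply: (@integrable_prod_dom _ _ _ _ R leb leb
    (fun t x => f x * resolvent (fun w => psi (x - w)) t)
    (fun t => kap t ^- 2) (fun x => 2 * K * `|f x|)).
  - apply: measurable_funM; first exact: measurableT_comp.
    rewrite (_ : (fun z => _) = (fun z : R * R => resolvent (fun w => psi (z.1 - w)) z.2) \o
      (fun z : R * R => (z.2, z.1)))//.
    by apply: measurableT_comp; [exact: mres|exact: mpair].
  - exact: integrable_kapV2.
  - by apply: integrableRZ => //; exact: integrable_norm fi.
  - move=> t x; rewrite normrM mulrC mulrA ler_wpM2r//.
    rewrite [leRHS]mulrC; apply: resolvent_bound => //; exact: mshift.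
have ri x := integrable_resolvent (mshift x mf) (fun w => fb _).
have pi' x := integrable_resolvent (mshift x mp) (fun w => pK _).
transitivity ((2 * pi)^-1 * \int[leb]_x \int[leb]_t (resolvent (fun w => f (x - w)) t * psi x)).
  rewrite -RintegralZl//; last exact: (integrable_Rfubini i1).
  by apply: eq_Rintegral => x _; rewrite RintegralZr// mulrA.
rewrite (Rfubini_swap i1).
under eq_Rintegral => t _ do rewrite (resolvent_symmetric t mf mp fM pK).
rewrite (Rfubini_swap i2) -RintegralZl//; last exact: (integrable_Rfubini2 i2).
by apply: eq_Rintegral => x _; rewrite RintegralZl// mulrCA.
Qed.

(** In the sense of distributions, Lambda applied to [bessel f] is [f]. Membership in the image of
    the parabolic space and in H^-1 is checked through this identity. *)
Lemma bessel_dual f M phi : measurable_fun setT f -> schwartz phi ->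
  (forall y, `|f y| <= M * expR (- `|y|)) ->
  \int[leb]_x (bessel f x * Lambda 1 phi x) = \int[leb]_x (f x * phi x).
Proof.
move=> mf sp fM; have [K HK] := Lambda_bounded sp.
rewrite (bessel_symmetric mf (measurable_Lambda sp) fM HK).
by apply: eq_Rintegral => x _; rewrite bessel_Lambda.
Qed.

End Bessel_symmetry.

(** * A weight reproduced by the resolvent kernels *)

Section Singular_weight.
Context {R : realType}.
Local Notation leb := (@lebesgue_measure R).
Implicit Types (t x y w c s : R).

(** The exceptional point is needed because 0 to a nonzero power is 0, so that [omega] vanishes at
    the origin and bounds by it can fail there. *)
Lemma Rintegral_norm_le1 (c : R) (f g : R -> R) : measurable_fun setT f ->
  leb.-integrable setT (EFin \o g) -> (forall x, x != c -> `|f x| <= g x) ->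
  `|\int[leb]_x f x| <= \int[leb]_x g x.
Proof.
move=> mf gi fg.
have mD : measurable ([set: R] `\ c) by exact: measurableD.
have D1 h : measurable_fun setT h -> \int[leb]_x h x = \int[leb]_(x in [set: R] `\ c) h x.
  move=> mh; rewrite /Rintegral integral_setD1//.
  by apply/measurable_EFinP; exact: measurable_funTS.
have mg : measurable_fun setT g by apply/measurable_EFinP; exact: measurable_int gi.
rewrite (D1 f mf) (D1 g mg).
have giD : leb.-integrable ([set: R] `\ c) (EFin \o g) by exact: integrableRT gi.
have fgD x : ([set: R] `\ c) x -> `|f x| <= g x by move=> [_ /eqP]; exact: fg.
have fi : leb.-integrable ([set: R] `\ c) (EFin \o f).
  by apply: integrable_dom giD => //; exact: measurable_funTS.
apply: le_trans (le_normr_Rintegral (mu := leb) _ fi) _; first exact: mD.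
by apply: le_Rintegral => //; have := integrable_norm fi.
Qed.

Variable th : R.
Hypothesis th01 : 0 < th < 1.
Let th0 : 0 < th. Proof. by case/andP: th01. Qed.
Let th1 : th < 1. Proof. by case/andP: th01. Qed.

(** The singularity buys a factor t^(th/2) in bounds for self-similar functions, and p th < 1 keeps
    the weight in L_p. *)
Definition omega x := `|x| `^ (- th) * expR (- (2^-1 * `|x|)).

Lemma omega_ge0 x : 0 <= omega x.
Proof. by rewrite mulr_ge0 ?powR_ge0 ?expR_ge0. Qed.

Lemma measurable_omega : measurable_fun setT omega.
Proof.
apply: measurable_funM; first by apply: (measurableT_comp (measurable_powR _)).
by do 2 apply: measurableT_comp => //; apply: measurable_funM.
Qed.

Let k6 : R := 6 ^+ 3.
Let k6_ge0 : 0 <= k6. Proof. exact: exprn_ge0. Qed.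

Let exp_cube (z : R) : 0 <= z -> expR (- (2^-1 * z)) <= k6 / (1 + z) ^+ 3.
Proof.
move=> z0; have p : 0 < 1 + z by rewrite ltr_wpDr.
rewrite ler_pdivlMr ?exprn_gt0// mulrC expRN ler_pdivrMr ?expR_gt0//.
(* Cubing this turns exp (z / 6) into exp (z / 2), whence the constant 6^3. *)
have e1 : 1 + z <= 6 * expR (z / 6).
  by have := expR_ge1Dx (z / 6); lra.
have : (1 + z) ^+ 3 <= (6 * expR (z / 6)) ^+ 3.
  by rewrite ler_pXn2r ?nnegrE ?(ltW p)// mulr_ge0 ?expR_ge0.
by rewrite exprMn -expRM_natl (_ : 3%:R * (z / 6) = 2^-1 * z)//; field.
Qed.

Lemma integrable_omega_powR (p : R) : 1 <= p -> p * th < 1 ->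
  leb.-integrable setT (EFin \o (fun x => omega x `^ p)).
Proof.
move=> p1 pth; have p0 : 0 < p by exact: lt_le_trans p1.
have pw : 0 <= p * th < 1 by rewrite pth andbT mulr_ge0// ltW.
apply: integrable_dom (integrableRZ k6 measurableT (integrable_powR_weight pw)) => //.
  by apply: (measurableT_comp (measurable_powR _)); exact: measurable_omega.
move=> x _; rewrite ger0_norm ?powR_ge0// /omega powRM ?powR_ge0 ?expR_ge0//.
rewrite -powRrM mulNr [th * p]mulrC mulrCA ler_wpM2l ?powR_ge0//.
have e : expR (- (2^-1 * `|x|)) `^ p <= expR (- (2^-1 * `|x|)).
  apply: ge1r_powR => //; rewrite expR_gt0 -expR0 ler_expR oppr_le0 mulr_ge0//.
apply: le_trans e _; apply: le_trans (exp_cube (normr_ge0 x)) _.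
rewrite ler_wpM2l// lef_pV2 ?posrE ?exprn_gt0 ?ltr_wpDr//.
by apply: ler_weXn2l => //; rewrite lerDl.
Qed.

Lemma integrable_omega : leb.-integrable setT (EFin \o omega).
Proof.
have := @integrable_omega_powR 1 (lexx _); rewrite mul1r => /(_ th1).
by under [X in EFin \o X]funext => x do rewrite powRr1 ?omega_ge0//.
Qed.

(** The integrable majorants in the scaled variables kap t w and kap t (x - w); each change of
    variables contributes a factor 1 / kap t. *)
Let h1 (v : R) := (1 + `|v|) ^- 2.
Let h2 (v : R) := `|v| `^ (- th) / (1 + `|v|) ^+ 2.
Let h1_ge0 v : 0 <= h1 v. Proof. by rewrite invr_ge0 exprn_ge0// addr_ge0. Qed.
Let h2_ge0 v : 0 <= h2 v.
Proof. by rewrite mulr_ge0 ?powR_ge0 ?invr_ge0 ?exprn_ge0 ?addr_ge0. Qed.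

Let h1i : leb.-integrable setT (EFin \o h1).
Proof.
have t0 : 0 <= (0 : R) < 1 by rewrite lexx ltr01.
have := integrable_powR_weight t0.
by under [X in EFin \o X]funext => x do rewrite oppr0 powRr0 mul1r.
Qed.

Let h2i : leb.-integrable setT (EFin \o h2).
Proof. by apply: integrable_powR_weight; rewrite (ltW th0). Qed.

Let powR_le1D s : 0 <= s -> s `^ th <= 1 + s.
Proof.
move=> s0; apply: (@le_trans _ _ ((1 + s) `^ th)).
  by apply: ge0_ler_powR; rewrite ?nnegrE ?addr_ge0 ?(ltW th0)// lerDr.
by apply: ler1_powR; [rewrite lerDl|exact: ltW].
Qed.

(* |x|^th <= (|w| + |x - w|)^th <= 2 |x - w|^th (1 + (|w| / |x - w|)^th), and the ratio
   is scale invariant. *)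
Let weight_pointwise t x w : x != 0 -> w != x ->
  ekap t w * omega (x - w) <=
  omega x * (2 * k6 * (2 * h1 (kap t * w) + 4 * h2 (- kap t * w + kap t * x))).
Proof.
move=> x0 wx; have k0 := kap_gt0 t.
have X0 : 0 < `|x| by rewrite normr_gt0.
have D0 : 0 < `|x - w| by rewrite normr_gt0 subr_eq0 eq_sym.
pose z := kap t * `|w|; pose v := kap t * `|x - w|.
have z0 : 0 <= z by rewrite mulr_ge0// ltW.
have v0 : 0 < v by rewrite mulr_gt0.
have -> : h1 (kap t * w) = (1 + z) ^- 2 by rewrite /h1 normrM gtr0_norm.
have -> : h2 (- kap t * w + kap t * x) = v `^ (- th) / (1 + v) ^+ 2.
  rewrite /h2 (_ : - kap t * w + kap t * x = kap t * (x - w)); last by ring.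
  by rewrite normrM gtr0_norm.
have e1 : ekap t w * expR (- (2^-1 * `|x - w|)) <= expR (- (2^-1 * `|x|)) * expR (- (2^-1 * z)).
  rewrite -!expRD ler_expR /z.
  have := ler_normD (x - w) w; rewrite subrK.
  have : `|w| <= kap t * `|w| by rewrite ler_peMl ?kap_ge1.
  by move: `|x| `|w| `|x - w| => a b c; lra.
have e2 : `|x - w| `^ (- th) <= `|x| `^ (- th) * (2 * (1 + z) * (1 + v `^ (- th))).
  have p1 : 0 < `|x| `^ th by rewrite powR_gt0.
  have p2 : 0 < `|x - w| `^ th by rewrite powR_gt0.
  have p3 : 0 < v `^ th by rewrite powR_gt0.
  rewrite !powRN ler_pdivlMl// ler_pdivrMr// mulrC.
  have xle : `|x| <= `|x - w| + `|w| by rewrite -{1}(subrK w x) ler_normD.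
  have step (a b : R) : 0 <= a -> 0 <= b -> (a + b) `^ th <= 2 * (a `^ th + b `^ th).
    have two : 2 `^ th <= 2 :> R by apply: ler1_powR; [rewrite ler1n|exact: ltW].
    have gen (a' b' : R) : 0 <= a' -> a' <= b' -> (a' + b') `^ th <= 2 * (a' `^ th + b' `^ th).
      move=> a0 ab; have b0 := le_trans a0 ab.
      apply: (@le_trans _ _ ((2 * b') `^ th)).
        by apply: ge0_ler_powR; rewrite ?nnegrE ?addr_ge0 ?mulr_ge0 ?(ltW th0)//; lra.
      rewrite powRM//; apply: ler_pM; rewrite ?powR_ge0//.
      by rewrite lerDr powR_ge0.
    by move=> a0 b0; have [ab|/ltW ab] := leP a b; [exact: gen|rewrite addrC [_ `^ _ + _]addrC; exact: gen].
  apply: (@le_trans _ _ ((`|x - w| + `|w|) `^ th)).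
    by apply: ge0_ler_powR; rewrite ?nnegrE ?addr_ge0 ?(ltW th0).
  apply: le_trans (step _ _ (ltW D0) (normr_ge0 w)) _.
  have zw : kap t `^ th * `|w| `^ th <= 1 + z.
    by rewrite -powRM ?(ltW k0)//; exact: powR_le1D.
  have vE : v `^ th = kap t `^ th * `|x - w| `^ th by rewrite /v powRM ?(ltW k0).
  have kth : 0 < kap t `^ th by rewrite powR_gt0.
  have -> : `|x - w| `^ th * (2 * (1 + z) * (1 + (v `^ th)^-1)) =
     2 * ((1 + z) * `|x - w| `^ th + (1 + z) / kap t `^ th).
    by rewrite vE; field; rewrite !gt_eqF.
  rewrite ler_wpM2l//; apply: lerD; first by rewrite ler_peMl ?(ltW p2)// lerDl.
  by rewrite ler_pdivlMr// mulrC.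
have e3 : expR (- (2^-1 * z)) * (2 * (1 + z) * (1 + v `^ (- th))) <=
    2 * k6 * (2 * (1 + z) ^- 2 + 4 * (v `^ (- th) / (1 + v) ^+ 2)).
  have pz : 0 < 1 + z by rewrite ltr_wpDr.
  have pv : 0 < 1 + v by rewrite ltr_wpDr// ltW.
  have pp : 0 <= 1 + v `^ (- th) by rewrite addr_ge0 ?powR_ge0.
  apply: (@le_trans _ _ (k6 / (1 + z) ^+ 3 * (2 * (1 + z) * (1 + v `^ (- th))))).
    by rewrite ler_wpM2r ?exp_cube// !mulr_ge0// ltW.
  have -> : k6 / (1 + z) ^+ 3 * (2 * (1 + z) * (1 + v `^ (- th))) =
      2 * k6 * ((1 + z) ^- 2 + v `^ (- th) * (1 + z) ^- 2).
    by field; rewrite gt_eqF.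
  rewrite ler_wpM2l ?mulr_ge0//; rewrite [leRHS](_ : _ = (1 + z) ^- 2 +
    ((1 + z) ^- 2 + 4 * (v `^ (- th) / (1 + v) ^+ 2))); last by ring.
  rewrite lerD2l.
  have [v1|v1] := leP 1 v.
    rewrite ler_wpDr// ?mulr_ge0 ?powR_ge0 ?invr_ge0 ?exprn_ge0 ?(ltW pv)//.
    rewrite ler_piMl ?invr_ge0 ?exprn_ge0 ?(ltW pz)// powRN invf_le1 ?powR_gt0//.
    by rewrite -(powRr0 v); apply: ler_powR => //; exact: ltW.
  rewrite ler_wpDl ?invr_ge0 ?exprn_ge0 ?(ltW pz)// mulrCA ler_wpM2l ?powR_ge0//.
  apply: (@le_trans _ _ 1); first by rewrite invf_le1 ?exprn_gt0// expr_ge1 ?lerDl ?(ltW pz).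
  rewrite ler_pdivlMr ?exprn_gt0// mul1r (_ : 4 = 2 ^+ 2); last by rewrite -natrX.
  by rewrite ler_pXn2r ?nnegrE ?(ltW pv)//; have := ltW v1; lra.
rewrite {1}/omega mulrCA.
apply: (@le_trans _ _ (`|x| `^ (- th) * (2 * (1 + z) * (1 + v `^ (- th))) *
   (expR (- (2^-1 * `|x|)) * expR (- (2^-1 * z))))).
  by apply: ler_pM => //; rewrite ?powR_ge0// mulr_ge0 ?expR_ge0// ltW// ekap_gt0.
rewrite /omega (_ : _ * _ * (_ * _) = (`|x| `^ (- th) * expR (- (2^-1 * `|x|))) *
  (expR (- (2^-1 * z)) * (2 * (1 + z) * (1 + v `^ (- th))))); last by ring.
by rewrite ler_wpM2l ?mulr_ge0 ?powR_ge0 ?expR_ge0.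
Qed.

Definition omegaC := 2 * k6 * (2 * \int[leb]_v h1 v + 4 * \int[leb]_v h2 v).

Lemma omegaC_ge0 : 0 <= omegaC.
Proof.
have i1 : 0 <= \int[leb]_v h1 v by apply: Rintegral_ge0.
have i2 : 0 <= \int[leb]_v h2 v by apply: Rintegral_ge0.
apply: mulr_ge0; first exact: mulr_ge0.
by apply: addr_ge0; apply: mulr_ge0.
Qed.

Lemma integrable_ekap_omega t x :
  leb.-integrable setT (EFin \o (fun w => ekap t w * omega (x - w))).
Proof.
have := integrable_reflect x integrable_omega.
apply: integrable_dom => //.
  apply: measurable_ekapM; apply: measurableT_comp; first exact: measurable_omega.
  exact: measurable_funB.
move=> w _; rewrite normrM [`|omega _|]ger0_norm ?omega_ge0// ler_piMl ?omega_ge0//.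
by rewrite gtr0_norm ?ekap_gt0// /ekap -expR0 ler_expR oppr_le0 mulr_ge0// ltW// kap_gt0.
Qed.

(** The constant depends neither on t nor on x: up to it, the kernel returns the weight with the
    gain 1 / kap t that it has on constants. *)
Lemma integral_ekap_omega t x : x != 0 ->
  \int[leb]_w (ekap t w * omega (x - w)) <= omegaC / kap t * omega x.
Proof.
move=> x0; have k0 := kap_gt0 t; have kN : kap t != 0 by rewrite gt_eqF.
have kNN : - kap t != 0 by rewrite oppr_eq0.
have a1 := integrable_affine 0 kN h1i; have a2 := integrable_affine (kap t * x) kNN h2i.
have b1 := Rintegral_affine 0 kN h1i; have b2 := Rintegral_affine (kap t * x) kNN h2i.
have s1 := integrableRZ 2 measurableT a1; have s2 := integrableRZ 4 measurableT a2.
have s12 := integrableRD measurableT s1 s2.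
have gi := integrableRZ (omega x) measurableT (integrableRZ (2 * k6) measurableT s12).
have := @Rintegral_norm_le1 x (fun w => ekap t w * omega (x - w)) _ _ gi.
have mf : measurable_fun setT (fun w => ekap t w * omega (x - w)).
  apply: measurable_ekapM; apply: measurableT_comp; first exact: measurable_omega.
  exact: measurable_funB.
move=> /(_ mf) h; apply: le_trans (ler_norm _) _; apply: le_trans (h _) _ => [w wx|].
  rewrite ger0_norm; last by rewrite mulr_ge0 ?omega_ge0// ltW// ekap_gt0.
  by have := weight_pointwise t x0 wx; rewrite addr0.
rewrite RintegralZl//; last exact: integrableRZ.
rewrite RintegralZl// RintegralD// !RintegralZl// b1 b2 normrN gtr0_norm//.
rewrite mulrC ler_wpM2r ?omega_ge0// /omegaC le_eqVlt; apply/orP; left; apply/eqP.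
by move: (\int[leb]_x _) (\int[leb]_x _) => I J; field.
Qed.

End Singular_weight.

(** * Lambda^-1 of a derivative, by interpolation *)

Section Bessel_derivative_bound.
Context {R : realType}.
Local Notation leb := (@lebesgue_measure R).
Variables (th ep : R).
Hypotheses (th01 : 0 < th < 1) (ep01 : 0 < ep < 1).
Let ep0 : 0 < ep. Proof. by case/andP: ep01. Qed.
Let ep1 : ep < 1. Proof. by case/andP: ep01. Qed.
Local Notation om := (omega th).
Implicit Types (t x w : R).

Section one_function.
Variables (V V' : R -> R) (B M s : R).
Hypothesis dV : forall x : R, is_derive x 1 V (V' x).
Hypothesis cV' : continuous V'.
Hypotheses (VB : forall x, `|V x| <= B) (V'B : forall x, `|V' x| <= B).
Hypotheses (s0 : 0 < s) (M0 : 0 <= M).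
Hypothesis VM : forall x, x != 0 -> `|V x| <= M * om x.
Hypothesis V'M : forall x, x != 0 -> `|V' x| <= M / s * om x.

Let cV : continuous V. Proof. by move=> x; exact: is_derive_continuous (dV x). Qed.
Let mV : measurable_fun setT V. Proof. exact: continuous_measurable_fun. Qed.
Let mV' : measurable_fun setT V'. Proof. exact: continuous_measurable_fun. Qed.
Let mshift (f : R -> R) x : measurable_fun setT f -> measurable_fun setT (fun w : R => f (x - w)).
Proof. by move=> mf; apply: measurableT_comp => //; exact: measurable_funB. Qed.

Let norm_le (f : R -> R) K t x : measurable_fun setT f -> 0 <= K -> x != 0 ->
  (forall y, y != 0 -> `|f y| <= K * om y) ->
  \int[leb]_w (ekap t w * `|f (x - w)|) <= K * (omegaC th / kap t * om x).
Proof.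
move=> mf K0 x0 fK.
have gi := integrableRZ K measurableT (integrable_ekap_omega th01 t x).
have mn : measurable_fun setT (fun w => ekap t w * `|f (x - w)|).
  apply: measurable_ekapM; apply: measurableT_comp => //; exact: mshift.
apply: le_trans (ler_norm _) _.
apply: le_trans (Rintegral_norm_le1 (c := x) mn gi _) _ => [w wx|].
  rewrite normrM normr_id gtr0_norm ?ekap_gt0// mulrCA ler_pM2l ?ekap_gt0//.
  by apply: fK; rewrite subr_eq0 eq_sym.
rewrite RintegralZl//; last exact: integrable_ekap_omega.
by rewrite ler_wpM2l//; exact: integral_ekap_omega.
Qed.

Let ekap_abs_le (f : R -> R) t x : measurable_fun setT f -> (forall y, `|f y| <= B) ->
  `|\int[leb]_w (ekap t w * f (x - w))| <= \int[leb]_w (ekap t w * `|f (x - w)|).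
Proof.
move=> mf fB; have fi : leb.-integrable setT (EFin \o (fun w => ekap t w * `|f (x - w)|)).
  apply: (@integrable_ekapM _ _ B) => [|w]; last by rewrite normr_id.
  by apply: measurableT_comp => //; exact: mshift.
apply: (Rintegral_norm_le (m := leb)) => //.
  by apply: measurable_ekapM; exact: mshift.
by move=> w; rewrite normrM gtr0_norm ?ekap_gt0.
Qed.

(* V'(x - w) + V'(x + w) is even in w and is the w-derivative of V(x + w) - V(x - w),
   which vanishes at w = 0. *)
Let by_parts t x : \int[leb]_w (ekap t w * V' (x - w)) =
  kap t / 2 * \int[leb]_w (ekap t w * (V (x + `|w|) - V (x - `|w|))).
Proof.
have k0 := kap_gt0 t.
pose S w := ekap t w * (V' (x - w) + V' (x + w)).
pose T w := ekap t w * (V (x + `|w|) - V (x - `|w|)).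
have cplus w : continuous (fun w : R => x + w).
  by move=> z; apply: cvgD; [exact: cvg_cst|exact: cvg_id].
have cek : continuous (ekap t).
  move=> w; apply: continuous_comp; last exact: continuous_expR.
  by apply: cvgN; apply: cvgMr; exact: norm_continuous.
have csub (f : R -> R) : continuous f -> continuous (fun w : R => f (x - w)).
  move=> cf w; apply: continuous_comp; last exact: cf.
  by apply: cvgB; [exact: cvg_cst|exact: cvg_id].
have cadd (f : R -> R) : continuous f -> continuous (fun w : R => f (x + w)).
  move=> cf w; apply: continuous_comp; last exact: cf.
  by apply: cvgD; [exact: cvg_cst|exact: cvg_id].
have cabs (f : R -> R) : continuous f -> continuous (fun w : R => f `|w|).
  by move=> cf w; apply: continuous_comp; [exact: norm_continuous|exact: cf].
have cS : continuous (fun w => V' (x - w) + V' (x + w)).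
  by move=> w; apply: cvgD; [exact: csub|exact: cadd].
have cT : continuous (fun w => V (x + `|w|) - V (x - `|w|)).
  by move=> w; apply: cvgB; [exact: (cabs _ (cadd _ cV))|exact: (cabs _ (csub _ cV))].
have Si : leb.-integrable setT (EFin \o S).
  apply: (@integrable_ekapM _ _ (B + B)); first exact: continuous_measurable_fun.
  by move=> w; rewrite (le_trans (ler_normD _ _))// lerD.
have Ti : leb.-integrable setT (EFin \o T).
  apply: (@integrable_ekapM _ _ (B + B)); first exact: continuous_measurable_fun.
  by move=> w; rewrite (le_trans (ler_normB _ _))// lerD.
have V'i : leb.-integrable setT (EFin \o (fun w => ekap t w * V' (x - w))).
  by apply: (@integrable_ekapM _ _ B) => //; exact: mshift.
have r0 : (fun w => ekap t (0 - w) * V' (x - (0 - w))) = (fun w => ekap t w * V' (x + w)).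
  by apply/funext => w; rewrite sub0r opprK /ekap normrN.
have e := Rintegral_reflect 0 V'i; rewrite r0 in e.
have V'i' := integrable_reflect 0 V'i; rewrite r0 in V'i'.
have Se : \int[leb]_w S w = 2 * \int[leb]_w (ekap t w * V' (x - w)).
  transitivity (\int[leb]_w (ekap t w * V' (x - w) + ekap t w * V' (x + w))).
    by apply: eq_Rintegral => w _; rewrite /S mulrDr.
  by rewrite RintegralD// e mulr2n mulrDl mul1r.
have Sev w : S (- w) = S w by rewrite /S /ekap normrN opprK addrC.
have Tev w : T (- w) = T w by rewrite /T /ekap normrN.
have Siy : leb.-integrable `]0, +oo[%classic (EFin \o S) by exact: integrableRT.
have Tiy : leb.-integrable `]0, +oo[%classic (EFin \o T) by exact: integrableRT.
have half : \int[leb]_(w in `]0, +oo[) S w = kap t * \int[leb]_(w in `]0, +oo[) T w.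
  have kTi : leb.-integrable `]0, +oo[%classic (EFin \o (fun w => kap t * T w)) by exact: integrableRZ.
  apply/eqP; rewrite -subr_eq0 -RintegralZl// -RintegralB//; apply/eqP.
  pose F w := expR (- (kap t * w)) * (V (x + w) - V (x - w)).
  have dF (w : R) : is_derive w 1 F (- kap t * F w +
      expR (- (kap t * w)) * (V' (x + w) + V' (x - w))).
    have d1 : is_derive w 1 (fun w : R => x + w) 1.
      by apply: (is_derive_eq (is_deriveD (is_derive_cst x w 1) (is_derive_id w (1 : R)))); rewrite add0r.
    have d2 : is_derive w 1 (fun w : R => x - w) (-1).
      by apply: (is_derive_eq (is_deriveB (is_derive_cst x w 1) (is_derive_id w (1 : R)))); rewrite sub0r.
    have d3 : is_derive w 1 (fun w : R => - (kap t * w)) (- kap t).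
      by apply: is_derive_eq; rewrite /GRing.scale/= mulr1.
    have v1 := @is_derive1_comp R V _ w _ _ (dV (x + w)) d1.
    have v2 := @is_derive1_comp R V _ w _ _ (dV (x - w)) d2.
    have v3 := @is_derive1_comp R expR _ w _ _ (is_derive_expR _) d3.
    by rewrite /F; apply: is_derive_eq; rewrite /GRing.scale/=; ring.
  transitivity ((0 : R) - F 0); last by rewrite /F addr0 subr0 subrr mulr0 subr0.
  apply: (FTC_half_line (F := F)).
  - exact: integrableRB Siy kTi.
  - move=> w w0; apply: (is_derive_eq (dF w)).
    by rewrite /S /T /F /ekap gtr0_norm//; ring.
  - move=> w _; apply: cvgB; first by apply: cvgM; [exact: cek|exact: cS].
    by apply: cvgMr; apply: cvgM; [exact: cek|exact: cT].
  - by apply: cvg_at_right_filter; exact: is_derive_continuous (dF 0).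
  - have h : (B + B) * expR (- (kap t * w)) @[w --> +oo] --> (0 : R).
      by rewrite -(mulr0 (B + B)); apply: cvgMr; exact: cvg_expRMNy.
    have hN : - ((B + B) * expR (- (kap t * w))) @[w --> +oo] --> (0 : R).
      by rewrite -oppr0; exact: cvgN.
    apply: squeeze_cvgr hN h; apply: nearW => w /=.
    rewrite -ler_norml /F normrM gtr0_norm ?expR_gt0// mulrC ler_pM2r ?expR_gt0//.
    by rewrite (le_trans (ler_normB _ _))// lerD.
apply: (@mulfI _ 2) => //; rewrite -Se (integrable_even Sev Siy).2 half.
by rewrite (integrable_even Tev Tiy).2; field.
Qed.

Let parts_le t x : x != 0 ->
  `|\int[leb]_w (ekap t w * V' (x - w))| <= M * (omegaC th * om x).
Proof.
move=> x0; have k0 := kap_gt0 t; rewrite by_parts normrM gtr0_norm ?divr_gt0//.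
have Vi z : leb.-integrable setT (EFin \o (fun w => ekap t w * `|V (z - w)|)).
  apply: (@integrable_ekapM _ _ B) => [|w]; last by rewrite normr_id.
  by apply: measurableT_comp => //; exact: mshift.
have r0 : (fun w => ekap t (0 - w) * `|V (x - (0 - w))|) = (fun w => ekap t w * `|V (x + w)|).
  by apply/funext => w; rewrite sub0r opprK /ekap normrN.
have e := Rintegral_reflect 0 (Vi x); rewrite r0 in e.
have Vi' := integrable_reflect 0 (Vi x); rewrite r0 in Vi'.
have cabs : measurable_fun setT (fun w => V (x + `|w|) - V (x - `|w|)).
  apply: measurable_funB; apply: measurableT_comp => //.
    by apply: measurable_funD.
  by apply: measurable_funB.
have h : `|\int[leb]_w (ekap t w * (V (x + `|w|) - V (x - `|w|)))| <=
    \int[leb]_w (ekap t w * `|V (x + w)| + ekap t w * `|V (x - w)|).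
  apply: (Rintegral_norm_le (m := leb)).
  - exact: measurable_ekapM.
  - exact: integrableRD.
  - move=> w; rewrite normrM gtr0_norm ?ekap_gt0// -mulrDr ler_pM2l ?ekap_gt0//.
    apply: le_trans (ler_normB _ _) _.
    by case: (leP 0 w) => w0; rewrite ?(ger0_norm w0)// (ltr0_norm w0) opprK addrC.
rewrite RintegralD// e -mulr2n -mulr_natl in h.
have n := norm_le t mV M0 x0 VM.
apply: (@le_trans _ _ (kap t / 2 * (2 * (M * (omegaC th / kap t * om x))))).
  by rewrite ler_pM2l ?divr_gt0// (le_trans h)// ler_wpM2l.
by rewrite le_eqVlt; apply/orP; left; apply/eqP; field; rewrite gt_eqF.
Qed.

Let Ms : 0 <= M / s. Proof. by rewrite divr_ge0// ltW. Qed.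

Let powR_min (r : R) : 0 < r -> Num.min 1 r <= r `^ ep.
Proof.
move=> r0; have [r1|r1] := leP 1 r.
  by rewrite -(powRr0 r); apply: ler_powR => //; exact: ltW.
by apply: ger1_powR; [rewrite r0 ltW|exact: ltW].
Qed.

Let kap_powR t : (kap t)^-1 * (kap t)^-1 `^ ep <= 4 * (1 + `|t|) `^ (- (1 + ep)).
Proof.
have k0 := kap_gt0 t; have p0 : 0 < 1 + `|t| by rewrite ltr_wpDr.
have kl : (1 + `|t|) / 2 <= kap t.
  rewrite ler_pdivrMr// -(@ler_pXn2r _ 2)// ?nnegrE ?mulr_ge0 ?(ltW p0) ?(ltW k0)//.
  rewrite [leRHS]exprMn sqr_kap -(real_normK (num_real t)).
  by have := sqr_ge0 (1 - `|t|); have := sqr_ge0 `|t|; rewrite !expr2; lra.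
have kV : (kap t)^-1 <= 2 * (1 + `|t|)^-1.
  by rewrite -[2]invrK -invfM lef_pV2 ?posrE ?mulr_gt0 ?invr_gt0// mulrC.
apply: (@le_trans _ _ ((2 * (1 + `|t|)^-1) * (2 * (1 + `|t|) `^ (- ep)))).
  have kn : 0 <= (kap t)^-1 by rewrite invr_ge0 ltW.
  apply: ler_pM; rewrite ?powR_ge0//.
  apply: (@le_trans _ _ ((2 * (1 + `|t|)^-1) `^ ep)).
    by apply: ge0_ler_powR; rewrite ?nnegrE ?(ltW ep0) ?mulr_ge0 ?invr_ge0 ?(ltW p0) ?(ltW k0).
  rewrite powRM ?invr_ge0 ?(ltW p0)// -(powR_inv1 (ltW p0)) -powRrM mulN1r.
  by rewrite ler_wpM2r ?powR_ge0//; apply: ler1_powR; [rewrite ler1n|exact: ltW].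
rewrite opprD powRD; last by rewrite (gt_eqF p0) implybT.
by rewrite powR_inv1 ?(ltW p0)// le_eqVlt; apply/orP; left; apply/eqP; ring.
Qed.

Definition bessel_deriveC := (2 * pi)^-1 *
  (4 * omegaC th * \int[leb]_t ((1 + `|t|) `^ (- (1 + ep)))).

(** Moving the derivative onto the kernel bounds the convolution by M omegaC om; leaving it on V
    gives the same divided by s kap, where [s] is the length scale of V. As min (1, r) <= r^ep, both
    together give (s kap)^(-ep), and the extra power makes kap^(-1-ep) integrable in t. *)
Lemma bessel_derive_le x : x != 0 ->
  `|bessel V' x| <= bessel_deriveC * (M * s `^ (- ep) * om x).
Proof.
move=> x0; have C0 := omegaC_ge0 th; have o0 := omega_ge0 th x.
have A0 : 0 <= M * (omegaC th * om x) by apply: mulr_ge0 => //; apply: mulr_ge0.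
have res t : `|resolvent (fun w => V' (x - w)) t| <=
    4 * (M * (omegaC th * om x)) * s `^ (- ep) * (1 + `|t|) `^ (- (1 + ep)).
  have k0 := kap_gt0 t; have kV0 : 0 < (kap t)^-1 by rewrite invr_gt0.
  rewrite normrM gtr0_norm//.
  have b1 := parts_le t x0.
  have b2 : `|\int[leb]_w (ekap t w * V' (x - w))| <= M * (omegaC th * om x) * (s * kap t)^-1.
    apply: le_trans (ekap_abs_le t x mV' V'B) _.
    apply: le_trans (norm_le t mV' Ms x0 V'M) _.
    by rewrite le_eqVlt; apply/orP; left; apply/eqP; field; rewrite !gt_eqF.
  have sk : 0 < (s * kap t)^-1 by rewrite invr_gt0 mulr_gt0.
  have b3 : `|\int[leb]_w (ekap t w * V' (x - w))| <=
      M * (omegaC th * om x) * (s * kap t)^-1 `^ ep.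
    apply: (@le_trans _ _ (M * (omegaC th * om x) * Num.min 1 (s * kap t)^-1)).
      by have [_|_] := leP 1 (s * kap t)^-1; rewrite ?mulr1.
    by rewrite ler_wpM2l// powR_min.
  apply: (@le_trans _ _ ((kap t)^-1 * (M * (omegaC th * om x) * (s * kap t)^-1 `^ ep))).
    by rewrite ler_pM2l.
  rewrite invfM powRM ?invr_ge0 ?(ltW s0) ?(ltW k0)//.
  rewrite -(powR_inv1 (ltW s0)) -powRrM mulN1r.
  have -> : (kap t)^-1 * (M * (omegaC th * om x) * (s `^ (- ep) * (kap t)^-1 `^ ep)) =
    M * (omegaC th * om x) * s `^ (- ep) * ((kap t)^-1 * (kap t)^-1 `^ ep) by ring.
  have -> : 4 * (M * (omegaC th * om x)) * s `^ (- ep) * (1 + `|t|) `^ (- (1 + ep)) =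
    M * (omegaC th * om x) * s `^ (- ep) * (4 * (1 + `|t|) `^ (- (1 + ep))) by ring.
  by rewrite ler_wpM2l ?kap_powR// mulr_ge0 ?powR_ge0.
have p0 : 0 < (2 * pi : R)^-1 by rewrite invr_gt0 mulr_gt0// pi_gt0.
have qi := integrable_one_plus_powR ep0.
have gi := integrableRZ (4 * (M * (omegaC th * om x)) * s `^ (- ep)) measurableT qi.
have := Rintegral_norm_le (m := leb) (measurable_resolvent1 (mshift x mV')) gi res.
rewrite RintegralZl// => h; rewrite /bessel /bessel0 normrM (gtr0_norm p0) /bessel_deriveC.
rewrite -mulrA ler_pM2l// (le_trans h)// le_eqVlt; apply/orP; left; apply/eqP.
by move: (\int[leb]_x _) => I; ring.
Qed.

End one_function.

End Bessel_derivative_bound.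

(** * Self-similar functions *)

Section Self_similar.
Context {R : realType}.
Local Notation leb := (@lebesgue_measure R).
Implicit Types (G : R -> R) (m t x : R).

Definition simvar t x := 2^-1 * x * t `^ (- 2^-1).
Definition selfsim m G t x := t `^ (- m) * G (simvar t x).

Lemma measurable_simvar : measurable_fun setT (fun z : R * R => simvar z.1 z.2).
Proof.
apply: measurable_funM; first by apply: measurable_funM => //; exact: measurable_snd.
exact: (measurableT_comp (measurable_powR _) measurable_fst).
Qed.

Lemma measurable_selfsim m G : measurable_fun setT G ->
  measurable_fun setT (fun z : R * R => selfsim m G z.1 z.2).
Proof.
move=> mG; apply: measurable_funM.
  exact: (measurableT_comp (measurable_powR _) measurable_fst).
exact: (measurableT_comp mG measurable_simvar).
Qed.

Lemma selfsim_measurable m G t : measurable_fun setT G -> measurable_fun setT (selfsim m G t).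
Proof. by move=> mG; exact: (measurableT_comp (measurable_selfsim m mG) (pair1_measurable t)). Qed.

Lemma powR_addN (a b t : R) : 0 < t -> t `^ (- a) * t `^ (- b) = t `^ (- (a + b)).
Proof. by move=> t0; rewrite opprD powRD// (gt_eqF t0) implybT. Qed.

Definition dxprof (G' : R -> R) (y : R) := 2^-1 * G' y.
Definition dtprof m (G G' : R -> R) (y : R) := - (m * G y) - 2^-1 * (y * G' y).

Lemma is_derive_selfsim_x m (G G' : R -> R) t x : 0 < t ->
  (forall y : R, is_derive y 1 G (G' y)) ->
  is_derive x 1 (selfsim m G t) (selfsim (m + 2^-1) (dxprof G') t x).
Proof.
move=> t0 dG.
have d : is_derive x 1 (simvar t) (2^-1 * t `^ (- 2^-1)).
  by rewrite /simvar; apply: is_derive_eq; rewrite /GRing.scale/=; ring.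
have e := @is_derive1_comp R G _ x _ _ (dG (simvar t x)) d.
apply: (is_derive_eq (is_deriveM (is_derive_cst (t `^ (- m)) x 1) e)).
by rewrite /GRing.scale/= /selfsim /dxprof -powR_addN//; ring.
Qed.

Lemma is_derive_selfsim_t m (G G' : R -> R) t x : 0 < t ->
  (forall y : R, is_derive y 1 G (G' y)) ->
  is_derive t 1 (selfsim m G ^~ x) (selfsim (m + 1) (dtprof m G G') t x).
Proof.
move=> t0 dG.
have p c := @is_derive_powR_comp R id (- c) t 1 t0 (is_derive_id t 1).
have d : is_derive t 1 (simvar ^~ x) (- 2^-1 * simvar t x * t `^ (- 1)).
  apply: (is_derive_eq (is_deriveM (is_derive_cst (2^-1 * x) t 1) (p 2^-1))).
  by rewrite /GRing.scale/= /simvar -opprD -powR_addN//; ring.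
have e := @is_derive1_comp R G _ t _ _ (dG (simvar t x)) d.
apply: (is_derive_eq (is_deriveM (p m) e)).
by rewrite /GRing.scale/= /selfsim /dtprof -opprD -powR_addN//; ring.
Qed.

Lemma selfsim_continuous m G t : continuous G -> continuous (selfsim m G t).
Proof.
move=> cG x; apply: cvgMr; apply: continuous_comp; last exact: cG.
by apply: cvgMl; apply: cvgMr; exact: cvg_id.
Qed.

Let sqrt2 t : 0 < t <= 2 -> 2^-1 <= t `^ (- 2^-1).
Proof.
move=> /andP[t0 t2]; rewrite powRN lef_pV2 ?posrE ?powR_gt0//.
apply: (@le_trans _ _ (2 `^ 2^-1)); first by apply: ge0_ler_powR; rewrite ?nnegrE ?(ltW t0).
by apply: ler1_powR; [rewrite ler1n|rewrite invf_le1// ler1n].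
Qed.

(** The range t <= 2 is that of the time cutoff; on it t^(-1/2) >= 1/2. *)
Lemma simvar_ge t x : 0 < t <= 2 -> `|x| <= 4 * `|simvar t x|.
Proof.
move=> ht; have h := sqrt2 ht; rewrite /simvar !normrM [`|2^-1|]gtr0_norm ?invr_gt0// [`|t `^ _|]ger0_norm ?powR_ge0//.
have := ler_wpM2l (normr_ge0 x) h; lra.
Qed.

Lemma selfsim_decay m G : superexp_decay G -> exists2 C, 0 <= C &
  forall t x, 0 < t <= 2 -> `|selfsim m G t x| <= C * t `^ (- m) * expR (- `|x|).
Proof.
move=> /(_ 4)[C HC]; have C0 : 0 <= C.
  by have := HC 0; rewrite normr0 mulr0 oppr0 expR0 mulr1; exact: le_trans.
exists C => // t x ht; rewrite normrM ger0_norm ?powR_ge0// mulrAC [leRHS]mulrC.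
rewrite ler_wpM2l ?powR_ge0// (le_trans (HC _))// ler_wpM2l// ler_expR lerN2.
exact: simvar_ge.
Qed.

Lemma selfsim_bounded m G : superexp_decay G -> 0 <= m -> exists2 C, 0 <= C &
  forall t t0 x, 0 < t0 -> t0 <= t -> `|selfsim m G t x| <= C * t0 `^ (- m).
Proof.
move=> /(_ 0)[C HC] m0; have C0 : 0 <= C.
  by have := HC 0; rewrite mul0r oppr0 expR0 mulr1; exact: le_trans.
exists C => // t t0 x t00 tt; rewrite normrM ger0_norm ?powR_ge0// mulrC.
apply: ler_pM; rewrite ?powR_ge0//.
  by have := HC (simvar t x); rewrite mul0r oppr0 expR0 mulr1.
rewrite !powRN lef_pV2 ?posrE ?powR_gt0 ?(lt_le_trans t00)//.
by apply: ge0_ler_powR; rewrite ?nnegrE ?(ltW t00)// (le_trans (ltW t00)).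
Qed.

Variable th : R.
Hypothesis th01 : 0 < th < 1.
Let th0 : 0 < th. Proof. by case/andP: th01. Qed.
Let th1 : th < 1. Proof. by case/andP: th01. Qed.

(** Write y for the similarity variable. Of the decay e^(-4|y|) one unit absorbs |y|^th, and the
    rest yields e^(-|x|/2) since |x| <= 4 |y|. The factor |y|^(-th) thus gained is a multiple of
    t^(th/2) |x|^(-th). *)
Lemma selfsim_omega m G : superexp_decay G -> exists2 C, 0 <= C &
  forall t x, 0 < t <= 2 -> x != 0 ->
    `|selfsim m G t x| <= C * t `^ (- (m - th / 2)) * omega th x.
Proof.
move=> /(_ 4)[C HC]; have C0 : 0 <= C.
  by have := HC 0; rewrite normr0 mulr0 oppr0 expR0 mulr1; exact: le_trans.
exists (2 * C) => [|t x ht x0]; first by rewrite mulr_ge0.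
have /andP[t0 t2] := ht; set y := simvar t x.
have y0 : 0 < `|y|.
  by rewrite normr_gt0 /y /simvar !mulf_neq0 ?invr_eq0// gt_eqF// powR_gt0.
have G1 : `|G y| <= C * (`|y| `^ (- th) * expR (- (2^-1 * `|x|))).
  apply: le_trans (HC y) _; rewrite ler_wpM2l// powRN ler_pdivlMl ?powR_gt0//.
  have e1 : `|y| `^ th <= expR `|y|.
    apply: le_trans (expR_ge1Dx _); apply: (@le_trans _ _ ((1 + `|y|) `^ th)).
      by apply: ge0_ler_powR; rewrite ?nnegrE ?addr_ge0 ?(ltW th0)// lerDr.
    by apply: ler1_powR; [rewrite lerDl|exact: ltW].
  apply: (@le_trans _ _ (expR `|y| * expR (- (4 * `|y|)))); first by rewrite ler_wpM2r ?expR_ge0.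
  rewrite -expRD ler_expR; have := simvar_ge x ht; rewrite -/y; have := normr_ge0 x.
  by move: `|y| `|x| => a b; lra.
have yE : `|y| `^ (- th) <= 2 * (t `^ (th / 2) * `|x| `^ (- th)).
  rewrite /y /simvar !normrM gtr0_norm ?invr_gt0// (ger0_norm (powR_ge0 _ _)).
  rewrite !powRM ?mulr_ge0 ?invr_ge0 ?powR_ge0// -powRrM mulrNN [2^-1 * th]mulrC.
  rewrite -mulrA [`|x| `^ _ * _]mulrC ler_wpM2r ?mulr_ge0 ?powR_ge0//.
  rewrite -(powR_inv1 (ler0n _ 2)) -powRrM mulrNN mul1r.
  by apply: ler1_powR; [rewrite ler1n|exact: ltW].
rewrite normrM ger0_norm ?powR_ge0// -powR_addN// opprK.
apply: (@le_trans _ _ (t `^ (- m) * (C * (2 * (t `^ (th / 2) * `|x| `^ (- th)) * expR (- (2^-1 * `|x|)))))).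
  rewrite ler_wpM2l ?powR_ge0// (le_trans G1)// ler_wpM2l// ler_wpM2r ?expR_ge0//.
by rewrite /omega le_eqVlt; apply/orP; left; apply/eqP; ring.
Qed.

End Self_similar.

Section Bessel_self_similar.
Context {R : realType}.
Local Notation leb := (@lebesgue_measure R).
Implicit Types (f G : R -> R) (m t x : R).

Let mshift (f : R -> R) x : measurable_fun setT f -> measurable_fun setT (fun w : R => f (x - w)).
Proof. by move=> mf; apply: measurableT_comp => //; exact: measurable_funB. Qed.

Let itv1 x : x - 1 < x < x + 1. Proof. by rewrite gtrBl ltrDl ltr01. Qed.

Lemma is_derive_bessel (f f' : R -> R) (B x : R) :
  (forall x : R, is_derive x 1 f (f' x)) -> continuous f' ->
  (forall x, `|f x| <= B) -> (forall x, `|f' x| <= B) ->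
  is_derive x 1 (bessel f) (bessel f' x).
Proof.
move=> df cf' fB f'B.
have mf : measurable_fun setT f.
  by apply: continuous_measurable_fun => y; exact: is_derive_continuous (df y).
have mf' : measurable_fun setT f' by exact: continuous_measurable_fun.
apply: (@is_derive_bessel0 _ (fun s w => f (s - w)) (fun s w => f' (s - w)) _ _ x B (itv1 x)) => //.
- by move=> s; exact: mshift.
- by move=> s _; exact: mshift.
- move=> s w _.
  have d : is_derive s 1 (fun s : R => s - w) 1.
    by apply: (is_derive_eq (is_deriveB (is_derive_id s (1 : R)) (is_derive_cst w s 1))); rewrite subr0.
  by apply: (is_derive_eq (@is_derive1_comp R f _ s _ _ (df (s - w)) d)); rewrite mulr1.
Qed.

Lemma continuous_bessel f (B : R) : continuous f -> (forall x, `|f x| <= B) ->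
  continuous (bessel f).
Proof.
move=> cf fB x; have mf : measurable_fun setT f by exact: continuous_measurable_fun.
have xI : x \in `]x - 1, x + 1[%classic by rewrite inE/= in_itv/= itv1.
have cs w : continuous (fun s => f (s - w)).
  move=> s; apply: continuous_comp; last exact: cf.
  by apply: cvgB; [exact: cvg_id|exact: cvg_cst].
have cres t : continuous (fun s => resolvent (fun w => f (s - w)) t).
  move=> y; have yI : y \in `]y - 1, y + 1[%classic by rewrite inE/= in_itv/= itv1.
  apply: cvgMr.
  apply: (@continuity_under_integral _ _ _ leb (fun s w => ekap t w * f (s - w)) setT
    measurableT (y - 1) (y + 1) _ _ (fun w => B * ekap t w) _ _ y yI).
  - by move=> s _; apply: integrable_ekapM => //; exact: mshift.
  - apply: aeW => w _ s _; apply: cvgMr; exact: cs.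
  - by apply: integrableRZ => //; exact: integrable_ekap.
  - move=> s _; apply: aeW => w _.
    by rewrite normrM gtr0_norm ?ekap_gt0// mulrC ler_wpM2r// ltW// ekap_gt0.
apply: cvgMr.
apply: (@continuity_under_integral _ _ _ leb (fun s t => resolvent (fun w => f (s - w)) t) setT
  measurableT (x - 1) (x + 1) _ _ (fun t => 2 * B * kap t ^- 2) _ _ x xI).
- by move=> s _; apply: (@integrable_resolvent _ _ B) => //; exact: mshift.
- by apply: aeW => t _ s _; exact: cres.
- by apply: integrableRZ => //; exact: integrable_kapV2.
- by move=> s _; apply: aeW => t _; apply: resolvent_bound => //; exact: mshift.
Qed.

Lemma superexp_dxprof G : superexp_decay G -> superexp_decay (dxprof G).
Proof. exact: superexp_decayZ. Qed.

Lemma superexp_dtprof m G G' : superexp_decay G -> superexp_decay G' ->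
  superexp_decay (dtprof m G G').
Proof.
move=> sG sG'; have h1 := superexp_decayZ (- m) sG.
have h2 := superexp_decayZ (- 2^-1) (superexp_decay_id sG').
apply: superexp_decay_le (superexp_decayD h1 h2) => y.
by rewrite /dtprof !mulNr.
Qed.

Lemma measurable_dtprof m G G' : measurable_fun setT G -> measurable_fun setT G' ->
  measurable_fun setT (dtprof m G G').
Proof.
move=> mG mG'; apply: measurable_funB; first by apply: measurable_funN; exact: measurable_funM.
by apply: measurable_funM => //; exact: measurable_funM.
Qed.

Lemma measurable_bessel_selfsim m G : measurable_fun setT G ->
  measurable_fun setT (fun z : R * R => bessel (selfsim m G z.1) z.2).
Proof.
move=> mG; apply: (@measurable_bessel0 R _ (R * R)%type (fun z w => selfsim m G z.1 (z.2 - w))).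
rewrite (_ : (fun z => _) = (fun z : R * R => selfsim m G z.1 z.2) \o
   (fun z : (R * R) * R => (z.1.1, z.1.2 - z.2)))//.
apply: measurableT_comp; first exact: measurable_selfsim.
apply/measurable_fun_pairP; split; first exact: (measurableT_comp measurable_fst measurable_fst).
apply: measurable_funB; last exact: measurable_snd.
exact: (measurableT_comp measurable_snd measurable_fst).
Qed.

Lemma selfsim_bounded_t m G t : superexp_decay G -> 0 <= m -> 0 < t ->
  exists B, forall s x, t / 2 <= s -> `|selfsim m G s x| <= B.
Proof.
move=> sG m0 t0; have [C C0 HC] := selfsim_bounded sG m0.
by exists (C * (t / 2) `^ (- m)) => s x ts; apply: HC => //; rewrite divr_gt0.
Qed.

Lemma is_derive_bessel_selfsim_x m G G' t x : 0 < t -> 0 <= m ->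
  (forall y : R, is_derive y 1 G (G' y)) -> continuous G' ->
  superexp_decay G -> superexp_decay G' ->
  is_derive x 1 (bessel (selfsim m G t)) (bessel (selfsim (m + 2^-1) (dxprof G') t) x).
Proof.
move=> t0 m0 dG cG' sG sG'.
have [B1 HB1] := selfsim_bounded_t sG m0 t0.
have m1 : 0 <= m + 2^-1 by rewrite addr_ge0.
have [B2 HB2] := selfsim_bounded_t (superexp_dxprof sG') m1 t0.
have tt : t / 2 <= t by rewrite ler_pdivrMr// ler_peMr ?ler1n// ltW.
apply: (@is_derive_bessel _ _ (Num.max B1 B2)) => [y||y|y].
- exact: is_derive_selfsim_x.
- by apply: selfsim_continuous => y; apply: cvgMr; exact: cG'.
- by rewrite le_max HB1.
- by rewrite le_max HB2// orbT.
Qed.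

Lemma is_derive_bessel_selfsim_t m G G' t x : 0 < t -> 0 <= m ->
  (forall y : R, is_derive y 1 G (G' y)) -> measurable_fun setT G' ->
  superexp_decay G -> superexp_decay G' ->
  is_derive t 1 (fun t => bessel (selfsim m G t) x)
    (bessel (selfsim (m + 1) (dtprof m G G') t) x).
Proof.
move=> t0 m0 dG mG' sG sG'.
have mG : measurable_fun setT G.
  by apply: continuous_measurable_fun => y; exact: is_derive_continuous (dG y).
have [B1 HB1] := selfsim_bounded_t sG m0 t0.
have m1 : 0 <= m + 1 by rewrite addr_ge0.
have [B2 HB2] := selfsim_bounded_t (superexp_dtprof m sG sG') m1 t0.
have th : t / 2 < t < t + 1 by rewrite ltr_pdivrMr// ltr_pMr// ltr1n ltrDl ltr01.
have sp s : t / 2 < s < t + 1 -> 0 < s.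
  by move=> /andP[+ _]; apply: lt_trans; rewrite divr_gt0.
apply: (@is_derive_bessel0 _ (fun s w => selfsim m G s (x - w))
   (fun s w => selfsim (m + 1) (dtprof m G G') s (x - w)) _ _ t (Num.max B1 B2) th) => s.
- by apply: mshift; exact: selfsim_measurable.
- by move=> _; apply: mshift; apply: selfsim_measurable; exact: measurable_dtprof.
- by move=> w /sp s0; exact: is_derive_selfsim_t.
- by move=> w /andP[/ltW ts _]; rewrite le_max HB1.
- by move=> w /andP[/ltW ts _]; rewrite le_max HB2// orbT.
Qed.

Variables (th ep : R).
Hypotheses (th01 : 0 < th < 1) (ep01 : 0 < ep < 1).

(** Interpolation at the length scale s = t^(1/2): an x-derivative costs t^(-1/2), but after
    Lambda^-1 only t^(-ep/2) of it remains. *)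
Lemma bessel_selfsim_le m G G' : 0 <= m ->
  (forall y : R, is_derive y 1 G (G' y)) -> continuous G' ->
  superexp_decay G -> superexp_decay G' ->
  exists2 C, 0 <= C & forall t x, 0 < t <= 2 -> x != 0 ->
    `|bessel (selfsim (m + 2^-1) (dxprof G') t) x| <=
      C * t `^ (- (m - (th - ep) / 2)) * omega th x.
Proof.
move=> m0 dG cG' sG sG'.
have [C1 C10 HC1] := selfsim_omega th01 m sG.
have [C2 C20 HC2] := selfsim_omega th01 (m + 2^-1) (superexp_dxprof sG').
have m1 : 0 <= m + 2^-1 by rewrite addr_ge0.
have CC0 : 0 <= C1 + C2 by rewrite addr_ge0.
have H t x : 0 < t <= 2 -> x != 0 -> `|bessel (selfsim (m + 2^-1) (dxprof G') t) x| <=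
    bessel_deriveC th ep * ((C1 + C2) * t `^ (- (m - (th - ep) / 2)) * omega th x).
  move=> ht x0; have /andP[t0 _] := ht.
  have [B1 HB1] := selfsim_bounded_t sG m0 t0.
  have [B2 HB2] := selfsim_bounded_t (superexp_dxprof sG') m1 t0.
  have tt : t / 2 <= t by rewrite ler_pdivrMr// ler_peMr ?ler1n// ltW.
  have s0 : 0 < t `^ 2^-1 by rewrite powR_gt0.
  have M0 : 0 <= (C1 + C2) * t `^ (- (m - th / 2)) by rewrite mulr_ge0 ?powR_ge0.
  have := @bessel_derive_le R th ep th01 ep01 (selfsim m G t) (selfsim (m + 2^-1) (dxprof G') t)
    (Num.max B1 B2) ((C1 + C2) * t `^ (- (m - th / 2))) (t `^ 2^-1) _ _ _ _ s0 M0 _ _ x x0.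
  have -> : (C1 + C2) * t `^ (- (m - th / 2)) * (t `^ 2^-1) `^ (- ep) =
      (C1 + C2) * t `^ (- (m - (th - ep) / 2)).
    rewrite -mulrA -powRrM (_ : 2^-1 * - ep = - (ep / 2)); last by ring.
    by rewrite powR_addN//; congr (_ * _ `^ _); ring.
  apply.
  - by move=> y; exact: is_derive_selfsim_x.
  - by apply: selfsim_continuous => y; apply: cvgMr; exact: cG'.
  - by move=> y; rewrite le_max HB1.
  - by move=> y; rewrite le_max HB2// orbT.
  - move=> y y0; apply: le_trans (HC1 t y ht y0) _.
    by rewrite ler_wpM2r ?omega_ge0// ler_wpM2r ?powR_ge0// lerDl.
  - move=> y y0; apply: le_trans (HC2 t y ht y0) _.
    rewrite ler_wpM2r ?omega_ge0// -mulrA -powRN powR_addN//.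
    rewrite (_ : m - th / 2 + 2^-1 = m + 2^-1 - th / 2); last by ring.
    by rewrite ler_wpM2r ?powR_ge0// lerDr.
exists (`|bessel_deriveC th ep| * (C1 + C2)); first by rewrite mulr_ge0.
move=> t x ht x0; apply: le_trans (H t x ht x0) _.
have h : 0 <= (C1 + C2) * t `^ (- (m - (th - ep) / 2)) * omega th x.
  by rewrite mulr_ge0 ?omega_ge0// mulr_ge0 ?powR_ge0.
by apply: le_trans (ler_wpM2r h (ler_norm _)) _; rewrite !mulrA.
Qed.

End Bessel_self_similar.

(** * Cutting off in time *)

Section Planar_functions.
Context {R : realType}.
Local Notation leb := (@lebesgue_measure R).
Local Notation leb2 := (leb \x leb)%E.
Implicit Types t : R.

Lemma Rintegral_off (c : R) (f g : R -> R) : measurable_fun setT f -> measurable_fun setT g ->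
  (forall x, x != c -> f x = g x) -> \int[leb]_x f x = \int[leb]_x g x.
Proof.
move=> mf mg fg; have mD : measurable ([set: R] `\ c) by exact: measurableD.
have D1 h : measurable_fun setT h -> \int[leb]_x h x = \int[leb]_(x in [set: R] `\ c) h x.
  move=> mh; rewrite /Rintegral integral_setD1//.
  by apply/measurable_EFinP; exact: measurable_funTS.
rewrite (D1 f mf) (D1 g mg); apply: eq_Rintegral => x.
by rewrite inE => -[_ /eqP]; exact: fg.
Qed.

Lemma Lfun_integrable_powR d (T : measurableType d) (m : {measure set T -> \bar R})
    (p : R) (f : T -> R) : measurable_fun setT f ->
  m.-integrable setT (EFin \o (fun y => `|f y| `^ p)) -> f \in Lfun m p%:E.
Proof.
move=> mf fi; rewrite inE; apply/andP; split; first by rewrite inE.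
rewrite inE /=; rewrite /finite_norm unlock /Lnorm; apply: poweR_lty.
have := integrableP _ _ _ fi => -[_]; apply: le_lt_trans.
apply: ge0_le_integral => //.
- by move=> x _; exact: poweR_ge0.
- rewrite (_ : (fun x => _) = EFin \o (fun y : T => `|f y| `^ p)); last by [].
  exact: measurable_int fi.
- by apply: measurableT_comp => //; exact: measurable_int fi.
- by move=> x _; exact: lee_abs.
Qed.

Let measurable_bin (k : nat) (c N : R) : measurable_fun setT
  (fun t => (((k%:R <= N * (t + c)) && (N * (t + c) < k.+1%:R))%:R : R)).
Proof.
apply: (measurableT_comp (f := fun b : bool => (b%:R : R))) => //.
have mN : measurable_fun setT (fun t : R => N * (t + c)).
  by apply: measurable_funM => //; exact: measurable_funD.
by apply: measurable_and; [exact: measurable_fun_ler|exact: measurable_fun_ltr].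
Qed.

(** Functions of Caratheodory type: t is replaced by the point of the grid of step 1 / (n + 1) just
    below it, on the window from -(n + 1) to n + 1, which has 2 (n + 1)^2 cells. Each approximation
    is a finite sum of products. *)
Lemma measurable_partially_continuous (f : R -> R -> R) :
  (forall t, measurable_fun setT (f t)) -> (forall x, continuous (f ^~ x)) ->
  measurable_fun setT (fun z : R * R => f z.1 z.2).
Proof.
move=> mf cf.
pose a (n k : nat) : R := k%:R / n.+1%:R - n.+1%:R.
pose b (n k : nat) (t : R) : bool :=
  (k%:R <= n.+1%:R * (t + n.+1%:R)) && (n.+1%:R * (t + n.+1%:R) < k.+1%:R).
pose h n (z : R * R) := \sum_(k < 2 * n.+1 ^ 2) ((b n k z.1)%:R * f (a n k) z.2).
apply: (@measurable_fun_cvg _ _ _ setT h) => [n|z _].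
  apply: measurable_sum => k; apply: measurable_funM; last exact: measurableT_comp.
  exact: (measurableT_comp (measurable_bin k n.+1%:R n.+1%:R) measurable_fst).
case: z => t x /=.
pose K n := Num.truncn (n.+1%:R * (t + n.+1%:R)).
have hE : \forall n \near \oo, h n (t, x) = f (a n (K n)) x.
  near=> n; have tn : `|t| < n.+1%:R.
    by apply: lt_le_trans (_ : n%:R <= _); [near: n; exact: nbhs_infty_gtr|rewrite ler_nat].
  move: (tn); rewrite ltr_norml => /andP[t1 t2].
  have s0 : 0 <= n.+1%:R * (t + n.+1%:R) by rewrite mulr_ge0//; lra.
  have /andP[k1 k2] := truncn_itv s0; rewrite -/(K n) in k1 k2.
  have Kn : (K n < 2 * n.+1 ^ 2)%N.
    rewrite -(ltr_nat R) (le_lt_trans k1)// natrM natrX expr2 mulrCA ltr_pM2l//; lra.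
  rewrite /h (bigD1 (Ordinal Kn))//= big1 ?addr0.
    by rewrite /b k1 k2 mul1r.
  move=> i /eqP iK; suff -> : b n i t = false by rewrite mul0r.
  apply/negP => /andP[i1 i2]; apply: iK; apply/val_inj => /=.
  have := le_lt_trans k1 i2; have := le_lt_trans i1 k2.
  by rewrite !ltr_nat !ltnS => ? ?; apply/eqP; rewrite eqn_leq; apply/andP.
have aK : a n (K n) @[n --> \oo] --> t.
  have low : t - n.+1%:R^-1 @[n --> \oo] --> t.
    by rewrite -[X in _ --> X]subr0; apply: cvgB; [exact: cvg_cst|exact: cvg_harmonic].
  apply: (squeeze_cvgr _ low (cvg_cst t)).
  near=> n; have tn : `|t| < n.+1%:R.
    by apply: lt_le_trans (_ : n%:R <= _); [near: n; exact: nbhs_infty_gtr|rewrite ler_nat].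
  move: (tn); rewrite ltr_norml => /andP[t1 t2].
  have s0 : 0 <= n.+1%:R * (t + n.+1%:R) by rewrite mulr_ge0//; lra.
  have /andP[k1 k2] := truncn_itv s0; rewrite -/(K n) in k1 k2.
  have n0 : (0 : R) < n.+1%:R by [].
  rewrite /a lerBrDr lerBlDr; apply/andP; split.
    rewrite ler_pdivlMr// (_ : _ * _ = n.+1%:R * (t + n.+1%:R) - 1); last by field; rewrite gt_eqF.
    by rewrite -natr1 in k2; lra.
  by rewrite ler_pdivrMr// mulrC.
have cc : f (a n (K n)) x @[n --> \oo] --> f t x by exact: cvg_comp aK (cf x t).
by apply: cvg_trans cc; apply: near_eq_cvg; apply: filterS hE => n ->.
Unshelve. all: by end_near. Qed.

(** Compact support is recorded as a bound by (1 + x^2)^-1, the form already used for Schwartz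
    functions, so that the same integration by parts applies. *)
Lemma test_fun_bound (phi : R -> R -> R) : test_fun phi ->
  [/\ forall t x : R, is_derive t 1 (phi ^~ x) (dt phi t x),
      forall t x : R, is_derive x 1 (phi t) (dx phi t x),
      [/\ forall x, continuous (dt phi ^~ x) & forall t, continuous (dx phi t)],
      [/\ measurable_fun setT (fun z : R * R => phi z.1 z.2),
          measurable_fun setT (fun z : R * R => dt phi z.1 z.2) &
          measurable_fun setT (fun z : R * R => dx phi z.1 z.2)] &
      exists2 K, 0 <= K & forall t x, [/\ `|phi t x| <= K * (1 + x ^+ 2)^-1,
        `|dt phi t x| <= K * (1 + x ^+ 2)^-1 & `|dx phi t x| <= K * (1 + x ^+ 2)^-1]].
Proof.
move=> [Ck [M supp]].
have [d1 c1 c2] := Ck 1%N; have c0 := Ck 0%N.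
have slice (f : R -> R -> R) : Ck_on setT 0 f ->
    (forall x, continuous (f ^~ x)) /\ (forall t, continuous (f t)).
  move=> cf; split => [x t|t x].
    have h : {for t, continuous (fun t => (t, x))}.
      by apply: (@cvg_pair _ _ _ _ (nbhs t) (nbhs x)); [exact: cvg_id|exact: cvg_cst].
    exact: (continuous_comp h (cf (t, x) I)).
  have h : {for x, continuous (fun x => (t, x))}.
    by apply: (@cvg_pair _ _ _ _ (nbhs t) (nbhs x)); [exact: cvg_cst|exact: cvg_id].
  exact: (continuous_comp h (cf (t, x) I)).
have meas (f : R -> R -> R) : Ck_on setT 0 f -> measurable_fun setT (fun z : R * R => f z.1 z.2).
  move=> /slice[ct cx]; apply: measurable_partially_continuous => // t.
  exact: continuous_measurable_fun.
have bnd (f : R -> R -> R) : Ck_on setT 0 f -> (forall t x, (M < `|t|) || (M < `|x|) -> f t x = 0) ->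
    exists2 K, 0 <= K & forall t x, `|f t x| <= K * (1 + x ^+ 2)^-1.
  move=> cf f0; pose A := `[- M, M]%classic `*` `[- M, M]%classic : set (R * R).
  have cA : compact (unc f @` A).
    apply: continuous_compact; last by apply: compact_setX; exact: segment_compact.
    by apply: continuous_subspaceT => z; exact: cf.
  have [B [_ HB]] := compact_bounded cA.
  pose B' := `|B| + 1.
  have fB t x : `|t| <= M -> `|x| <= M -> `|f t x| <= B'.
    move=> tM xM; apply: (HB B'); first by rewrite /B' (le_lt_trans (ler_norm B))// ltrDl.
    by exists (t, x) => //; split; rewrite /= in_itv/= -ler_norml.
  exists (B' * (1 + M ^+ 2)) => [|t x]; first by rewrite mulr_ge0// addr_ge0// sqr_ge0.
  have p : 0 < 1 + x ^+ 2 by rewrite ltr_wpDr ?sqr_ge0.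
  rewrite ler_pdivlMr//; have [h|] := boolP ((M < `|t|) || (M < `|x|)).
    by rewrite f0// normr0 mul0r mulr_ge0// addr_ge0// sqr_ge0.
  rewrite negb_or -!leNgt => /andP[tM xM].
  apply: ler_pM => //; [by rewrite ltW|exact: fB|rewrite lerD2l -(real_normK (num_real x))].
  by rewrite ler_pXn2r ?nnegrE// (le_trans _ xM).
have loc0 (f : R -> R) (a : R) : (\near a, f a = 0) -> derive1 f a = 0.
  move=> h; rewrite derive1E (near_eq_derive (g := cst 0)) ?derive_cst//.
have gtM (a : R) : M < `|a| -> \near a, M < `|a| by exact: (cvgr_gt _ (@norm_continuous _ R a)).
have [K0 K00 HK0] := bnd phi c0 supp.
have [K1 K10 HK1] : exists2 K, 0 <= K & forall t x, `|dt phi t x| <= K * (1 + x ^+ 2)^-1.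
  apply: (bnd (dt phi) c1) => t x /orP[h|h]; apply: loc0; last by near=> s; rewrite supp// h orbT.
  by have := gtM _ h; apply: filterS => s hs; rewrite supp// hs.
have [K2 K20 HK2] : exists2 K, 0 <= K & forall t x, `|dx phi t x| <= K * (1 + x ^+ 2)^-1.
  apply: (bnd (dx phi) c2) => t x /orP[h|h]; apply: loc0; first by near=> s; rewrite supp// h.
  by have := gtM _ h; apply: filterS => s hs; rewrite supp// hs orbT.
split.
- by move=> t x; have [d _] := d1 (t, x) I; apply: DeriveDef => //; rewrite /dt derive1E.
- by move=> t x; have [_ d] := d1 (t, x) I; apply: DeriveDef => //; rewrite /dx derive1E.
- by split; [exact: (slice _ c1).1|exact: (slice _ c2).2].
- by split; [exact: (meas phi c0)|exact: (meas (dt phi) c1)|exact: (meas (dx phi) c2)].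
- exists (K0 + K1 + K2) => [|t x]; first by rewrite !addr_ge0.
  have p : 0 <= (1 + x ^+ 2)^-1 by rewrite invr_ge0 addr_ge0// sqr_ge0.
  split; [apply: le_trans (HK0 t x) _|apply: le_trans (HK1 t x) _|apply: le_trans (HK2 t x) _];
    by rewrite ler_wpM2r//; lra.
Unshelve. all: by end_near. Qed.

Lemma integrable_cut_powR (s : R) : s < 1 ->
  leb.-integrable setT (EFin \o (fun t : R => (0 < t <= 2)%R%:R * t `^ (- s))).
Proof.
move=> s1.
have mb : measurable_fun setT (fun t : R => ((0 < t <= 2)%R%:R : R)).
  apply: (measurableT_comp (f := fun b : bool => (b%:R : R))) => //.
  by apply: measurable_and; [exact: measurable_fun_ltr|exact: measurable_fun_ler].
have mt : measurable_fun setT (fun t : R => (0 < t <= 2)%R%:R * t `^ (- s)).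
  by apply: measurable_funM => //; exact: measurable_powR.
(* On the support (1 + t)^2 <= (1 + 2)^2 = 9. *)
have w (t : R) (r : R) : 0 < t <= 2 -> t `^ (- r) <= 9 * (`|t| `^ (- r) / (1 + `|t|) ^+ 2).
  move=> /andP[t0 t2]; rewrite gtr0_norm// mulrCA ler_peMr ?powR_ge0//.
  rewrite ler_pdivlMr ?exprn_gt0 ?addr_gt0// mul1r.
  rewrite (_ : 9 = 3 ^+ 2); last by ring.
  by rewrite ler_pXn2r ?nnegrE ?addr_ge0 ?(ltW t0)//; lra.
have [s0|s0] := leP 0 s.
  have sw : 0 <= s < 1 by rewrite s0.
  apply: integrable_dom (integrableRZ 9 measurableT (integrable_powR_weight sw)) => // t _.
  rewrite ger0_norm; last by rewrite mulr_ge0 ?powR_ge0.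
  have [h|h] := boolP (0 < t <= 2); first by rewrite mul1r; exact: w.
  by rewrite mul0r mulr_ge0// mulr_ge0 ?powR_ge0// invr_ge0 exprn_ge0// addr_ge0.
have z0 : 0 <= (0 : R) < 1 by rewrite lexx ltr01.
apply: integrable_dom (integrableRZ (2 `^ (- s) * 9) measurableT (integrable_powR_weight z0)) => // t _.
rewrite ger0_norm; last by rewrite mulr_ge0 ?powR_ge0.
have wn : 0 <= `|t| `^ (- 0) / (1 + `|t|) ^+ 2.
  by rewrite mulr_ge0 ?powR_ge0// invr_ge0 exprn_ge0// addr_ge0.
have [h|h] := boolP (0 < t <= 2); last by rewrite mul0r !mulr_ge0 ?powR_ge0.
rewrite mul1r -mulrA -[leLHS]mulr1; apply: ler_pM; rewrite ?powR_ge0//.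
  by case/andP: h => t0 t2; apply: ge0_ler_powR; rewrite ?nnegrE ?(ltW t0) ?oppr_ge0// ltW.
by have := w t 0 h; rewrite oppr0 powRr0.
Qed.

End Planar_functions.

Section Cutoff.
Context {R : realType}.
Local Notation leb := (@lebesgue_measure R).
Local Notation leb2 := (leb \x leb)%E.
Implicit Types (z : R -> R) (F : R -> R -> R).

(** A cutoff of class C^1, equal to 1 for t <= 1 and to 0 for t >= 2, built from truncated
    squares. *)
Definition zeta (t : R) := pospow 2 (1 - pospow 2 (t - 1)).
Definition zeta1 (t : R) :=
  2 * pospow 1 (1 - pospow 2 (t - 1)) * - (2 * pospow 1 (t - 1)).

Lemma is_derive_zeta (t : R) : is_derive t 1 zeta (zeta1 t).
Proof.
have d0 : is_derive t 1 (fun t : R => t - 1) 1.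
  by apply: (is_derive_eq (is_deriveB (is_derive_id t (1 : R)) (is_derive_cst (1 : R) t 1))); rewrite subr0.
have d1 := @is_derive1_comp R (pospow 2) _ t _ _ (is_derive_pospow 0 (t - 1)) d0.
have d2 := is_deriveB (is_derive_cst (1 : R) t 1) d1; rewrite mulr1 sub0r in d2.
exact: (@is_derive1_comp R (pospow 2) _ t _ _ (is_derive_pospow 0 _) d2).
Qed.

Let pp_ge0 n (s : R) : 0 <= pospow n s.
Proof. by rewrite exprn_ge0// le_max lexx. Qed.

Let pp_le1 n (s : R) : s <= 1 -> pospow n s <= 1.
Proof. by move=> s1; rewrite exprn_ile1 ?le_max ?lexx// ge_max ler01. Qed.

Let pp0 n (s : R) : s <= 0 -> pospow n.+1 s = 0.
Proof. by move=> s0; rewrite /pospow (max_idPl s0) expr0n. Qed.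

Lemma continuous_zeta1 : continuous zeta1.
Proof.
have c1 n (c : R -> R) : continuous c -> continuous (fun t => pospow n (c t)).
  by move=> cc t; apply: continuous_comp; [exact: cc|exact: continuous_pospow].
have cm : continuous (fun t : R => t - 1) by move=> t; apply: cvgB; [exact: cvg_id|exact: cvg_cst].
have ci : continuous (fun t : R => 1 - pospow 2 (t - 1)).
  by move=> t; apply: cvgB; [exact: cvg_cst|exact: (c1 2%N _ cm)].
move=> t; apply: cvgM; first by apply: cvgMr; exact: (c1 1%N _ ci).
by apply: cvgN; apply: cvgMr; exact: (c1 1%N _ cm).
Qed.

Lemma continuous_zeta : continuous zeta.
Proof. by move=> t; exact: is_derive_continuous (is_derive_zeta t). Qed.

Lemma zeta_id (t : R) : t <= 1 -> zeta t = 1.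
Proof.
move=> t1; have e : pospow 2 (t - 1) = 0 by rewrite pp0// subr_le0.
by rewrite /zeta e subr0 /pospow (max_idPr ler01) expr1n.
Qed.

Let far (t : R) : 2 <= t -> 1 - pospow 2 (t - 1) <= 0.
Proof.
move=> t2; have h : 1 <= Num.max 0 (t - 1) by rewrite le_max; apply/orP; right; lra.
by rewrite subr_le0 /pospow expr_ge1// (le_trans _ h).
Qed.

Lemma zeta_far (t : R) : 2 <= t -> zeta t = 0 /\ zeta1 t = 0.
Proof.
move=> /far h; have e n : pospow n.+1 (1 - pospow 2 (t - 1)) = 0 by exact: pp0.
by rewrite /zeta /zeta1 !e mulr0 mul0r.
Qed.

(** The bound 1 holds; 4 is the bound for [zeta1], used for both so that they satisfy the same
    predicate [cutoff]. *)
Lemma zeta_le (t : R) : `|zeta t| <= 4.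
Proof.
rewrite ger0_norm ?pp_ge0// (@le_trans _ _ 1)//; last by rewrite ler1n.
by apply: pp_le1; rewrite gerBl.
Qed.

Lemma zeta1_le (t : R) : `|zeta1 t| <= 4.
Proof.
have [t2|t2] := leP 2 t; first by rewrite (zeta_far t2).2 normr0.
have a : pospow 1 (1 - pospow 2 (t - 1)) <= 1 by apply: pp_le1; rewrite gerBl.
have b : pospow 1 (t - 1) <= 1 by apply: pp_le1; lra.
rewrite /zeta1 normrM normrN ger0_norm ?mulr_ge0// ger0_norm ?mulr_ge0//.
have := ler_pM (pp_ge0 _ _) (pp_ge0 _ _) a b; lra.
Qed.

(** Removing the line x = 0 changes nothing almost everywhere and makes bounds by [omega], valid off
    that line, hold at every point. *)
Definition cutf z F (t x : R) := (0 < t)%R%:R * ((x != 0)%R%:R * (z t * F t x)).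

Definition cutoff z := [/\ continuous z, forall t, `|z t| <= 4 & forall t, 2 <= t -> z t = 0].

Lemma cutoff_zeta : cutoff zeta.
Proof.
by split; [exact: continuous_zeta|exact: zeta_le|move=> t /zeta_far[]].
Qed.
Lemma cutoff_zeta1 : cutoff zeta1.
Proof.
by split; [exact: continuous_zeta1|exact: zeta1_le|move=> t /zeta_far[]].
Qed.

Variables (p th : R).
Hypotheses (p1 : 1 <= p) (th01 : 0 < th < 1) (pth : p * th < 1).

Definition controlled (mu : R) F := exists2 C, 0 <= C & forall t x, 0 < t <= 2 -> x != 0 ->
  `|F t x| <= C * t `^ (- mu) * omega th x.

Let bump (mu t : R) := (0 < t <= 2)%R%:R * t `^ (- mu).

Let bump_ge0 mu t : 0 <= bump mu t.
Proof. by rewrite mulr_ge0 ?powR_ge0. Qed.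

Lemma cutf_dom z F mu : cutoff z -> controlled mu F ->
  exists2 C, 0 <= C & forall t x, `|cutf z F t x| <= C * bump mu t * omega th x.
Proof.
move=> [cz z4 z0] [C C0 HC]; exists (4 * C) => [|t x]; first by rewrite mulr_ge0.
have r0 y : 0 <= 4 * C * bump mu t * omega th y.
  by apply: mulr_ge0; [apply: mulr_ge0 => //; exact: mulr_ge0|exact: omega_ge0].
have [t0|t0] := ltP 0 t; last by rewrite /cutf ltNge t0 mul0r normr0.
have [->|x0] := eqVneq x 0; first by rewrite /cutf eqxx mul0r mulr0 normr0.
have [t2|/ltW t2] := leP t 2; last by rewrite /cutf z0// mul0r !mulr0 normr0.
rewrite /cutf t0 x0 !mul1r /bump t0 t2 mul1r normrM.
have ht : 0 < t <= 2 by rewrite t0.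
by rewrite -!mulrA; apply: ler_pM => //; rewrite mulrA; exact: HC.
Qed.

Let mpos : measurable_fun setT (fun t : R => ((0 < t)%R%:R : R)).
Proof.
apply: (measurableT_comp (f := fun b : bool => (b%:R : R))) => //.
exact: measurable_fun_ltr.
Qed.

Let mneq : measurable_fun setT (fun x : R => ((x != 0)%R%:R : R)).
Proof.
apply: (measurableT_comp (f := fun b : bool => (b%:R : R))) => //.
by apply: measurable_neg; exact: measurable_fun_eqr.
Qed.

Lemma measurable_cutf z F : cutoff z -> measurable_fun setT (unc F) ->
  measurable_fun setT (unc (cutf z F)).
Proof.
move=> [cz _ _] mF; apply: measurable_funM; first exact: (measurableT_comp mpos).
apply: measurable_funM; first exact: (measurableT_comp mneq).
by apply: measurable_funM => //; exact: (measurableT_comp (continuous_measurable_fun cz)).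
Qed.

Lemma cutf_Lp z F mu : cutoff z -> measurable_fun setT (unc F) -> controlled mu F ->
  p * mu < 1 -> in_Lp2 p (cutf z F).
Proof.
move=> cz mF cF pmu; have [C C0 HC] := cutf_dom cz cF.
have p0 : 0 < p by exact: lt_le_trans p1.
have mW := measurable_cutf cz mF.
apply: Lfun_integrable_powR => //.
apply: (@integrable_prod_dom _ _ _ _ R leb leb (fun t x => `|cutf z F t x| `^ p)
  (fun t => C `^ p * bump (p * mu) t) (fun x => omega th x `^ p)).
- by apply: (measurableT_comp (measurable_powR _)); exact: measurableT_comp.
- by apply: integrableRZ => //; exact: integrable_cut_powR.
- exact: integrable_omega_powR.
- move=> t x; rewrite ger0_norm ?powR_ge0//.
  apply: (@le_trans _ _ ((C * bump mu t * omega th x) `^ p)).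
    by apply: ge0_ler_powR; rewrite ?nnegrE ?(ltW p0)// mulr_ge0 ?omega_ge0// mulr_ge0.
  rewrite !powRM ?omega_ge0 ?mulr_ge0// ?powR_ge0// ler_wpM2r ?powR_ge0// ler_wpM2l ?powR_ge0//.
  rewrite -powRrM mulNr [mu * p]mulrC ler_wpM2r ?powR_ge0//.
  by case: (0 < t <= 2); rewrite ?powR1// powR0// gt_eqF.
Qed.

Lemma cutf_integrable z F psi mu B : cutoff z -> measurable_fun setT (unc F) ->
  controlled mu F -> mu < 1 -> measurable_fun setT (unc psi) ->
  (forall t x, `|psi t x| <= B) ->
  leb2.-integrable setT (fun y : R * R => (cutf z F y.1 y.2 * psi y.1 y.2)%:E) /\
  forall x, leb.-integrable setT (EFin \o (fun t => cutf z F t x * psi t x)).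
Proof.
move=> cz mF cF mu1 mpsi psiB; have [C C0 HC] := cutf_dom cz cF.
have B0 : 0 <= B by rewrite (le_trans _ (psiB 0 0)).
have mW := measurable_cutf cz mF.
have bi := integrable_cut_powR mu1.
have dom t x : `|cutf z F t x * psi t x| <= B * C * bump mu t * omega th x.
  apply: (@le_trans _ _ (B * (C * bump mu t * omega th x))); last by rewrite !mulrA.
  by rewrite normrM mulrC; apply: ler_pM.
have mm : measurable_fun setT (fun y : R * R => cutf z F y.1 y.2 * psi y.1 y.2).
  exact: measurable_funM.
split => [|x].
  apply: (@integrable_prod_dom _ _ _ _ R leb leb (fun t x => cutf z F t x * psi t x)
    (fun t => B * C * bump mu t) (omega th)) => //.
    exact: integrableRZ.
  exact: integrable_omega.
apply: integrable_dom (integrableRZ (B * C * omega th x) measurableT bi) => //.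
  exact: (measurableT_comp mm (pair2_measurable x)).
by move=> t _; have := dom t x; rewrite /bump [leRHS]mulrAC.
Qed.

Let test_le K x : 0 <= K -> K * (1 + x ^+ 2)^-1 <= K :> R.
Proof.
move=> K0; rewrite ler_piMr// invf_le1 ?lerDl ?sqr_ge0//.
by rewrite ltr_wpDr ?sqr_ge0.
Qed.

Let int0 (f : R -> R) : (forall x, f x = 0) -> \int[leb]_x f x = 0.
Proof.
move=> f0; rewrite (_ : f = fun=> 0); last exact/funext.
by rewrite /Rintegral integral0.
Qed.

(** For each t the function is differentiable and bounded in x, so the identity is integration by
    parts on the slice, the line x = 0 being negligible. The conditions on [mu] and [mu'] serve
    Fubini. *)
Lemma weak_dx_cutf z F F' mu mu' : cutoff z ->
  measurable_fun setT (unc F) -> measurable_fun setT (unc F') ->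
  controlled mu F -> controlled mu' F' -> mu < 1 -> mu' < 1 ->
  (forall t x : R, 0 < t -> is_derive x 1 (F t) (F' t x)) ->
  (forall t, 0 < t -> continuous (F' t)) ->
  (forall t, 0 < t <= 2 -> exists B, forall x, `|F t x| <= B /\ `|F' t x| <= B) ->
  weak_dx (cutf z F) (cutf z F').
Proof.
move=> cz mF mF' cF cF' mu1 mu1' dF cF'c bF phi tphi.
have [_ d2 [_ cx] [m0 _ m2] [K K0 HK]] := test_fun_bound tphi.
have HK0 t x : `|phi t x| <= K by have [h _ _] := HK t x; exact: le_trans h (test_le x K0).
have HK2 t x : `|dx phi t x| <= K by have [_ _ h] := HK t x; exact: le_trans h (test_le x K0).
have [i1 _] := cutf_integrable cz mF cF mu1 m2 HK2.
have [i2 _] := cutf_integrable cz mF' cF' mu1' m0 HK0.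
have e1 : \int[Defs.leb2]_y (cutf z F y.1 y.2 * dx phi y.1 y.2) =
    \int[leb]_t \int[leb]_x (cutf z F t x * dx phi t x).
  exact: (@Rfubini1 _ _ _ _ R leb leb (fun t x => cutf z F t x * dx phi t x) i1).
have e2 : \int[Defs.leb2]_y (cutf z F' y.1 y.2 * phi y.1 y.2) =
    \int[leb]_t \int[leb]_x (cutf z F' t x * phi t x).
  exact: (@Rfubini1 _ _ _ _ R leb leb (fun t x => cutf z F' t x * phi t x) i2).
rewrite e1 e2 -mulN1r -RintegralZl//; last first.
  exact: (@integrable_Rfubini _ _ _ _ R leb leb (fun t x => cutf z F' t x * phi t x) i2).
apply: eq_Rintegral => t _; have [cz' z4 z0] := cz.
have [t0|t0] := ltP 0 t; last first.
  have zz (g psi : R -> R -> R) : \int[leb]_x (cutf z g t x * psi t x) = 0.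
    by apply: int0 => x; rewrite /cutf ltNge t0 !mul0r.
  by rewrite !zz mulr0.
have [t2|/ltW t2] := leP t 2; last first.
  have zz (g psi : R -> R -> R) : \int[leb]_x (cutf z g t x * psi t x) = 0.
    by apply: int0 => x; rewrite /cutf z0// !(mul0r, mulr0).
  by rewrite !zz mulr0.
have [B HB] : exists B, forall x, `|F t x| <= B /\ `|F' t x| <= B by apply: bF; rewrite t0.
have B0 : 0 <= B by have [h _] := HB 0; exact: le_trans h.
have mt (f : R -> R -> R) : measurable_fun setT (unc f) -> measurable_fun setT (f t).
  by move=> mf; exact: (measurableT_comp mf (pair1_measurable t)).
have gi (g psi : R -> R) : measurable_fun setT g -> measurable_fun setT psi ->
    (forall x, `|g x| <= B) -> (forall x, `|psi x| <= K * (1 + x ^+ 2)^-1) ->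
    leb.-integrable setT (EFin \o (fun x => g x * psi x)).
  move=> mg mp gB pK.
  apply: integrable_dom (integrableRZ (B * K) measurableT (@integrable_oneDsqrV R)) => //.
    exact: measurable_funM.
  by move=> x _; rewrite normrM -mulrA; exact: ler_pM.
have cutE (f psi : R -> R -> R) : measurable_fun setT (unc f) -> measurable_fun setT (unc psi) ->
    leb.-integrable setT (EFin \o (fun x => f t x * psi t x)) ->
    \int[leb]_x (cutf z f t x * psi t x) = z t * \int[leb]_x (f t x * psi t x).
  move=> mf mp fi; rewrite -RintegralZl//; apply: (Rintegral_off (c := 0)).
  - apply: measurable_funM; last exact: mt.
    exact: (mt _ (measurable_cutf cz mf)).
  - by apply: measurable_funM => //; apply: measurable_funM; exact: mt.
  - by move=> x x0; rewrite /cutf t0 x0 !mul1r mulrA.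
have a1 : leb.-integrable setT (EFin \o (fun x => F t x * dx phi t x)).
  by apply: gi => [||x|x]; [exact: mt|exact: (mt _ m2)|have [] := HB x|have [] := HK t x].
have a2 : leb.-integrable setT (EFin \o (fun x => F' t x * phi t x)).
  by apply: gi => [||x|x]; [exact: mt|exact: (mt _ m0)|have [] := HB x|have [] := HK t x].
rewrite (cutE _ _ mF m2 a1) (cutE _ _ mF' m0 a2) mulrCA; congr (_ * _).
apply/eqP; rewrite mulN1r -addr_eq0 -RintegralD//; apply/eqP.
have cphi : continuous (phi t) by move=> x; exact: is_derive_continuous (d2 t x).
have cFt : continuous (F t) by move=> x; exact: is_derive_continuous (dF t x t0).
apply: (@integral_derive_eq0 _ _ (fun x => F t x * phi t x) (B * K)) => //.
- exact: integrableRD a1 a2.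
- move=> x; apply: (is_derive_eq (is_deriveM (dF t x t0) (d2 t x))).
  by rewrite /GRing.scale/= [phi t x * _]mulrC.
- move=> x; apply: cvgD; apply: cvgM; [exact: cFt|exact: cx|exact: cF'c|exact: cphi].
- by move=> x; rewrite normrM -mulrA; apply: ler_pM => //; [have [] := HB x|have [] := HK t x].
Qed.

(** The condition mu < 0 forces F to tend to 0 as t decreases to 0 for every fixed x != 0, so that
    extension by zero produces no boundary term; at the other end [zeta] vanishes. The second
    summand of the derivative comes from differentiating [zeta]. *)
Lemma weak_dt_cutf F F' mu mu' :
  measurable_fun setT (unc F) -> measurable_fun setT (unc F') ->
  controlled mu F -> controlled mu' F' -> mu < 0 -> mu' < 1 ->
  (forall t x : R, 0 < t -> is_derive t 1 (F ^~ x) (F' t x)) ->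
  (forall t x, 0 < t -> {for t, continuous (F' ^~ x)}) ->
  weak_dt (cutf zeta F) (fun t x => cutf zeta F' t x + cutf zeta1 F t x).
Proof.
move=> mF mF' cF cF' mu0 mu1' dF cF'c phi tphi.
have mu1 : mu < 1 by exact: lt_trans mu0 ltr01.
have [d1 _ [ct _] [m0 m1 _] [K K0 HK]] := test_fun_bound tphi.
have HK0 t x : `|phi t x| <= K by have [h _ _] := HK t x; exact: le_trans h (test_le x K0).
have HK1 t x : `|dt phi t x| <= K by have [_ h _] := HK t x; exact: le_trans h (test_le x K0).
have [i1 j1] := cutf_integrable cutoff_zeta mF cF mu1 m1 HK1.
have [i2 j2] := cutf_integrable cutoff_zeta mF' cF' mu1' m0 HK0.
have [i3 j3] := cutf_integrable cutoff_zeta1 mF cF mu1 m0 HK0.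
pose f t x := cutf zeta F t x * dt phi t x +
  (cutf zeta F' t x * phi t x + cutf zeta1 F t x * phi t x).
have i23 := integrableRD (m := leb2) measurableT i2 i3.
have i123 := integrableRD (m := leb2) measurableT i1 i23.
apply/eqP; rewrite -addr_eq0 /Defs.leb2.
rewrite (_ : \int[leb2]_y ((cutf zeta F' y.1 y.2 + cutf zeta1 F y.1 y.2) * phi y.1 y.2) =
  \int[leb2]_y (cutf zeta F' y.1 y.2 * phi y.1 y.2 + cutf zeta1 F y.1 y.2 * phi y.1 y.2)); last first.
  by apply: eq_Rintegral => y _; rewrite mulrDl.
rewrite -(RintegralD (mu := leb2) measurableT i1 i23); apply/eqP.
have i4 : leb2.-integrable setT (fun y : R * R => (f y.1 y.2)%:E) by exact: i123.
transitivity (\int[leb]_x \int[leb]_t f t x); first exact: (@Rfubini2 _ _ _ _ R leb leb f i4).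
apply: int0 => x.
have [->|x0] := eqVneq x 0.
  by apply: int0 => t; rewrite /f /cutf eqxx !(mul0r, mulr0) !addr0.
pose h t := zeta t * F t x * dt phi t x + (zeta t * F' t x + zeta1 t * F t x) * phi t x.
have fi : leb.-integrable setT (EFin \o (fun t => f t x)).
  exact: integrableRD (j1 x) (integrableRD measurableT (j2 x) (j3 x)).
have fE : (fun t => f t x) = h \_ `]0, +oo[.
  apply/funext => t; rewrite patchE mem_setE in_itv/= andbT /f /cutf x0.
  by have [t0|t0] := ltP 0 t; rewrite ?mul0r ?addr0// /h !mul1r -mulrDl.
have fh t : 0 < t -> f t x = h t.
  move=> t0; have -> : f t x = (h \_ `]0, +oo[) t by rewrite -fE.
  by rewrite patchE mem_setE in_itv/= t0.
have mI : measurable (`]0, +oo[%classic : set R) by exact: measurable_itv.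
rewrite /= fE -Rintegral_mkcond.
have hi : leb.-integrable `]0, +oo[%classic (EFin \o h).
  have fi' : leb.-integrable `]0, +oo[%classic (EFin \o (fun t => f t x)) by exact: integrableRT.
  apply: eq_integrable fi' => //.
  by move=> t; rewrite inE/= in_itv/= andbT => t0; rewrite /= fh.
transitivity ((0 : R) - 0); last by rewrite subr0.
apply: (FTC_half_line (F := fun t => zeta t * F t x * phi t x)) => //.
- move=> t t0.
  have a := is_deriveM (is_derive_zeta t) (dF t x t0).
  apply: (is_derive_eq (is_deriveM a (d1 t x))).
  have -> : (zeta * F^~ x) t = zeta t * F t x by [].
  by rewrite /GRing.scale/= /h; ring.
- move=> t t0; have cF0 : {for t, continuous (F ^~ x)} by exact: is_derive_continuous (dF t x t0).
  have cp : {for t, continuous (phi ^~ x)} by exact: is_derive_continuous (d1 t x).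
  apply: cvgD; first by apply: cvgM; [apply: cvgM; [exact: continuous_zeta|exact: cF0]|exact: ct].
  apply: cvgM; last exact: cp.
  apply: cvgD; apply: cvgM; [exact: continuous_zeta|exact: cF'c|exact: continuous_zeta1|exact: cF0].
- have [C C0 HC] := cF.
  have l0 : t `^ (- mu) @[t --> 0^'+] --> (0 : R).
    have mu0' : 0 < - mu by rewrite oppr_gt0.
    exact: powR_cvg0.
  have l1 : 4 * C * omega th x * K * t `^ (- mu) @[t --> 0^'+] --> (0 : R).
    by rewrite -[X in _ --> X](mulr0 (4 * C * omega th x * K)); apply: cvgMr.
  have l2 : - (4 * C * omega th x * K) * t `^ (- mu) @[t --> 0^'+] --> (0 : R).
    by rewrite -[X in _ --> X](mulr0 (- (4 * C * omega th x * K))); apply: cvgMr.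
  apply: (squeeze_cvgr _ l2 l1); near=> t.
  have ht : 0 < t <= 2 by apply/andP; split; near: t; [exact: nbhs_right_gt|exact: nbhs_right_le].
  rewrite mulNr -ler_norml normrM (normrM (zeta t)).
  apply: (@le_trans _ _ (4 * (C * t `^ (- mu) * omega th x) * K)).
    by apply: ler_pM => //; apply: ler_pM => //; [exact: zeta_le|exact: HC].
  by rewrite le_eqVlt; apply/orP; left; apply/eqP; ring.
- apply: cvg_near_cst; near=> t.
  have t2 : 2 <= t by near: t; exact: nbhs_pinfty_ge.
  by rewrite (zeta_far t2).1 !mul0r.
Unshelve. all: by end_near. Qed.

End Cutoff.

(** * The self-similar solution *)

Section Bessel_norm.
Context {R : realType}.
Local Notation leb := (@lebesgue_measure R).
Variable p : R.
Hypothesis p1 : 1 <= p.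
Let p0 : 0 < p. Proof. exact: lt_le_trans p1. Qed.

Let E (x : R) := 2 * expR (- (2^-1 * `|x|)).
Let E0 x : 0 <= E x. Proof. by rewrite mulr_ge0 ?expR_ge0. Qed.
Let mE : measurable_fun setT E.
Proof.
by apply: measurable_funM => //; do 2 apply: measurableT_comp => //; exact: measurable_funM.
Qed.

Let Ei : leb.-integrable setT (EFin \o (fun x => E x `^ p)).
Proof.
have ph : 0 < p / 2 by rewrite divr_gt0.
have := integrableRZ (2 `^ p) measurableT (integrable_expR_norm ph).1.
apply: integrable_dom => //; first by apply: (measurableT_comp (measurable_powR _)).
move=> x _; rewrite ger0_norm ?powR_ge0// /E powRM ?expR_ge0// ler_wpM2l ?powR_ge0//.
by rewrite -expRM ler_expR le_eqVlt; apply/orP; left; apply/eqP; field.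
Qed.

Definition bessel_normC := (\int[leb]_x (E x `^ p)) `^ p^-1.

Lemma bessel_Lfun (f : R -> R) M : measurable_fun setT f ->
  (forall y, `|f y| <= M * expR (- `|y|)) ->
  bessel f \in Lfun leb p%:E /\
  ('N[leb]_(p%:E)[EFin \o bessel f] <= (M * bessel_normC)%:E)%E.
Proof.
move=> mf fM.
have M0 : 0 <= M by have := fM 0; rewrite normr0 oppr0 expR0 mulr1; exact: le_trans.
have mb : measurable_fun setT (bessel f).
  apply: (@measurable_bessel0 R _ R (fun x w => f (x - w))).
  by apply: measurableT_comp => //; exact: measurable_funB.
have bE x : `|bessel f x| `^ p <= M `^ p * E x `^ p.
  rewrite -powRM//; apply: ge0_ler_powR; rewrite ?nnegrE ?(ltW p0)//; first exact: mulr_ge0.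
  by rewrite (le_trans (bessel_decay x mf fM))// /E mulrA [M * 2]mulrC.
have mbp : measurable_fun setT (fun x => `|bessel f x| `^ p).
  by apply: (measurableT_comp (measurable_powR _)); exact: measurableT_comp.
have MEi := integrableRZ (M `^ p) measurableT Ei.
have bi : leb.-integrable setT (EFin \o (fun x => `|bessel f x| `^ p)).
  by apply: integrable_dom MEi => // x _; rewrite ger0_norm ?powR_ge0.
split; first exact: Lfun_integrable_powR.
have -> : 'N[leb]_(p%:E)[EFin \o bessel f]%E = ((\int[leb]_x (`|bessel f x| `^ p)) `^ p^-1)%:E.
  rewrite unlock /Lnorm -poweR_EFin; congr poweR.
  rewrite /Rintegral fineK; last exact: (integrable_fin_num _ bi).
  by apply: eq_integral => x _.
rewrite lee_fin /bessel_normC.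
have I0 : 0 <= \int[leb]_x (E x `^ p) by apply: Rintegral_ge0 => x _; exact: powR_ge0.
have -> : M * (\int[leb]_x (E x `^ p)) `^ p^-1 = (M `^ p * \int[leb]_x (E x `^ p)) `^ p^-1.
  by rewrite powRM ?powR_ge0// -powRrM mulfV ?gt_eqF// powRr1.
apply: ge0_ler_powR.
- by rewrite invr_ge0 ltW.
- by rewrite nnegrE; apply: Rintegral_ge0 => x _; exact: powR_ge0.
- by rewrite nnegrE; apply: mulr_ge0 => //; exact: powR_ge0.
- by rewrite -RintegralZl//; apply: le_Rintegral.
Qed.

(** By [bessel_dual] the function [bessel f] is an L_p preimage of [T], so its norm bounds the
    infimum that defines the H^-1 norm. *)
Lemma bessel_preimage (T : distr) (f : R -> R) M : measurable_fun setT f ->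
  (forall y, `|f y| <= M * expR (- `|y|)) ->
  (forall phi, schwartz phi -> T phi = \int[leb]_x (f x * phi x)) ->
  in_H (-1) p T /\ (0 <= H_norm (-1) p T <= (M * bessel_normC)%:E)%E.
Proof.
move=> mf fM TE; have [Lf nf] := bessel_Lfun mf fM.
have P : H_preimage (-1) p T (bessel f).
  split => // phi sp; rewrite TE// /distr_Lambda /regd opprK.
  by rewrite (bessel_dual mf sp fM).
split; first by exists (bessel f).
apply/andP; split; first by apply: le_ereal_inf_tmp => _ [h _ <-]; exact: Lnorm_ge0.
by apply: le_trans nf; apply: ereal_inf_lbound; exists (bessel f).
Qed.

End Bessel_norm.

Section Self_similar_calculus.
Context {R : realType}.
Local Notation leb := (@lebesgue_measure R).
Implicit Types (G : R -> R) (m : R).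

Lemma decay_schwartz_integrable (f phi : R -> R) M : measurable_fun setT f ->
  (forall y, `|f y| <= M * expR (- `|y|)) -> schwartz phi ->
  leb.-integrable setT (EFin \o (fun x => f x * phi x)).
Proof.
move=> mf fM sp; have [K HK] := schwartz_bounded sp.
have M0 : 0 <= M by have := fM 0; rewrite normr0 oppr0 expR0 mulr1; exact: le_trans.
have K0 : 0 <= K by exact: le_trans (HK 0).
apply: integrable_dom (integrableRZ (M * K) measurableT (@integrable_expRN R)) => //.
  by apply: measurable_funM => //; exact: schwartz_measurable.
move=> x _; rewrite normrM mulrAC; exact: ler_pM.
Qed.

Lemma selfsim_at m G t : 0 < t <= 2 -> superexp_decay G ->
  exists M, forall y, `|selfsim m G t y| <= M * expR (- `|y|).
Proof. by move=> ht /(selfsim_decay m)[C C0 HC]; exists (C * t `^ (- m)) => y; exact: HC. Qed.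

Lemma selfsim_parts m G G' t phi : 0 < t <= 2 ->
  (forall y : R, is_derive y 1 G (G' y)) -> continuous G' ->
  superexp_decay G -> superexp_decay G' -> schwartz phi ->
  \int[leb]_x (selfsim (m + 2^-1) (dxprof G') t x * phi x) =
  - \int[leb]_x (selfsim m G t x * derive1 phi x).
Proof.
move=> ht dG cG' sG sG' sp; have sp1 := schwartz_derive sp.
have /andP[t0 _] := ht.
have cG : continuous G by move=> y; exact: is_derive_continuous (dG y).
have cD : continuous (dxprof G') by move=> y; apply: cvgMr; exact: cG'.
have c0 := @selfsim_continuous R m G t cG.
have c1 := @selfsim_continuous R (m + 2^-1) _ t cD.
have [M0 H0] := selfsim_at m ht sG.
have [M1 H1] := selfsim_at (m + 2^-1) ht (superexp_dxprof sG').
have i0 := decay_schwartz_integrable (continuous_measurable_fun c0) H0 sp1.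
have i1 := decay_schwartz_integrable (continuous_measurable_fun c1) H1 sp.
have [K K0 HK] := schwartz_le sp.
have M00 : 0 <= M0 by have := H0 0; rewrite normr0 oppr0 expR0 mulr1; exact: le_trans.
apply/eqP; rewrite -addr_eq0 addrC -RintegralD//; apply/eqP.
apply: (@integral_derive_eq0 R (fun x => selfsim m G t x * derive1 phi x +
  selfsim (m + 2^-1) (dxprof G') t x * phi x) (fun x => selfsim m G t x * phi x) (M0 * K)).
- exact: integrableRD i0 i1.
- move=> x; apply: (is_derive_eq (is_deriveM (is_derive_selfsim_x m x t0 dG) (schwartz_is_derive x sp))).
  by rewrite /GRing.scale/= [phi x * _]mulrC.
- move=> x; apply: cvgD; apply: cvgM.
  + exact: c0.
  + exact: schwartz_continuous.
  + exact: c1.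
  + exact: schwartz_continuous.
- move=> x; rewrite normrM -mulrA; apply: ler_pM => //.
  by rewrite (le_trans (H0 x))// ler_piMr// -expR0 ler_expR oppr_le0.
Qed.

Lemma continuous_selfsim2 m G (z : R * R) : 0 < z.1 -> continuous G ->
  {for z, continuous (unc (selfsim m G))}.
Proof.
move=> z0 cG.
have cp c : {for z, continuous (fun y : R * R => y.1 `^ c)}.
  have d := @is_derive_powR_comp R id c z.1 1 z0 (is_derive_id z.1 1).
  by apply: (continuous_comp (f := fst) (g := fun t => t `^ c)); [exact: cvg_fst|exact: is_derive_continuous d].
apply: cvgM; first exact: cp.
apply: (continuous_comp (f := fun y : R * R => simvar y.1 y.2) (g := G)); last exact: cG.
by apply: cvgM; [apply: cvgMr; exact: cvg_snd|exact: cp].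
Qed.

Let near_pos (F F' : R -> R -> R) (z : R * R) : 0 < z.1 ->
  (forall t x : R, 0 < t -> F t x = F' t x) -> {for z, continuous (unc F')} ->
  {for z, continuous (unc F)}.
Proof.
move=> z0 FF c; have n : \near z, 0 < z.1.
  have h : (fst : R * R -> R) y @[y --> z] --> z.1 by exact: cvg_fst.
  exact: (cvgr_gt _ h).
have e : unc F z = unc F' z by rewrite /unc FF.
rewrite /prop_for /continuous_at e; apply: cvg_trans c; apply: near_eq_cvg; apply: filterS n => y y0.
by rewrite /unc FF.
Qed.

Let near_t (F F' : R -> R -> R) (t x : R) : 0 < t -> (forall t x : R, 0 < t -> F t x = F' t x) ->
  \near t, F' t x = F t x.
Proof. by move=> t0 FF; near=> s; rewrite FF//; near: s; exact: lt_nbhsr. Unshelve. all: by end_near. Qed.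

Section derivatives.
Variables (m : R) (G G' : R -> R) (F : R -> R -> R).
Hypothesis dG : forall y : R, is_derive y 1 G (G' y).
Hypothesis FE : forall t x : R, 0 < t -> F t x = selfsim m G t x.

Lemma is_derive_eq_selfsim (t x : R) : 0 < t ->
  is_derive t 1 (F ^~ x) (selfsim (m + 1) (dtprof m G G') t x) /\
  is_derive x 1 (F t) (selfsim (m + 2^-1) (dxprof G') t x).
Proof.
move=> t0; split.
  by apply: near_eq_is_derive (is_derive_selfsim_t m x t0 dG); exact: near_t.
apply: near_eq_is_derive (is_derive_selfsim_x m x t0 dG).
by near=> y; rewrite FE.
Unshelve. all: by end_near. Qed.

Lemma dt_selfsim (t x : R) : 0 < t -> dt F t x = selfsim (m + 1) (dtprof m G G') t x.
Proof. by move=> t0; rewrite /dt derive1E; have [[_ ->] _] := is_derive_eq_selfsim x t0. Qed.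

Lemma dx_selfsim (t x : R) : 0 < t -> dx F t x = selfsim (m + 2^-1) (dxprof G') t x.
Proof. by move=> t0; rewrite /dx derive1E; have [_ [_ ->]] := is_derive_eq_selfsim x t0. Qed.

Lemma derivable_selfsim (t x : R) : Q (t, x) -> derivable (F ^~ x) t 1 /\ derivable (F t) x 1.
Proof.
move=> Qtx; have t0 : 0 < t by case/andP: Qtx.
by have [d1 d2] := is_derive_eq_selfsim x t0; split; [case: d1|case: d2].
Qed.

Lemma C1_selfsim : continuous G' -> Ck_on Q 1 F.
Proof.
move=> cG'; have cG : continuous G by move=> y; exact: is_derive_continuous (dG y).
split; first by move=> [t x]; exact: derivable_selfsim.
  move=> z /andP[z0 _]; apply: (near_pos z0 dt_selfsim); apply: continuous_selfsim2 => // y.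
  apply: cvgB; first by apply: cvgN; apply: cvgMr; exact: cG.
  by apply: cvgMr; apply: cvgM; [exact: cvg_id|exact: cG'].
move=> z /andP[z0 _]; apply: (near_pos z0 dx_selfsim); apply: continuous_selfsim2 => // y.
by apply: cvgMr; exact: cG'.
Qed.

End derivatives.

Let mvt_near (f f' : R -> R) (a b x y : R) :
  (forall s : R, a <= s <= b -> is_derive s 1 f (f' s)) ->
  a <= x <= b -> a <= y <= b ->
  exists2 s, a <= s <= b & f y - f x = f' s * (y - x) /\ `|s - x| <= `|y - x|.
Proof.
move=> df xab yab.
have gen (u v : R) : a <= u -> v <= b -> u < v ->
    exists2 s, u < s < v & f v - f u = f' s * (v - u).
  move=> au vb uv; have sub (s : R) : u <= s <= v -> is_derive s 1 f (f' s).
    by move=> /andP[us sv]; apply: df; rewrite (le_trans au us) (le_trans sv vb).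
  have dI (s : R) : s \in `]u, v[ -> is_derive s 1 f (f' s).
    by rewrite in_itv/= => /andP[us sv]; apply: sub; rewrite !ltW.
  have cf : {within `[u, v], continuous f}.
    apply: continuous_in_subspaceT => s; rewrite inE/= in_itv/= => suv.
    exact: is_derive_continuous (sub s suv).
  by have [s] := MVT uv dI cf; rewrite in_itv/= => suv e; exists s.
move: xab yab => /andP[ax xb] /andP[ay yb].
have [xy|yx|<-] := ltgtP x y.
- have [s /andP[s1 s2] e] := gen _ _ ax yb xy; exists s; first by apply/andP; split; lra.
  by split => //; rewrite !gtr0_norm ?subr_gt0// lerB// ltW.
- have [s /andP[s1 s2] e] := gen _ _ ay xb yx; exists s; first by apply/andP; split; lra.
  split; first by rewrite -[LHS]opprB e; ring.
  by rewrite !ltr0_norm ?subr_lt0// !opprB lerB// ltW.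
- by exists x; [rewrite ax|rewrite !subrr mulr0].
Qed.

(** Two applications of the mean value theorem: the quotient is f' s with |s - t| <= |h|, and f' s -
    f' t is f'' r times s - t. *)
Lemma diff_quotient_le (f f' f'' : R -> R) (a b B t h : R) :
  (forall s : R, a <= s <= b -> is_derive s 1 f (f' s)) ->
  (forall s : R, a <= s <= b -> is_derive s 1 f' (f'' s)) ->
  (forall s : R, a <= s <= b -> `|f'' s| <= B) ->
  a <= t <= b -> a <= t + h <= b -> h != 0 ->
  `|h^-1 * (f (t + h) - f t) - f' t| <= `|h| * B.
Proof.
move=> d1 d2 fB tab thab h0.
have [s sab [e1 l1]] := mvt_near d1 tab thab.
have [r rab [e2 l2]] := mvt_near d2 tab sab.
have th : t + h - t = h by ring.
rewrite th in e1 l1; rewrite e1 mulrC -mulrA mulfV// mulr1 e2 normrM mulrC.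
by apply: ler_pM => //; exact: fB.
Qed.

End Self_similar_calculus.

(** * The solution generated by a given profile *)

Section Solution.
Context {R : realType}.
Local Notation leb := (@lebesgue_measure R).
Variables (p m : R) (g g1 g2 g3 A : R -> R).
Hypotheses (hp : 1 < p < 3 / 2) (m0 : 0 < m) (mp : m < 3 / p - 2).
Hypothesis dg : forall y : R, is_derive y 1 g (g1 y).
Hypothesis dg1 : forall y : R, is_derive y 1 g1 (g2 y).
Hypothesis dg2 : forall y : R, is_derive y 1 g2 (g3 y).
Hypothesis cg3 : continuous g3.
Hypotheses (sg : superexp_decay g) (sg1 : superexp_decay g1)
  (sg2 : superexp_decay g2) (sg3 : superexp_decay g3).
Hypothesis mA : measurable_fun setT A.
Hypothesis Ag2 : forall y, A y * g2 y = - (2 * m * g y + 2 * y * g1 y).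

(** With w = t^(-m/2) g and u = w_x, the numbers [n0] to [n3] are the exponents of w, of u, of u_x
    and the flux, and of u_xx and u_t. *)
Let n0 := m / 2.
Let n1 := n0 + 2^-1.
Let n2 := n1 + 2^-1.
Let n3 := n2 + 2^-1.
Let P1 := dxprof g1.
Let P2 := dxprof (dxprof g2).
Let P3 := dxprof (dxprof (dxprof g3)).
(** Profile of the flux a u_x. By [Ag2] it is A g2 / 4; in this form it is differentiable although A
    is only measurable. *)
Let kv (y : R) := - (2 * m * g y + 2 * y * g1 y) / 4.
Let kv' (y : R) := - ((2 * m + 2) * g1 y + 2 * y * g2 y) / 4.
Let Pt := dtprof n1 P1 (dxprof g2).
Let Pt' (y : R) := - (n1 * dxprof g2 y) - 2^-1 * (dxprof g2 y + y * dxprof g3 y).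

Definition coef (t x : R) := A (simvar t x).
Definition sol := selfsim n1 P1.
Let ux := selfsim n2 P2.
Let v := selfsim n2 kv.
Let ut := selfsim n3 (dxprof kv').

Let cg1 : continuous g1. Proof. by move=> y; exact: is_derive_continuous (dg1 y). Qed.
Let cg2 : continuous g2. Proof. by move=> y; exact: is_derive_continuous (dg2 y). Qed.
Let cd (f : R -> R) : continuous f -> continuous (dxprof f).
Proof. by move=> cf y; apply: cvgMr; exact: cf. Qed.
Let sd (f : R -> R) : superexp_decay f -> superexp_decay (dxprof f).
Proof. exact: superexp_dxprof. Qed.
Let dd (f f' : R -> R) : (forall y : R, is_derive y 1 f (f' y)) ->
  forall y : R, is_derive y 1 (dxprof f) (dxprof f' y).
Proof.
move=> df y; apply: (is_derive_eq (is_deriveM (is_derive_cst (2^-1 : R) y 1) (df y))).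
by rewrite /GRing.scale/= mulr0 addr0.
Qed.
Let cy (f : R -> R) : continuous f -> continuous (fun y : R => y * f y).
Proof. by move=> cf y; apply: cvgM; [exact: cvg_id|exact: cf]. Qed.

Let dP1 : forall y : R, is_derive y 1 P1 (dxprof g2 y). Proof. exact: dd. Qed.
Let dP2 : forall y : R, is_derive y 1 P2 (dxprof (dxprof g3) y). Proof. by do 2 apply: dd. Qed.
Let sP1 : superexp_decay P1. Proof. exact: sd. Qed.
Let sP2 : superexp_decay P2. Proof. by do 2 apply: sd. Qed.
Let cdg2 : continuous (dxprof g2). Proof. exact: cd. Qed.
Let cddg3 : continuous (dxprof (dxprof g3)). Proof. by do 2 apply: cd. Qed.
Let cP1 : continuous P1. Proof. exact: cd. Qed.
Let cP2 : continuous P2. Proof. by do 2 apply: cd. Qed.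
Let cP3 : continuous P3. Proof. by do 3 apply: cd. Qed.

Let dkv (y : R) : is_derive y 1 kv (kv' y).
Proof.
have a := dg y; have b := dg1 y.
by rewrite /kv; apply: is_derive_eq; rewrite /GRing.scale/= /kv'; field.
Qed.
Let ckv' : continuous kv'.
Proof.
move=> y; apply: cvgMl; apply: cvgN; apply: cvgD; first by apply: cvgMr; exact: cg1.
by apply: cvgM; [apply: cvgMr; exact: cvg_id|exact: cg2].
Qed.
Let skv : superexp_decay kv.
Proof.
have h1 := superexp_decayZ (- (2 * m / 4)) sg.
have h2 := superexp_decayZ (- (2 / 4)) (superexp_decay_id sg1).
apply: superexp_decay_le (superexp_decayD h1 h2) => y.
by rewrite /kv le_eqVlt; apply/orP; left; apply/eqP; congr (`|_|); field.
Qed.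
Let skv' : superexp_decay kv'.
Proof.
have h1 := superexp_decayZ (- ((2 * m + 2) / 4)) sg1.
have h2 := superexp_decayZ (- (2 / 4)) (superexp_decay_id sg2).
apply: superexp_decay_le (superexp_decayD h1 h2) => y.
by rewrite /kv' le_eqVlt; apply/orP; left; apply/eqP; congr (`|_|); field.
Qed.

Let dPt (y : R) : is_derive y 1 Pt (Pt' y).
Proof.
have a := dP1 y; have b := dd dg2 y.
by rewrite /Pt /dtprof; apply: is_derive_eq; rewrite /GRing.scale/= /Pt'; ring.
Qed.
Let sPt : superexp_decay Pt. Proof. by apply: superexp_dtprof => //; exact: sd. Qed.
Let cPt' : continuous Pt'.
Proof.
move=> y; apply: cvgB; first by apply: cvgN; apply: cvgMr; exact: cdg2.
apply: cvgMr; apply: cvgD; first exact: cdg2.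
by apply: cy; exact: cd.
Qed.
Let sPt' : superexp_decay Pt'.
Proof.
have h1 := superexp_decayZ (- n1 - 2^-1) (sd sg2).
have h2 := superexp_decayZ (- 2^-1) (superexp_decay_id (sd sg3)).
apply: superexp_decay_le (superexp_decayD h1 h2) => y.
by rewrite /Pt' le_eqVlt; apply/orP; left; apply/eqP; congr (`|_|); ring.
Qed.

Let n1E : n1 + 1 = n3. Proof. by rewrite /n3 /n2; field. Qed.
(** The equation itself, as an identity between profiles: the left side is the t-derivative of
    [sol], the right side the x-derivative of the flux. *)
Let utE t x : selfsim (n1 + 1) Pt t x = ut t x.
Proof.
rewrite n1E /ut /selfsim; congr (_ * _).
by rewrite /Pt /dtprof /P1 /dxprof /kv' /n1 /n0; move: (simvar t x) => y; field.
Qed.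

Let n00 : 0 <= n0. Proof. by rewrite /n0 divr_ge0// ltW. Qed.
Let n10 : 0 <= n1. Proof. by rewrite /n1 addr_ge0. Qed.
Let n20 : 0 <= n2. Proof. by rewrite /n2 addr_ge0. Qed.
Let n30 : 0 <= n3. Proof. by rewrite /n3 addr_ge0. Qed.

Lemma coef_ux t x : coef t x * ux t x = v t x.
Proof.
rewrite /v /ux /selfsim mulrCA; congr (_ * _); rewrite /coef /P2 /dxprof /kv -Ag2.
by move: (simvar t x) => y; field.
Qed.

Lemma sol_dx t x : 0 < t -> dx sol t x = ux t x.
Proof. exact: (dx_selfsim dP1). Qed.
Lemma sol_dt t x : 0 < t -> dt sol t x = ut t x.
Proof.
have sE t' x' : 0 < t' -> sol t' x' = selfsim n1 P1 t' x' by [].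
by move=> t0; rewrite (dt_selfsim dP1 sE)// utE.
Qed.
Lemma coef_sol_dx t x : 0 < t -> coef t x * dx sol t x = v t x.
Proof. by move=> t0; rewrite sol_dx// coef_ux. Qed.

Lemma sol_classical :
  [/\ forall t x, Q (t, x) -> derivable (sol^~ x) t 1 /\ derivable (sol t) x 1,
      Ck_on Q 1 (dt sol), Ck_on Q 1 (dx sol), Ck_on Q 1 (fun t x => coef t x * dx sol t x) &
      forall t x, Q (t, x) -> dt sol t x = dx (fun t x => coef t x * dx sol t x) t x].
Proof.
split.
- by move=> t x; exact: (derivable_selfsim dP1).
- apply: (@C1_selfsim R (n1 + 1) Pt Pt') => // t x t0.
  by rewrite utE sol_dt.
- exact: (@C1_selfsim R n2 P2 _ _ dP2 sol_dx).
- exact: (@C1_selfsim R n2 kv _ _ dkv coef_sol_dx).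
- move=> t x Qtx; have t0 : 0 < t by case/andP: Qtx.
  by rewrite sol_dt// (dx_selfsim dkv coef_sol_dx).
Qed.

Let mP1 : measurable_fun setT P1. Proof. exact: continuous_measurable_fun. Qed.
Let mP2 : measurable_fun setT P2. Proof. exact: continuous_measurable_fun. Qed.
Let mP3 : measurable_fun setT P3. Proof. exact: continuous_measurable_fun. Qed.
Let mkv' : measurable_fun setT (dxprof kv').
Proof. by apply: continuous_measurable_fun; exact: cd. Qed.

Let q := p^-1.
Let pq : p * q = 1. Proof. by rewrite mulfV// gt_eqF// (lt_trans _ (andP hp).1). Qed.
Let p1 : 1 <= p. Proof. by rewrite ltW// (andP hp).1. Qed.
Let p0 : 0 < p. Proof. exact: lt_le_trans p1. Qed.
Let q1 : q < 1. Proof. by rewrite invf_lt1// (andP hp).1. Qed.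
Let q23 : 2 / 3 < q.
Proof. by rewrite -[2 / 3]invrK invf_div ltf_pV2 ?posrE ?divr_gt0// (andP hp).2. Qed.
(** Three conditions must hold: th < q for the weight, n0 - b < 0 for the behaviour at t = 0, and n2
    - b < q for the second derivatives. With th = q - ep the last one becomes ep < (3 q - 2 - m) /
    2, which this choice meets by a factor 2; this is where m < 3 / p - 2 is used. The second
    reduces to m + q < 2. *)
Let ep := (3 * q - 2 - m) / 4.
Let th := q - ep.
Let mp' : m < 3 * q - 2. Proof. exact: mp. Qed.
Let ep01 : 0 < ep < 1.
Proof. by have := mp'; have := m0; have := q1; rewrite /ep => *; apply/andP; split; lra. Qed.
Let th01 : 0 < th < 1.
Proof. by have := mp'; have := m0; have := q1; have := q23; rewrite /th /ep => *; apply/andP; split; lra. Qed.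
Let pth : p * th < 1.
Proof. by rewrite /th mulrBr pq ltrBlDr ltrDl mulr_gt0//; case/andP: ep01. Qed.

Let b := (th - ep) / 2.
Let mu0 : n0 - b < 0.
Proof. by have := mp'; have := q1; rewrite /n0 /b /th /ep => *; lra. Qed.
Let mu2 : n2 - b < q.
Proof.
have /andP[e0 _] := ep01; move: e0; rewrite /n2 /n1 /n0 /b /th /ep => *; lra.
Qed.

Let J0 t := bessel (selfsim n1 P1 t).
Let J1 t := bessel (selfsim n2 P2 t).
Let J2 t := bessel (selfsim n3 P3 t).
Let J3 t := bessel (ut t).

Let c0 : controlled th (n0 - b) J0. Proof. exact: bessel_selfsim_le. Qed.
Let c1 : controlled th (n1 - b) J1.
Proof. exact: (bessel_selfsim_le th01 ep01 n10 dP1 cdg2 sP1 (sd sg2)). Qed.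
Let c2 : controlled th (n2 - b) J2.
Proof. exact: (bessel_selfsim_le th01 ep01 n20 dP2 cddg3 sP2 (sd (sd sg3))). Qed.
(** As u_t is the x-derivative of the flux, whose exponent is [n2], it obeys the same bound as
    Lambda^-1 u_xx after Lambda^-1 is applied. *)
Let c3 : controlled th (n2 - b) J3. Proof. exact: bessel_selfsim_le. Qed.

Let mJ0 : measurable_fun setT (unc J0). Proof. exact: measurable_bessel_selfsim. Qed.
Let mJ1 : measurable_fun setT (unc J1). Proof. exact: measurable_bessel_selfsim. Qed.
Let mJ2 : measurable_fun setT (unc J2). Proof. exact: measurable_bessel_selfsim. Qed.
Let mJ3 : measurable_fun setT (unc J3). Proof. exact: measurable_bessel_selfsim. Qed.

Let bounded_bessel n (P P' : R -> R) n' t : continuous P -> continuous P' ->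
  superexp_decay P -> superexp_decay P' -> 0 < t <= 2 ->
  exists B, forall x, `|bessel (selfsim n P t) x| <= B /\ `|bessel (selfsim n' P' t) x| <= B.
Proof.
move=> cP cP' sP sP' ht.
have one (k : R) (f : R -> R) : continuous f -> superexp_decay f ->
    exists2 B, 0 <= B & forall x, `|bessel (selfsim k f t) x| <= B.
  move=> cf sf; have [M HM] := selfsim_at k ht sf.
  have M0 : 0 <= M by have := HM 0; rewrite normr0 oppr0 expR0 mulr1; exact: le_trans.
  exists (2 * M) => [|x]; first exact: mulr_ge0.
  apply: le_trans (bessel_decay x _ HM) _; first by apply: selfsim_measurable; exact: continuous_measurable_fun.
  by rewrite ler_piMr ?mulr_ge0// -expR0 ler_expR oppr_le0 mulr_ge0.
have [B1 B10 H1] := one n P cP sP; have [B2 B20 H2] := one n' P' cP' sP'.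
exists (B1 + B2) => x; split; [apply: le_trans (H1 x) _|apply: le_trans (H2 x) _].
  by rewrite lerDl.
by rewrite lerDr.
Qed.

Let sP3 : superexp_decay P3. Proof. by do 3 apply: sd. Qed.

Let cJ2 t : 0 < t -> continuous (J2 t).
Proof.
move=> t0; have [B HB] := selfsim_bounded_t sP3 n30 t0.
have tt : t / 2 <= t by rewrite ler_pdivrMr// ler_peMr ?ler1n// ltW.
apply: (@continuous_bessel R _ B); first exact: selfsim_continuous.
by move=> x; exact: HB.
Qed.

Let dJ0 (t x : R) : 0 < t -> is_derive t 1 (J0 ^~ x) (J3 t x).
Proof.
move=> t0; have := is_derive_bessel_selfsim_t x t0 n10 dP1
  (continuous_measurable_fun cdg2) sP1 (sd sg2).
by rewrite (_ : selfsim (n1 + 1) _ t = ut t)//; apply/funext => y; exact: utE.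
Qed.

Let cJ3 (t x : R) : 0 < t -> {for t, continuous (J3 ^~ x)}.
Proof.
move=> t0; have n11 : 0 <= n1 + 1 by rewrite addr_ge0.
have d := is_derive_bessel_selfsim_t x t0 n11 dPt (continuous_measurable_fun cPt') sPt sPt'.
rewrite (_ : J3^~ x = fun t => bessel (selfsim (n1 + 1) Pt t) x); first exact: is_derive_continuous d.
by apply/funext => s; congr (bessel _ x); apply/funext => y; rewrite utE.
Qed.

(** The function of the parabolic space representing Lambda^-1 u: it agrees with [J0] for 0 < t <= 1
    off the line x = 0. *)
Definition pot := cutf zeta J0.

Let pmu mu : mu < q -> p * mu < 1.
Proof. by move=> h; rewrite -pq ltr_pM2l. Qed.

Lemma pot_W12 : W12_0 p pot.
Proof.
have q0 : 0 < q by rewrite invr_gt0.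
have l0 : n0 - b < q by exact: lt_trans mu0 q0.
have l1 : n1 - b < q by apply: lt_trans mu2; rewrite ltrD2r /n2 ltrDl invr_gt0.
have k0 := lt_trans l0 q1; have k1 := lt_trans l1 q1; have k2 := lt_trans mu2 q1.
split; last by move=> t x t0; rewrite /pot /cutf ltNge t0 mul0r.
split; first exact: (cutf_Lp p1 th01 pth cutoff_zeta mJ0 c0 (pmu l0)).
exists (fun t x => cutf zeta J3 t x + cutf zeta1 J0 t x), (cutf zeta J1), (cutf zeta J2).
split; split.
- have h1 := cutf_Lp p1 th01 pth cutoff_zeta mJ3 c3 (pmu mu2).
  have h2 := cutf_Lp p1 th01 pth cutoff_zeta1 mJ0 c0 (pmu l0).
  have p1e : (1 <= p%:E)%E by rewrite lee_fin.
  exact: ((Lfun_addr_closed leb2 p1e).2 _ _ h1 h2).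
- exact: (cutf_Lp p1 th01 pth cutoff_zeta mJ1 c1 (pmu l1)).
- exact: (cutf_Lp p1 th01 pth cutoff_zeta mJ2 c2 (pmu mu2)).
- exact: (weak_dt_cutf th01 mJ0 mJ3 c0 c3 mu0 k2 dJ0 cJ3).
- apply: (weak_dx_cutf th01 cutoff_zeta mJ0 mJ1 c0 c1 k0 k1).
  + by move=> t x t0; exact: (is_derive_bessel_selfsim_x x t0 n10 dP1 cdg2 sP1 (sd sg2)).
  + move=> t t0 x.
    exact: is_derive_continuous (is_derive_bessel_selfsim_x x t0 n20 dP2 cddg3 sP2 (sd (sd sg3))).
  + by move=> t ht; exact: bounded_bessel.
- apply: (weak_dx_cutf th01 cutoff_zeta mJ1 mJ2 c1 c2 k1 k2).
  + by move=> t x t0; exact: (is_derive_bessel_selfsim_x x t0 n20 dP2 cddg3 sP2 (sd (sd sg3))).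
  + exact: cJ2.
  + by move=> t ht; exact: bounded_bessel.
Qed.

Let ht2 (t : R) : 0 < t < 1 -> 0 < t <= 2.
Proof. by move=> /andP[-> t1] /=; lra. Qed.

Let msol (t : R) : measurable_fun setT (sol t). Proof. exact: selfsim_measurable. Qed.
Let mut (t : R) : measurable_fun setT (ut t). Proof. exact: selfsim_measurable. Qed.
Let sut : superexp_decay (dxprof kv'). Proof. exact: sd. Qed.

Lemma sol_calH1 : calH1_0 p sol.
Proof.
split; first by apply: measurable_funTS; exact: measurable_selfsim.
exists pot; first exact: pot_W12.
apply: aeW => t t01; have [M HM] := selfsim_at n1 (ht2 t01) sP1.
split => [phi sp|phi sp]; first exact: decay_schwartz_integrable HM sp.
rewrite /distr_Lambda /regd -(bessel_dual (msol t) sp HM).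
have mb : measurable_fun setT (bessel (sol t)).
  exact: (measurableT_comp mJ0 (pair1_measurable t)).
have /andP[t0 t1] := t01.
apply: (Rintegral_off (c := 0)).
- by apply: measurable_funM; [exact: mb|exact: measurable_Lambda].
- apply: measurable_funM; last exact: measurable_Lambda.
  exact: (measurableT_comp (measurable_cutf cutoff_zeta mJ0) (pair1_measurable t)).
- by move=> x x0; rewrite /pot /cutf t0 x0 zeta_id ?(ltW t1)// !mul1r.
Qed.

Let flux (t : R) : distr := distr_der (regd (fun x => coef t x * ux t x)).

Let fluxE (t : R) (phi : R -> R) : 0 < t <= 2 -> schwartz phi -> flux t phi = \int[leb]_x (ut t x * phi x).
Proof.
move=> ht sp; rewrite /flux /distr_der /regd.
rewrite /ut (selfsim_parts n2 ht dkv ckv' skv skv' sp); congr (- _).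
by apply: eq_Rintegral => x _; rewrite coef_ux.
Qed.

Let flux_in_H (t : R) : 0 < t <= 2 -> in_H (-1) p (flux t).
Proof.
move=> ht; have [M HM] := selfsim_at n3 ht sut.
by have [] := bessel_preimage p1 (mut t) HM (fun phi sp => fluxE ht sp).
Qed.

(** For |h| <= t / 2 all times involved stay in [t / 2, 2], where the second t-derivative of [sol]
    is bounded by a multiple of e^(-|y|). *)
Let sol_quotient (t : R) : 0 < t < 1 -> exists M : R, forall h y, h != 0 -> `|h| <= t / 2 ->
  `|h^-1 * (sol (t + h) y - sol t y) - ut t y| <= `|h| * M * expR (- `|y|).
Proof.
move=> /andP[t0 t1].
have [C C0 HC] := selfsim_decay (n1 + 1 + 1) (superexp_dtprof (n1 + 1) sPt sPt').
exists (C * (t / 2) `^ (- (n1 + 1 + 1))) => h y h0 ht; rewrite -mulrA.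
have sp s : t / 2 <= s -> 0 < s by apply: lt_le_trans; rewrite divr_gt0.
have ht' := ht; rewrite ler_norml in ht'; case/andP: ht' => hl hr.
apply: (@diff_quotient_le R (sol ^~ y) (ut ^~ y)
  (fun s => selfsim (n1 + 1 + 1) (dtprof (n1 + 1) Pt Pt') s y) (t / 2) 2) => //.
- move=> s /andP[/sp s0 _]; apply: (is_derive_eq (is_derive_selfsim_t n1 y s0 dP1)).
  by rewrite utE.
- move=> s /andP[/sp s0 _]; rewrite (_ : ut^~ y = selfsim (n1 + 1) Pt ^~ y).
    exact: is_derive_selfsim_t.
  by apply/funext => r; rewrite utE.
- move=> s /andP[ts s2]; have s0 := sp s ts.
  apply: le_trans (HC s y _) _; first by rewrite s0.
  rewrite ler_wpM2r ?expR_ge0// ler_wpM2l// !powRN lef_pV2 ?posrE ?powR_gt0 ?divr_gt0//.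
  apply: ge0_ler_powR; rewrite ?nnegrE ?(ltW s0)// ?divr_ge0 ?(ltW t0)//.
  by rewrite !addr_ge0.
- by apply/andP; split; lra.
- by apply/andP; split; lra.
Qed.

(** The strong t-derivative is the flux derivative: the remainder of the difference quotient is at
    most |h| M e^(-|y|), and [bessel_preimage] turns this into an H^-1 norm of order |h|. *)
Lemma sol_solves : solves_div p coef sol.
Proof.
exists ux, flux; split.
- split; first by apply: measurable_funTS; exact: measurable_selfsim.
  apply: aeW => t /ht2 ht; have [M HM] := selfsim_at n2 ht sP2.
  split => [phi sp|phi sp].
    by apply: decay_schwartz_integrable HM sp; exact: selfsim_measurable.
  exact: (selfsim_parts n1 ht dP1 cdg2 sP1 (sd sg2) sp).
- apply: aeW => t t01; have ht := ht2 t01; split; first exact: flux_in_H.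
  have /andP[t0 t1] := t01; have [M HM] := sol_quotient t01.
  pose K := M * bessel_normC p.
  have lim : (fun h : R => (`|h| * K)%:E) h @[h --> (0 : R)^'] --> 0%E.
    apply: cvg_EFin; first by near=> h.
    have c : (fun h : R => `|h| * K) h @[h --> (0 : R)] --> (0 : R).
      by rewrite -[X in _ --> X](mul0r K) -{2}(normr0 R); apply: cvgMl; exact: norm_continuous.
    exact: cvg_trans (cvg_app _ (cvg_within _)) c.
  apply: (squeeze_cvge _ (cvg_cst 0%E) lim); near=> h.
  have h0 : h != 0 by near: h; exact: nbhs_dnbhs_neq.
  have hs : `|h| <= t / 2 by near: h; apply: dnbhs0_le; rewrite divr_gt0.
  have hs' := hs; rewrite ler_norml in hs'; case/andP: hs' => hl hr.
  have hth : 0 < t + h <= 2 by apply/andP; split; lra.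
  have [M0 HM0] := selfsim_at n1 ht sP1; have [M1 HM1] := selfsim_at n1 hth sP1.
  have [M2 HM2] := selfsim_at n3 ht sut.
  pose D y := h^-1 * (sol (t + h) y - sol t y) - ut t y.
  have mD : measurable_fun setT D.
    by apply: measurable_funB => //; apply: measurable_funM => //; exact: measurable_funB.
  have DM y : `|D y| <= `|h| * M * expR (- `|y|) by exact: HM.
  have DE phi : schwartz phi ->
      h^-1 * (regd (sol (t + h)) phi - regd (sol t) phi) - flux t phi =
      \int[leb]_y (D y * phi y).
    move=> sp; rewrite fluxE// /regd.
    have i0 := decay_schwartz_integrable (msol t) HM0 sp.
    have i1 := decay_schwartz_integrable (msol (t + h)) HM1 sp.
    have i2 := decay_schwartz_integrable (mut t) HM2 sp.
    have i3 := integrableRB measurableT i1 i0.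
    have i4 := integrableRZ h^-1 measurableT i3.
    rewrite -RintegralB// -RintegralZl// -RintegralB//.
    by apply: eq_Rintegral => y _; rewrite /D; ring.
  have [_] := bessel_preimage p1 mD DM DE.
  by rewrite mulrA.
- by apply: aeW => t /ht2 ht; split; [exact: flux_in_H|move=> phi sp].
Unshelve. all: by end_near. Qed.

(** On the rectangle [B], t < 1/2 gives t^(-1/2) >= 1 and x > 2 c gives x / 2 >= c >= Y, so the
    similarity variable lies where [g1] is negative. The rectangle has measure 1/4. *)
Lemma sol_nonzero : (exists Y, forall y, Y <= y -> g1 y < 0) -> nonzero_on_Q sol.
Proof.
move=> [Y HY] ae0; pose c := `|Y| + 1.
have c0' : 0 < c by rewrite ltr_wpDl.
pose B := `]4^-1, 2^-1[%classic `*` `]2 * c, 2 * c + 1[%classic : set (R * R).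
have mB : measurable (B : set (measurableTypeR R * measurableTypeR R)).
  by apply: measurableX; exact: measurable_itv.
have nB : leb2.-negligible B.
  apply: negligibleS ae0 => -[t x] [/=]; rewrite !in_itv/= => /andP[t1 t2] /andP[x1 x2].
  have t0 : 0 < t by apply: lt_trans t1.
  have Qtx : Q (t, x) by rewrite /Q/= t0/=; lra.
  move=> /(_ Qtx)/eqP; rewrite /sol /selfsim mulf_eq0 gt_eqF ?powR_gt0//=.
  have sv : Y <= simvar t x.
    have h1 : 1 <= t `^ (- 2^-1).
      rewrite powRN invf_ge1 ?powR_gt0// [leRHS](_ : 1 = 1 `^ 2^-1); last by rewrite powR1.
      by apply: ge0_ler_powR; rewrite ?nnegrE ?(ltW t0)//; lra.
    have h2 : c <= 2^-1 * x by lra.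
    have h3 : Y <= c by rewrite /c (le_trans (ler_norm _))// lerDl.
    rewrite /simvar (le_trans h3)// (le_trans h2)// ler_peMr//.
    by rewrite (le_trans (ltW c0')).
  by rewrite /P1 /dxprof mulf_eq0 invr_eq0 pnatr_eq0/= lt_eqF// HY.
have /eqP : leb2 B = 0%E.
  have [N [mN N0 BN]] := nB.
  apply/eqP; rewrite eq_le measure_ge0 andbT -N0; apply: le_measure; rewrite ?inE//.
rewrite /leb2 /B product_measure1E; last 2 first.
- exact: measurable_itv.
- exact: measurable_itv.
rewrite (_ : (_ * _)%E = (leb `]4^-1%R, 2^-1%R[ * leb `](2 * c)%R, (2 * c + 1)%R[)%E)//.
rewrite !lebesgue_measure_itv/= !lte_fin.
have -> : (4^-1 < 2^-1 :> R) by rewrite ltf_pV2 ?posrE// ltr_nat.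
rewrite ltrDl ltr01 -!EFinB -EFinM eqe => /eqP.
lra.
Qed.

Lemma coef_frakA al : (forall y, 1 <= A y <= al) -> frakA 1 al coef.
Proof.
move=> hA; split; last by move=> t x _; exact: hA.
by apply: measurable_funTS; exact: (measurableT_comp mA measurable_simvar).
Qed.

End Solution.

Theorem theorem2p5 (R : realType) (gamma : R -> R)
    (gamma01 : forall q : R, 1 < q < 3 / 2 -> 0 < gamma q < 1)
    (gamma_lt : forall q : R, 1 < q < 3 / 2 -> gamma q < 3 / q - 2)
    (gamma_lim : gamma q @[q --> (1 : R)^'+] --> (1 : R))
    (p : R) (hp : 1 < p < 3 / 2) :
  exists2 a : R -> R -> R, frakA 1 (alpha gamma p) a &
  exists u : R -> R -> R,
    [/\ calH1_0 p u, nonzero_on_Q u & solves_div p a u] /\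
    let au_x := fun t x => a t x * dx u t x in
    [/\ forall t x, Q (t, x) ->
          derivable (u^~ x) t 1 /\ derivable (u t) x 1,
        Ck_on Q 1 (dt u), Ck_on Q 1 (dx u), Ck_on Q 1 au_x &
        forall t x, Q (t, x) -> dt u t x = dx au_x t x].
Proof.
have [m [g [g1 [g2 [g3 [A [/andP[gm mp] [[dg dg1 dg2 cg3] [[sg sg1 sg2 sg3] [mA hA Ag far]]]]]]]]]] :=
  hermite_profile (gamma01 _ hp) (gamma_lt _ hp).
have m0 : 0 < m by apply: lt_trans gm; case/andP: (gamma01 _ hp).
exists (coef A); first exact: coef_frakA.
exists (sol m g1); split.
  split; first exact: (sol_calH1 hp m0 mp dg dg1 dg2 cg3 sg sg1 sg2 sg3).
    exact: sol_nonzero.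
  exact: (sol_solves hp m0 dg dg1 dg2 sg sg1 sg2 sg3 Ag).
exact: (sol_classical dg dg1 dg2 cg3 Ag).
Qed.
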